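(* Let $0<a\le 5.7$ be the signal-to-noise ratio of the Gaussian channel. Then $E(R,a)=E_0(R,a)$ for all $R_1\le R\le R_{\mathrm{crit}}$.
   Context: Natural logarithms. Codes are finite sets $C$ of points on the unit sphere $S^{n-1}\subset\mathbb R^n$ (suitably scaled to the power constraint), used on the additive white Gaussian noise channel with signal-to-noise ratio $a$ under maximum-likelihood decoding; the rate is $R=\frac1n\ln|C|$ and $P_e(C,a)$ is the average error probability. The reliability function is $E(R,a)=\limsup_{n\to\infty}\frac1n\ln\max_{C:\,R(C)=R}\frac1{P_e(C,a)}$. Define $R_x=\frac12\ln\big(\frac12+\frac12\sqrt{1+a^2/4}\big)$, $\theta_x=\cos^{-1}\sqrt{1-e^{-2R_x}}$, $R_{\mathrm{crit}}=\frac12\ln\big(\frac12+\frac a4+\frac12\sqrt{1+a^2/4}\big)$, $E_0(R,a)=\frac a4(1-\cos\theta_x)+R_x-R$, $\psi(x)=-\frac{1-\sin x}{2\sin x}\ln\frac{1-\sin x}{1+\sin x}-\ln\frac{2\sin x}{1+\sin x}$, and $R_1=\psi(\theta_x)$. *)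

(* Defs.v *)
From HB Require Import structures.
From mathcomp Require Import all_boot all_order all_algebra.
From mathcomp Require Import all_classical all_reals all_analysis.
From mathcomp Require Import normal_distribution.
Set Implicit Arguments. Unset Strict Implicit. Unset Printing Implicit Defensive.
Import Order.TTheory GRing.Theory Num.Theory.
Local Open Scope ring_scope.

Section Gaussian_channel.
Context {R : realType}.

Definition norm2 {n} (v : 'rV[R]_n) : R := \sum_(i < n) v 0 i ^+ 2.

(* Expectation of f(Z) for Z a standard Gaussian vector in R^n
   (i.i.d. N(0,1) coordinates), written as an iterated integral
   against the one-dimensional standard normal law. *)
Fixpoint gauss_expect (n : nat) : ('rV[R]_n -> \bar R) -> \bar R :=
  match n with
  | 0 => fun f => f 0
  | n'.+1 => fun f =>
      (\int[normal_prob (0:R) 1]_x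
         gauss_expect (fun v : 'rV[R]_n' => f (row_mx (\row_(j < 1) x) v)))%E
  end.

Definition is_code {n} (C : seq 'rV[R]_n) : bool :=
  uniq C && all (fun c => norm2 c == 1) C.

(* Transmission of codeword c is the point sqrt(n a) c (power constraint:
   average energy a per coordinate, unit noise variance, SNR = a).
   Under ML (= minimum distance) decoding, an error occurs iff some other
   codeword is at least as close to the received vector y = sqrt(n a) c + Z. *)
Definition err_prob_cw {n} (a : R) (C : seq 'rV[R]_n) (c : 'rV[R]_n) : R :=
  let s := Num.sqrt (n%:R * a) in
  fine (gauss_expect (fun z : 'rV[R]_n =>
     ((has (fun c' => (c' != c) &&
        (norm2 (s *: c + z - s *: c') <= norm2 z)) C)%:R : R)%:E)).

Definition Pe {n} (a : R) (C : seq 'rV[R]_n) : R :=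
  (size C)%:R^-1 * \sum_(c <- C) err_prob_cw a C c.

Definition exponent_of {n} (a : R) (C : seq 'rV[R]_n) : \bar R :=
  if Pe a C == 0 then +oo%E else ((- ln (Pe a C)) / n%:R)%:E.

Definition best_exponent (Rt a : R) (n : nat) : \bar R :=
  ereal_sup [set exponent_of a C | C in
    [set C : seq 'rV[R]_n | is_code C /\ expR (n%:R * Rt) <= (size C)%:R]].

Definition reliability (Rt a : R) : \bar R :=
  limn_esup (best_exponent Rt a).

Definition R_x (a : R) : R :=
  2^-1 * ln (2^-1 + 2^-1 * Num.sqrt (1 + a ^+ 2 / 4)).
Definition theta_x (a : R) : R :=
  acos (Num.sqrt (1 - expR (- (2 * R_x a)))).
Definition R_crit (a : R) : R :=
  2^-1 * ln (2^-1 + a / 4 + 2^-1 * Num.sqrt (1 + a ^+ 2 / 4)).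
Definition E0 (Rt a : R) : R :=
  a / 4 * (1 - cos (theta_x a)) + R_x a - Rt.
Definition psi (x : R) : R :=
  - ((1 - sin x) / (2 * sin x)) * ln ((1 - sin x) / (1 + sin x))
  - ln (2 * sin x / (1 + sin x)).
Definition R_1 (a : R) : R := psi (theta_x a).

End Gaussian_channel.

(* Main.v *)
(** Put b = a/4, s = cos theta_x and d(c, c') = 1 - <c, c'>; then s = b (1 - s^2) and
    e^{-2 R_x} = 1 - s^2, and two codewords are confused with probability e^{-n b d (1 + o(1))}.

    Achievability.  By the union bound it suffices that the sums of e^{n b <c, c'>} over c' are
    at most |C| e^{n (b s - R_x + eps)}.  This exponent is the average over the sphere (a saddle
    point computation for a Gaussian vector conditioned on its norm), so codewords can be chosen
    greedily.

    Converse.  A linear programming bound with the polynomial (t - y) h(t)^2, where h is a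
    combination of consecutive Gegenbauer polynomials of degree about n (1 - sin theta_x) /
    (2 sin theta_x), shows that every subset A of at least e^{n R_1} points satisfies
    sum_{c <> c'} e^{-n b d} >= |A|^2 e^{-n (b (1 - s) + R_x + eps)}.  A halving argument yields
    a subset and an exponent E <= E_0 + eps such that sum_{c'} e^{-n b d(c, c')} <= e^{-n E} for
    every c, with near equality on average, the pairs at a single distance d carrying the average;
    they are the edges of a graph.  Let (c, c') be a random edge and let y be the midpoint of the
    two signals plus noise.  Given c and y, the posterior entropy kappa of c' controls the
    probability that a decoder sees some neighbour nearer than c.  If c' is recovered with
    probability bounded below, the error exponent is at most E.  Otherwise a Kullback-Leibler
    comparison forces a second posterior sample c'' to be at distance at least about d from c',
    and the entropy-mean square error inequality gives E + kappa <= b d + ln (1 - b d) / 2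
    <= E_0 (R_crit), while d > 1 - s contradicts the linear estimation bound on the error. *)
Require Import Defs.
From HB Require Import structures.
From mathcomp Require Import all_boot all_order all_algebra.
From mathcomp Require Import ring lra.
Set Implicit Arguments. Unset Strict Implicit. Unset Printing Implicit Defensive.
Import Order.TTheory GRing.Theory Num.Theory.
Local Open Scope ring_scope.

Section dot.
Context {A : comNzRingType} {n : nat}.
Implicit Types u v w : 'rV[A]_n.

Definition dot u v : A := \sum_i u 0 i * v 0 i.

Lemma dotC u v : dot u v = dot v u.
Proof. by apply: eq_bigr => i _; rewrite mulrC. Qed.

Lemma dotDl u v w : dot (u + v) w = dot u w + dot v w.
Proof. by rewrite /dot -big_split; apply: eq_bigr => i _; rewrite mxE mulrDl. Qed.

Lemma dotZl k u v : dot (k *: u) v = k * dot u v.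
Proof. by rewrite /dot mulr_sumr; apply: eq_bigr => i _; rewrite mxE mulrA. Qed.

Lemma dotDr u v w : dot w (u + v) = dot w u + dot w v.
Proof. by rewrite !(dotC w) dotDl. Qed.

Lemma dotZr k u v : dot u (k *: v) = k * dot u v.
Proof. by rewrite !(dotC u) dotZl. Qed.

Lemma dotNl u w : dot (- u) w = - dot u w.
Proof. by rewrite -scaleN1r dotZl mulN1r. Qed.

Lemma dotNr u w : dot w (- u) = - dot w u.
Proof. by rewrite !(dotC w) dotNl. Qed.

Lemma dotBl u v w : dot (u - v) w = dot u w - dot v w.
Proof. by rewrite dotDl dotNl. Qed.

Lemma dotBr u v w : dot w (u - v) = dot w u - dot w v.
Proof. by rewrite dotDr dotNr. Qed.

Lemma dot0l w : dot 0 w = 0.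
Proof. by rewrite -(scale0r 0) dotZl mul0r. Qed.

Lemma dot_suml (I : Type) (r : seq I) (P : pred I) (u : I -> 'rV[A]_n) w :
  dot (\sum_(i <- r | P i) u i) w = \sum_(i <- r | P i) dot (u i) w.
Proof. by elim/big_rec2: _ => [|i x y _ <-]; rewrite ?dot0l ?dotDl. Qed.

End dot.

Module Zonal.
From mathcomp.multinomials Require Import mpoly.

(** * Zonal harmonics and positive definiteness *)

Section zonal.
Variables (R : realFieldType) (N : nat).
Hypothesis N3 : (2 < N)%N.
Local Notation M := {mpoly R[N]}.
Implicit Types (p q : M) (x y : 'rV[R]_N).

Definition geg_coef (i : nat) : R :=
  i%:R * (i%:R + N%:R - 3) / ((2 * i%:R + N%:R - 2) * (2 * i%:R + N%:R - 4)).

(* [geg i] is the monic Gegenbauer polynomial of degree i for the sphere of R^N; the pair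
   carries degrees i and i - 1, with 0 in degree -1. *)
Fixpoint geg_pair (i : nat) : {poly R} * {poly R} :=
  if i is i'.+1 then let: (P, P') := geg_pair i' in ('X * P - geg_coef i' *: P', P) else (1, 0).
Definition geg i := (geg_pair i).1.

Definition linf x : M := \sum_j x 0 j *: 'X_j.
Definition sqrad : M := \sum_j 'X_j ^+ 2.
Definition dirder x p : M := \sum_j x 0 j *: p^`M(j).
Definition laplacian p : M := \sum_j p^`M(j)^`M(j).
Definition euler p : M := \sum_j 'X_j * p^`M(j).

(* [zonal x i] evaluates at w to |w|^i geg_i(<x, w> / |w|): the zonal harmonic with pole x. *)
Fixpoint zonal_pair x (i : nat) : M * M :=
  if i is i'.+1 then let: (P, P') := zonal_pair x i' in (linf x * P - geg_coef i' *: (sqrad * P'),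
    P) else (1, 0).
Definition zonal x i := (zonal_pair x i).1.

Lemma gegS i : geg i.+2 = 'X * geg i.+1 - geg_coef i.+1 *: geg i.
Proof. by rewrite /geg /=; case: (geg_pair i). Qed.

Lemma zonalS x i : zonal x i.+2 = linf x * zonal x i.+1 - geg_coef i.+1 *: (sqrad * zonal x i).
Proof. by rewrite /zonal /=; case: (zonal_pair x i). Qed.

Lemma geg0 : geg 0 = 1. Proof. by []. Qed.
Lemma geg1 : geg 1 = 'X. Proof. by rewrite /geg /= mulr1 scaler0 subr0. Qed.
Lemma zonal0 x : zonal x 0 = 1. Proof. by []. Qed.
Lemma zonal1 x : zonal x 1 = linf x. Proof. by rewrite /zonal /= mulr1 mulr0 scaler0 subr0. Qed.

Lemma two_step_ind (P : nat -> Prop) : P 0 -> P 1 -> (forall i, P i -> P i.+1 -> P i.+2) -> forall i, P i.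
Proof.
move=> P0 P1 PS i; suff: P i /\ P i.+1 by case.
by elim: i => [|i [ih1 ih2]]; split=> //; exact: PS.
Qed.

Lemma mderivXU i j : ('X_i : M)^`M(j) = (i == j)%:R.
Proof.
rewrite mderivX mnm1E; case: eqP => [->|_]; last by rewrite scale0r.
rewrite scale1r; suff -> : (U_(j) - U_(j) = 0)%MM by rewrite mpolyX0.
by apply/mnmP => k; rewrite mnmBE subnn mnm0E.
Qed.

Lemma dirderM x p q : dirder x (p * q) = dirder x p * q + p * dirder x q.
Proof.
rewrite /dirder mulr_suml mulr_sumr -big_split; apply: eq_bigr => j _ /=.
by rewrite mderivM scalerDr -scalerAl -scalerAr.
Qed.

Lemma dirderB x p q : dirder x (p - q) = dirder x p - dirder x q.
Proof. by rewrite /dirder -sumrB; apply: eq_bigr => j _; rewrite mderivB scalerBr. Qed.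

Lemma dirderZ x c p : dirder x (c *: p) = c *: dirder x p.
Proof. by rewrite /dirder scaler_sumr; apply: eq_bigr => j _; rewrite mderivZ !scalerA mulrC. Qed.

Lemma eulerM p q : euler (p * q) = euler p * q + p * euler q.
Proof.
rewrite /euler mulr_suml mulr_sumr -big_split; apply: eq_bigr => j _ /=.
by rewrite mderivM; ring.
Qed.

Lemma eulerB p q : euler (p - q) = euler p - euler q.
Proof. by rewrite /euler -sumrB; apply: eq_bigr => j _; rewrite mderivB mulrBr. Qed.

Lemma eulerZ c p : euler (c *: p) = c *: euler p.
Proof. by rewrite /euler scaler_sumr; apply: eq_bigr => j _; rewrite mderivZ scalerAr. Qed.

Lemma mderiv_linf x j : (linf x)^`M(j) = (x 0 j)%:MP.
Proof.
rewrite /linf raddf_sum (bigD1 j)//= mderivZ mderivXU eqxx big1 ?addr0.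
  by rewrite -mul_mpolyC mulr1.
by move=> k /negbTE kj; rewrite mderivZ mderivXU kj scaler0.
Qed.

Lemma mderiv_sqrad j : sqrad^`M(j) = 'X_j *+ 2.
Proof.
rewrite /sqrad raddf_sum (bigD1 j)//= expr2 mderivM mderivXU eqxx mul1r mulr1 big1 ?addr0//.
by move=> k /negbTE kj; rewrite expr2 mderivM mderivXU kj mul0r mulr0 addr0.
Qed.

Lemma dirder_linf x y : dirder x (linf y) = (dot x y)%:MP.
Proof.
rewrite /dirder /dot raddf_sum; apply: eq_bigr => j _; rewrite mderiv_linf -mul_mpolyC -mpolyCM //.
Qed.

Lemma dirder_sqrad x : dirder x sqrad = linf x *+ 2.
Proof. by rewrite /dirder /linf -sumrMnl; apply: eq_bigr => j _; rewrite mderiv_sqrad scalerMnr. Qed.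

Lemma euler_linf x : euler (linf x) = linf x.
Proof. by apply: eq_bigr => j _; rewrite mderiv_linf mulrC mul_mpolyC. Qed.

Lemma euler_sqrad : euler sqrad = sqrad *+ 2.
Proof. by rewrite /euler /sqrad -sumrMnl; apply: eq_bigr => j _; rewrite mderiv_sqrad mulrnAr -expr2. Qed.

Lemma laplacian_linfM x p : laplacian (linf x * p) = dirder x p *+ 2 + linf x * laplacian p.
Proof.
rewrite /laplacian /dirder -sumrMnl mulr_sumr -big_split; apply: eq_bigr => j _ /=.
rewrite mderivM mderiv_linf mderivD !mderivM mderiv_linf mderivC mul0r add0r !mul_mpolyC.
by ring.
Qed.

Lemma laplacian_sqradM p : laplacian (sqrad * p) = p *+ (2 * N) + euler p *+ 4 + sqrad * laplacian p.
Proof.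
have -> : p *+ (2 * N) = \sum_(j < N) p *+ 2.
  by rewrite sumr_const card_ord -mulrnA.
rewrite /laplacian /euler -sumrMnl mulr_sumr -!big_split; apply: eq_bigr => j _ /=.
rewrite mderivM mderiv_sqrad mderivD !mderivM mderiv_sqrad mderivMn mderivXU eqxx.
(* [ring] is impractical on {mpoly R[N]}: such identities are checked in an arbitrary ring. *)
have id_ring (A : comNzRingType) (X a a' r a'' : A) :
    (1 *+ 2) * a + (X *+ 2) * a' + ((X *+ 2) * a' + r * a'') =
    a *+ 2 + X * a' *+ 4 + r * a''.
  by rewrite !mulr2n; ring.
exact: id_ring.
Qed.

Lemma laplacianB p q : laplacian (p - q) = laplacian p - laplacian q.
Proof. by rewrite /laplacian -sumrB; apply: eq_bigr => j _; rewrite !mderivB. Qed.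

Lemma laplacianZ c p : laplacian (c *: p) = c *: laplacian p.
Proof. by rewrite /laplacian scaler_sumr; apply: eq_bigr => j _; rewrite !mderivZ. Qed.

Lemma euler_zonal x i : euler (zonal x i) = zonal x i *+ i.
Proof.
elim/two_step_ind: i => [||i ih1 ih2].
- by rewrite zonal0 mulr0n /euler big1// => j _; rewrite -mpolyC1 mderivC mulr0.
- by rewrite zonal1 euler_linf.
- rewrite zonalS eulerB eulerZ !eulerM euler_linf euler_sqrad ih1 ih2 -!mul_mpolyC.
  have id_ring (A : comNzRingType) (L P1 P0 c r : A) k :
      L * P1 + L * (P1 *+ k.+1) - c * (r *+ 2 * P0 + r * (P0 *+ k)) =
      (L * P1 - c * (r * P0)) *+ k.+2.
    by rewrite !mulrS !mulr0n mulrnBl !mulrnAr; ring.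
  exact: id_ring.
Qed.

Definition geg_dcoef i : R := geg_coef i * (N%:R + 2 * i%:R - 2).

Lemma geg_dcoef1 : geg_dcoef 1 = 1.
Proof.
have N2 : (2 : R) < N%:R by rewrite (ltr_nat R 2).
by rewrite /geg_dcoef /geg_coef; field; lra.
Qed.

Lemma geg_dcoefS i : geg_dcoef i.+2 = 1 + geg_dcoef i.+1 - 2 * geg_coef i.+1.
Proof.
have N2 : (2 : R) < N%:R by rewrite (ltr_nat R 2).
have i0 : (0 : R) <= i%:R by rewrite ler0n.
by rewrite /geg_dcoef /geg_coef -!natr1; field; lra.
Qed.

Lemma geg_dcoef_coef i : (geg_dcoef i.+2 - 2 * geg_coef i.+2) * geg_coef i.+1 =
  geg_coef i.+2 * geg_dcoef i.+1.
Proof.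
have N2 : (2 : R) < N%:R by rewrite (ltr_nat R 2).
have i0 : (0 : R) <= i%:R by rewrite ler0n.
by rewrite /geg_dcoef /geg_coef -!natr1; field; lra.
Qed.

Lemma dirder_zonal x i : dot x x = 1 -> dirder x (zonal x i.+1) = geg_dcoef i.+1 *: zonal x i.
Proof.
move=> x1; elim/two_step_ind: i => [||i ih1 ih2].
- by rewrite zonal1 zonal0 dirder_linf x1 geg_dcoef1 scale1r.
- have id_ring (A : comNzRingType) (L c r : A) :
      1 * L + L * 1 - c * (L *+ 2 + r * 0) = (1 + 1 - (c + c)) * L.
    by rewrite mulr2n; ring.
  rewrite zonalS zonal1 zonal0 dirderB dirderZ !dirderM !dirder_linf x1 mulr1 dirder_sqrad.
  rewrite geg_dcoefS geg_dcoef1 -!mul_mpolyC.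
  rewrite -mpolyC1 [dirder x _]big1 => [|j _]; last by rewrite mderivC scaler0.
  by rewrite mulr_natl mulr2n mpolyCB !mpolyCD !mpolyC1; exact: id_ring.
rewrite zonalS dirderB dirderZ !dirderM dirder_linf x1 dirder_sqrad ih1 ih2.
have id_ring (A : comNzRingType) (L Z0 Z1 Z2 c c1 g g1 r : A) :
    g * c1 = c * g1 + 2%:R * c * c1 -> L * Z1 = Z2 + c1 * (r * Z0) ->
    1 * Z2 + L * (g * Z1) - c * (L *+ 2 * Z1 + r * (g1 * Z0)) = (1 + g - 2%:R * c) * Z2.
  move=> gE LZ; rewrite mulr2n.
  have -> : 1 * Z2 + L * (g * Z1) - c * ((L + L) * Z1 + r * (g1 * Z0)) =
      Z2 + (g - 2%:R * c) * (L * Z1) - c * g1 * (r * Z0) by ring.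
  have -> : c * g1 = g * c1 - 2%:R * c * c1 by rewrite gE addrK.
  by rewrite LZ; ring.
rewrite (geg_dcoefS i.+1) -!mul_mpolyC.
have mpolyC_coef (g c : R) : (1 + g - 2 * c)%:MP = 1 + g%:MP - 2%:R * c%:MP :> M.
  by rewrite mpolyCB mpolyCD mpolyCM mpolyC_nat mpolyC1.
rewrite mpolyC_coef.
have gE : (geg_dcoef i.+2)%:MP * (geg_coef i.+1)%:MP =
    (geg_coef i.+2)%:MP * (geg_dcoef i.+1)%:MP + 2%:R * (geg_coef i.+2)%:MP * (geg_coef i.+1)%:MP :> M.
  have -> : 2%:R = (2%:R)%:MP :> M by rewrite mpolyC_nat.
  rewrite -!mpolyCM -mpolyCD; congr _%:MP.
  by apply: subr0_eq; rewrite -geg_dcoef_coef; ring.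
have zE : linf x * zonal x i.+1 = zonal x i.+2 + (geg_coef i.+1)%:MP * (sqrad * zonal x i).
  by rewrite zonalS mul_mpolyC subrK.
exact: (id_ring _ _ _ _ _ _ _ _ _ _ gE zE).
Qed.

Lemma laplacian_zonal x i : dot x x = 1 -> laplacian (zonal x i) = 0.
Proof.
move=> x1; elim/two_step_ind: i => [||i ih1 ih2].
- by rewrite zonal0 /laplacian big1// => j _; rewrite -mpolyC1 !mderivC.
- by rewrite zonal1 /laplacian big1// => j _; rewrite mderiv_linf mderivC.
- rewrite zonalS laplacianB laplacianZ laplacian_linfM laplacian_sqradM ih1 ih2 !mulr0 !addr0
  dirder_zonal// euler_zonal.
  rewrite /geg_dcoef -!mulrnA -!scaler_nat -scalerDl !scalerA -scalerBl.
  suff -> : 2 * (geg_coef i.+1 * (N%:R + 2 * i.+1%:R - 2)) - geg_coef i.+1 * ((2 * N)%:R +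
    (i * 4)%:R) = 0 by rewrite scale0r.
  by rewrite -(natr1 i) !natrM; ring.
Qed.

Definition row_point x : 'I_N -> R := fun j => x 0 j.

Lemma meval_linf x y : (linf x).@[row_point y] = dot x y.
Proof.
rewrite /linf raddf_sum; apply: eq_bigr => j _ /=.
by rewrite mevalZ mevalXU.
Qed.

Lemma meval_sqrad y : sqrad.@[row_point y] = dot y y.
Proof.
rewrite /sqrad raddf_sum; apply: eq_bigr => j _ /=.
by rewrite expr2 mevalM mevalXU.
Qed.

Lemma meval_zonal x y i : dot y y = 1 -> (zonal x i).@[row_point y] = (geg i).[dot x y].
Proof.
move=> y1; elim/two_step_ind: i => [||i ih1 ih2].
- by rewrite zonal0 geg0 hornerE -mpolyC1 mevalC.
- by rewrite zonal1 geg1 hornerX meval_linf.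
- by rewrite zonalS gegS !hornerE mevalB mevalZ !mevalM meval_linf meval_sqrad y1 mul1r ih1 ih2.
Qed.

(* The apolar product, for which multiplication by 'X_j is adjoint to differentiation. *)
Definition mfact (m : 'X_{1..N}) : R := \prod_j (m j)`!%:R.
Definition apolar p q : R := \sum_(m <- msupp p) mfact m * p@_m * q@_m.

Lemma apolarE s p q : uniq s -> {subset msupp p <= s} -> apolar p q = \sum_(m <- s) mfact m * p@_m * q@_m.
Proof.
move=> us ps; rewrite /apolar [RHS](bigID (fun m => m \in msupp p)) /= [X in _ + X]big1 ?addr0; last first.
  by move=> m /memN_msupp_eq0 ->; rewrite mulr0 mul0r.
rewrite -[RHS]big_filter; apply: perm_big; apply: uniq_perm; rewrite ?msupp_uniq ?filter_uniq//.
by move=> m; rewrite mem_filter; case: (boolP (m \in msupp p)) => // /ps ->.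
Qed.

Lemma apolarC p q : apolar p q = apolar q p.
Proof.
pose s := undup (msupp p ++ msupp q).
rewrite (@apolarE s p)/s ?undup_uniq//; last by move=> m mp; rewrite mem_undup mem_cat mp.
rewrite (@apolarE s q)/s ?undup_uniq//; last by move=> m mp; rewrite mem_undup mem_cat mp orbT.
by apply: eq_bigr => m _; rewrite mulrAC.
Qed.

Lemma apolarDr p q q' : apolar p (q + q') = apolar p q + apolar p q'.
Proof. by rewrite /apolar -big_split; apply: eq_bigr => m _; rewrite mcoeffD mulrDr. Qed.
Lemma apolarZr p c q : apolar p (c *: q) = c * apolar p q.
Proof. by rewrite /apolar mulr_sumr; apply: eq_bigr => m _; rewrite mcoeffZ mulrCA. Qed.
Lemma apolar0r p : apolar p 0 = 0.
Proof. by rewrite -(scale0r 0) apolarZr mul0r. Qed.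
Lemma apolar_sumr p (I : Type) (s : seq I) (P : pred I) (F : I -> M) :
  apolar p (\sum_(i <- s | P i) F i) = \sum_(i <- s | P i) apolar p (F i).
Proof. by apply: (big_morph (apolar p)) => [q q'|]; [exact: apolarDr|exact: apolar0r]. Qed.
Lemma apolar_suml q (I : Type) (s : seq I) (P : pred I) (F : I -> M) :
  apolar (\sum_(i <- s | P i) F i) q = \sum_(i <- s | P i) apolar (F i) q.
Proof. by rewrite apolarC apolar_sumr; apply: eq_bigr => i _; rewrite apolarC. Qed.
Lemma apolarDl p p' q : apolar (p + p') q = apolar p q + apolar p' q.
Proof. by rewrite ![apolar _ q]apolarC apolarDr. Qed.
Lemma apolarZl p c q : apolar (c *: p) q = c * apolar p q.
Proof. by rewrite ![apolar _ q]apolarC apolarZr. Qed.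

Lemma apolar_ge0 p : 0 <= apolar p p.
Proof.
apply: sumr_ge0 => m _; rewrite -mulrA -expr2 mulr_ge0 ?sqr_ge0//.
by apply: prodr_ge0 => j _; rewrite ler0n.
Qed.

Lemma apolarXl j p q : apolar ('X_j * p) q = apolar p q^`M(j).
Proof.
rewrite /apolar mulrC (perm_big _ (msuppMX p U_(j))) big_map; apply: eq_bigr => m _.
rewrite mcoeffMX mcoeff_deriv addmC.
have -> : mfact (m + U_(j)) = mfact m * (m j).+1%:R.
  rewrite /mfact (bigD1 j)//= [X in _ = X * _](bigD1 j)//= mnmDE mnm1E eqxx addn1 factS natrM.
  rewrite -[LHS]mulrA mulrC; congr (_ * _ * _); apply: eq_bigr => k kj.
  by rewrite mnmDE mnm1E eq_sym (negbTE kj) addn0.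
by rewrite -mulr_natl; ring.
Qed.

Lemma apolar_linf x p q : apolar (linf x * p) q = apolar p (dirder x q).
Proof.
rewrite /linf mulr_suml apolar_suml /dirder apolar_sumr; apply: eq_bigr => j _.
by rewrite -scalerAl apolarZl apolarZr apolarXl.
Qed.

Lemma apolar_sqrad p q : apolar (sqrad * p) q = apolar p (laplacian q).
Proof.
rewrite /sqrad mulr_suml apolar_suml /laplacian apolar_sumr; apply: eq_bigr => j _.
by rewrite expr2 -mulrA !apolarXl.
Qed.

Lemma laplacian_dirder x q : laplacian (dirder x q) = dirder x (laplacian q).
Proof.
have D_comm k p : (dirder x p)^`M(k) = dirder x p^`M(k).
  by rewrite /dirder raddf_sum; apply: eq_bigr => j _ /=; rewrite mderivZ mderiv_comm.
rewrite /laplacian; under eq_bigr do rewrite !D_comm.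
rewrite /dirder exchange_big; apply: eq_bigr => j _ /=.
by rewrite -scaler_sumr; congr (_ *: _); rewrite [RHS]raddf_sum.
Qed.

Lemma apolar_zonal x i q : laplacian q = 0 -> apolar (zonal x i) q = apolar 1 (iter i (dirder x) q).
Proof.
elim/two_step_ind: i q => [||i ih1 ih2] q q0.
- by rewrite zonal0.
- by rewrite zonal1 -[linf x]mulr1 apolar_linf.
- rewrite zonalS apolarDl -scaleNr apolarZl apolar_sqrad q0 apolar0r mulr0 addr0 apolar_linf ih2 ?iterSr//.
  by rewrite laplacian_dirder q0 /dirder big1// => j _; rewrite mderiv0 scaler0.
Qed.

Lemma apolar1l q : apolar 1 q = q@_0.
Proof.
rewrite /apolar -mpolyX0 msuppX big_seq1 mcoeffX eqxx mulr1 /mfact big1 ?mul1r// => j _.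
by rewrite mnm0E.
Qed.

Lemma meval_euler x q : (euler q).@[row_point x] = (dirder x q).@[row_point x].
Proof.
rewrite /euler /dirder !raddf_sum; apply: eq_bigr => j _ /=.
by rewrite mevalM mevalZ mevalXU.
Qed.

Lemma euler_sum (F : 'I_N -> M) : euler (\sum_j F j) = \sum_j euler (F j).
Proof.
rewrite /euler exchange_big /=; apply: eq_bigr => k _.
by rewrite -mulr_sumr; congr (_ * _); rewrite raddf_sum.
Qed.

Lemma euler_mderiv q j k : euler q = q *+ k.+1 -> euler q^`M(j) = q^`M(j) *+ k.
Proof.
move=> h; have hj := congr1 (fun p => p^`M(j)) h; rewrite /= mderivMn mulrS in hj.
apply: (@addrI _ q^`M(j)); rewrite -hj /euler raddf_sum.
rewrite -[X in X + _](_ : \sum_l (l == j)%:R * q^`M(l) = _); last first.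
  by rewrite (bigD1 j)//= eqxx mul1r big1 ?addr0// => l /negbTE ->; rewrite mul0r.
by rewrite -big_split; apply: eq_bigr => l _ /=; rewrite mderivM mderivXU mderiv_comm.
Qed.

Lemma euler_dirder x q k : euler q = q *+ k.+1 -> euler (dirder x q) = dirder x q *+ k.
Proof.
move=> h; rewrite /dirder euler_sum -sumrMnl; apply: eq_bigr => j _.
by rewrite eulerZ (euler_mderiv j h) scalerMnr.
Qed.

Lemma mcoeff_euler q m : (euler q)@_m = q@_m *+ mdeg m.
Proof.
rewrite /euler raddf_sum mdegE -sumrMnr; apply: eq_bigr => j _ /=.
rewrite mulrC; case: (posnP (m j)) => [m0|m0].
  rewrite m0 mulr0n; apply: memN_msupp_eq0; rewrite (perm_mem (msuppMX _ _)).
  apply/mapP => -[m' _ mE]; move: m0; rewrite mE mnmDE mnm1E eqxx //.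
have mE : m = (U_(j) + (m - U_(j)))%MM.
  apply/mnmP => k; rewrite mnmDE mnmBE mnm1E; case: eqP => [<-|_]; last by rewrite subn0.
  by rewrite subnKC.
rewrite {1}mE mcoeffMX mcoeff_deriv addmC -mE mnmBE mnm1E eqxx subn1 prednK//.
Qed.

Lemma mcoeff0_euler0 x q : euler q = 0 -> q@_0 = q.@[row_point x].
Proof.
move=> h; suff -> : q = (q@_0)%:MP by rewrite mevalC mcoeffC eqxx mulr1.
apply/mpolyP => m; rewrite mcoeffC; have [->|m0] := eqVneq m 0%MM; first by rewrite mulr1.
rewrite mulr0; have := mcoeff_euler q m; rewrite h mcoeff0 => /esym/eqP.
by rewrite mulrn_eq0 mdeg_eq0 (negbTE m0) => /eqP.
Qed.

Lemma mcoeff0_iter_dirder x q i : euler q = q *+ i -> (iter i (dirder x) q)@_0 = i`!%:R * q.@[row_point x].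
Proof.
elim: i q => [|i ih] q h; first by rewrite /= fact0 mul1r (mcoeff0_euler0 x).
rewrite iterSr ih; last exact: euler_dirder.
by rewrite -meval_euler h mevalMn factS natrM -mulr_natl; ring.
Qed.

Lemma apolar_zonal2 x y i : dot x x = 1 -> dot y y = 1 ->
  apolar (zonal x i) (zonal y i) = i`!%:R * (geg i).[dot y x].
Proof.
move=> x1 y1; rewrite apolar_zonal ?laplacian_zonal// apolar1l mcoeff0_iter_dirder ?euler_zonal//.
by rewrite meval_zonal.
Qed.

Lemma geg_posdef (T : finType) (A : {set T}) (x : T -> 'rV[R]_N) i :
  (forall c, dot (x c) (x c) = 1) ->
  0 <= \sum_(c in A) \sum_(c' in A) (geg i).[dot (x c) (x c')].
Proof.
move=> x1; have f0 : (0 : R) < i`!%:R by rewrite ltr0n fact_gt0.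
rewrite -(pmulr_rge0 _ f0) exchange_big /= mulr_sumr.
under eq_bigr do rewrite mulr_sumr.
have -> : \sum_(c' in A) \sum_(c in A) i`!%:R * (geg i).[dot (x c) (x c')] =
    apolar (\sum_(c in A) zonal (x c) i) (\sum_(c in A) zonal (x c) i).
  rewrite apolar_suml; apply: eq_bigr => c _; rewrite apolar_sumr; apply: eq_bigr => c' _.
  by rewrite apolar_zonal2.
exact: apolar_ge0.
Qed.

End zonal.

End Zonal.

From mathcomp Require Import all_classical all_reals all_analysis.
From mathcomp Require Import measurable_realfun normal_distribution.
Import numFieldNormedType.Exports.
Local Open Scope classical_set_scope.
Local Open Scope ring_scope.

(** * The one-dimensional normal law *)

Section density.
Local Open Scope ereal_scope.
Context d (T : measurableType d) (R : realType).
Variables (mu nu : {measure set T -> \bar R}) (g : T -> R).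
Hypothesis mg : measurable_fun setT g.
Hypothesis g0 : forall x, (0 <= g x)%R.
Hypothesis nuE : forall A, measurable A -> nu A = \int[mu]_(x in A) (g x)%:E.
Import HBNNSimple.

Let mgE : measurable_fun setT (EFin \o g).
Proof. exact/measurable_EFinP. Qed.

Lemma integral_density_nnsfun (h : {nnsfun T >-> R}) :
  \int[nu]_x (h x)%:E = \int[mu]_x ((h x)%:E * (g x)%:E).
Proof.
under [LHS]eq_integral do rewrite fimfunE -fsumEFin//.
rewrite [LHS]ge0_integral_fsum//; last 2 first.
  - by move=> r; exact/measurable_EFinP/measurableT_comp.
  - by move=> r x _; rewrite EFinM nnfun_muleindic_ge0.
under [RHS]eq_integral.
  move=> x _; rewrite fimfunE -fsumEFin// ge0_mule_fsuml; last first.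
    by move=> r; rewrite EFinM; exact: nnfun_muleindic_ge0.
  over.
rewrite [RHS]ge0_integral_fsum//; last 2 first.
  - by move=> r; apply: emeasurable_funM => //; exact/measurable_EFinP/measurableT_comp.
  - move=> r x _; apply: mule_ge0; last by rewrite lee_fin.
    by rewrite EFinM; exact: nnfun_muleindic_ge0.
apply: eq_fsbigr => r _.
rewrite integralZl_indic_nnsfun//= integral_indic// setIT nuE; last exact: measurable_sfunP.
have [r0|r0] := leP 0%R r; last first.
  rewrite preimage_nnfun0// integral_set0 mule0.
  by rewrite integral0_eq// => x _; rewrite indicE in_set0 mulr0 mul0e.
under [RHS]eq_integral do rewrite EFinM -muleA.
rewrite ge0_integralZl//; last 2 first.
- by apply: emeasurable_funM => //; exact/measurable_EFinP/measurable_indic.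
- by move=> x _; rewrite mule_ge0// lee_fin.
congr (_ * _); rewrite integral_mkcond/=; apply: eq_integral => x _.
by rewrite patchE indicE; case: ifPn => _; rewrite ?mul1e ?mul0e.
Qed.

Lemma integral_density (f : T -> \bar R) :
  measurable_fun setT f -> (forall x, 0 <= f x) ->
  \int[nu]_x f x = \int[mu]_x (f x * (g x)%:E).
Proof.
move=> mf f0; pose f_ := nnsfun_approx measurableT mf.
have cvgf x : (f_ n x)%:E @[n --> \oo] --> f x by exact: cvg_nnsfun_approx.
have ndf x : {homo (fun n => f_ n x) : m n / (m <= n)%N >-> (m <= n)%R}.
  by move=> m n mn; exact/lefP/nd_nnsfun_approx.
transitivity (limn (fun n => \int[nu]_x (f_ n x)%:E)).
  rewrite -monotone_convergence//=.
  - by apply: eq_integral => x _; exact/esym/cvg_lim.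
  - by move=> n; exact/measurable_EFinP/measurable_funTS.
  - by move=> n ? _; rewrite lee_fin.
  - by move=> x _ m n mn; rewrite lee_fin ndf.
transitivity (limn (fun n => \int[mu]_x ((f_ n x)%:E * (g x)%:E))).
  by apply: congr_lim; apply/funext => n; exact: integral_density_nnsfun.
rewrite -monotone_convergence//=.
- by apply: eq_integral => x _; apply/cvg_lim => //=; apply: cvgeZr.
- move=> n; apply: emeasurable_funM => //.
  exact/measurable_EFinP/measurable_funTS.
- by move=> n x _; rewrite mule_ge0// lee_fin.
- by move=> x _ m n mn; rewrite lee_wpmul2r ?lee_fin ?ndf.
Qed.

End density.

Section normal_law.
Context {R : realType}.
Local Open Scope ereal_scope.
Implicit Types (m s x a h v alpha beta : R) (f : R -> \bar R).
Local Notation mu := (@lebesgue_measure R).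
Local Notation N01 := (normal_prob (0 : R) 1).

Lemma measurable_affine alpha beta : measurable_fun setT (fun x => alpha * x + beta)%R.
Proof. by apply: measurable_funD => //; exact: measurable_funM. Qed.

Lemma measurable_normal_pdfE m s : measurable_fun setT (fun x => (normal_pdf m s x)%:E).
Proof. by apply/measurable_EFinP; exact: measurable_normal_pdf. Qed.

Lemma integral_normal_prob m s f :
  measurable_fun setT f -> (forall x, 0 <= f x) ->
  \int[normal_prob m s]_x f x = \int[mu]_x (f x * (normal_pdf m s x)%:E).
Proof.
move=> mf f0; apply: (@integral_density _ _ _ mu (normal_prob m s) (normal_pdf m s)) => //.
- exact: measurable_normal_pdf.
- by move=> x; exact: normal_pdf_ge0.
Qed.

Lemma integral_affine alpha beta f : (0 < alpha)%R ->
  measurable_fun setT f -> (forall x, 0 <= f x) ->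
  \int[mu]_x f x = alpha%:E * \int[mu]_x f (alpha * x + beta)%R.
Proof.
move=> a0 mf f0.
pose phi : measurableTypeR R -> measurableTypeR R := fun x => (alpha * x + beta)%R.
have mphi : measurable_fun setT phi by exact: measurable_affine.
have muE A : measurable A -> mu A = mscale (NngNum (ltW a0)) (pushforward mu phi) A.
  apply: lebesgue_measure_unique => //= _ [[a b]] _ <-; rewrite /mscale/=.
  have -> : pushforward mu phi `]a, b]%classic =
      mu `]((a - beta) / alpha)%R, ((b - beta) / alpha)%R]%classic.
    congr (mu _); apply/seteqP; split => x/=; rewrite /phi !in_itv/=.
      by rewrite ltr_pdivrMr// ler_pdivlMr// ltrBlDr lerBrDr (mulrC x).
    by rewrite ltr_pdivrMr// ler_pdivlMr// ltrBlDr lerBrDr (mulrC x).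
  rewrite !lebesgue_measure_itv/= !lte_fin ltr_pM2r ?invr_gt0// ltrD2r.
  case: ifPn => ab; last by rewrite mule0.
  rewrite -!EFinD -EFinM -mulrBl mulrCA mulfV ?gt_eqF// mulr1; congr (_%:E).
  by rewrite opprB addrA subrK.
rewrite (@eq_measure_integral _ _ _ _ (mscale (NngNum (ltW a0)) (pushforward mu phi))); last first.
  by move=> A mA _; exact: muE.
rewrite ge0_integral_mscale//=; congr (_ * _).
by rewrite ge0_integral_pushforward//= => x _; exact: f0.
Qed.

Lemma normal_peakM s : (0 < s)%R -> (s * normal_peak s = normal_peak 1)%R.
Proof.
move=> s0; rewrite /normal_peak expr1n mul1r -mulrnAr sqrtrM ?sqr_ge0//.
rewrite sqrtr_sqr gtr0_norm// invfM mulrA divff ?mul1r// gt_eqF//.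
Qed.

Lemma normal_pdf_expE m s x : (0 < s)%R ->
  normal_pdf m s x = (normal_peak s * expR (- (x - m) ^+ 2 / (2 * s ^+ 2)))%R.
Proof.
by move=> s0; rewrite normal_pdfE ?gt_eqF// /normal_fun -(mulr_natl (s ^+ 2)).
Qed.

Lemma normal_pdf_affine m s x : (0 < s)%R ->
  (s * normal_pdf m s (s * x + m) = normal_pdf 0 1 x)%R.
Proof.
move=> s0; rewrite !normal_pdf_expE// mulrA normal_peakM//; congr (_ * expR _)%R.
by rewrite addrK subr0; field; rewrite gt_eqF.
Qed.

Lemma integral_normal_affine m s f : (0 < s)%R ->
  measurable_fun setT f -> (forall x, 0 <= f x) ->
  \int[N01]_x f (s * x + m)%R = \int[normal_prob m s]_x f x.
Proof.
move=> s0 mf f0.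
have mfa : measurable_fun setT (fun x => f (s * x + m)%R).
  by apply: (measurableT_comp mf); exact: measurable_affine.
have mpa : measurable_fun setT (fun x => (normal_pdf m s (s * x + m))%:E).
  by apply: (measurableT_comp (measurable_normal_pdfE m s)); exact: measurable_affine.
rewrite (integral_normal_prob 0 1 mfa (fun=> f0 _)) (integral_normal_prob m s mf f0).
rewrite [RHS](integral_affine m s0); last 2 first.
- by apply: emeasurable_funM => //; exact: measurable_normal_pdfE.
- by move=> x; rewrite mule_ge0// lee_fin normal_pdf_ge0.
rewrite -ge0_integralZl//; last 3 first.
- exact: emeasurable_funM.
- by move=> x _; rewrite mule_ge0// lee_fin normal_pdf_ge0.
- by rewrite lee_fin ltW.
by apply: eq_integral => x _; rewrite muleCA -EFinM normal_pdf_affine.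
Qed.

Lemma normal_pdf_shift a x :
  (normal_pdf a 1 x = expR (a * x - a ^+ 2 / 2) * normal_pdf 0 1 x)%R.
Proof.
rewrite !normal_pdf_expE// [RHS]mulrCA -expRD; congr (_ * expR _)%R.
by field.
Qed.

Lemma integral_normal_shift a f :
  measurable_fun setT f -> (forall x, 0 <= f x) ->
  \int[N01]_x f (x + a)%R = \int[N01]_x (f x * (expR (a * x - a ^+ 2 / 2))%:E).
Proof.
move=> mf f0; under eq_integral do rewrite -[X in f (X + _)%R]mul1r.
have me : measurable_fun setT (fun x : R => (expR (a * x - a ^+ 2 / 2))%:E).
  by apply/measurable_EFinP/measurableT_comp => //; exact: measurable_affine.
have mfe := emeasurable_funM mf me.
have fe0 x : 0 <= f x * (expR (a * x - a ^+ 2 / 2))%:E by rewrite mule_ge0// lee_fin expR_ge0.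
rewrite (integral_normal_affine a ltr01 mf f0).
rewrite (integral_normal_prob a 1 mf f0) (integral_normal_prob 0 1 mfe fe0).
by apply: eq_integral => x _; rewrite normal_pdf_shift EFinM muleA.
Qed.

Lemma normal_pdf_quad v h x : (v < 1)%R ->
  (expR (h * x + v * x ^+ 2 / 2) * normal_pdf 0 1 x =
   expR (h ^+ 2 / (2 * (1 - v))) * (Num.sqrt (1 - v))^-1 *
   normal_pdf (h / (1 - v)) (Num.sqrt (1 - v))^-1 x)%R.
Proof.
move=> v1; set s := ((Num.sqrt (1 - v))^-1)%R.
have s0 : (0 < s)%R by rewrite invr_gt0 sqrtr_gt0 subr_gt0.
have s2 : (s ^+ 2 = (1 - v)^-1)%R by rewrite exprVn sqr_sqrtr// subr_ge0 ltW.
have expE : (expR (h * x + v * x ^+ 2 / 2) * expR (- (x - 0) ^+ 2 / (2 * 1 ^+ 2)) =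
    expR (h ^+ 2 / (2 * (1 - v))) * expR (- (x - h / (1 - v)) ^+ 2 / (2 * s ^+ 2)))%R.
  by rewrite -!expRD s2; congr expR; field; rewrite subr_eq0 gt_eqF.
by rewrite !normal_pdf_expE// -(normal_peakM s0) [LHS]mulrCA expE; ring.
Qed.

Lemma integral_normal_quad v h : (v < 1)%R ->
  \int[N01]_x (expR (h * x + v * x ^+ 2 / 2))%:E =
  (expR (h ^+ 2 / (2 * (1 - v))) * (Num.sqrt (1 - v))^-1)%:E.
Proof.
move=> v1; rewrite integral_normal_prob//; last first.
  apply/measurable_EFinP/measurableT_comp => //; apply: measurable_funD; first exact: measurable_funM.
  by apply: measurable_funM => //; apply: measurable_funM => //; exact: measurable_funX.
under eq_integral do rewrite -EFinM normal_pdf_quad// EFinM.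
rewrite ge0_integralZl//.
- by rewrite integral_normal_pdf mule1.
- exact: measurable_normal_pdfE.
- by move=> x _; rewrite lee_fin normal_pdf_ge0.
Qed.

(* Both sides are the joint density of (x, y) when x and y are standard normal with covariance beta. *)
Lemma normal_pdf_sym alpha beta x y : (0 < alpha)%R -> (alpha ^+ 2 + beta ^+ 2 = 1)%R ->
  (normal_pdf 0 1 x * normal_pdf (beta * x) alpha y =
   normal_pdf 0 1 y * normal_pdf (beta * y) alpha x)%R.
Proof.
move=> a0 ab1; rewrite !normal_pdf_expE// mulrACA [RHS]mulrACA -!expRD.
congr (_ * expR _)%R; have a2 : (alpha ^+ 2 != 0)%R by rewrite expf_neq0// gt_eqF.
move: a2; rewrite (_ : (alpha ^+ 2 = 1 - beta ^+ 2)%R); last by rewrite -ab1 addrK.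
by move=> a2; field.
Qed.

Lemma integral_normal_rot alpha beta f : (0 < alpha)%R -> (alpha ^+ 2 + beta ^+ 2 = 1)%R ->
  measurable_fun setT f -> (forall x, 0 <= f x) ->
  \int[N01]_x \int[N01]_y f (alpha * y + beta * x)%R = \int[N01]_x f x.
Proof.
move=> a0 ab1 mf f0.
pose p (z : R * R) := (normal_pdf 0 1 z.1 * normal_pdf (beta * z.1) alpha z.2)%R.
have p0 z : (0 <= p z)%R by rewrite mulr_ge0 ?normal_pdf_ge0.
have mp : measurable_fun setT p.
  apply: measurable_funM; first by apply: measurableT_comp => //; exact: measurable_normal_pdf.
  rewrite (_ : (fun z => _) = fun z : R * R =>
    (alpha^-1 * normal_pdf 0 1 (alpha^-1 * (z.2 - beta * z.1)))%R); last first.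
    apply/funext => z; rewrite -(@normal_pdf_affine (beta * z.1) alpha)// mulKf ?gt_eqF//.
    by rewrite mulVKf ?gt_eqF// subrK.
  apply: measurable_funM => //; apply: measurableT_comp; first exact: measurable_normal_pdf.
  apply: measurable_funM => //; apply: measurable_funB => //; exact: measurable_funM.
pose fp (z : R * R) := f z.2 * (p z)%:E.
have mfp : measurable_fun setT fp.
  by apply: emeasurable_funM; [exact: measurableT_comp|exact/measurable_EFinP].
have fp0 z : 0 <= fp z by rewrite mule_ge0// lee_fin.
transitivity (\int[mu]_x \int[mu]_y fp (x, y)).
  under eq_integral do rewrite integral_normal_affine//.
  rewrite integral_normal_prob//; last by move=> x; apply: integral_ge0.
    apply: eq_integral => x _; rewrite integral_normal_prob// -ge0_integralZr//; last 3 first.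
    - by apply: emeasurable_funM => //; exact: measurable_normal_pdfE.
    - by move=> y _; rewrite mule_ge0// lee_fin normal_pdf_ge0.
    - by rewrite lee_fin normal_pdf_ge0.
    by apply: eq_integral => y _; rewrite /fp -muleA -EFinM mulrC.
  under eq_fun do rewrite -integral_normal_affine//.
  apply: (@measurable_fun_fubini_tonelli_F _ _ _ _ _ N01
    (fun z : R * R => f (alpha * z.2 + beta * z.1)%R)) => //.
  apply: (measurableT_comp mf).
  by apply: measurable_funD; apply: measurable_funM.
rewrite fubini_tonelli// integral_normal_prob//; apply: eq_integral => y _.
rewrite /fp/= ge0_integralZl//; last 2 first.
- by apply/measurable_EFinP; apply: (measurableT_comp mp); exact: pair2_measurable.
- by move=> x _; rewrite lee_fin.
congr (_ * _); under eq_integral do rewrite /p/= normal_pdf_sym// EFinM.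
rewrite ge0_integralZl//.
- by rewrite integral_normal_pdf mule1.
- exact: measurable_normal_pdfE.
- by move=> x _; rewrite lee_fin normal_pdf_ge0.
- by rewrite lee_fin normal_pdf_ge0.
Qed.

End normal_law.

(** * Standard Gaussian vectors *)

Section gauss_measure.
Context {R : realType}.
Local Open Scope ereal_scope.
Local Notation N01 := (normal_prob (0 : R) 1).
Local Notation row_cons x v := (row_mx (\row_(j < 1) x) v).

Definition cons_pair n (z : measurableTypeR R * n.-tuple R) : n.+1.-tuple R :=
  [the n.+1.-tuple R of z.1 :: z.2].

Lemma measurable_cons_pair n : measurable_fun setT (@cons_pair n).
Proof. exact: measurable_cons. Qed.

HB.instance Definition _ n :=
  isMeasurableFun.Build _ _ _ _ (@cons_pair n) (@measurable_cons_pair n).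

Fixpoint gauss_prob n : probability (n.-tuple R) R :=
  match n with
  | 0%N => @dirac _ (0.-tuple R) [tuple] R
  | n'.+1 => distribution (N01 \x gauss_prob n') (@cons_pair n')
  end.

Definition tuple_row n (t : n.-tuple R) : 'rV[R]_n := \row_j tnth t j.
Definition row_tuple n (v : 'rV[R]_n) : n.-tuple R := [tuple v 0%R j | j < n].
Definition row_tail n (a : 'rV[R]_n.+1) : 'rV[R]_n := \row_j a 0%R (lift ord0 j).

Lemma row_tupleK n : cancel (@row_tuple n) (@tuple_row n).
Proof. by move=> v; apply/rowP => j; rewrite mxE tnth_mktuple. Qed.

Lemma row_cons_head n (x : R) (v : 'rV[R]_n) : (row_cons x v : 'rV[R]_n.+1) 0%R ord0 = x.
Proof. by rewrite mxE; case: splitP => k //; rewrite ?mxE// => /= h; rewrite mxE. Qed.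

Lemma row_consS n (x : R) (v : 'rV[R]_n) j :
  (row_cons x v : 'rV[R]_n.+1) 0%R (lift ord0 j) = v 0%R j.
Proof.
rewrite mxE; case: splitP => k /=; rewrite /bump leq0n add1n; first by case: k => -[].
by rewrite add1n => -[h]; congr (v _ _); apply/val_inj.
Qed.

Lemma row_tail_cons n x (v : 'rV[R]_n) : row_tail (row_cons x v) = v.
Proof. by apply/rowP => j; rewrite mxE row_consS. Qed.

Lemma row_head_tail n (a : 'rV[R]_n.+1) : a = row_cons (a 0%R ord0) (row_tail a).
Proof.
apply/rowP => j; case: (unliftP ord0 j) => [k ->|->]; rewrite ?row_consS ?row_cons_head//.
by rewrite mxE.
Qed.

Lemma tuple_row_cons n (z : measurableTypeR R * n.-tuple R) :
  tuple_row (cons_pair z) = row_cons z.1 (tuple_row z.2).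
Proof.
rewrite [LHS]row_head_tail mxE tnth0; congr (row_cons _ _).
by apply/rowP => j; rewrite !mxE tnthS.
Qed.

Lemma row_consD n (x y : R) (u v : 'rV[R]_n) :
  (row_cons x u + row_cons y v = row_cons (x + y) (u + v))%R.
Proof. by rewrite add_row_mx; congr row_mx; apply/rowP => j; rewrite !mxE. Qed.

Lemma row_consZ n (k x : R) (u : 'rV[R]_n) : (k *: row_cons x u = row_cons (k * x) (k *: u))%R.
Proof. by rewrite scale_row_mx; congr row_mx; apply/rowP => j; rewrite !mxE. Qed.

Lemma dot_row_cons n (a : 'rV[R]_n.+1) x (v : 'rV[R]_n) :
  dot a (row_cons x v : 'rV[R]_n.+1) = (a 0%R ord0 * x + dot (row_tail a) v)%R.
Proof.
rewrite /dot big_ord_recl row_cons_head; congr (_ + _)%R; apply: eq_bigr => i _.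
by rewrite row_consS mxE.
Qed.

Lemma norm2_head_tail n (a : 'rV[R]_n.+1) : norm2 a = (a 0%R ord0 ^+ 2 + norm2 (row_tail a))%R.
Proof.
by rewrite /norm2 big_ord_recl; congr (_ + _)%R; apply: eq_bigr => i _; rewrite mxE.
Qed.

Definition measurable_row d (T : measurableType d) n (phi : T -> 'rV[R]_n) :=
  forall j, measurable_fun setT (fun x => phi x 0%R j).

Definition measurable_rowfun n (f : 'rV[R]_n -> \bar R) := measurable_fun setT (f \o @tuple_row n).

Lemma measurable_tuple_row n : measurable_row (@tuple_row n).
Proof.
move=> j; rewrite (_ : (fun t => _) = (fun t => tnth t j)); first exact: measurable_tnth.
by apply/funext => t; rewrite mxE.
Qed.

Lemma measurable_row_comp d d' (T : measurableType d) (T' : measurableType d') n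
    (phi : T -> 'rV[R]_n) (g : T' -> T) :
  measurable_row phi -> measurable_fun setT g -> measurable_row (fun z => phi (g z)).
Proof. by move=> mphi mg j; exact: (measurableT_comp (mphi j)). Qed.

Lemma measurable_row_cst d (T : measurableType d) n (a : 'rV[R]_n) :
  measurable_row (fun _ : T => a).
Proof. by move=> j; exact: measurable_cst. Qed.

Lemma measurable_rowD d (T : measurableType d) n (phi psi : T -> 'rV[R]_n) :
  measurable_row phi -> measurable_row psi -> measurable_row (fun x => phi x + psi x)%R.
Proof. by move=> mphi mpsi j; under eq_fun do rewrite mxE; exact: measurable_funD. Qed.

Lemma measurable_rowZ d (T : measurableType d) n (k : R) (phi : T -> 'rV[R]_n) :
  measurable_row phi -> measurable_row (fun x => k *: phi x)%R.
Proof. by move=> mphi j; under eq_fun do rewrite mxE; exact: measurable_funM. Qed.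

Lemma measurable_row_tail d (T : measurableType d) n (phi : T -> 'rV[R]_n.+1) :
  measurable_row phi -> measurable_row (fun x => row_tail (phi x)).
Proof. by move=> mphi j; under eq_fun do rewrite mxE; exact: mphi. Qed.

Lemma measurable_row_cons d (T : measurableType d) n (x : T -> R) (phi : T -> 'rV[R]_n) :
  measurable_fun setT x -> measurable_row phi ->
  measurable_row (fun z => row_cons (x z) (phi z) : 'rV[R]_n.+1).
Proof.
move=> mx mphi j; case: (unliftP ord0 j) => [k ->|->].
  by under eq_fun do rewrite row_consS; exact: mphi.
by under eq_fun do rewrite row_cons_head.
Qed.

Lemma measurable_rowfun_comp d (T : measurableType d) n (f : 'rV[R]_n -> \bar R) (phi : T -> 'rV[R]_n) :
  measurable_row phi -> measurable_rowfun f -> measurable_fun setT (fun x => f (phi x)).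
Proof.
move=> mphi mf; rewrite (_ : (fun x => _) = (f \o @tuple_row n) \o (@row_tuple n \o phi)); last first.
  by apply/funext => x /=; rewrite row_tupleK.
apply: measurableT_comp => //; apply/measurable_fun_tnthP => i.
rewrite (_ : _ \o _ = fun x => phi x 0%R i); first exact: mphi.
by apply/funext => x/=; rewrite tnth_mktuple.
Qed.

Lemma measurable_dot d (T : measurableType d) n (a : 'rV[R]_n) (phi : T -> 'rV[R]_n) :
  measurable_row phi -> measurable_fun setT (fun x => dot a (phi x)).
Proof. by move=> mphi; apply: measurable_sum => i; apply: measurable_funM. Qed.

Lemma measurable_norm2 d (T : measurableType d) n (phi : T -> 'rV[R]_n) :
  measurable_row phi -> measurable_fun setT (fun x => norm2 (phi x)).
Proof. by move=> mphi; apply: measurable_sum => i; exact: measurable_funX. Qed.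

Lemma measurable_rowfun_expR_quad n (h : 'rV[R]_n) (k c : R) :
  measurable_rowfun (fun w => (expR (dot h w + k * norm2 w + c))%:E).
Proof.
apply/measurable_EFinP; apply: measurableT_comp => //.
apply: measurable_funD => //; apply: measurable_funD.
  by apply: measurable_dot; exact: measurable_tuple_row.
by apply: measurable_funM => //; apply: measurable_norm2; exact: measurable_tuple_row.
Qed.

Lemma measurable_gauss_integral d (T : measurableType d) n (F : T -> 'rV[R]_n -> \bar R) :
  (forall x v, 0 <= F x v) ->
  measurable_fun setT (fun z : T * n.-tuple R => F z.1 (tuple_row z.2)) ->
  measurable_fun setT (fun x => \int[gauss_prob n]_v F x (tuple_row v)).
Proof.
move=> F0 mF.
apply: (@measurable_fun_fubini_tonelli_F _ _ _ _ _ (gauss_prob n)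
  (fun z : T * n.-tuple R => F z.1 (tuple_row z.2))) => //=.
Qed.

Lemma integral_gauss_probS n (f : n.+1.-tuple R -> \bar R) :
  measurable_fun setT f -> (forall t, 0 <= f t) ->
  \int[gauss_prob n.+1]_t f t = \int[N01]_x \int[gauss_prob n]_v f (cons_pair (x, v)).
Proof.
move=> mf f0 /=; rewrite ge0_integral_distribution//= fubini_tonelli1//=.
by apply: measurableT_comp => //; exact: measurable_cons_pair.
Qed.

Lemma integral_gauss_rowS n (f : 'rV[R]_n.+1 -> \bar R) :
  measurable_rowfun f -> (forall w, 0 <= f w) ->
  \int[gauss_prob n.+1]_t f (tuple_row t) =
  \int[N01]_x \int[gauss_prob n]_v f (row_cons x (tuple_row v)).
Proof.
move=> mf f0; rewrite (@integral_gauss_probS n (f \o @tuple_row _)); [|exact: mf|by move=> t; exact: f0].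
by apply: eq_integral => x _; apply: eq_integral => v _ /=; rewrite tuple_row_cons.
Qed.

Lemma measurable_rowfun_cons n (f : 'rV[R]_n.+1 -> \bar R) x :
  measurable_rowfun f -> measurable_rowfun (fun v => f (row_cons x v)).
Proof.
apply: (@measurable_rowfun_comp _ _ n.+1).
by apply: measurable_row_cons => //; exact: measurable_tuple_row.
Qed.

Lemma gauss_expectE n (f : 'rV[R]_n -> \bar R) : measurable_rowfun f -> (forall v, 0 <= f v) ->
  gauss_expect f = \int[gauss_prob n]_t f (tuple_row t).
Proof.
elim: n f => [|n ih] f mf f0 /=.
  by rewrite integral_dirac//= diracT mul1e; congr f; apply/rowP => -[].
rewrite -/(gauss_prob n.+1) integral_gauss_rowS//.
by apply: eq_integral => x _; rewrite ih//; exact: measurable_rowfun_cons.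
Qed.

Lemma integral_gauss_shift n (a : 'rV[R]_n) (f : 'rV[R]_n -> \bar R) :
  measurable_rowfun f -> (forall v, 0 <= f v) ->
  \int[gauss_prob n]_t f (tuple_row t + a)%R =
  \int[gauss_prob n]_t (f (tuple_row t) * (expR (dot a (tuple_row t) - norm2 a / 2))%:E).
Proof.
pose q m (b w : 'rV[R]_m) := (expR (dot b w - norm2 b / 2))%:E.
have q0 m (b w : 'rV[R]_m) : 0 <= q m b w by rewrite lee_fin expR_ge0.
have mq m (b : 'rV[R]_m) : measurable_rowfun (q m b).
  have := measurable_rowfun_expR_quad b 0 (- (norm2 b / 2)).
  by under eq_fun do rewrite mul0r addr0.
elim: n a f => [|n ih] a f mf f0.
  apply: eq_integral => t _.
  have -> : (tuple_row t + a = tuple_row t)%R by apply/rowP => -[].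
  by rewrite /dot /norm2 !big_ord0 mul0r subr0 expR0 mule1.
pose G x := \int[gauss_prob n]_v (f (row_cons x (tuple_row v)) * q n (row_tail a) (tuple_row v)).
have mfq : measurable_rowfun (fun w : 'rV[R]_n.+1 => f w * q n (row_tail a) (row_tail w)).
  apply: emeasurable_funM => //; apply: measurable_rowfun_comp (mq _ _).
  by apply: measurable_row_tail; exact: measurable_tuple_row.
have G0 x : 0 <= G x by apply: integral_ge0 => v _; exact: mule_ge0.
have mG : measurable_fun setT G.
  apply: (@measurable_gauss_integral _ R n (fun x v => f (row_cons x v) * q n (row_tail a) v)).
    by move=> x v; exact: mule_ge0.
  have mcons : measurable_row (fun z : R * n.-tuple R => row_cons z.1 (tuple_row z.2) : 'rV[R]_n.+1).
    by apply: measurable_row_cons => //; exact: measurable_row_comp (@measurable_tuple_row n) _.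
  by have := measurable_rowfun_comp mcons mfq; under eq_fun do rewrite row_tail_cons.
transitivity (\int[N01]_x G (x + a 0%R ord0)%R).
  rewrite (@integral_gauss_rowS n (fun w => f (w + a)%R))//; last first.
    apply: (@measurable_rowfun_comp _ _ n.+1 f) => //.
    by apply: measurable_rowD; [exact: measurable_tuple_row|exact: measurable_row_cst].
  apply: eq_integral => x _.
  rewrite /G /q -(ih _ (fun v => f (row_cons (x + a 0 ord0)%R v)))//; last exact: measurable_rowfun_cons.
  by apply: eq_integral => v _; rewrite [in LHS](row_head_tail a) row_consD.
rewrite (@integral_normal_shift _ _ G mG G0).
rewrite (@integral_gauss_rowS n (fun w => f w * q n.+1 a w)); last 2 first.
- by apply: emeasurable_funM => //; exact: mq.
- by move=> w; exact: mule_ge0.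
apply: eq_integral => x _; rewrite /G -ge0_integralZr//; last 2 first.
- by apply: emeasurable_funM; [exact: measurable_rowfun_cons|exact: mq].
- by move=> v _; exact: mule_ge0.
apply: eq_integral => v _; rewrite -muleA -EFinM -expRD; congr (_ * (expR _)%:E).
by rewrite dot_row_cons norm2_head_tail; field.
Qed.

Lemma integral_gauss_quad n (v : R) (h : 'rV[R]_n) : (v < 1)%R ->
  \int[gauss_prob n]_t (expR (dot h (tuple_row t) + v * norm2 (tuple_row t) / 2))%:E =
  (expR (norm2 h / (2 * (1 - v))) * ((Num.sqrt (1 - v))^-1) ^+ n)%:E.
Proof.
move=> v1.
have mq m (g : 'rV[R]_m) : measurable_rowfun (fun w => (expR (dot g w + v * norm2 w / 2))%:E).
  have := measurable_rowfun_expR_quad g (v / 2) 0; rewrite /measurable_rowfun.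
  by under eq_fun do rewrite addr0 mulrAC.
elim: n h => [|n ih] h.
  under eq_integral do rewrite /norm2 /dot !big_ord0 mulr0 mul0r addr0 expR0.
  by rewrite integral_cst//= mul1e probability_setT /norm2 big_ord0 mul0r expR0 mulr1.
rewrite (@integral_gauss_rowS n (fun w => (expR (dot h w + v * norm2 w / 2))%:E))//.
under eq_integral.
  move=> x _; under eq_integral.
    move=> t _; rewrite dot_row_cons norm2_head_tail row_cons_head row_tail_cons mulrDr mulrDl addrACA.
    rewrite expRD EFinM; over.
  rewrite ge0_integralZl//; first by rewrite ih; over.
  exact: mq.
rewrite ge0_integralZr//.
- rewrite integral_normal_quad// -EFinM norm2_head_tail; congr (_%:E).
  by rewrite [in RHS]mulrDl expRD [(_ ^+ n.+1)%R]exprS; ring.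
- apply/measurable_EFinP; apply: measurableT_comp => //; apply: measurable_funD; first exact: measurable_funM.
  by do 2 apply: measurable_funM => //; exact: measurable_funX.
Qed.

Section gauss_rot.
Variables (n : nat) (alpha beta : R) (f : 'rV[R]_n.+1 -> \bar R).
Hypotheses (mf : measurable_rowfun f) (f0 : forall v, 0 <= f v).

Definition rot_slice (t : 'rV[R]_n.+1) y := \int[gauss_prob n]_u
  f (row_cons (alpha * y + beta * t 0 ord0) (alpha *: tuple_row u + beta *: row_tail t))%R.

Lemma rot_slice_ge0 t y : 0 <= rot_slice t y. Proof. exact: integral_ge0. Qed.

Lemma measurable_row_comb d (T : measurableType d) m (t u : T -> 'rV[R]_m) :
  measurable_row t -> measurable_row u -> measurable_row (fun z => alpha *: u z + beta *: t z)%R.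
Proof. by move=> mt mu; apply: measurable_rowD; exact: measurable_rowZ. Qed.

Lemma measurable_rot_slice d (T : measurableType d) (t : T -> 'rV[R]_n.+1) (y : T -> R) :
  measurable_row t -> measurable_fun setT y -> measurable_fun setT (fun z => rot_slice (t z) (y z)).
Proof.
move=> mt my; apply: (@measurable_gauss_integral _ T n (fun z u =>
  f (row_cons (alpha * y z + beta * t z 0 ord0) (alpha *: u + beta *: row_tail (t z)))%R)) => //.
apply: (@measurable_rowfun_comp _ _ n.+1 f) => //; apply: measurable_row_cons.
  apply: measurable_funD; apply: measurable_funM => //; first exact: measurableT_comp.
  exact: measurableT_comp (mt ord0) _.
apply: measurable_row_comb; last exact: measurable_row_comp (@measurable_tuple_row n) _.
by apply: measurable_row_tail; exact: measurable_row_comp mt _.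
Qed.

Lemma integral_rot_slice :
  \int[gauss_prob n.+1]_t \int[gauss_prob n.+1]_u f (alpha *: tuple_row u + beta *: tuple_row t)%R =
  \int[N01]_x \int[gauss_prob n]_t \int[N01]_y rot_slice (row_cons x (tuple_row t)) y.
Proof.
have slice_ge0 t y : 0 <= rot_slice t y by exact: rot_slice_ge0.
transitivity (\int[gauss_prob n.+1]_t \int[N01]_y rot_slice (tuple_row t) y).
  apply: eq_integral => t _.
  rewrite (@integral_gauss_rowS n (fun w => f (alpha *: w + beta *: tuple_row t)%R)).
  - apply: eq_integral => y _; apply: eq_integral => u _; congr f.
    by rewrite [in LHS](row_head_tail (tuple_row t)) !row_consZ row_consD.
  - apply: (@measurable_rowfun_comp _ _ n.+1 f) => //.
    by apply: measurable_row_comb; [exact: measurable_row_cst|exact: measurable_tuple_row].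
  - by move=> w; exact: f0.
apply: (@integral_gauss_rowS n (fun w => \int[N01]_y rot_slice w y)).
- apply: (@measurable_fun_fubini_tonelli_F _ _ _ _ _ N01
    (fun z : n.+1.-tuple R * measurableTypeR R => rot_slice (tuple_row z.1) z.2)) => //=.
  by apply: measurable_rot_slice => //; exact: measurable_row_comp (@measurable_tuple_row n.+1) _.
- by move=> w; apply: integral_ge0.
Qed.

End gauss_rot.

Lemma integral_gauss_rot n (alpha beta : R) (f : 'rV[R]_n -> \bar R) :
  (0 < alpha)%R -> (alpha ^+ 2 + beta ^+ 2 = 1)%R ->
  measurable_rowfun f -> (forall v, 0 <= f v) ->
  \int[gauss_prob n]_t \int[gauss_prob n]_u f (alpha *: tuple_row u + beta *: tuple_row t)%R =
  \int[gauss_prob n]_t f (tuple_row t).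
Proof.
move=> a0 ab1; elim: n f => [|n ih] f mf f0.
  under eq_integral.
    move=> t _; under eq_integral.
      move=> u _; rewrite (_ : (_ + _)%R = tuple_row t); last by apply/rowP => -[].
      over.
    by rewrite integral_cst//= probability_setT mule1; over.
  by [].
rewrite integral_rot_slice//.
have slice_ge0 t y : 0 <= rot_slice alpha beta f t y by exact: rot_slice_ge0.
pose g x := \int[gauss_prob n]_t f (row_cons x (tuple_row t)).
transitivity (\int[N01]_x \int[N01]_y g (alpha * y + beta * x)%R).
  apply: eq_integral => x _.
  rewrite (@fubini_tonelli _ _ _ _ _ (gauss_prob n) N01
    (fun z : n.-tuple R * measurableTypeR R => rot_slice alpha beta f (row_cons x (tuple_row z.1)) z.2))//=.
    apply: eq_integral => y _; rewrite /g -(ih (fun w => f (row_cons _ w))); last 2 first.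
    - exact: measurable_rowfun_cons.
    - by move=> w; exact: f0.
    by apply: eq_integral => t _; rewrite /rot_slice row_cons_head row_tail_cons.
  apply: measurable_rot_slice => //; apply: measurable_row_cons => //.
  exact: measurable_row_comp (@measurable_tuple_row n) _.
rewrite (integral_normal_rot a0 ab1); last 2 first.
- apply: (@measurable_gauss_integral _ R n (fun x v => f (row_cons x v))) => //.
  apply: (@measurable_rowfun_comp _ _ n.+1 f) => //; apply: measurable_row_cons => //.
  exact: measurable_row_comp (@measurable_tuple_row n) _.
- by move=> x; apply: integral_ge0.
by rewrite (@integral_gauss_rowS n f).
Qed.

End gauss_measure.

(** * Gaussian expectation of functions of exponential growth *)

Section norm2.
Context {R : realType} {n : nat}.
Implicit Types u v : 'rV[R]_n.

Lemma norm2E u : norm2 u = dot u u.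
Proof. by apply: eq_bigr => i _; rewrite expr2. Qed.

Lemma norm2_ge0 u : 0 <= norm2 u.
Proof. by apply: sumr_ge0 => i _; exact: sqr_ge0. Qed.

Lemma norm2_0 : norm2 (0 : 'rV[R]_n) = 0.
Proof. by rewrite norm2E dot0l. Qed.

Lemma norm2_eq0 u : norm2 u = 0 -> u = 0.
Proof.
move=> /eqP; rewrite /norm2 psumr_eq0 => [/allP h|i _]; last exact: sqr_ge0.
apply/rowP => i; rewrite mxE; apply/eqP; rewrite -sqrf_eq0; apply: h.
by rewrite mem_index_enum.
Qed.

Lemma norm2Z k u : norm2 (k *: u) = k ^+ 2 * norm2 u.
Proof. by rewrite !norm2E dotZl dotZr mulrA expr2. Qed.

Lemma norm2D u v : norm2 (u + v) = norm2 u + norm2 v + 2 * dot u v.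
Proof. by rewrite !norm2E !(dotDl, dotDr) (dotC v u); ring. Qed.

Lemma norm2B u v : norm2 (u - v) = norm2 u + norm2 v - 2 * dot u v.
Proof. by rewrite !norm2E !(dotBl, dotBr) (dotC v u); ring. Qed.

Lemma dot_unit u v : norm2 u = 1 -> norm2 v = 1 -> `|dot u v| <= 1.
Proof.
move=> u1 v1; have := norm2_ge0 (u - v); have := norm2_ge0 (u + v).
by rewrite norm2B norm2D u1 v1 ler_norml; lra.
Qed.

Lemma dot_sqr_le u v : dot u v ^+ 2 <= norm2 u * norm2 v.
Proof.
have [v0|v_neq0] := eqVneq (norm2 v) 0.
  by rewrite (norm2_eq0 v0) dotC dot0l norm2_0 mulr0 expr0n.
have v0 : 0 < norm2 v by rewrite lt0r v_neq0 norm2_ge0.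
have := norm2_ge0 (norm2 v *: u - dot u v *: v).
rewrite norm2B !norm2Z dotZl dotZr -(pmulr_rge0 _ v0).
have -> : norm2 v ^+ 2 * norm2 u + dot u v ^+ 2 * norm2 v - 2 * (norm2 v * (dot u v * dot u v)) =
  norm2 v * (norm2 u * norm2 v - dot u v ^+ 2) by ring.
by rewrite !(pmulr_rge0 _ v0) subr_ge0.
Qed.

End norm2.

Section norm1.
Context {R : realType} {n : nat}.
Implicit Types u v w : 'rV[R]_n.

Definition norm1 w : R := \sum_i `|w 0 i|.

Lemma norm1_ge0 w : 0 <= norm1 w.
Proof. exact: sumr_ge0. Qed.

Lemma norm1D u v : norm1 (u + v) <= norm1 u + norm1 v.
Proof. by rewrite /norm1 -big_split; apply: ler_sum => i _; rewrite mxE ler_normD. Qed.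

Lemma norm1Z k v : norm1 (k *: v) = `|k| * norm1 v.
Proof. by rewrite /norm1 mulr_sumr; apply: eq_bigr => i _; rewrite mxE normrM. Qed.

Lemma normr_le_norm1 w i : `|w 0 i| <= norm1 w.
Proof. by rewrite /norm1 (bigD1 i)//= lerDl; exact: sumr_ge0. Qed.

Lemma dot_le_norm1 u w : `|dot u w| <= norm1 u * norm1 w.
Proof.
rewrite (le_trans (ler_norm_sum _ _ _))// /norm1 mulr_sumr; apply: ler_sum => i _.
by rewrite normrM ler_wpM2r// normr_le_norm1.
Qed.

Lemma norm2_le_norm1 w : norm2 w <= norm1 w ^+ 2.
Proof.
rewrite /norm2 [leRHS]expr2 [leRHS]mulr_suml; apply: ler_sum => i _.
by rewrite -real_normK ?num_real// expr2 ler_wpM2l// normr_le_norm1.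
Qed.

Lemma measurable_norm1 d (T : measurableType d) (phi : T -> 'rV[R]_n) :
  measurable_row phi -> measurable_fun setT (fun t => norm1 (phi t)).
Proof.
by move=> mphi; apply: measurable_sum => i; apply: measurableT_comp => //; exact: mphi.
Qed.

Lemma expR_norm1_le (C : R) w :
  expR (C * norm1 w) <= expR (n%:R * C ^+ 2) * expR (2^-1 * norm2 w / 2).
Proof.
rewrite -expRD ler_expR /norm1 /norm2.
have -> : n%:R * C ^+ 2 = \sum_(i < n) C ^+ 2 by rewrite sumr_const card_ord mulr_natl.
rewrite mulr_sumr mulr_sumr mulr_suml -big_split/=.
apply: ler_sum => i _; rewrite -[w 0 i ^+ 2]real_normK ?num_real//.
by have := sqr_ge0 (C - `|w 0 i| / 2); nra.
Qed.

End norm1.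

Section exponential_growth.
Context {R : realType}.
Implicit Types n m : nat.

Definition expgrowth n (f : 'rV[R]_n -> R) :=
  measurable_fun setT (f \o @tuple_row R n) /\
  exists2 C, 0 <= C & forall w, `|f w| <= C * expR (C * norm1 w).

Lemma expgrowth_measurable n (f : 'rV[R]_n -> R) :
  expgrowth f -> measurable_fun setT (f \o @tuple_row R n).
Proof. by case. Qed.

Lemma expgrowth_rowfun n (f : 'rV[R]_n -> R) : expgrowth f -> measurable_rowfun (fun w => (f w)%:E).
Proof. by case=> mf _; apply/measurable_EFinP. Qed.

Lemma measurable_expgrowth d (T : measurableType d) n (f : 'rV[R]_n -> R) (phi : T -> 'rV[R]_n) :
  measurable_row phi -> expgrowth f -> measurable_fun setT (fun x => f (phi x)).
Proof.
move=> mphi gf; have := measurable_rowfun_comp mphi (expgrowth_rowfun gf).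
by move/measurable_EFinP.
Qed.

Lemma expgrowth_le n (f g : 'rV[R]_n -> R) :
  measurable_fun setT (f \o @tuple_row R n) -> expgrowth g ->
  (forall w, `|f w| <= `|g w|) -> expgrowth f.
Proof.
move=> mf [_ [C C0 gC]] fg; split=> //; exists C => // w.
exact: le_trans (fg w) (gC w).
Qed.

Lemma expgrowth_cst n k : expgrowth (fun _ : 'rV[R]_n => k).
Proof.
split; first exact: measurable_cst.
exists `|k| => // w; rewrite ler_peMr// -expR0 ler_expR.
by rewrite mulr_ge0// norm1_ge0.
Qed.

Lemma expgrowthD n (f g : 'rV[R]_n -> R) :
  expgrowth f -> expgrowth g -> expgrowth (fun w => f w + g w).
Proof.
move=> [mf [C C0 fC]] [mg [D D0 gD]]; split; first exact: measurable_funD.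
exists (C + D) => [|w]; first exact: addr_ge0.
rewrite (le_trans (ler_normD _ _))// mulrDl lerD//.
  by rewrite (le_trans (fC w))// ler_wpM2l// ler_expR ler_wpM2r ?norm1_ge0// lerDl.
by rewrite (le_trans (gD w))// ler_wpM2l// ler_expR ler_wpM2r ?norm1_ge0// lerDr.
Qed.

Lemma expgrowthM n (f g : 'rV[R]_n -> R) :
  expgrowth f -> expgrowth g -> expgrowth (fun w => f w * g w).
Proof.
move=> [mf [C C0 fC]] [mg [D D0 gD]]; split; first exact: measurable_funM.
exists (C * D + (C + D)) => [|w]; first by rewrite !addr_ge0// mulr_ge0.
rewrite normrM (le_trans (ler_pM _ _ (fC w) (gD w)))// mulrACA -expRD -mulrDl.
apply: ler_pM; rewrite ?mulr_ge0 ?expR_ge0//.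
  by rewrite lerDl addr_ge0.
by rewrite ler_expR ler_wpM2r ?norm1_ge0// lerDr mulr_ge0.
Qed.

Lemma expgrowthZ n k (f : 'rV[R]_n -> R) : expgrowth f -> expgrowth (fun w => k * f w).
Proof. by move=> gf; apply: expgrowthM => //; exact: expgrowth_cst. Qed.

Lemma expgrowthN n (f : 'rV[R]_n -> R) : expgrowth f -> expgrowth (fun w => - f w).
Proof. by move=> gf; under eq_fun do rewrite -mulN1r; exact: expgrowthZ. Qed.

Lemma expgrowthB n (f g : 'rV[R]_n -> R) :
  expgrowth f -> expgrowth g -> expgrowth (fun w => f w - g w).
Proof. by move=> gf gg; apply: expgrowthD => //; exact: expgrowthN. Qed.

Lemma expgrowthX n (f : 'rV[R]_n -> R) k : expgrowth f -> expgrowth (fun w => f w ^+ k).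
Proof.
move=> gf; elim: k => [|k ih]; first exact: expgrowth_cst.
by under eq_fun do rewrite exprS; exact: expgrowthM.
Qed.

Lemma expgrowth_sum n (I : Type) (r : seq I) (P : pred I) (f : I -> 'rV[R]_n -> R) :
  (forall i, P i -> expgrowth (f i)) -> expgrowth (fun w => \sum_(i <- r | P i) f i w).
Proof.
move=> gf; elim: r => [|i r ih].
  by under eq_fun do rewrite big_nil; exact: expgrowth_cst.
case: (boolP (P i)) => Pi; last by under eq_fun do rewrite big_cons (negbTE Pi).
under eq_fun do rewrite big_cons Pi.
by apply: expgrowthD => //; exact: gf.
Qed.

Lemma expgrowth_norm n (f : 'rV[R]_n -> R) : expgrowth f -> expgrowth (fun w => `|f w|).
Proof.
move=> gf; apply: (expgrowth_le _ gf) => [|w]; last by rewrite normr_id.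
by apply: measurableT_comp => //; exact: expgrowth_measurable gf.
Qed.

Lemma expgrowth_ind n (P : 'rV[R]_n -> bool) :
  measurable_fun setT (fun t : n.-tuple R => P (tuple_row t)) -> expgrowth (fun w => (P w)%:R).
Proof.
move=> mP; apply: (expgrowth_le _ (expgrowth_cst n 1)) => [|w]; last first.
  by case: (P w); rewrite ?normr0 ?normr1 ?ler01 ?lexx.
rewrite (_ : _ \o _ = fun t : n.-tuple R => if P (tuple_row t) then 1 else 0 : R).
  exact: measurable_fun_ifT.
by apply/funext => t /=; case: (P _).
Qed.

Lemma measurable_row_dot n (a : 'rV[R]_n) : measurable_fun setT ((fun w => dot a w) \o @tuple_row R n).
Proof. by apply: measurable_dot; exact: measurable_tuple_row. Qed.

Lemma expgrowth_dot n (a : 'rV[R]_n) : expgrowth (fun w => dot a w).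
Proof.
split; first exact: measurable_row_dot.
exists (1 + norm1 a) => [|w]; first by rewrite addr_ge0// norm1_ge0.
rewrite (le_trans (dot_le_norm1 _ _))//; have a0 := norm1_ge0 a; have w0 := norm1_ge0 w.
have := expR_ge1Dx ((1 + norm1 a) * norm1 w); nra.
Qed.

Lemma expgrowth_norm2 n : expgrowth (@norm2 R n).
Proof.
split; first by apply: measurable_norm2; exact: measurable_tuple_row.
exists 2 => // w; rewrite ger0_norm ?norm2_ge0//; apply: (le_trans (norm2_le_norm1 w)).
have -> : expR (2 * norm1 w) = expR (norm1 w) ^+ 2 by rewrite -expRM_natl mulrC.
by have := norm1_ge0 w; have := expR_ge1Dx (norm1 w); nra.
Qed.

Lemma expgrowth_expR_norm1 n (C : R) : 0 <= C -> expgrowth (fun w : 'rV[R]_n => expR (C * norm1 w)).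
Proof.
move=> C0; split.
  apply: measurableT_comp => //; apply: measurable_funM => //.
  by apply: measurable_norm1; exact: measurable_tuple_row.
exists (1 + C) => [|w]; first by rewrite addr_ge0.
rewrite ger0_norm ?expR_ge0// -[leLHS]mul1r; apply: ler_pM; rewrite ?expR_ge0 ?lerDl//.
by rewrite ler_expR ler_wpM2r ?norm1_ge0// lerDr.
Qed.

Lemma expgrowth_expR_dot n (a : 'rV[R]_n) : expgrowth (fun w => expR (dot a w)).
Proof.
apply: (expgrowth_le _ (expgrowth_expR_norm1 n (norm1_ge0 a))) => [|w].
  by apply: measurableT_comp => //; exact: measurable_row_dot.
by rewrite !ger0_norm ?expR_ge0// ler_expR (le_trans (ler_norm _))// dot_le_norm1.
Qed.

Lemma expgrowth_expR_quad n (h : 'rV[R]_n) (l : R) : 0 <= l ->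
  expgrowth (fun w => expR (dot h w - l * norm2 w)).
Proof.
move=> l0; apply: (expgrowth_le _ (expgrowth_expR_dot h)) => [|w].
  apply: measurableT_comp => //; apply: measurable_funB; first exact: measurable_row_dot.
  by apply: measurable_funM => //; apply: measurable_norm2; exact: measurable_tuple_row.
by rewrite !ger0_norm ?expR_ge0// ler_expR gerBl mulr_ge0// norm2_ge0.
Qed.

Lemma expgrowth_comp n m (f : 'rV[R]_n -> R) (phi : 'rV[R]_m -> 'rV[R]_n) K :
  0 <= K -> measurable_row (phi \o @tuple_row R m) ->
  (forall w, norm1 (phi w) <= K * (1 + norm1 w)) ->
  expgrowth f -> expgrowth (fun w => f (phi w)).
Proof.
move=> K0 mphi phiK gf; split; first exact: measurable_expgrowth gf.
case: gf => _ [C C0 fC]; exists (C * expR (C * K) + C * K) => [|w].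
  by rewrite addr_ge0 ?mulr_ge0 ?expR_ge0.
rewrite (le_trans (fC _))//.
apply: (@le_trans _ _ (C * (expR (C * K) * expR (C * K * norm1 w)))).
  by rewrite ler_wpM2l// -expRD ler_expR -mulrA -mulrDr ler_wpM2l// -[X in X + _]mulr1 -mulrDr.
rewrite mulrA; apply: ler_pM; rewrite ?mulr_ge0 ?expR_ge0//.
  by rewrite lerDl mulr_ge0.
by rewrite ler_expR ler_wpM2r ?norm1_ge0// lerDr mulr_ge0// expR_ge0.
Qed.

Lemma expgrowth_affine n (f : 'rV[R]_n -> R) k a :
  expgrowth f -> expgrowth (fun w => f (k *: w + a)).
Proof.
apply: (@expgrowth_comp _ _ _ _ (`|k| + norm1 a)) => [||w].
- by rewrite addr_ge0// norm1_ge0.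
- apply: measurable_rowD; last exact: measurable_row_cst.
  by apply: measurable_rowZ; exact: measurable_tuple_row.
- rewrite (le_trans (norm1D _ _))// norm1Z mulrDr mulr1.
  have := normr_ge0 k; have := norm1_ge0 a; have := norm1_ge0 w; nra.
Qed.

Lemma expgrowth_shift n (f : 'rV[R]_n -> R) a : expgrowth f -> expgrowth (fun w => f (w + a)).
Proof. by move=> /(expgrowth_affine 1 a); under eq_fun do rewrite scale1r. Qed.

Lemma expgrowth_ge0_ind n (P : ('rV[R]_n -> R) -> Prop) :
  (forall f, expgrowth f -> (forall w, 0 <= f w) -> P f) ->
  (forall f g, expgrowth f -> expgrowth g -> P f -> P g -> P (fun w => f w - g w)) ->
  forall f, expgrowth f -> P f.
Proof.
move=> P0 PB f gf; pose g w := Num.max 0 (f w); pose h w := Num.max 0 (- f w).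
have max_bound (x : R) : 0 <= Num.max 0 x <= `|x|.
  by rewrite le_max lexx/= ge_max normr_ge0 ler_norm.
have gg : expgrowth g.
  apply: (expgrowth_le _ gf) => [|w].
    by apply: measurable_maxr => //; exact: expgrowth_measurable.
  by rewrite ger0_norm; have /andP[] := max_bound (f w).
have gh : expgrowth h.
  apply: (expgrowth_le _ gf) => [|w].
    by apply: measurable_maxr => //; apply: measurableT_comp => //; exact: expgrowth_measurable.
  by rewrite -[leRHS]normrN ger0_norm; have /andP[] := max_bound (- f w).
have -> : f = fun w => g w - h w.
  by apply/funext => w; rewrite /g /h; case: (leP 0 (f w)) => ?; case: (leP 0 (- f w)) => ?; lra.
by apply: PB => //; apply: P0 => // w; have /andP[] := max_bound (f w); have /andP[] := max_bound (- f w).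
Qed.

Definition biexpgrowth n (f : 'rV[R]_n -> R) :=
  [/\ forall w, 0 < f w, expgrowth f & expgrowth (fun w => (f w)^-1)].

Lemma biexpgrowth_gt0 n (f : 'rV[R]_n -> R) w : biexpgrowth f -> 0 < f w.
Proof. by case. Qed.

Lemma biexpgrowth_expgrowth n (f : 'rV[R]_n -> R) : biexpgrowth f -> expgrowth f.
Proof. by case. Qed.

Lemma biexpgrowth_cst n k : 0 < k -> biexpgrowth (fun _ : 'rV[R]_n => k).
Proof. by move=> k0; split=> //; exact: expgrowth_cst. Qed.

Lemma biexpgrowth_expR_affine n (a : 'rV[R]_n) k : biexpgrowth (fun w => expR (dot a w + k)).
Proof.
have gexp b c : expgrowth (fun w : 'rV[R]_n => expR (dot b w + c)).
  under eq_fun do rewrite expRD.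
  by apply: expgrowthM; [exact: expgrowth_expR_dot|exact: expgrowth_cst].
split=> [w||]; [exact: expR_gt0|exact: gexp|].
by under eq_fun do rewrite -expRN opprD -dotNl; exact: gexp.
Qed.

Lemma biexpgrowthM n (f g : 'rV[R]_n -> R) :
  biexpgrowth f -> biexpgrowth g -> biexpgrowth (fun w => f w * g w).
Proof.
move=> [f0 gf gf'] [g0 gg gg']; split=> [w||]; [exact: mulr_gt0|exact: expgrowthM|].
by under eq_fun do rewrite invfM; exact: expgrowthM.
Qed.

Lemma biexpgrowthV n (f : 'rV[R]_n -> R) : biexpgrowth f -> biexpgrowth (fun w => (f w)^-1).
Proof.
move=> [f0 gf gf']; split=> [w||]; [by rewrite invr_gt0|exact: gf'|].
by under eq_fun do rewrite invrK.
Qed.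

Lemma biexpgrowth_div n (f g : 'rV[R]_n -> R) :
  biexpgrowth f -> biexpgrowth g -> biexpgrowth (fun w => f w / g w).
Proof. by move=> gf gg; apply: biexpgrowthM => //; exact: biexpgrowthV. Qed.

Lemma measurable_funV d (T : measurableType d) (f : T -> R) :
  (forall t, 0 < f t) -> measurable_fun setT f -> measurable_fun setT (fun t => (f t)^-1).
Proof.
move=> f0 mf; rewrite (_ : (fun t => _) = fun t => expR (- ln (f t))); last first.
  by apply/funext => t; rewrite expRN lnK// posrE.
apply: measurableT_comp => //; apply: measurableT_comp => //.
exact: (measurableT_comp (@measurable_ln R)).
Qed.

Lemma biexpgrowthD n (f g : 'rV[R]_n -> R) :
  biexpgrowth f -> expgrowth g -> (forall w, 0 <= g w) -> biexpgrowth (fun w => f w + g w).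
Proof.
move=> [f0 gf gf'] gg g0.
have fg0 w : 0 < f w + g w by rewrite ltr_pwDl.
have gfg := expgrowthD gf gg.
split=> //; apply: (expgrowth_le _ gf') => [|w].
  apply: (@measurable_funV _ _ (fun t => f (tuple_row t) + g (tuple_row t))) => [t|]; first exact: fg0.
  exact: expgrowth_measurable gfg.
by rewrite !gtr0_norm ?invr_gt0// lef_pV2 ?posrE// lerDl.
Qed.

Lemma biexpgrowth_sum n (I : finType) (P : pred I) (f : I -> 'rV[R]_n -> R) i :
  P i -> (forall i, P i -> biexpgrowth (f i)) -> biexpgrowth (fun w => \sum_(i | P i) f i w).
Proof.
move=> Pi pf; under eq_fun do rewrite (bigD1 i)//=.
apply: biexpgrowthD; first exact: pf.
  by apply: expgrowth_sum => j /andP[/pf[]].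
by move=> w; apply: sumr_ge0 => j /andP[/pf[+ _ _] _] => /(_ w)/ltW.
Qed.

Lemma expgrowth_ln n (f : 'rV[R]_n -> R) : biexpgrowth f -> expgrowth (fun w => ln (f w)).
Proof.
move=> [f0 gf gf']; apply: (expgrowth_le _ (expgrowthD gf gf')) => [|w].
  exact: (measurableT_comp (@measurable_ln R) (expgrowth_measurable gf)).
have fi0 : 0 < (f w)^-1 by rewrite invr_gt0.
rewrite [leRHS]gtr0_norm ?addr_gt0//.
have := ln_sublinear (f0 w); have := ln_sublinear fi0; rewrite lnV ?posrE// => ln_inv_le ln_le.
by rewrite ler_norml; have := f0 w; lra.
Qed.

End exponential_growth.

Section gexpect.
Context {R : realType}.
Implicit Types n m : nat.

Lemma integrable_expgrowth n (f : 'rV[R]_n -> R) : expgrowth f ->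
  (gauss_prob n).-integrable setT (fun t => (f (tuple_row t))%:E).
Proof.
move=> [mf [C C0 fC]].
pose g (w : 'rV[R]_n) := C * expR (n%:R * C ^+ 2) * expR (2^-1 * norm2 w / 2).
apply: (@le_integrable _ _ _ _ _ measurableT _ (fun t => (g (tuple_row t))%:E)).
- by apply/measurable_EFinP; exact: mf.
- move=> t _ /=; rewrite lee_fin (le_trans (fC _))// [leRHS]ger0_norm; last first.
    by rewrite /g !mulr_ge0// expR_ge0.
  by rewrite /g -mulrA ler_wpM2l// expR_norm1_le.
- under eq_fun do rewrite /g EFinM; apply: integrableZl => //.
  have quadE (w : 'rV[R]_n) : 2^-1 * norm2 w / 2 = dot 0 w + 2^-1 * norm2 w / 2.
    by rewrite dot0l add0r.
  apply/integrableP; split.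
    apply/measurable_EFinP/measurableT_comp => //; do 2 apply: measurable_funM => //.
    by apply: measurable_norm2; exact: measurable_tuple_row.
  under eq_integral do rewrite /= ger0_norm ?expR_ge0// quadE.
  by rewrite integral_gauss_quad ?ltry//; lra.
Qed.

Definition gexpect n (f : 'rV[R]_n -> R) : R :=
  fine (\int[gauss_prob n]_t (f (tuple_row t))%:E)%E.

Lemma gexpectE n (f : 'rV[R]_n -> R) : expgrowth f ->
  (gexpect f)%:E = (\int[gauss_prob n]_t (f (tuple_row t))%:E)%E.
Proof.
move=> gf; rewrite fineK//.
exact: (integrable_fin_num measurableT (integrable_expgrowth gf)).
Qed.

Lemma eq_gexpect n (f g : 'rV[R]_n -> R) : f =1 g -> gexpect f = gexpect g.
Proof. by move=> fg; congr gexpect; apply/funext. Qed.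

Lemma gexpectD n (f g : 'rV[R]_n -> R) : expgrowth f -> expgrowth g ->
  gexpect (fun w => f w + g w) = gexpect f + gexpect g.
Proof.
move=> gf gg; rewrite /gexpect; under eq_integral do rewrite EFinD.
rewrite integralD//=; [|exact: integrable_expgrowth|exact: integrable_expgrowth].
by rewrite -(gexpectE gf) -(gexpectE gg).
Qed.

Lemma gexpectZ n k (f : 'rV[R]_n -> R) : expgrowth f -> gexpect (fun w => k * f w) = k * gexpect f.
Proof.
move=> gf; rewrite /gexpect; under eq_integral do rewrite EFinM.
by rewrite integralZl//=; [rewrite -(gexpectE gf)|exact: integrable_expgrowth].
Qed.

Lemma gexpect_cst n k : gexpect (fun _ : 'rV[R]_n => k) = k.
Proof. by rewrite /gexpect integral_cst//= probability_setT mule1. Qed.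

Lemma gexpectN n (f : 'rV[R]_n -> R) : expgrowth f -> gexpect (fun w => - f w) = - gexpect f.
Proof. by move=> gf; rewrite -mulN1r -gexpectZ//; apply: eq_gexpect => w; rewrite mulN1r. Qed.

Lemma gexpectB n (f g : 'rV[R]_n -> R) : expgrowth f -> expgrowth g ->
  gexpect (fun w => f w - g w) = gexpect f - gexpect g.
Proof. by move=> gf gg; rewrite gexpectD ?gexpectN//; exact: expgrowthN. Qed.

Lemma le_gexpect n (f g : 'rV[R]_n -> R) : expgrowth f -> expgrowth g ->
  (forall w, f w <= g w) -> gexpect f <= gexpect g.
Proof.
move=> gf gg fg; rewrite -lee_fin !gexpectE//.
apply: le_integral => //; [exact: integrable_expgrowth|exact: integrable_expgrowth|].
by move=> t _; rewrite lee_fin.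
Qed.

Lemma gexpect_ge0 n (f : 'rV[R]_n -> R) : (forall w, 0 <= f w) -> 0 <= gexpect f.
Proof. by move=> f0; apply: fine_ge0; apply: integral_ge0 => t _; rewrite lee_fin. Qed.

Lemma le_norm_gexpect n (f : 'rV[R]_n -> R) : expgrowth f ->
  `|gexpect f| <= gexpect (fun w => `|f w|).
Proof.
move=> gf; have ga := expgrowth_norm gf; rewrite ler_norml; apply/andP; split.
  rewrite -gexpectN//; apply: le_gexpect => // [|w]; first exact: expgrowthN.
  by rewrite lerNl -normrN ler_norm.
by apply: le_gexpect => // w; exact: ler_norm.
Qed.

Lemma gexpect_sum n (I : Type) (r : seq I) (P : pred I) (f : I -> 'rV[R]_n -> R) :
  (forall i, P i -> expgrowth (f i)) ->
  gexpect (fun w => \sum_(i <- r | P i) f i w) = \sum_(i <- r | P i) gexpect (f i).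
Proof.
move=> gf; elim: r => [|i r ih].
  by under eq_gexpect do rewrite big_nil; rewrite big_nil gexpect_cst.
rewrite big_cons; case: ifPn => Pi; last first.
  by rewrite -ih; apply: eq_gexpect => w; rewrite big_cons (negbTE Pi).
under eq_gexpect do rewrite big_cons Pi.
by rewrite gexpectD ?ih//; [exact: gf|exact: expgrowth_sum].
Qed.

Lemma gexpect_shift n (f : 'rV[R]_n -> R) a : expgrowth f ->
  gexpect (fun w => f (w + a)) = gexpect (fun w => f w * expR (dot a w - norm2 a / 2)).
Proof.
have ge : expgrowth (fun w => expR (dot a w - norm2 a / 2)).
  exact: biexpgrowth_expgrowth (biexpgrowth_expR_affine _ _).
move: f; apply: expgrowth_ge0_ind => [f gf f0|f g gf gg Ef Eg].
  by rewrite /gexpect; congr fine; rewrite (integral_gauss_shift a (expgrowth_rowfun gf)).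
rewrite gexpectB ?Ef ?Eg; [|exact: expgrowth_shift|exact: expgrowth_shift].
rewrite -gexpectB; [|exact: expgrowthM|exact: expgrowthM].
by apply: eq_gexpect => w; rewrite mulrBl.
Qed.

Lemma gexpect_shift_inv n (a : 'rV[R]_n) (f : 'rV[R]_n -> R) : expgrowth f ->
  gexpect f = gexpect (fun w => f (w + a) * expR (- dot a w - norm2 a / 2)).
Proof.
move=> gf; pose f1 w := f w * expR (- dot a w + norm2 a / 2).
have g1 : expgrowth f1.
  apply: expgrowthM => //; under eq_fun do rewrite -dotNl.
  exact: biexpgrowth_expgrowth (biexpgrowth_expR_affine _ _).
have := gexpect_shift a g1.
rewrite (_ : (fun w => f1 w * _) = f); last first.
  apply/funext => w; rewrite /f1 -mulrA -expRD.
  by rewrite (_ : _ + _ = 0) ?expR0 ?mulr1//; ring.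
move=> <-; apply: eq_gexpect => w; rewrite /f1; congr (_ * expR _).
by rewrite dotDr -norm2E; field.
Qed.

Lemma gexpect_expR_dot n (a : 'rV[R]_n) : gexpect (fun w => expR (dot a w)) = expR (norm2 a / 2).
Proof.
have := @gexpect_shift n (fun _ => 1) a (expgrowth_cst _ _).
rewrite gexpect_cst; under [in RHS]eq_gexpect do rewrite mul1r addrC expRD.
rewrite gexpectZ; last exact: expgrowth_expR_dot.
by rewrite expRN => /(congr1 ( *%R (expR (norm2 a / 2)))); rewrite mulr1 mulVKf// gt_eqF// expR_gt0.
Qed.

Lemma gexpect_expR_quad n (h : 'rV[R]_n) (l : R) : 0 <= l ->
  gexpect (fun w => expR (dot h w - l * norm2 w)) =
  expR (norm2 h / (2 * (1 + 2 * l)) - n%:R * (ln (1 + 2 * l) / 2)).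
Proof.
move=> l0; have l1 : 0 < 1 + 2 * l by lra.
have v1 : - (2 * l) < 1 by lra.
have quadE (w : 'rV[R]_n) : dot h w - l * norm2 w = dot h w + - (2 * l) * norm2 w / 2 by field.
rewrite /gexpect; under eq_integral do rewrite quadE.
rewrite integral_gauss_quad//= opprK expRD; congr (_ * _).
rewrite -mulrN expRM_natl; congr (_ ^+ _); rewrite expRN; congr (_^-1).
rewrite -[in RHS](@sqr_sqrtr _ (1 + 2 * l)) ?ltW// lnXn ?sqrtr_gt0//.
have -> (y : R) : y *+ 2 / 2 = y by rewrite mulr2n; field.
by rewrite lnK// posrE sqrtr_gt0.
Qed.

Section rotation.
Variables (n : nat) (alpha beta : R).
Implicit Types f : 'rV[R]_n -> R.
Local Notation comb u v := (alpha *: v + beta *: u).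

Lemma expgrowth_gexpect_comb f : expgrowth f ->
  expgrowth (fun u => gexpect (fun v => f (comb u v))).
Proof.
have gcomb (u : 'rV[R]_n) (g : 'rV[R]_n -> R) : expgrowth g -> expgrowth (fun v => g (comb u v)).
  exact: expgrowth_affine.
move=> gf; split.
  move: f gf; apply: expgrowth_ge0_ind => [f gf f0|f g gf gg mf mg]; last first.
    have gfgB u := gexpectB (gcomb u f gf) (gcomb u g gg).
    by under eq_fun do rewrite /= gfgB; exact: measurable_funB.
  have gcombE u := gexpectE (gcomb u f gf).
  apply/measurable_EFinP; rewrite (_ : _ \o _ = fun t =>
    \int[gauss_prob n]_v (f (comb (tuple_row t) (tuple_row v)))%:E)%E; last first.
    by apply/funext => t; rewrite /= gcombE.
  apply: (@measurable_gauss_integral _ _ _ n (fun t v => (f (comb (tuple_row t) v))%:E)).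
    by move=> t v; rewrite lee_fin.
  apply: measurable_rowfun_comp (expgrowth_rowfun gf); apply: measurable_rowD; apply: measurable_rowZ.
    exact: measurable_row_comp (@measurable_tuple_row R n) _.
  exact: measurable_row_comp (@measurable_tuple_row R n) _.
have [_ [C C0 fC]] := gf.
have Ca : 0 <= C * `|alpha| by rewrite mulr_ge0.
have Cb : 0 <= C * `|beta| by rewrite mulr_ge0.
set K := gexpect (fun v : 'rV[R]_n => expR (C * `|alpha| * norm1 v)).
have K0 : 0 <= K by apply: gexpect_ge0 => v; exact: expR_ge0.
exists (C * K + C * `|beta|) => [|u]; first by rewrite addr_ge0// mulr_ge0.
apply: le_trans (le_norm_gexpect (gcomb u f gf)) _.
apply: (@le_trans _ _ (C * expR (C * `|beta| * norm1 u) * K)).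
  rewrite -gexpectZ; last exact: expgrowth_expR_norm1.
  apply: le_gexpect => [||v].
  - by apply: expgrowth_norm; exact: gcomb.
  - by apply: expgrowthZ; exact: expgrowth_expR_norm1.
  apply: le_trans (fC _) _; rewrite -[leRHS]mulrA ler_wpM2l// -expRD ler_expR.
  by rewrite addrC -!mulrA -mulrDr ler_wpM2l// (le_trans (norm1D _ _))// !norm1Z.
rewrite mulrAC; apply: ler_pM; rewrite ?mulr_ge0 ?expR_ge0 ?lerDl//.
by rewrite ler_expR ler_wpM2r ?norm1_ge0// lerDr mulr_ge0.
Qed.

Lemma gexpect_rot f : 0 < alpha -> alpha ^+ 2 + beta ^+ 2 = 1 -> expgrowth f ->
  gexpect (fun u => gexpect (fun v => f (comb u v))) = gexpect f.
Proof.
have gcomb (u : 'rV[R]_n) (g : 'rV[R]_n -> R) : expgrowth g -> expgrowth (fun v => g (comb u v)).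
  exact: expgrowth_affine.
move=> a0 ab; move: f; apply: expgrowth_ge0_ind => [f gf f0|f g gf gg Ef Eg].
  have gcombE u := gexpectE (gcomb u f gf).
  rewrite {1}/gexpect; under eq_integral do rewrite gcombE.
  by rewrite (integral_gauss_rot a0 ab (expgrowth_rowfun gf)).
rewrite gexpectB// -Ef -Eg -gexpectB; try exact: expgrowth_gexpect_comb.
by apply: eq_gexpect => u; rewrite gexpectB//; exact: gcomb.
Qed.

End rotation.

Lemma gexpect_dot n (a : 'rV[R]_n) : gexpect (fun w => dot a w) = 0.
Proof.
have gd := expgrowth_dot a.
have alpha0 : 0 < 3 / 5 :> R by lra.
have alpha_beta : (3 / 5) ^+ 2 + (4 / 5) ^+ 2 = 1 :> R by field.
have := gexpect_rot alpha0 alpha_beta gd.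
under eq_gexpect do under eq_gexpect do rewrite dotDr !dotZr.
under eq_gexpect do rewrite (gexpectD (expgrowthZ _ gd) (expgrowth_cst _ _)) gexpectZ// gexpect_cst.
rewrite (gexpectD (expgrowth_cst _ _) (expgrowthZ _ gd)) (gexpectZ _ gd) gexpect_cst.
by lra.
Qed.

End gexpect.

(** * Calculus in one variable *)

Section calculus.
Context {R : realType}.
Implicit Types (f g : R -> R) (x a b : R).

Definition der f x l := is_derive x 1 f l.

Lemma der_eq f x l l' : der f x l -> l = l' -> der f x l'.
Proof. by move=> h <-. Qed.

Lemma der_cst k x : der (fun _ => k) x 0.
Proof. exact: is_derive_cst. Qed.

Lemma der_id x : der (fun y => y) x 1.
Proof. exact: is_derive_id. Qed.

Lemma derD f g x a b : der f x a -> der g x b -> der (fun y => f y + g y) x (a + b).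
Proof. exact: is_deriveD. Qed.

Lemma derN f x a : der f x a -> der (fun y => - f y) x (- a).
Proof. exact: is_deriveN. Qed.

Lemma derB f g x a b : der f x a -> der g x b -> der (fun y => f y - g y) x (a - b).
Proof. exact: is_deriveB. Qed.

Lemma derM f g x a b :
  der f x a -> der g x b -> der (fun y => f y * g y) x (a * g x + f x * b).
Proof. by move=> da db; apply: der_eq (is_deriveM da db) _; rewrite /GRing.scale/=; ring. Qed.

Lemma derZ k f x a : der f x a -> der (fun y => k * f y) x (k * a).
Proof. by move=> da; apply: der_eq (derM (der_cst k x) da) _; ring. Qed.

Lemma derX n f x a : der f x a -> der (fun y => f y ^+ n) x (n%:R * f x ^+ n.-1 * a).
Proof.
move=> da; have := is_deriveX n da; rewrite /der (_ : f ^+ n = fun y => f y ^+ n) //.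
by apply/funext => y; rewrite fctE.
Qed.

Lemma der_expR f x a : der f x a -> der (fun y => expR (f y)) x (expR (f x) * a).
Proof. by move=> da; exact: is_derive1_comp. Qed.

Lemma der_ln f x a : 0 < f x -> der f x a -> der (fun y => ln (f y)) x (a / f x).
Proof.
move=> f0 da; apply: der_eq (is_derive1_comp (is_derive1_ln f0) da) _.
by rewrite mulrC.
Qed.

Lemma derV f x a : f x != 0 -> der f x a -> der (fun y => (f y)^-1) x (- a / f x ^+ 2).
Proof.
move=> f0 da; have dV : derivable (fun y => (f y)^-1) x 1.
  by apply: derivableV => //; case: da.
split; first exact: dV.
rewrite deriveV; [|exact: f0|by case: da].
by rewrite (@derive_val _ _ _ _ _ _ _ da) /GRing.scale/= mulrC mulrN mulNr.
Qed.

Lemma der_horner (p : {poly R}) x : der (fun y => p.[y]) x p^`().[x].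
Proof. exact: is_derive_poly. Qed.

Lemma der_continuous f x l : der f x l -> {for x, continuous f}.
Proof. by move=> [d _]; apply: differentiable_continuous; exact/derivable1_diffP. Qed.

Lemma der_ge0_le f f' a b : a <= b -> (forall x, a <= x <= b -> der f x (f' x)) ->
  (forall x, a <= x <= b -> 0 <= f' x) -> f a <= f b.
Proof.
move=> ab df f'0; have cf : {within `[a, b], continuous f}.
  apply: continuous_in_subspaceT => x; rewrite inE/= in_itv/= => xab.
  exact: der_continuous (df _ xab).
have dfo x : x \in `]a, b[ -> is_derive x 1 f (f' x).
  by rewrite in_itv/= => /andP[/ltW ax /ltW xb]; apply: df; rewrite ax xb.
have [c] := MVT_segment ab dfo cf; rewrite in_itv/= => cab fba.
by rewrite -subr_ge0 fba mulr_ge0 ?subr_ge0// f'0.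
Qed.

Lemma der_le0_ge f f' a b : a <= b -> (forall x, a <= x <= b -> der f x (f' x)) ->
  (forall x, a <= x <= b -> f' x <= 0) -> f b <= f a.
Proof.
move=> ab df f'0; rewrite -lerN2.
apply: (@der_ge0_le (fun y => - f y) (fun y => - f' y)) => // x xab.
  exact: derN (df _ xab).
by rewrite oppr_ge0 f'0.
Qed.

Lemma ln1D_le (t : R) : -1 < t -> ln (1 + t) <= t - t ^+ 2 / 2 + t ^+ 3 / 3.
Proof.
move=> t1; pose f (y : R) : R := y - 2^-1 * y ^+ 2 + 3^-1 * y ^+ 3 - ln (1 + y).
have df (y : R) : -1 < y -> der f y (y ^+ 3 / (1 + y)).
  move=> y1; have y1_gt0 : 0 < 1 + y by lra.
  have dX k : der (fun z : R => z ^+ k) y (k%:R * y ^+ k.-1 * 1) by exact: derX (der_id y).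
  have dln := der_ln y1_gt0 (derD (der_cst 1 y) (der_id y)).
  apply: der_eq (derB (derD (derB (der_id y) (derZ 2^-1 (dX 2))) (derZ 3^-1 (dX 3))) dln) _.
  by rewrite /=; field; lra.
have f0 : f 0 = 0 by rewrite /f !expr0n/= !mulr0 !addr0 ln1 !subr0.
suff : 0 <= f t by rewrite /f; lra.
rewrite -f0; have [t0|t0] := leP 0 t.
  apply: (@der_ge0_le f (fun y => y ^+ 3 / (1 + y))) => [//|y /andP[y0 yt]|y /andP[y0 yt]].
    by apply: df; lra.
  by rewrite divr_ge0 ?exprn_ge0//; lra.
apply: (@der_le0_ge f (fun y => y ^+ 3 / (1 + y))) => [|y /andP[y0 yt]|y /andP[y0 yt]]; first lra.
  by apply: df; lra.
by rewrite pmulr_lle0 ?invr_gt0 ?exprn_odd_le0//; lra.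
Qed.

Lemma expR_le_inv1B x : x < 1 -> expR x <= (1 - x)^-1.
Proof.
move=> x1; rewrite -[expR x]invrK -expRN lef_pV2 ?posrE ?expR_gt0//; last lra.
by have := expR_ge1Dx (- x).
Qed.

Lemma expR_le_quad x : x <= 2^-1 -> expR x <= 1 + x + 2 * x ^+ 2.
Proof.
move=> x_le; have x1 : x < 1 by lra.
apply: le_trans (expR_le_inv1B x1) _; rewrite -[leLHS]mul1r ler_pdivrMr; last lra.
by have := sqr_ge0 x; nra.
Qed.

Lemma double_le_expRB x : 0 <= x -> 2 * x <= expR x - expR (- x).
Proof.
move=> x0; rewrite -subr_ge0; pose f (y : R) := expR y - expR (- y) - 2 * y.
have df (y : R) : der f y (expR y * 1 - expR (- y) * -1 - 2 * 1).
  apply: derB (derZ _ (der_id y)); apply: derB; apply: der_expR; first exact: der_id.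
  exact: derN (der_id y).
have f0 : f 0 = 0 by rewrite /f oppr0 subrr mulr0 subrr.
rewrite -[X in X <= _]f0; apply: der_ge0_le x0 (fun y _ => df y) _ => y _.
by have := expR_ge1Dx y; have := expR_ge1Dx (- y); lra.
Qed.

Lemma sqr_le_cosh x : x ^+ 2 <= expR x + expR (- x) - 2.
Proof.
wlog x0 : x / 0 <= x => [le_nneg|].
  have [/le_nneg//|/ltW x0] := leP 0 x.
  by have := le_nneg (- x); rewrite sqrrN opprK oppr_ge0 => /(_ x0); lra.
have x2 : 0 <= x / 2 by rewrite divr_ge0.
have := double_le_expRB x2; rewrite mulrC divfK// => x_le.
have -> : expR x + expR (- x) - 2 = (expR (x / 2) - expR (- (x / 2))) ^+ 2.
  have xE k : (expR (k * (x / 2))) ^+ 2 = expR (k * x).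
    by rewrite -expRM_natl; congr expR; field.
  have := expRxMexpNx_1 (x / 2); have := xE 1; have := xE (-1).
  by rewrite !mul1r !mulN1r sqrrB => -> -> ->; ring.
by rewrite ler_sqr ?nnegrE//; exact: le_trans x_le.
Qed.

(* The cubic term of the Taylor expansion is absorbed in the quadratic and quartic ones. *)
Lemma xlnx_le (eta t : R) : 0 < eta <= 1 -> -1 < t ->
  (1 + t) * ln (1 + t) <= t + (1 + eta) / 2 * t ^+ 2 + eta^-1 * t ^+ 4.
Proof.
move=> /andP[eta0 eta1] t1; have t0 : 0 <= 1 + t by lra.
apply: le_trans (ler_wpM2l t0 (ln1D_le t1)) _; rewrite -subr_ge0.
have -> : t + (1 + eta) / 2 * t ^+ 2 + eta^-1 * t ^+ 4 - (1 + t) * (t - t ^+ 2 / 2 + t ^+ 3 / 3) =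
  ((eta * t + t ^+ 2 / 6) ^+ 2 / 2 + (71 / 72 - eta / 3) * (t ^+ 2) ^+ 2) / eta.
  by field; rewrite gt_eqF.
apply: divr_ge0 (ltW eta0); apply: addr_ge0; first by rewrite divr_ge0 ?sqr_ge0.
by rewrite mulr_ge0 ?sqr_ge0//; lra.
Qed.

End calculus.

(** * Gaussian moments *)

Section gauss_moments.
Context {R : realType} {n : nat}.

Lemma gexpect_dot_sqr_le (a : 'rV[R]_n) : gexpect (fun w => dot a w ^+ 2) <= norm2 a.
Proof.
have a0 := norm2_ge0 a; set A := norm2 a in a0 *; set E := gexpect _.
have gd2 : expgrowth (fun w => dot a w ^+ 2) by apply: expgrowthX; exact: expgrowth_dot.
have E_le t : 0 < t -> t ^+ 2 * A <= 1 -> E <= A + t ^+ 2 * A ^+ 2.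
  move=> t0 tA; have ge := @expgrowth_expR_dot R n.
  have : gexpect (fun w => t ^+ 2 * dot a w ^+ 2) <=
      gexpect (fun w => expR (dot (t *: a) w) + expR (dot (- (t *: a)) w) - 2).
    apply: le_gexpect => [||w]; first exact: expgrowthZ.
      exact: expgrowthB (expgrowthD (ge _) (ge _)) (expgrowth_cst _ _).
    by have := sqr_le_cosh (t * dot a w); rewrite dotNl dotZl exprMn.
  rewrite gexpectZ// gexpectB; [|exact: expgrowthD|exact: expgrowth_cst].
  rewrite gexpectD// gexpect_cst !gexpect_expR_dot -scaleNr !norm2Z sqrrN -/A -/E => tE_le.
  have : t ^+ 2 * A / 2 <= 2^-1 by lra.
  move=> /expR_le_quad exp_le; rewrite -(ler_pM2l (exprn_gt0 2 t0)).
  have -> : t ^+ 2 * (A + t ^+ 2 * A ^+ 2) = t ^+ 2 * A + 4 * (t ^+ 2 * A / 2) ^+ 2 by field.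
  by lra.
apply/ler_addgt0Pr => e e0; set s := (A + 1 + A ^+ 2 / e)^-1.
have Ae0 : 0 <= A ^+ 2 / e by rewrite divr_ge0 ?sqr_ge0// ltW.
have d0 : 0 < A + 1 + A ^+ 2 / e by lra.
have s0 : 0 < s by rewrite invr_gt0.
have sqrt_s : Num.sqrt s ^+ 2 = s by rewrite sqr_sqrtr// ltW.
have := E_le (Num.sqrt s); rewrite sqrtr_gt0 sqrt_s => /(_ s0) {}E_le.
apply: le_trans (E_le _) _; first by rewrite mulrC (ler_pdivrMr _ _ d0); lra.
rewrite lerD2l mulrC (ler_pdivrMr _ _ d0) mulrDr [e * (_ / _)]mulrC (divfK (lt0r_neq0 e0)) lerDr.
by rewrite (mulr_ge0 (ltW e0)) ?addr_ge0.
Qed.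

Lemma gexpect_norm2_le : gexpect (@norm2 R n) <= n%:R.
Proof.
have dotE i (w : 'rV[R]_n) : dot (delta_mx 0 i) w = w 0 i.
  rewrite /dot (bigD1 i)//= mxE !eqxx/= mul1r big1 ?addr0// => j /negbTE ji.
  by rewrite mxE eqxx/= ji mul0r.
rewrite (_ : gexpect _ = gexpect (fun w : 'rV[R]_n => \sum_i dot (delta_mx 0 i) w ^+ 2)); last first.
  by apply: eq_gexpect => w; apply: eq_bigr => i _; rewrite dotE.
rewrite gexpect_sum; last by move=> i _; apply: expgrowthX; exact: expgrowth_dot.
have -> : n%:R = \sum_(i < n) 1 :> R by rewrite sumr_const card_ord.
apply: ler_sum => i _; apply: le_trans (gexpect_dot_sqr_le _) _.
by rewrite norm2E dotE mxE !eqxx.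
Qed.

End gauss_moments.

(** * Conditional entropy and mean square error in Gaussian noise *)

Section weighted_mean.
Context {R : realType} (I : finType) (D : {set I}).

Lemma wmean_sqr_le (p y : I -> R) :
  (forall i, i \in D -> 0 <= p i) -> \sum_(i in D) p i = 1 ->
  (\sum_(i in D) p i * y i) ^+ 2 <= \sum_(i in D) p i * y i ^+ 2.
Proof.
move=> p0 p1; set m := \sum_(i in D) _.
have : 0 <= \sum_(i in D) p i * (y i - m) ^+ 2.
  by apply: sumr_ge0 => i iD; rewrite mulr_ge0 ?sqr_ge0 ?p0.
have -> : \sum_(i in D) p i * (y i - m) ^+ 2 =
   \sum_(i in D) p i * y i ^+ 2 - 2 * m * m + m ^+ 2 * \sum_(i in D) p i.
  have -> : 2 * m * m = \sum_(i in D) 2 * m * (p i * y i) by rewrite -mulr_sumr.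
  by rewrite [m ^+ 2 * _]mulr_sumr -sumrB -big_split; apply: eq_bigr => i _ /=; ring.
by rewrite p1; nra.
Qed.

Lemma wmean_pow4_le (p y : I -> R) :
  (forall i, i \in D -> 0 <= p i) -> \sum_(i in D) p i = 1 ->
  (\sum_(i in D) p i * y i) ^+ 4 <= \sum_(i in D) p i * y i ^+ 4.
Proof.
move=> p0 p1; under [leRHS]eq_bigr do rewrite (exprM _ 2 2).
apply: le_trans (wmean_sqr_le (fun i => y i ^+ 2) p0 p1); rewrite (exprM _ 2 2).
rewrite ler_sqr ?wmean_sqr_le// nnegrE ?sqr_ge0// sumr_ge0// => i iD.
by rewrite mulr_ge0 ?sqr_ge0 ?p0.
Qed.

Lemma wsum_norm2B n (x : I -> 'rV[R]_n) (l : I -> R) (y : 'rV[R]_n) (L := \sum_(i in D) l i) :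
  (forall i, i \in D -> norm2 (x i) = 1) -> 0 < L ->
  \sum_(i in D) l i * norm2 (x i - y) =
  \sum_(i in D) \sum_(j in D) l i * l j / L * (1 - dot (x i) (x j)) +
  L * norm2 (y - L^-1 *: \sum_(i in D) l i *: x i).
Proof.
move=> x1 L0; set m := \sum_(i in D) l i *: x i.
have -> : \sum_(i in D) \sum_(j in D) l i * l j / L * (1 - dot (x i) (x j)) = L - norm2 m / L.
  have inner_sum i : \sum_(j in D) l i * l j / L * (1 - dot (x i) (x j)) =
      l i - l i * dot (x i) m / L.
    rewrite dotC /m dot_suml -[X in X - _](@mulfK _ L) ?gt_eqF// {2}/L.
    rewrite !mulr_sumr !mulr_suml -sumrB.
    by apply: eq_bigr => j _; rewrite dotZl (dotC (x j)); ring.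
  under eq_bigr do rewrite inner_sum.
  rewrite sumrB norm2E {2}/m dot_suml mulr_suml; congr (_ - _).
  by apply: eq_bigr => i _; rewrite dotZl.
have -> : \sum_(i in D) l i * norm2 (x i - y) = L - 2 * dot m y + L * norm2 y.
  rewrite /L /m dot_suml mulr_sumr mulr_suml -sumrB -big_split; apply: eq_bigr => i iD /=.
  by rewrite norm2B x1// dotZl; ring.
by rewrite norm2B norm2Z dotZr (dotC y); field; rewrite gt_eqF.
Qed.

End weighted_mean.

Section channel.
Context {R : realType} (n : nat) (I : finType) (D : {set I}) (x : I -> 'rV[R]_n) (i0 : I).
Implicit Types (g d eta : R) (u v w : 'rV[R]_n).
Hypothesis n_gt0 : (0 < n)%N.
Hypothesis x_unit : forall i, i \in D -> norm2 (x i) = 1.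
Hypothesis i0D : i0 \in D.

(* An index i, uniform in D, is observed through y = sqrt g x_i + W: [lik] is the density of y
   given i relative to the law of W, [lik2] that of y and two independent samples of the posterior
   law of i, and [cond_ent] the entropy of i given y. *)
Definition lik g i w := expR (dot (Num.sqrt g *: x i) w - g / 2).
Definition liks g w := \sum_(i in D) lik g i w.
Definition lik2 g i j w := lik g i w * lik g j w / liks g w.
Definition post_var g w := \sum_(i in D) \sum_(j in D) lik2 g i j w * (1 - dot (x i) (x j)).
Definition mmse g := #|D|%:R^-1 * gexpect (post_var g).
Definition cond_ent g := #|D|%:R^-1 * gexpect (fun w => liks g w * ln (liks g w)) - g / 2.

Lemma cardD_gt0 : 0 < #|D|%:R :> R.
Proof. by rewrite ltr0n; apply/card_gt0P; exists i0. Qed.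

Lemma lik_gt0 g i w : 0 < lik g i w. Proof. exact: expR_gt0. Qed.

Lemma biexpgrowth_lik g i : biexpgrowth (lik g i).
Proof. exact: biexpgrowth_expR_affine. Qed.

Lemma expgrowth_lik g i : expgrowth (lik g i).
Proof. exact: biexpgrowth_expgrowth (biexpgrowth_lik g i). Qed.

Lemma biexpgrowth_liks g : biexpgrowth (liks g).
Proof. by apply: (biexpgrowth_sum i0D) => i _; exact: biexpgrowth_lik. Qed.

Lemma expgrowth_liks g : expgrowth (liks g).
Proof. exact: biexpgrowth_expgrowth (biexpgrowth_liks g). Qed.

Lemma expgrowth_xlnx_liks g : expgrowth (fun w => liks g w * ln (liks g w)).
Proof. exact: expgrowthM (expgrowth_liks g) (expgrowth_ln (biexpgrowth_liks g)). Qed.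

Lemma liks_gt0 g w : 0 < liks g w.
Proof. exact: biexpgrowth_gt0 (biexpgrowth_liks g). Qed.

Lemma lik2_ge0 g i j w : 0 <= lik2 g i j w.
Proof. by rewrite /lik2 divr_ge0 ?mulr_ge0// ltW ?lik_gt0 ?liks_gt0. Qed.

Lemma sum_lik2 g i w : \sum_(j in D) lik2 g i j w = lik g i w.
Proof. by rewrite -mulr_suml -mulr_sumr mulfK// gt_eqF// liks_gt0. Qed.

Lemma expgrowth_lik2 g i j : expgrowth (lik2 g i j).
Proof.
apply: biexpgrowth_expgrowth; apply: biexpgrowth_div; last exact: biexpgrowth_liks.
by apply: biexpgrowthM; exact: biexpgrowth_lik.
Qed.

Lemma gexpect_likX g i k : 0 <= g -> i \in D ->
  gexpect (fun w => lik g i w ^+ k) = expR (g * (k%:R * (k%:R - 1) / 2)).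
Proof.
move=> g0 iD; transitivity (gexpect (fun w =>
    expR (- (k%:R * g / 2)) * expR (dot ((k%:R * Num.sqrt g) *: x i) w))).
  by apply: eq_gexpect => w; rewrite -expRD /lik -expRM_natl; congr expR; rewrite !dotZl; field.
rewrite gexpectZ; last exact: expgrowth_expR_dot.
by rewrite gexpect_expR_dot -expRD norm2Z x_unit// exprMn sqr_sqrtr//; congr expR; field.
Qed.

Lemma gexpect_lik g i : 0 <= g -> i \in D -> gexpect (lik g i) = 1.
Proof.
move=> g0 iD; have := gexpect_likX 1 g0 iD; rewrite subrr mulr0 mul0r mulr0 expR0 => <-.
by apply: eq_gexpect => w; rewrite expr1.
Qed.

Lemma gexpect_likM g i j : 0 <= g -> i \in D -> j \in D ->
  gexpect (fun w => lik g i w * lik g j w) = expR (g * dot (x i) (x j)).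
Proof.
move=> g0 iD jD; transitivity (gexpect (fun w =>
    expR (- g) * expR (dot (Num.sqrt g *: (x i + x j)) w))).
  by apply: eq_gexpect => w; rewrite -!expRD; congr expR; rewrite !dotZl dotDl; field.
rewrite gexpectZ; last exact: expgrowth_expR_dot.
by rewrite gexpect_expR_dot -expRD norm2Z norm2D !x_unit// sqr_sqrtr//; congr expR; field.
Qed.

Lemma gexpect_liks g : 0 <= g -> gexpect (liks g) = #|D|%:R.
Proof.
move=> g0; rewrite gexpect_sum; last by move=> i _; exact: expgrowth_lik.
by under eq_bigr => i iD do rewrite (gexpect_lik g0 iD); rewrite sumr_const.
Qed.

Lemma gexpect_lik_shift g i (f : 'rV[R]_n -> R) : 0 <= g -> i \in D -> expgrowth f ->
  gexpect (fun w => f w * lik g i w) = gexpect (fun w => f (w + Num.sqrt g *: x i)).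
Proof.
move=> g0 iD gf; rewrite (gexpect_shift _ gf); apply: eq_gexpect => w.
by rewrite /lik norm2Z x_unit// sqr_sqrtr// mulr1.
Qed.

Lemma post_var_ge0 g w : 0 <= post_var g w.
Proof.
apply: sumr_ge0 => i iD; apply: sumr_ge0 => j jD; rewrite mulr_ge0 ?lik2_ge0//.
by have := dot_unit (x_unit iD) (x_unit jD); rewrite ler_norml => /andP[_]; lra.
Qed.

Lemma expgrowth_post_var g : expgrowth (post_var g).
Proof.
apply: expgrowth_sum => i _; apply: expgrowth_sum => j _.
by apply: expgrowthM; [exact: expgrowth_lik2|exact: expgrowth_cst].
Qed.

Lemma post_var_le g w y : post_var g w <= \sum_(i in D) lik g i w * norm2 (x i - y).
Proof.
rewrite (wsum_norm2B _ x_unit (liks_gt0 g w)) lerDl.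
by rewrite mulr_ge0 ?norm2_ge0// ltW// liks_gt0.
Qed.

Definition post_mean g w := (liks g w)^-1 *: \sum_(i in D) lik g i w *: x i.

Lemma sum_lik_norm2B_mean g w :
  \sum_(i in D) lik g i w * norm2 (x i - post_mean g w) = post_var g w.
Proof. by rewrite (wsum_norm2B _ x_unit (liks_gt0 g w)) subrr norm2_0 mulr0 addr0. Qed.

Lemma sum_lik2_dot g w :
  \sum_(i in D) \sum_(j in D) lik2 g i j w * dot (x i) (x j) = liks g w - post_var g w.
Proof.
rewrite /liks -sumrB; apply: eq_bigr => i _; rewrite -{1}sum_lik2 -sumrB.
by apply: eq_bigr => j _; ring.
Qed.

Lemma mmse_ge0 g : 0 <= mmse g.
Proof. by rewrite mulr_ge0 ?invr_ge0// gexpect_ge0//; exact: post_var_ge0. Qed.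

Lemma gexpect_post_var g : gexpect (post_var g) = #|D|%:R * mmse g.
Proof. by rewrite mulrA divff ?mul1r// gt_eqF// cardD_gt0. Qed.

Lemma expgrowth_norm2_affine (a : 'rV[R]_n) be : expgrowth (fun w => norm2 (a - be *: w)).
Proof.
under eq_fun do rewrite norm2B norm2Z dotZr.
apply: expgrowthB; last by do 2 apply: expgrowthZ; exact: expgrowth_dot.
by apply: expgrowthD; [exact: expgrowth_cst|apply: expgrowthZ; exact: expgrowth_norm2].
Qed.

Lemma expgrowth_lik_norm2 g i (y : 'rV[R]_n) be :
  expgrowth (fun w => lik g i w * norm2 (x i - (y + be *: w))).
Proof.
apply: expgrowthM; first exact: expgrowth_lik.
by under eq_fun do rewrite opprD addrA; exact: expgrowth_norm2_affine.
Qed.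

Lemma gexpect_lik_norm2_le g i (y : 'rV[R]_n) a be : 0 <= g -> i \in D ->
  be * Num.sqrt g = 1 - a ->
  gexpect (fun w => lik g i w * norm2 (x i - (a *: y + be *: w))) <=
  a ^+ 2 * norm2 (x i - y) + be ^+ 2 * n%:R.
Proof.
move=> g0 iD be_a; under eq_gexpect do rewrite opprD addrA mulrC.
rewrite (gexpect_lik_shift g0 iD); last exact: expgrowth_norm2_affine.
under eq_gexpect => w.
  have -> : x i - a *: y - be *: (w + Num.sqrt g *: x i) = a *: (x i - y) - be *: w.
    by rewrite scalerDr scalerA be_a; apply/rowP => j; rewrite !mxE; ring.
  rewrite norm2B !norm2Z dotZr; over.
have gdot : expgrowth (fun w => dot (a *: (x i - y)) w) by exact: expgrowth_dot.
have gnorm := expgrowthZ (be ^+ 2) (@expgrowth_norm2 R n).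
rewrite gexpectB; last by do 2 apply: expgrowthZ.
  rewrite (gexpectD (expgrowth_cst _ _) gnorm) gexpect_cst (gexpectZ _ (@expgrowth_norm2 R n)).
  rewrite (gexpectZ _ (expgrowthZ _ gdot)) (gexpectZ _ gdot) gexpect_dot !mulr0 subr0.
  by rewrite lerD2l ler_wpM2l ?sqr_ge0 ?gexpect_norm2_le.
exact: expgrowthD (expgrowth_cst _ _) gnorm.
Qed.

(* The minimizers of a^2 B + be^2 n subject to the constraint of [gexpect_lik_norm2_le]. *)
Lemma linear_estimator_gain g (B : R) : 0 <= g -> 0 <= B ->
  exists a be, be * Num.sqrt g = 1 - a /\
    a ^+ 2 * B + be ^+ 2 * n%:R = n%:R * B / (n%:R + g * B).
Proof.
move=> g0 B0; have den : 0 < n%:R + g * B by rewrite ltr_pwDl ?mulr_ge0 ?ltr0n.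
exists (n%:R / (n%:R + g * B)), (B / (n%:R + g * B) * Num.sqrt g).
have sqrt_g : Num.sqrt g * Num.sqrt g = g by rewrite -expr2 sqr_sqrtr.
by split; [rewrite -(mulrA _ (Num.sqrt g)) sqrt_g|rewrite [(_ * Num.sqrt g) ^+
  2]exprMn sqr_sqrtr//]; field; rewrite gt_eqF.
Qed.

Lemma mmse_center g B (y : 'rV[R]_n) : 0 <= g -> 0 <= B ->
  (forall i, i \in D -> norm2 (x i - y) <= B) ->
  mmse g <= n%:R * B / (n%:R + g * B).
Proof.
move=> g0 B0 xyB; have [a [be [be_a <-]]] := linear_estimator_gain g0 B0.
rewrite /mmse ler_pdivrMl ?cardD_gt0//.
have glik i := expgrowth_lik_norm2 g i (a *: y) be.
apply: le_trans (le_gexpect (expgrowth_post_var g) _ (fun w => post_var_le g w (a *: y + be *: w))) _.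
  by apply: expgrowth_sum => i _; exact: glik.
rewrite gexpect_sum; last by move=> i _; exact: glik.
rewrite mulr_natl -sumr_const; apply: ler_sum => i iD.
apply: le_trans (gexpect_lik_norm2_le y g0 iD be_a) _.
by rewrite lerD2r ler_wpM2l ?sqr_ge0 ?xyB.
Qed.

Definition mix g d u v := (Num.sqrt d / Num.sqrt (g + d)) *: v + (Num.sqrt g / Num.sqrt (g + d)) *: u.

Lemma lik_mix g d i u v : 0 <= g -> 0 < d -> lik (g + d) i (mix g d u v) = lik g i u * lik d i v.
Proof.
move=> g0 d0; rewrite /lik -expRD; congr expR.
rewrite /mix dotDr !dotZr !dotZl; field; rewrite gt_eqF// sqrtr_gt0; lra.
Qed.

Lemma expgrowth_mix g d u (f : 'rV[R]_n -> R) : expgrowth f -> expgrowth (fun v => f (mix g d u v)).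
Proof. exact: expgrowth_affine. Qed.

Lemma expgrowth_gexpect_mix g d (f : 'rV[R]_n -> R) : expgrowth f ->
  expgrowth (fun u => gexpect (fun v => f (mix g d u v))).
Proof. exact: expgrowth_gexpect_comb. Qed.

Lemma gexpect_mix g d (f : 'rV[R]_n -> R) : 0 <= g -> 0 < d -> expgrowth f ->
  gexpect (fun u => gexpect (fun v => f (mix g d u v))) = gexpect f.
Proof.
move=> g0 d0 gf; apply: gexpect_rot => //; first by rewrite divr_gt0 ?sqrtr_gt0//; lra.
by rewrite !expr_div_n !sqr_sqrtr; [field|..]; lra.
Qed.

Lemma mmse_step g d : 0 <= g -> 0 < d ->
  mmse (g + d) <= n%:R * mmse g / (n%:R + d * mmse g).
Proof.
move=> g0 d0; have [a [be [be_a <-]]] := linear_estimator_gain (ltW d0) (mmse_ge0 g).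
pose m := post_mean g.
have glik i y := expgrowth_lik_norm2 d i y be.
have glm u i : expgrowth (fun v => lik g i u * (lik d i v * norm2 (x i - (a *: m u + be *: v)))).
  exact: expgrowthZ.
have inner_le u : gexpect (fun v => post_var (g + d) (mix g d u v)) <=
    a ^+ 2 * post_var g u + be ^+ 2 * n%:R * liks g u.
  apply: (@le_trans _ _ (gexpect (fun v =>
      \sum_(i in D) lik g i u * (lik d i v * norm2 (x i - (a *: m u + be *: v)))))).
    apply: le_gexpect => [||v]; [exact: expgrowth_mix (expgrowth_post_var _)|exact: expgrowth_sum|].
    apply: le_trans (post_var_le _ _ (a *: m u + be *: v)) _.
    by apply: ler_sum => i iD; rewrite lik_mix// mulrA.
  rewrite gexpect_sum => [|i _]; last exact: glm.
  have -> : a ^+ 2 * post_var g u + be ^+ 2 * n%:R * liks g u =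
      \sum_(i in D) lik g i u * (a ^+ 2 * norm2 (x i - m u) + be ^+ 2 * n%:R).
    rewrite -sum_lik_norm2B_mean !mulr_sumr -big_split.
    by apply: eq_bigr => i _ /=; ring.
  apply: ler_sum => i iD; rewrite gexpectZ//.
  by rewrite ler_wpM2l ?(ltW (lik_gt0 _ _ _))// (gexpect_lik_norm2_le (m u) (ltW d0) iD be_a).
have gR := expgrowthD (expgrowthZ (a ^+ 2) (expgrowth_post_var g))
                      (expgrowthZ (be ^+ 2 * n%:R) (expgrowth_liks g)).
rewrite /mmse ler_pdivrMl ?cardD_gt0// -(gexpect_mix g0 d0 (expgrowth_post_var _)).
apply: le_trans (le_gexpect (expgrowth_gexpect_mix _ _ (expgrowth_post_var _)) gR inner_le) _.
rewrite gexpectD; [|apply: expgrowthZ; exact: expgrowth_post_var|apply: expgrowthZ; exact: expgrowth_liks].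
rewrite (gexpectZ _ (expgrowth_post_var g)) (gexpectZ _ (expgrowth_liks g)) gexpect_liks//.
by rewrite gexpect_post_var mulKf ?gt_eqF ?cardD_gt0//; lra.
Qed.

Definition excess d i w := lik d i w - 1.

Lemma expgrowth_excess d i : expgrowth (excess d i).
Proof. exact: expgrowthB (expgrowth_lik d i) (expgrowth_cst _ _). Qed.

Lemma gexpect_excess d i : 0 <= d -> i \in D -> gexpect (excess d i) = 0.
Proof.
move=> d0 iD; rewrite (gexpectB (expgrowth_lik d i) (expgrowth_cst _ _)).
by rewrite gexpect_cst gexpect_lik// subrr.
Qed.

Lemma gexpect_excessM_le d i j : 0 <= d <= 2^-1 -> i \in D -> j \in D ->
  gexpect (fun w => excess d i w * excess d j w) <= d * dot (x i) (x j) + 2 * d ^+ 2.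
Proof.
move=> /andP[d0 d_le] iD jD; have gl k := expgrowth_lik d k.
rewrite (_ : gexpect _ =
    gexpect (fun w => lik d i w * lik d j w - lik d i w - excess d j w)); last first.
  by apply: eq_gexpect => w; rewrite /excess; ring.
rewrite gexpectB; [|by apply: expgrowthB => //; exact: expgrowthM|exact: expgrowth_excess].
rewrite gexpectB//; last exact: expgrowthM.
rewrite gexpect_likM// gexpect_lik// gexpect_excess// subr0.
have := dot_unit (x_unit iD) (x_unit jD); set c := dot (x i) (x j) => c1.
have /expR_le_quad : d * c <= 2^-1 by have := ler_norm c; nra.
have : (d * c) ^+ 2 <= d ^+ 2.
  by rewrite exprMn ler_piMr ?sqr_ge0// -real_normK ?num_real// expr_le1.
by lra.
Qed.

Lemma gexpect_excessX4_le d i : 0 <= d <= 12^-1 -> i \in D ->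
  gexpect (fun w => excess d i w ^+ 4) <= 84 * d ^+ 2.
Proof.
move=> /andP[d0 d_le] iD.
have gX k : expgrowth (fun w => lik d i w ^+ k) by exact/expgrowthX/expgrowth_lik.
have gcX c k := expgrowthZ c (gX k).
rewrite (_ : gexpect _ = gexpect (fun w => lik d i w ^+ 4 + 6 * lik d i w ^+ 2
    + 1 * lik d i w ^+ 0 - 4 * lik d i w ^+ 3 - 4 * lik d i w ^+ 1)); last first.
  by apply: eq_gexpect => w; rewrite /excess; ring.
have gsum := expgrowthD (expgrowthD (gX 4) (gcX 6 2)) (gcX 1 0).
rewrite (gexpectB (expgrowthB gsum (gcX 4 3)) (gcX 4 1)) (gexpectB gsum (gcX 4 3)).
rewrite (gexpectD (expgrowthD (gX 4) (gcX 6 2)) (gcX 1 0)) (gexpectD (gX 4) (gcX 6 2)).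
rewrite !gexpectZ; do ?exact: gX.
rewrite !gexpect_likX//.
have -> : d * (4 * (4 - 1) / 2) = 6 * d by field.
have -> : d * (3 * (3 - 1) / 2) = 3 * d by field.
have -> : d * (2 * (2 - 1) / 2) = d by field.
rewrite subrr mulr0 !mul0r mulr0 expR0.
have d12 : 12 * d <= 1 by rewrite mulrC -ler_pdivlMr// div1r.
have : expR (6 * d) <= 1 + 6 * d + 2 * (6 * d) ^+ 2 by apply: expR_le_quad; lra.
have : expR d <= 1 + d + 2 * d ^+ 2 by apply: expR_le_quad; lra.
by have := expR_ge1Dx (3 * d); lra.
Qed.

Section mean_excess.
Variables (d : R) (p : I -> R).
Hypothesis d_bounds : 0 < d <= 12^-1.
Hypothesis p_gt0 : forall i, i \in D -> 0 < p i.
Hypothesis sum_p : \sum_(i in D) p i = 1.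

Definition mean_excess w := \sum_(i in D) p i * excess d i w.

Let p_ge0 i : i \in D -> 0 <= p i. Proof. by move=> /p_gt0/ltW. Qed.

Let d_ge0 : 0 <= d. Proof. by case/andP: d_bounds => /ltW. Qed.

Lemma expgrowth_mean_excess : expgrowth mean_excess.
Proof. by apply: expgrowth_sum => i _; apply: expgrowthZ; exact: expgrowth_excess. Qed.

Lemma mean_lik w : \sum_(i in D) p i * lik d i w = 1 + mean_excess w.
Proof. by rewrite -sum_p -big_split; apply: eq_bigr => i _ /=; rewrite /excess; ring. Qed.

Lemma biexpgrowth_mean_lik : biexpgrowth (fun w => 1 + mean_excess w).
Proof.
under eq_fun do rewrite -mean_lik; apply: (biexpgrowth_sum i0D) => i iD.
by apply: biexpgrowthM; [exact/biexpgrowth_cst/p_gt0|exact: biexpgrowth_lik].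
Qed.

Lemma gexpect_mean_excess : gexpect mean_excess = 0.
Proof.
rewrite gexpect_sum; last by move=> i _; apply: expgrowthZ; exact: expgrowth_excess.
rewrite big1// => i iD; rewrite gexpectZ; last exact: expgrowth_excess.
by rewrite gexpect_excess// mulr0.
Qed.

Lemma gexpect_mean_excess2_le : gexpect (fun w => mean_excess w ^+ 2) <=
  d * (\sum_(i in D) \sum_(j in D) p i * p j * dot (x i) (x j)) + 2 * d ^+ 2.
Proof.
have ge i j : expgrowth (fun w => excess d i w * excess d j w).
  exact: expgrowthM (expgrowth_excess d i) (expgrowth_excess d j).
have gpe i j := expgrowthZ (p i * p j) (ge i j).
rewrite (_ : gexpect _ = gexpect (fun w =>
    \sum_(i in D) \sum_(j in D) p i * p j * (excess d i w * excess d j w))); last first.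
  apply: eq_gexpect => w; rewrite expr2 {1}/mean_excess mulr_suml; apply: eq_bigr => i _.
  by rewrite mulr_sumr; apply: eq_bigr => j _; ring.
rewrite gexpect_sum; last by move=> i _; apply: expgrowth_sum => j _; exact: gpe.
have -> : 2 * d ^+ 2 = \sum_(i in D) \sum_(j in D) p i * p j * (2 * d ^+ 2).
  under eq_bigr do rewrite -mulr_suml -mulr_sumr sum_p mulr1.
  by rewrite -mulr_suml sum_p mul1r.
rewrite mulr_sumr -big_split; apply: ler_sum => i iD /=.
rewrite gexpect_sum; last by move=> j _; exact: gpe.
rewrite mulr_sumr -big_split; apply: ler_sum => j jD /=.
rewrite (gexpectZ _ (ge i j)) mulrCA -mulrDr ler_wpM2l ?mulr_ge0 ?p_ge0//.
by apply: gexpect_excessM_le => //; case/andP: d_bounds => *; lra.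
Qed.

Lemma gexpect_mean_excess4_le : gexpect (fun w => mean_excess w ^+ 4) <= 84 * d ^+ 2.
Proof.
have ge i : expgrowth (fun w => excess d i w ^+ 4) by apply: expgrowthX; exact: expgrowth_excess.
apply: (@le_trans _ _ (gexpect (fun w => \sum_(i in D) p i * excess d i w ^+ 4))).
  apply: le_gexpect => [||w]; first by apply: expgrowthX; exact: expgrowth_mean_excess.
    by apply: expgrowth_sum => i _; apply: expgrowthZ; exact: ge.
  exact: wmean_pow4_le.
rewrite gexpect_sum => [|i _]; last by apply: expgrowthZ; exact: ge.
have -> : 84 * d ^+ 2 = \sum_(i in D) p i * (84 * d ^+ 2) by rewrite -mulr_suml sum_p mul1r.
apply: ler_sum => i iD.
rewrite (gexpectZ _ (ge i)) ler_wpM2l ?p_ge0// gexpect_excessX4_le//.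
by case/andP: d_bounds => /ltW ->.
Qed.

Lemma gexpect_xlnx_mean_lik_le (S : R) eta : 0 < S -> 0 < eta <= 1 ->
  gexpect (fun w => S * (1 + mean_excess w) * ln (S * (1 + mean_excess w))) <= S * ln S +
    S * ((1 + eta) / 2 * (d * (\sum_(i in D) \sum_(j in D) p i * p j * dot (x i) (x j)) + 2 * d ^+ 2)
         + eta^-1 * (84 * d ^+ 2)).
Proof.
move=> S0 eta01; have /andP[eta0 _] := eta01.
have gX k : expgrowth (fun w => mean_excess w ^+ k) by exact/expgrowthX/expgrowth_mean_excess.
have gcX c k := expgrowthZ c (gX k).
have gS : biexpgrowth (fun w => S * (1 + mean_excess w)).
  by apply: biexpgrowthM biexpgrowth_mean_lik; exact: biexpgrowth_cst.
apply: (@le_trans _ _ (gexpect (fun w => S * ln S + S * (1 + ln S) * mean_excess w ^+ 1 +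
    (S * ((1 + eta) / 2) * mean_excess w ^+ 2 + S / eta * mean_excess w ^+ 4)))).
  apply: le_gexpect => [||w].
  - exact: expgrowthM (biexpgrowth_expgrowth gS) (expgrowth_ln gS).
  - exact: expgrowthD (expgrowthD (expgrowth_cst _ _) (gcX _ 1)) (expgrowthD (gcX _ 2) (gcX _ 4)).
  have lik0 := biexpgrowth_gt0 w biexpgrowth_mean_lik.
  have t1 : -1 < mean_excess w by lra.
  have := ler_wpM2l (ltW S0) (xlnx_le eta01 t1).
  by rewrite lnM ?posrE// expr1; lra.
rewrite (gexpectD (expgrowthD (expgrowth_cst _ _) (gcX _ 1)) (expgrowthD (gcX _ 2) (gcX _ 4))).
rewrite (gexpectD (expgrowth_cst _ _) (gcX _ 1)) (gexpectD (gcX _ 2) (gcX _ 4)) gexpect_cst.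
rewrite (gexpectZ _ (gX 1)) (gexpectZ _ (gX 2)) (gexpectZ _ (gX 4)).
have -> : gexpect (fun w => mean_excess w ^+ 1) = 0.
  by rewrite -gexpect_mean_excess; apply: eq_gexpect => w; rewrite expr1.
have := gexpect_mean_excess2_le; set K := d * _ + _ => mean2_le.
have -> : S * ((1 + eta) / 2 * K + eta^-1 * (84 * d ^+ 2)) =
  S * ((1 + eta) / 2) * K + S / eta * (84 * d ^+ 2) by ring.
rewrite mulr0 addr0 lerD2l; apply: lerD; apply: ler_wpM2l => //; last exact: gexpect_mean_excess4_le.
- by rewrite mulr_ge0 ?divr_ge0 ?addr_ge0// ltW.
- by rewrite divr_ge0 ?ltW.
Qed.

End mean_excess.

Lemma gexpect_xlnx_liks_mix_le g d eta u : 0 <= g -> 0 < d <= 12^-1 -> 0 < eta <= 1 ->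
  gexpect (fun v => liks (g + d) (mix g d u v) * ln (liks (g + d) (mix g d u v))) <=
  liks g u * ln (liks g u) +
  ((1 + eta) / 2 * (d * (liks g u - post_var g u) + 2 * d ^+ 2 * liks g u) +
   84 * d ^+ 2 / eta * liks g u).
Proof.
move=> g0 d_bounds eta01; have /andP[d0 _] := d_bounds; have S0 := liks_gt0 g u.
pose p i := lik g i u / liks g u.
have p0 i : i \in D -> 0 < p i by rewrite divr_gt0 ?lik_gt0.
have p1 : \sum_(i in D) p i = 1 by rewrite -mulr_suml divff// gt_eqF.
have liksE v : liks (g + d) (mix g d u v) = liks g u * (1 + mean_excess d p v).
  rewrite -(mean_lik d p1) mulr_sumr; apply: eq_bigr => i iD; rewrite lik_mix// /p.
  by field; rewrite gt_eqF.
under eq_gexpect do rewrite liksE.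
apply: le_trans (gexpect_xlnx_mean_lik_le d_bounds p0 p1 S0 eta01) _.
have -> : liks g u - post_var g u =
    liks g u * \sum_(i in D) \sum_(j in D) p i * p j * dot (x i) (x j).
  rewrite -sum_lik2_dot mulr_sumr; apply: eq_bigr => i _; rewrite mulr_sumr.
  by apply: eq_bigr => j _; rewrite /lik2 /p; field; rewrite gt_eqF.
by rewrite lerD2l le_eqVlt; apply/orP; left; apply/eqP; ring.
Qed.

Lemma cond_ent_step g d eta : 0 <= g -> 0 < d <= 12^-1 -> 0 < eta <= 1 ->
  cond_ent (g + d) <= cond_ent g - d / 2 * mmse g + (eta * d / 2 + 86 * d ^+ 2 / eta).
Proof.
move=> g0 d_bounds eta01; have /andP[d0 _] := d_bounds; have /andP[eta0 eta1] := eta01.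
have gS := expgrowth_liks g; have gV := expgrowth_post_var g; have gH := expgrowth_xlnx_liks.
have gd := expgrowthZ d (expgrowthB gS gV); have gd2 := expgrowthZ (2 * d ^+ 2) gS.
have g84 := expgrowthZ (84 * d ^+ 2 / eta) gS.
have gR := expgrowthD (expgrowthZ ((1 + eta) / 2) (expgrowthD gd gd2)) g84.
have gHR := expgrowthD (gH g) gR.
have V0 := mmse_ge0 g; set V := mmse g in V0 *.
have ent_le : #|D|%:R^-1 * gexpect (fun w => liks (g + d) w * ln (liks (g + d) w)) <=
    #|D|%:R^-1 * gexpect (fun w => liks g w * ln (liks g w)) +
    ((1 + eta) / 2 * (d * (1 - V) + 2 * d ^+ 2) + 84 * d ^+ 2 / eta).
  rewrite ler_pdivrMl ?cardD_gt0// -(gexpect_mix g0 d0 (gH _)).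
  apply: le_trans (le_gexpect (expgrowth_gexpect_mix _ _ (gH _)) gHR
    (fun u => gexpect_xlnx_liks_mix_le u g0 d_bounds eta01)) _.
  rewrite (gexpectD (gH g) gR) (gexpectD (expgrowthZ _ (expgrowthD gd gd2)) g84).
  rewrite (gexpectZ _ (expgrowthD gd gd2)) (gexpectD gd gd2) (gexpectZ _ (expgrowthB gS gV)).
  rewrite (gexpectB gS gV) !(gexpectZ _ gS) gexpect_liks// gexpect_post_var -/V.
  by rewrite le_eqVlt; apply/orP; left; apply/eqP; field; rewrite !gt_eqF ?cardD_gt0.
have d2_le : d ^+ 2 <= d ^+ 2 / eta by rewrite ler_peMr ?sqr_ge0// invf_ge1.
have eta_d2_le : eta * d ^+ 2 <= d ^+ 2 by rewrite ler_piMl ?sqr_ge0.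
have etadV0 : 0 <= eta * d * V by rewrite mulr_ge0// mulr_ge0// ltW.
have collect (A A' : R) :
    A' <= A + ((1 + eta) / 2 * (d * (1 - V) + 2 * d ^+ 2) + 84 * d ^+ 2 / eta) ->
    A' - (g + d) / 2 <= A - g / 2 - d / 2 * V + (eta * d / 2 + 86 * d ^+ 2 / eta).
  by clear - d2_le eta_d2_le etadV0; lra.
exact: collect ent_le.
Qed.

Lemma gexpect_xlnx_lik g i : 0 <= g -> i \in D ->
  gexpect (fun w => lik g i w * ln (lik g i w)) = g / 2.
Proof.
move=> g0 iD; have gd := expgrowth_dot (Num.sqrt g *: x i).
under eq_gexpect do rewrite mulrC /lik expRK.
rewrite (gexpect_lik_shift g0 iD (expgrowthB gd (expgrowth_cst _ _))).
under eq_gexpect do rewrite dotDr -norm2E norm2Z x_unit// sqr_sqrtr// mulr1 -addrA.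
by rewrite (gexpectD gd (expgrowth_cst _ _)) gexpect_dot gexpect_cst; field.
Qed.

Lemma sum_gexpect_ln_post g : 0 <= g ->
  \sum_(i in D) gexpect (fun w => lik g i w * ln (lik g i w / liks g w)) = - (#|D|%:R * cond_ent g).
Proof.
move=> g0; have gl i : expgrowth (fun w => lik g i w * ln (lik g i w)).
  by apply: expgrowthM; [exact: expgrowth_lik|exact/expgrowth_ln/biexpgrowth_lik].
have gs i : expgrowth (fun w => lik g i w * ln (liks g w)).
  by apply: expgrowthM; [exact: expgrowth_lik|exact/expgrowth_ln/biexpgrowth_liks].
have lnE i : i \in D -> gexpect (fun w => lik g i w * ln (lik g i w / liks g w)) =
    g / 2 - gexpect (fun w => lik g i w * ln (liks g w)).
  move=> iD; rewrite -(gexpect_xlnx_lik g0 iD) -(gexpectB (gl i) (gs i)).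
  by apply: eq_gexpect => w; rewrite ln_div ?posrE ?lik_gt0 ?liks_gt0// mulrBr.
rewrite (eq_bigr _ lnE) sumrB sumr_const -gexpect_sum// /cond_ent mulrBr mulVKf; last first.
  by rewrite gt_eqF ?cardD_gt0.
rewrite opprB mulr_natl; congr (_ - _).
by apply: eq_gexpect => w; rewrite -mulr_suml.
Qed.

Lemma cond_ent0 : cond_ent 0 = ln #|D|%:R.
Proof.
have liks0 w : liks 0 w = #|D|%:R.
  rewrite /liks -sumr_const; apply: eq_bigr => i _.
  by rewrite /lik sqrtr0 scale0r dot0l mul0r subr0 expR0.
rewrite /cond_ent; under eq_gexpect do rewrite liks0.
by rewrite gexpect_cst mul0r subr0 mulKf// gt_eqF// cardD_gt0.
Qed.

(* The derivative in g of m/2 ln (1 - g V / m), where V' = - V^2 / m, is - V / 2. *)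
Lemma half_ln_mse_step (m d V V' g : R) : 0 < m -> 0 < d -> 0 <= V -> 0 <= g ->
  V' <= m * V / (m + d * V) -> 0 < 1 - g * V / m ->
  0 < 1 - (g + d) * V' / m /\
  m / 2 * ln (1 - g * V / m) - d / 2 * V <= m / 2 * ln (1 - (g + d) * V' / m).
Proof.
move=> m0 d0 V0 g0 V'_le; have dV0 : 0 <= d * V by rewrite mulr_ge0// ltW.
have dVm0 : 0 <= d * V / m by rewrite divr_ge0// ltW.
set A := 1 - g * V / m => A0; set C := 1 - (g + d) * V' / m.
have B0 : 0 < 1 + d * V / m by lra.
have AB_le : A / (1 + d * V / m) <= C.
  have : (g + d) * V' / m <= (g + d) * (m * V / (m + d * V)) / m.
    apply: ler_wpM2r; first by rewrite invr_ge0 ltW.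
    by rewrite ler_wpM2l//; lra.
  have -> : A / (1 + d * V / m) = 1 - (g + d) * (m * V / (m + d * V)) / m.
    by rewrite /A; field; rewrite !gt_eqF//; lra.
  by rewrite /C; lra.
have C0 := lt_le_trans (divr_gt0 A0 B0) AB_le; split=> //.
have lnC_ge : ln A - d * V / m <= ln C.
  apply: le_trans (_ : ln (A / (1 + d * V / m)) <= _); last by rewrite ler_ln ?posrE ?divr_gt0.
  by rewrite ln_div// lerD2l lerN2; apply: le_ln1Dx; lra.
have -> : m / 2 * ln A - d / 2 * V = m / 2 * (ln A - d * V / m) by field; rewrite gt_eqF.
by rewrite ler_wpM2l// divr_ge0// ltW.
Qed.

Lemma cond_ent_chain eta d k : 0 < d <= 12^-1 -> 0 < eta <= 1 ->
  0 < 1 - k%:R * d * mmse (k%:R * d) / n%:R /\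
  cond_ent (k%:R * d) <= ln #|D|%:R + n%:R / 2 * ln (1 - k%:R * d * mmse (k%:R * d) / n%:R) +
    k%:R * (eta * d / 2 + 86 * d ^+ 2 / eta).
Proof.
have collect (K K' L v q e A A' : R) :
    K <= L + A + q * e -> K' <= K - v + e -> A - v <= A' -> K' <= L + A' + (q + 1) * e by lra.
move=> d_bounds eta01; have n_gt0' : 0 < n%:R :> R by rewrite ltr0n.
have /andP[d0 _] := d_bounds.
elim: k => [|k [mse_pos ent_le]].
  by rewrite !mul0r subr0 ltr01 ln1 mulr0 cond_ent0 !addr0.
have kd0 : 0 <= k%:R * d by rewrite mulr_ge0// ltW.
have -> : k.+1%:R * d = k%:R * d + d by rewrite -natr1 mulrDl mul1r.
have ent_step := cond_ent_step kd0 d_bounds eta01.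
have [mse_pos' ln_step] := half_ln_mse_step n_gt0' d0 (mmse_ge0 _) kd0 (mmse_step kd0 d0) mse_pos.
split; first exact: mse_pos'.
have -> : k.+1%:R = k%:R + 1 :> R by rewrite -natr1.
exact: collect ent_le ent_step ln_step.
Qed.

Lemma mmse_lt g : 0 < g -> 0 < 1 - g * mmse g / n%:R.
Proof.
move=> g0; pose k := (Num.truncn (12 * g)).+1.
have kg : 12 * g < k%:R by exact: truncnS_gt.
have k0 : 0 < k%:R :> R by rewrite ltr0n.
have d_bounds : 0 < g / k%:R <= 12^-1.
  by rewrite divr_gt0//= ler_pdivrMr// ler_pdivlMl// ltW.
have eta01 : 0 < (1 : R) <= 1 by rewrite ltr01 lexx.
by have [+ _] := cond_ent_chain k d_bounds eta01; rewrite [k%:R * _]mulrC divfK// gt_eqF.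
Qed.

Lemma cond_ent_le g : 0 < g ->
  cond_ent g <= ln #|D|%:R + n%:R / 2 * ln (1 - g * mmse g / n%:R).
Proof.
move=> g0; apply/ler_addgt0Pr => e e0.
pose eta := Num.min 1 (e / g).
have eta01 : 0 < eta <= 1 by rewrite lt_min ltr01 divr_gt0//= ge_min lexx.
have /andP[eta0 eta1] := eta01.
have eta_g_le : eta * g <= e by rewrite -ler_pdivlMr// ge_min lexx orbT.
have etae0 : 0 < eta * e by rewrite mulr_gt0.
pose N := 12 * g + 172 * g ^+ 2 / (eta * e); pose k := (Num.truncn N).+1.
have Nk : N < k%:R by exact: truncnS_gt.
have k0 : 0 < k%:R :> R by rewrite ltr0n.
have q0 : 0 <= 172 * g ^+ 2 / (eta * e) by rewrite divr_ge0 ?mulr_ge0 ?sqr_ge0// ltW.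
have d_bounds : 0 < g / k%:R <= 12^-1.
  by rewrite divr_gt0//= ler_pdivrMr// ler_pdivlMl//; rewrite /N in Nk; lra.
have [_] := cond_ent_chain k d_bounds eta01.
have -> : k%:R * (g / k%:R) = g by rewrite mulrC divfK// gt_eqF.
move=> /le_trans; apply; rewrite lerD2l.
have -> : k%:R * (eta * (g / k%:R) / 2 + 86 * (g / k%:R) ^+ 2 / eta) =
   eta * g / 2 + 86 * g ^+ 2 / eta / k%:R by field; rewrite !gt_eqF.
have : 86 * g ^+ 2 / eta / k%:R <= e / 2.
  rewrite ler_pdivrMr//; have : 172 * g ^+ 2 / (eta * e) <= k%:R by rewrite /N in Nk; lra.
  by rewrite ler_pdivrMr// => k_ge; rewrite ler_pdivrMr//; lra.
by lra.
Qed.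

End channel.

(** * Random edges of a graph of code points *)

Section edge_sums.
Context {R : realType} {T : finType}.
Variable e : rel T.
Implicit Types (F G : T -> T -> R) (H K : T -> T -> T -> R).

Definition edge_sum F := \sum_c \sum_(c' | e c c') F c c'.
Definition path_sum H := edge_sum (fun c c' => \sum_(c'' | e c c'') H c c' c'').
Definition nedges := edge_sum (fun _ _ => 1).

Lemma eq_edge_sum F G : (forall c c', e c c' -> F c c' = G c c') -> edge_sum F = edge_sum G.
Proof. by move=> FG; apply: eq_bigr => c _; apply: eq_bigr => c'; exact: FG. Qed.

Lemma le_edge_sum F G : (forall c c', e c c' -> F c c' <= G c c') -> edge_sum F <= edge_sum G.
Proof. by move=> FG; apply: ler_sum => c _; apply: ler_sum => c'; exact: FG. Qed.

Lemma edge_sum_ge0 F : (forall c c', e c c' -> 0 <= F c c') -> 0 <= edge_sum F.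
Proof. by move=> F0; apply: sumr_ge0 => c _; apply: sumr_ge0 => c'; exact: F0. Qed.

Lemma edge_sumD F G : edge_sum (fun c c' => F c c' + G c c') = edge_sum F + edge_sum G.
Proof. by rewrite /edge_sum -big_split; apply: eq_bigr => c _; rewrite big_split. Qed.

Lemma edge_sumZ k F : edge_sum (fun c c' => k * F c c') = k * edge_sum F.
Proof. by rewrite mulr_sumr; apply: eq_bigr => c _; rewrite mulr_sumr. Qed.

Lemma edge_sumB F G : edge_sum (fun c c' => F c c' - G c c') = edge_sum F - edge_sum G.
Proof. by rewrite /edge_sum -sumrB; apply: eq_bigr => c _; rewrite sumrB. Qed.

Lemma edge_sum_cst k : edge_sum (fun _ _ => k) = k * nedges.
Proof. by rewrite -edge_sumZ; apply: eq_edge_sum => c c' _; rewrite mulr1. Qed.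

Lemma edge_sum_sym F : symmetric e -> edge_sum (fun c c' => F c' c) = edge_sum F.
Proof.
move=> esym; rewrite /edge_sum [RHS](exchange_big_dep xpredT)//=; apply: eq_bigr => c _.
by apply: eq_bigl => c'; rewrite esym.
Qed.

Lemma path_sumD H K : path_sum (fun c c' c'' => H c c' c'' + K c c' c'') = path_sum H + path_sum K.
Proof. by rewrite -edge_sumD; apply: eq_edge_sum => c c' _; rewrite big_split. Qed.

Lemma path_sumZ k H : path_sum (fun c c' c'' => k * H c c' c'') = k * path_sum H.
Proof. by rewrite -edge_sumZ; apply: eq_edge_sum => c c' _; rewrite mulr_sumr. Qed.

Lemma path_sumB H K : path_sum (fun c c' c'' => H c c' c'' - K c c' c'') = path_sum H - path_sum K.
Proof. by rewrite -edge_sumB; apply: eq_edge_sum => c c' _; rewrite sumrB. Qed.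

Lemma le_path_sum H K : (forall c c' c'', e c c' -> e c c'' -> H c c' c'' <= K c c' c'') ->
  path_sum H <= path_sum K.
Proof. by move=> HK; apply: le_edge_sum => c c' cc'; apply: ler_sum => c''; exact: HK. Qed.

Lemma path_sum_ge0 H : (forall c c' c'', e c c' -> e c c'' -> 0 <= H c c' c'') -> 0 <= path_sum H.
Proof. by move=> H0; apply: edge_sum_ge0 => c c' cc'; apply: sumr_ge0 => c''; exact: H0. Qed.

Lemma path_sum_diag H :
  path_sum (fun c c' c'' => (c'' == c')%:R * H c c' c'') = edge_sum (fun c c' => H c c' c').
Proof.
apply: eq_edge_sum => c c' cc'; rewrite (bigD1 c')//= eqxx mul1r big1 ?addr0// => c'' /andP[_].
by move=> /negbTE->; rewrite mul0r.
Qed.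

Lemma path_sum_swap H : path_sum (fun c c' c'' => H c c'' c') = path_sum H.
Proof. by apply: eq_bigr => c _; rewrite exchange_big. Qed.

Lemma expgrowth_edge_sum n (F : T -> T -> 'rV[R]_n -> R) :
  (forall c c', e c c' -> expgrowth (F c c')) ->
  expgrowth (fun z => edge_sum (fun c c' => F c c' z)).
Proof. by move=> gF; apply: expgrowth_sum => c _; apply: expgrowth_sum => c'; exact: gF. Qed.

Lemma gexpect_edge_sum n (F : T -> T -> 'rV[R]_n -> R) :
  (forall c c', e c c' -> expgrowth (F c c')) ->
  gexpect (fun z => edge_sum (fun c c' => F c c' z)) = edge_sum (fun c c' => gexpect (F c c')).
Proof.
move=> gF; rewrite gexpect_sum => [|c _]; last by apply: expgrowth_sum => c'; exact: gF.
by apply: eq_bigr => c _; rewrite gexpect_sum// => c'; exact: gF.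
Qed.

Lemma gexpect_path_sum n (H : T -> T -> T -> 'rV[R]_n -> R) :
  (forall c c' c'', e c c' -> e c c'' -> expgrowth (H c c' c'')) ->
  gexpect (fun z => path_sum (fun c c' c'' => H c c' c'' z)) =
  path_sum (fun c c' c'' => gexpect (H c c' c'')).
Proof.
move=> gH; rewrite gexpect_edge_sum => [|c c' cc']; last first.
  by apply: expgrowth_sum => c''; exact: gH.
by apply: eq_edge_sum => c c' cc'; rewrite gexpect_sum// => c''; exact: gH.
Qed.

End edge_sums.
Arguments nedges {R T} e.

(* A random path: (c, c') is drawn with weight l c c', then c'' is an independent copy of c' given
   c. The bound is Gibbs' inequality for the law of (c', c''); the normalizing sums cancel because
   c and c' play symmetric roles. *)
Section gibbs.
Context {R : realType} {T : finType}.
Variables (e : rel T) (l : T -> T -> R).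

Definition edge_post c c' c'' := l c c' * l c c'' / \sum_(c1 | e c c1) l c c1.

Hypothesis l_gt0 : forall c c', 0 < l c c'.

Lemma vertex_sum_gt0 c c' : e c c' -> 0 < \sum_(c1 | e c c1) l c c1.
Proof. by move=> cc'; rewrite (bigD1 c')//= ltr_pwDl// sumr_ge0// => c1 _; exact: ltW. Qed.

Lemma edge_post_gt0 c c' c'' : e c c' -> 0 < edge_post c c' c''.
Proof. by move=> cc'; rewrite divr_gt0 ?mulr_gt0// (vertex_sum_gt0 cc'). Qed.

Lemma sum_edge_post c c' : e c c' -> \sum_(c'' | e c c'') edge_post c c' c'' = l c c'.
Proof. by move=> cc'; rewrite -mulr_suml -mulr_sumr mulfK// gt_eqF// (vertex_sum_gt0 cc'). Qed.

Lemma path_sum_edge_post (F : T -> T -> R) :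
  path_sum e (fun c c' c'' => F c c' * edge_post c c' c'') = edge_sum e (fun c c' => F c c' * l c c').
Proof. by apply: eq_edge_sum => c c' cc'; rewrite -mulr_sumr sum_edge_post. Qed.

Variables (A : {set T}) (q : T -> T -> R) (N : R).
Hypothesis e_sym : symmetric e.
Hypothesis l_sym : forall c c', l c c' = l c' c.
Hypothesis q_gt0 : forall c c', 0 < q c c'.
Hypothesis N_gt0 : 0 < N.
Hypothesis edge_in : forall c c', e c c' -> c \in A.
Local Notation S c := (\sum_(c1 | e c c1) l c c1).

Lemma edge_gibbs c c' c'' : e c c' -> e c c'' ->
  edge_post c c' c'' * (ln (q c' c'') - ln (l c c'')) <=
  N * (q c' c'' * (l c c' / S c')) - (1 + ln N + (ln (S c) - ln (S c'))) * edge_post c c' c''.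
Proof.
move=> cc' cc''; have c'c : e c' c by rewrite e_sym.
have P0 := edge_post_gt0 c'' cc'; have S0 := vertex_sum_gt0 cc'; have S'0 := vertex_sum_gt0 c'c.
pose y := N * (q c' c'' * (l c c' / S c')) / edge_post c c' c''.
have y0 : 0 < y by rewrite !(divr_gt0, mulr_gt0).
have lny : ln y = ln N + ln (q c' c'') - ln (S c') - ln (l c c'') + ln (S c).
  have -> : y = N * q c' c'' * S c / (S c' * l c c'').
    by rewrite /y /edge_post; field; rewrite !gt_eqF.
  rewrite ln_div ?posrE ?mulr_gt0// !lnM ?posrE ?mulr_gt0//.
  by move: (ln N) (ln (q _ _)) (ln (S _)) (ln (S _)) (ln (l _ _)) => *; ring.
have y1 : -1 < y - 1 by rewrite ltrBrDl subrr.
have := le_ln1Dx y1; rewrite addrC subrK lny => /(ler_wpM2l (ltW P0)).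
rewrite mulrBr mulr1 [edge_post _ _ _ * y]mulrC divfK ?gt_eqF// => ln_le.
move: ln_le; set X := N * _; set p := edge_post _ _ _; clear.
by move: (ln N) (ln (q _ _)) (ln (S _)) (ln (S _)) (ln (l _ _)) => *; lra.
Qed.

Lemma edge_sum_transition_le (f : T -> R) : (forall c, 0 <= f c) ->
  edge_sum e (fun c c' => f c' * (l c c' / S c')) <= \sum_(c in A) f c.
Proof.
move=> f0; rewrite -edge_sum_sym// [leRHS]big_mkcond; apply: ler_sum => c _.
under eq_bigr do rewrite l_sym; rewrite -mulr_sumr -mulr_suml.
have [c' cc'|no_edge] := pickP (e c).
  by rewrite (edge_in cc') divff ?mulr1// gt_eqF// (vertex_sum_gt0 cc').
by rewrite big_pred0// mul0r mulr0; case: ifP.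
Qed.

Lemma gibbs_path_sum :
  path_sum e (fun c c' c'' => edge_post c c' c'' * (ln (q c' c'') - ln (l c c''))) <=
  N * (\sum_(c' in A) \sum_(c'' in A) q c' c'') - (1 + ln N) * edge_sum e l.
Proof.
pose Q c := \sum_(c'' in A) q c c''.
apply: le_trans (le_path_sum edge_gibbs) _; rewrite path_sumB path_sumZ path_sum_edge_post.
apply: lerB.
  rewrite ler_pM2l//; apply: le_trans (@edge_sum_transition_le Q _); last first.
    by move=> c; apply: sumr_ge0 => c'' _; exact: ltW.
  apply: le_edge_sum => c c' cc'; rewrite -mulr_suml.
  have c'c : e c' c by rewrite e_sym.
  apply: ler_wpM2r; first by rewrite divr_ge0// ltW// (vertex_sum_gt0 c'c).
  rewrite [leLHS]big_mkcond [leRHS]big_mkcond; apply: ler_sum => c'' _.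
  case: ifPn => [cc''|_]; last by case: ifP => // _; exact: ltW.
  have c''c : e c'' c by rewrite e_sym.
  by rewrite (edge_in c''c).
have -> : edge_sum e (fun c c' => (1 + ln N + (ln (S c) - ln (S c'))) * l c c') =
    (1 + ln N) * edge_sum e l + (edge_sum e (fun c c' => ln (S c) * l c c') -
                                 edge_sum e (fun c c' => ln (S c') * l c c')).
  by rewrite -edge_sumZ -edge_sumB -edge_sumD; apply: eq_edge_sum => c c' _; ring.
rewrite lerDl subr_ge0 -[leLHS]edge_sum_sym// le_eqVlt; apply/orP; left; apply/eqP.
by apply: eq_edge_sum => c c' _; rewrite l_sym.
Qed.

End gibbs.

Section graph.
Context {R : realType} {n : nat} {T : finType}.
Variables (x : T -> 'rV[R]_n) (e : rel T) (m : R).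
Implicit Types (c : T) (a z w : 'rV[R]_n).
Hypothesis m_gt0 : 0 < m.
Hypothesis x_unit : forall c, norm2 (x c) = 1.

Definition hdist c c' : R := 1 - dot (x c) (x c').

Lemma hdistC c c' : hdist c c' = hdist c' c. Proof. by rewrite /hdist dotC. Qed.

Lemma hdistxx c : hdist c c = 0. Proof. by rewrite /hdist -norm2E x_unit subrr. Qed.

Lemma hdist_bounds c c' : 0 <= hdist c c' <= 2.
Proof. by have := dot_unit (x_unit c) (x_unit c'); rewrite /hdist ler_norml; lra. Qed.

Lemma norm2_sum c c' : norm2 (x c + x c') = 4 - 2 * hdist c c'.
Proof. by rewrite norm2D !x_unit /hdist; ring. Qed.

Lemma norm2_diff c c' : norm2 (x c' - x c) = 2 * hdist c c'.
Proof. by rewrite norm2B !x_unit /hdist dotC; ring. Qed.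

Lemma dot_diff_sum c c' : dot (x c' - x c) (x c + x c') = 0.
Proof. by rewrite dotBl !dotDr -!norm2E !x_unit (dotC (x c')); ring. Qed.

(* [pair_lik k c c'] is the density, relative to the standard Gaussian law, of an observation
   centred at the midpoint k (x c + x c') of the signals 2 k x c and 2 k x c'; in [post_path] a
   second neighbour c'' is drawn from the posterior given c and the observation. *)
Definition pair_lik k c c' z := expR (dot (k *: (x c + x c')) z - k ^+ 2 / 2 * norm2 (x c + x c')).
Local Notation L := (pair_lik m).
Definition pair_liks c z := \sum_(c' | e c c') L c c' z.
Definition post_path c c' c'' z := edge_post e (fun c c' => L c c' z) c c' c''.

Lemma pair_likC k c c' z : pair_lik k c c' z = pair_lik k c' c z.
Proof. by rewrite /pair_lik [x c + _]addrC. Qed.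

Lemma pair_lik_gt0 k c c' z : 0 < pair_lik k c c' z. Proof. exact: expR_gt0. Qed.

Lemma biexpgrowth_pair_lik k c c' : biexpgrowth (pair_lik k c c').
Proof. exact: biexpgrowth_expR_affine. Qed.

Lemma expgrowth_pair_lik k c c' : expgrowth (pair_lik k c c').
Proof. exact: biexpgrowth_expgrowth (biexpgrowth_pair_lik k c c'). Qed.

Lemma biexpgrowth_pair_liks c c' : e c c' -> biexpgrowth (pair_liks c).
Proof. by move=> cc'; apply: (biexpgrowth_sum cc') => i _; exact: biexpgrowth_pair_lik. Qed.

Lemma pair_liks_gt0 c c' z : e c c' -> 0 < pair_liks c z.
Proof. by move=> cc'; exact: biexpgrowth_gt0 (biexpgrowth_pair_liks cc'). Qed.

Lemma pair_lik_le_liks c c' z : e c c' -> L c c' z <= pair_liks c z.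
Proof.
move=> cc'; rewrite /pair_liks (bigD1 c')//= lerDl; apply: sumr_ge0 => c'' _.
exact/ltW/pair_lik_gt0.
Qed.

Lemma biexpgrowth_post_path c c' c'' : e c c' -> biexpgrowth (post_path c c' c'').
Proof.
move=> cc'; apply: biexpgrowth_div; last exact: biexpgrowth_pair_liks cc'.
by apply: biexpgrowthM; exact: biexpgrowth_pair_lik.
Qed.

Lemma expgrowth_post_path c c' c'' : e c c' -> expgrowth (post_path c c' c'').
Proof. by move=> cc'; exact: biexpgrowth_expgrowth (biexpgrowth_post_path c'' cc'). Qed.

Lemma post_path_gt0 c c' c'' z : e c c' -> 0 < post_path c c' c'' z.
Proof. by move=> cc'; exact: biexpgrowth_gt0 (biexpgrowth_post_path c'' cc'). Qed.

Lemma sum_post_path c c' z : e c c' -> \sum_(c'' | e c c'') post_path c c' c'' z = L c c' z.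
Proof. by move=> cc'; rewrite sum_edge_post// => *; exact: pair_lik_gt0. Qed.

Lemma post_pathC c c' c'' z : post_path c c' c'' z = post_path c c'' c' z.
Proof. by rewrite /post_path /edge_post (mulrC (L c c' z)). Qed.

Lemma gexpect_pair_lik_shift k c c' (f : 'rV[R]_n -> R) : expgrowth f ->
  gexpect (fun w => f w * pair_lik k c c' w) = gexpect (fun w => f (w + k *: (x c + x c'))).
Proof.
move=> gf; rewrite (gexpect_shift _ gf); apply: eq_gexpect => w.
by rewrite /pair_lik norm2Z mulrAC.
Qed.

Lemma gexpect_pair_lik k c c' : gexpect (pair_lik k c c') = 1.
Proof.
have := gexpect_pair_lik_shift k c c' (expgrowth_cst n 1); rewrite gexpect_cst => <-.
by apply: eq_gexpect => w; rewrite mul1r.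
Qed.

Lemma sum_gexpect_post_path c c' : e c c' ->
  \sum_(c'' | e c c'') gexpect (post_path c c' c'') = 1.
Proof.
move=> cc'; rewrite -(gexpect_pair_lik m c c') -gexpect_sum => [|c'' _].
  by apply: eq_gexpect => z; rewrite sum_post_path.
exact: expgrowth_post_path.
Qed.

Lemma path_sum_gexpect_post_path : path_sum e (fun c c' c'' => gexpect (post_path c c' c'')) = nedges e.
Proof. by apply: eq_edge_sum => c c'; exact: sum_gexpect_post_path. Qed.

Lemma path_sum_gexpectM (F : T -> T -> 'rV[R]_n -> R) :
  (forall c c', e c c' -> expgrowth (F c c')) ->
  path_sum e (fun c c' c'' => gexpect (fun z => F c c' z * post_path c c' c'' z)) =
  edge_sum e (fun c c' => gexpect (fun z => F c c' z * L c c' z)).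
Proof.
move=> gF; apply: eq_edge_sum => c c' cc'; rewrite -gexpect_sum => [|c'' _].
  by apply: eq_gexpect => z; rewrite -mulr_sumr sum_post_path.
by apply: expgrowthM; [exact: gF|exact: expgrowth_post_path].
Qed.

Section path_gibbs.
Variables (A : {set T}) (q : T -> T -> 'rV[R]_n -> R).
Hypothesis e_sym : symmetric e.
Hypothesis edge_in : forall c c', e c c' -> c \in A.
Hypothesis nedges_gt0 : 0 < nedges e :> R.
Hypothesis biexpgrowth_q : forall c' c'', biexpgrowth (q c' c'').
Hypothesis mass_q : \sum_(c' in A) \sum_(c'' in A) gexpect (q c' c'') <= 1.

Lemma expgrowth_path_gibbs c c' c'' : e c c' ->
  expgrowth (fun z => post_path c c' c'' z * (ln (q c' c'' z) - ln (L c c'' z))).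
Proof.
move=> cc'; apply: expgrowthM; first exact: expgrowth_post_path.
by apply: expgrowthB; apply: expgrowth_ln => //; exact: biexpgrowth_pair_lik.
Qed.

Lemma path_gibbs :
  path_sum e (fun c c' c'' =>
    gexpect (fun z => post_path c c' c'' z * (ln (q c' c'' z) - ln (L c c'' z)))) <=
  - (nedges e * ln (nedges e)).
Proof.
set N : R := nedges e.
have gq : expgrowth (fun z => \sum_(c' in A) \sum_(c'' in A) q c' c'' z).
  by do 2 apply: expgrowth_sum => ? _; exact: biexpgrowth_expgrowth.
have gL : expgrowth (fun z => edge_sum e (fun c c' => L c c' z)).
  by apply: expgrowth_edge_sum => c c' _; exact: expgrowth_pair_lik.
have gG c c' c'' (cc' : e c c') (_ : e c c'') := expgrowth_path_gibbs c'' cc'.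
rewrite -gexpect_path_sum//.
apply: (@le_trans _ _ (gexpect (fun z => N * (\sum_(c' in A) \sum_(c'' in A) q c' c'' z) -
    (1 + ln N) * edge_sum e (fun c c' => L c c' z)))).
  apply: le_gexpect => [||z].
  - apply: expgrowth_edge_sum => c c' cc'; apply: expgrowth_sum => c'' _.
    exact: expgrowth_path_gibbs.
  - by apply: expgrowthB; exact: expgrowthZ.
  apply: (@gibbs_path_sum _ _ e (fun c c' => L c c' z) _ A (fun c c' => q c c' z)) => // c c'.
  - exact: pair_lik_gt0.
  - exact: pair_likC.
  - exact: biexpgrowth_gt0.
rewrite (gexpectB (expgrowthZ _ gq) (expgrowthZ _ gL)) (gexpectZ _ gq) (gexpectZ _ gL).
have -> : gexpect (fun z => edge_sum e (fun c c' => L c c' z)) = N.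
  rewrite gexpect_edge_sum => [|c c' _]; last exact: expgrowth_pair_lik.
  by apply: eq_edge_sum => c c' _; rewrite gexpect_pair_lik.
have -> : gexpect (fun z => \sum_(c' in A) \sum_(c'' in A) q c' c'' z) =
    \sum_(c' in A) \sum_(c'' in A) gexpect (q c' c'').
  rewrite gexpect_sum => [|c' _]; last by apply: expgrowth_sum => c'' _; exact: biexpgrowth_expgrowth.
  by apply: eq_bigr => c' _; rewrite gexpect_sum// => c'' _; exact: biexpgrowth_expgrowth.
by have := ler_wpM2l (ltW nedges_gt0) mass_q; rewrite -/N mulr1 mulrDl mul1r (mulrC (ln N)); lra.
Qed.

End path_gibbs.

End graph.

Section close_paths.
Context {R : realType} {n : nat} {T : finType}.
Variables (x : T -> 'rV[R]_n) (e : rel T) (m : R).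
Implicit Types (c : T) (z : 'rV[R]_n).
Hypothesis m_gt0 : 0 < m.
Hypothesis x_unit : forall c, norm2 (x c) = 1.
Local Notation hdist := (hdist x).
Local Notation L := (pair_lik x m).
Local Notation P := (post_path x e m).
Local Notation N := (nedges e : R).

Definition diff_noise c c' z := `|dot (x c' - x c) z|.
Definition center_noise c c' z := 2^-1 * `|dot (x c') z - m * (2 - hdist c c')|.

Lemma expgrowth_abs_dotB (a : 'rV[R]_n) k : expgrowth (fun z => `|dot a z - k|).
Proof. by apply/expgrowth_norm/expgrowthB; [exact: expgrowth_dot|exact: expgrowth_cst]. Qed.

Lemma expgrowth_diff_noise c c' : expgrowth (diff_noise c c').
Proof. exact/expgrowth_norm/expgrowth_dot. Qed.

Lemma expgrowth_center_noise c c' : expgrowth (center_noise c c').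
Proof. by apply: expgrowthZ; exact: expgrowth_abs_dotB. Qed.

Lemma gexpect_pair_lik_noise_le c c' (a : 'rV[R]_n) : norm2 a <= 4 ->
  gexpect (fun w => `|dot a w - dot a (m *: (x c + x c'))| * L c c' w) <= 5 / 2.
Proof.
move=> a4; rewrite (gexpect_pair_lik_shift x m c c' (expgrowth_abs_dotB _ _)).
under eq_gexpect do rewrite dotDr addrK.
have gd2 : expgrowth (fun w => dot a w ^+ 2) by apply: expgrowthX; exact: expgrowth_dot.
apply: (@le_trans _ _ (gexpect (fun w => 2^-1 + 2^-1 * dot a w ^+ 2))).
  apply: le_gexpect => [||w]; first exact/expgrowth_norm/expgrowth_dot.
    exact: expgrowthD (expgrowth_cst _ _) (expgrowthZ _ gd2).
  rewrite -[dot a w ^+ 2]real_normK ?num_real//.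
  by have := sqr_ge0 (`|dot a w| - 1); nra.
rewrite (gexpectD (expgrowth_cst _ _) (expgrowthZ _ gd2)) gexpect_cst (gexpectZ _ gd2).
by have := gexpect_dot_sqr_le a; lra.
Qed.

Lemma gexpect_center_noise_le c c' : gexpect (fun z => center_noise c c' z * L c c' z) <= 5 / 4.
Proof.
have x4 : norm2 (x c') <= 4 by rewrite x_unit; lra.
have := gexpect_pair_lik_noise_le c c' x4.
have -> : dot (x c') (m *: (x c + x c')) = m * (2 - hdist c c').
  by rewrite dotZr dotDr -norm2E x_unit /hdist dotC; ring.
have gn : expgrowth (fun z => `|dot (x c') z - m * (2 - hdist c c')| * L c c' z).
  by apply: expgrowthM; [exact: expgrowth_abs_dotB|exact: expgrowth_pair_lik].
under [in X in _ -> X]eq_gexpect do rewrite -mulrA.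
by rewrite (gexpectZ _ gn); lra.
Qed.

Lemma gexpect_diff_noise_le c c' : gexpect (fun z => diff_noise c c' z * L c c' z) <= 5 / 2.
Proof.
have D4 : norm2 (x c' - x c) <= 4.
  by rewrite (norm2_diff x_unit); have := hdist_bounds x_unit c c'; lra.
have := gexpect_pair_lik_noise_le c c' D4.
by rewrite dotZr (dot_diff_sum x_unit) mulr0; under eq_gexpect do rewrite subr0.
Qed.

Definition match_mass := edge_sum e (fun c c' => gexpect (P c c' c')).

Lemma match_mass_ge0 : 0 <= match_mass.
Proof.
by apply: edge_sum_ge0 => c c' cc'; apply: gexpect_ge0 => z; exact/ltW/post_path_gt0.
Qed.

Variables (A : {set T}) (F p0 d delta : R).
Hypothesis e_sym : symmetric e.
Hypothesis edge_in : forall c c', e c c' -> c \in A.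
Hypothesis edge_dist : forall c c', e c c' -> `|hdist c c' - p0| <= d.
Hypothesis weight_le : forall c, c \in A ->
  \sum_(c' in A | c' != c) expR (- (m ^+ 2 * hdist c c')) <= expR (- F).
Hypothesis nedges_gt0 : 0 < N.
Hypothesis delta_bounds : 0 < delta <= 1.
Hypothesis d_le : d <= delta / 4.

Definition close_pair c' c'' := (c'' != c') && (hdist c' c'' < p0 - delta).
Definition close_mass := path_sum e (fun c c' c'' => (close_pair c' c'')%:R * gexpect (P c c' c'')).

(* The factor 1 - delta / 2 moves the centre m (x c' + x c'') of the comparison density exactly for
   the pairs that are closer than typical; this is where they lose. *)
Definition ref_weight c' c'' := if c'' == c' then 1 else expR (F - m ^+ 2 * hdist c' c'').
Definition ref_tilt c' c'' := if close_pair c' c'' then 1 - delta / 2 else 1.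
Definition ref_density c' c'' z :=
  (2 * #|A|%:R)^-1 * ref_weight c' c'' * pair_lik x (ref_tilt c' c'' * m) c' c'' z.

Lemma ref_weight_gt0 c' c'' : 0 < ref_weight c' c''.
Proof. by rewrite /ref_weight; case: ifP => // _; exact: expR_gt0. Qed.

Lemma double_cardA_gt0 : 0 < 2 * #|A|%:R :> R.
Proof.
rewrite mulr_gt0// ltr0n; apply/card_gt0P; have [c cA|A0] := pickP (mem A); first by exists c.
move: nedges_gt0; rewrite /nedges /edge_sum big1 ?ltxx// => c _; rewrite big_pred0// => c'.
by apply/negP => /edge_in cA; have := A0 c; rewrite /= cA.
Qed.

Lemma biexpgrowth_ref_density c' c'' : biexpgrowth (ref_density c' c'').
Proof.
apply: biexpgrowthM; last exact: biexpgrowth_pair_lik.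
by apply: biexpgrowth_cst; rewrite mulr_gt0 ?ref_weight_gt0// invr_gt0 double_cardA_gt0.
Qed.

Lemma sum_gexpect_ref_le : \sum_(c' in A) \sum_(c'' in A) gexpect (ref_density c' c'') <= 1.
Proof.
have A0 := double_cardA_gt0; have cardA0 : 0 < #|A|%:R :> R by lra.
apply: (@le_trans _ _ (\sum_(c' in A) #|A|%:R^-1)); last first.
  by rewrite sumr_const -[_ *+ _]mulr_natl divff// gt_eqF.
apply: ler_sum => c' c'A.
have -> : \sum_(c'' in A) gexpect (ref_density c' c'') =
    (2 * #|A|%:R)^-1 * \sum_(c'' in A) ref_weight c' c''.
  rewrite mulr_sumr; apply: eq_bigr => c'' _.
  by rewrite (gexpectZ _ (expgrowth_pair_lik _ _ _ _)) gexpect_pair_lik mulr1.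
have weight_le1 : \sum_(c'' in A | c'' != c') ref_weight c' c'' <= 1.
  under eq_bigr => c'' /andP[_ /negbTE c''c'] do rewrite /ref_weight c''c' expRD.
  rewrite -mulr_sumr; apply: le_trans (ler_wpM2l (expR_ge0 _) (weight_le c'A)) _.
  by rewrite -expRD subrr expR0.
rewrite (bigD1 c')//= {1}/ref_weight eqxx invfM mulrAC -[leRHS]mul1r.
by apply: ler_wpM2r; [rewrite invr_ge0 ltW|lra].
Qed.

Lemma ln_ref_density c' c'' z :
  ln (ref_density c' c'' z) = - ln (2 * #|A|%:R) + (1 - (c'' == c')%:R) * F - m ^+ 2 * hdist c' c'' +
    (ref_tilt c' c'' * m * dot (x c' + x c'') z - (ref_tilt c' c'' * m) ^+ 2 * (2 - hdist c' c'')).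
Proof.
have A0 := double_cardA_gt0; have w0 := ref_weight_gt0 c' c''.
rewrite /ref_density [LHS]lnM ?posrE ?mulr_gt0 ?invr_gt0 ?expR_gt0//.
rewrite [ln (_^-1 * _)]lnM ?posrE ?invr_gt0// lnV ?posrE// /pair_lik expRK dotZl (norm2_sum x_unit).
have -> : ln (ref_weight c' c'') = (1 - (c'' == c')%:R) * F - m ^+ 2 * hdist c' c''.
  rewrite /ref_weight; case: eqP => [->|_]; last by rewrite expRK subr0 mul1r.
  by rewrite ln1 (hdistxx x_unit) subrr mul0r mulr0 subr0.
by field.
Qed.

(* The last term is the second-order effect of the tilt. *)
Lemma tilt_gain p1 p2 p3 Y Z : p0 - d <= p1 -> p0 - d <= p2 -> 0 <= p3 -> p3 < p0 - delta ->
  m ^+ 2 * (delta ^+ 2 / 4) - m / 2 * (`|Y - m * (2 - p1)| + `|Z - m * (2 - p2)|) <=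
  (delta - delta ^+ 2 / 4) * m ^+ 2 * (2 - p3) - delta / 2 * m * (Y + Z).
Proof.
have /andP[delta0 delta1] := delta_bounds; have d_le' := d_le.
move=> p1_ge p2_ge p3_ge0 p3_lt.
set NY := `|Y - _|; set NZ := `|Z - _|.
have Y_le : Y - m * (2 - p1) <= NY by exact: ler_norm.
have Z_le : Z - m * (2 - p2) <= NZ by exact: ler_norm.
have NY0 : 0 <= NY by exact: normr_ge0.
have NZ0 : 0 <= NZ by exact: normr_ge0.
have curvature : delta ^+ 2 / 4 <= delta / 2 * (p1 + p2 - 2 * p3) - delta ^+ 2 / 4 * (2 - p3).
  have : delta / 2 * (3 / 2 * delta) <= delta / 2 * (p1 + p2 - 2 * p3) by rewrite ler_wpM2l; lra.
  have : 0 <= delta ^+ 2 / 4 * p3 by rewrite mulr_ge0// divr_ge0// sqr_ge0.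
  by lra.
have := ler_wpM2l (sqr_ge0 m) curvature.
have m0 := ltW m_gt0; have deltam0 : 0 <= delta / 2 * m by rewrite mulr_ge0//; lra.
have gap0 : 0 <= NY + m * (2 - p1) - Y + (NZ + m * (2 - p2) - Z) by lra.
have := mulr_ge0 deltam0 gap0.
have : 0 <= (1 - delta) / 2 * m * (NY + NZ) by rewrite mulr_ge0 ?addr_ge0// mulr_ge0//; lra.
clearbody NY NZ.
by lra.
Qed.

Lemma ref_gain c c' c'' z : e c c' -> e c c'' ->
  - ln (2 * #|A|%:R) + F - m ^+ 2 * (p0 + d) - F * (c'' == c')%:R
    + m ^+ 2 * (delta ^+ 2 / 4) * (close_pair c' c'')%:R
    - m * (diff_noise c c' z + center_noise c c' z + center_noise c c'' z) <=
  ln (ref_density c' c'' z) - ln (L c c'' z).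
Proof.
move=> cc' cc''; have /andP[pp0 _] := hdist_bounds x_unit c' c''.
have := edge_dist cc'; have := edge_dist cc''; rewrite !ler_norml => /andP[p2_ge p2_le] /andP[p1_ge _].
rewrite ln_ref_density /pair_lik expRK dotZl (norm2_sum x_unit) /diff_noise /center_noise dotBl !dotDl.
set X := dot (x c) z; set Y := dot (x c') z; set Z := dot (x c'') z.
set p1 := hdist c c'; set p2 := hdist c c''; set p3 := hdist c' c''.
have untilted : - (m ^+ 2 * (p0 + d)) - m * `|Y - X| <=
    - (m ^+ 2 * p3) + (m * (Y + Z) - m ^+ 2 * (2 - p3)) - (m * (X + Z) - m ^+ 2 / 2 * (4 - 2 * p2)).
  have : m * (X - Y) <= m * `|Y - X| by rewrite ler_pM2l// distrC ler_norm.
  have : m ^+ 2 * p2 <= m ^+ 2 * (p0 + d) by rewrite ler_wpM2l ?sqr_ge0//; rewrite /p2; lra.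
  by lra.
have center_ge0 k q : 0 <= m * (2^-1 * `|k - m * (2 - q)|).
  by rewrite mulr_ge0 ?(ltW m_gt0)// mulr_ge0.
have := center_ge0 Y p1; have := center_ge0 Z p2.
rewrite /ref_tilt; case: ifPn => [c'c''|_] /=; last by rewrite mul1r; lra.
have /andP[_ p3_lt] := c'c''; rewrite -/p3 in p3_lt pp0.
have := @tilt_gain p1 p2 p3 Y Z; rewrite -/p1 -/p2 in p1_ge p2_ge *.
move=> /(_ ltac:(lra) ltac:(lra) pp0 p3_lt); lra.
Qed.

Let gain_cst := - ln (2 * #|A|%:R) + F - m ^+ 2 * (p0 + d).

Lemma gexpect_ref_gain c c' c'' : e c c' -> e c c'' ->
  gain_cst * gexpect (P c c' c'') - F * ((c'' == c')%:R * gexpect (P c c' c''))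
    + m ^+ 2 * (delta ^+ 2 / 4) * ((close_pair c' c'')%:R * gexpect (P c c' c''))
    - m * (gexpect (fun z => diff_noise c c' z * P c c' c'' z)
           + gexpect (fun z => center_noise c c' z * P c c' c'' z)
           + gexpect (fun z => center_noise c c'' z * P c c' c'' z)) <=
  gexpect (fun z => P c c' c'' z * (ln (ref_density c' c'' z) - ln (L c c'' z))).
Proof.
move=> cc' cc''; have gP := expgrowth_post_path x m c'' cc'.
have gM f : expgrowth f -> expgrowth (fun z => f z * P c c' c'' z) by move/expgrowthM; apply.
have gD := gM _ (expgrowth_diff_noise c c'); have gC := gM _ (expgrowth_center_noise c c').
have gC' := gM _ (expgrowth_center_noise c c'').
pose k := gain_cst - F * (c'' == c')%:R + m ^+ 2 * (delta ^+ 2 / 4) * (close_pair c' c'')%:R.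
have gPk := expgrowthZ k gP; have gn := expgrowthD (expgrowthD gD gC) gC'.
apply: (@le_trans _ _ (gexpect (fun z => k * P c c' c'' z - m * (diff_noise c c' z * P c c' c'' z +
    center_noise c c' z * P c c' c'' z + center_noise c c'' z * P c c' c'' z)))).
  rewrite (gexpectB gPk (expgrowthZ m gn)) (gexpectZ _ gP) (gexpectZ _ gn).
  rewrite (gexpectD (expgrowthD gD gC) gC') (gexpectD gD gC).
  by rewrite le_eqVlt; apply/orP; left; apply/eqP; rewrite /k; ring.
apply: le_gexpect => [||z]; first exact: expgrowthB gPk (expgrowthZ m gn).
  exact: (expgrowth_path_gibbs x m biexpgrowth_ref_density c'' cc').
rewrite [leLHS](_ : _ = P c c' c'' z * (k - m * (diff_noise c c' z + center_noise c c' z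
    + center_noise c c'' z))); last by ring.
by rewrite ler_pM2l ?post_path_gt0//; exact: ref_gain.
Qed.

Lemma close_mass_le :
  m ^+ 2 * (delta ^+ 2 / 4) * close_mass <=
  N * (ln (2 * #|A|%:R) - F + m ^+ 2 * (p0 + d) - ln N + 5 * m) + F * match_mass.
Proof.
have gD c c' := expgrowth_diff_noise c c'; have gC c c' := expgrowth_center_noise c c'.
have := le_trans (le_path_sum gexpect_ref_gain)
  (path_gibbs x m e_sym edge_in nedges_gt0 biexpgrowth_ref_density sum_gexpect_ref_le).
rewrite path_sumB path_sumD path_sumB !path_sumZ 2!path_sumD.
rewrite path_sum_gexpect_post_path path_sum_diag -/match_mass -/close_mass.
rewrite (path_sum_gexpectM x m (fun c c' _ => gD c c')) (path_sum_gexpectM x m (fun c c' _ => gC c c')).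
have -> : path_sum e (fun c c' c'' => gexpect (fun z => center_noise c c'' z * P c c' c'' z)) =
    edge_sum e (fun c c' => gexpect (fun z => center_noise c c' z * L c c' z)).
  rewrite -(path_sum_gexpectM x m (fun c c' _ => gC c c')) -path_sum_swap.
  apply: eq_edge_sum => c c' _; apply: eq_bigr => c'' _.
  by apply: eq_gexpect => z; rewrite post_pathC.
have D_le : edge_sum e (fun c c' => gexpect (fun z => diff_noise c c' z * L c c' z)) <= 5 / 2 * N.
  by rewrite -edge_sum_cst; apply: le_edge_sum => c c' _; exact: gexpect_diff_noise_le.
have C_le : edge_sum e (fun c c' => gexpect (fun z => center_noise c c' z * L c c' z)) <= 5 / 4 * N.
  by rewrite -edge_sum_cst; apply: le_edge_sum => c c' _; exact: gexpect_center_noise_le.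
have := ler_wpM2l (ltW m_gt0) (lerD (lerD D_le C_le) C_le).
move: (edge_sum _ _) (edge_sum _ _) => D C; rewrite /gain_cst.
move: match_mass close_mass (ln _) (ln _) => M SC a l; lra.
Qed.

End close_paths.

Section edge_channel.
Context {R : realType} {n : nat} {T : finType}.
Variables (x : T -> 'rV[R]_n) (e : rel T) (m : R).
Implicit Types (c : T) (z w : 'rV[R]_n).
Hypothesis m_gt0 : 0 < m.
Hypothesis x_unit : forall c, norm2 (x c) = 1.
Local Notation hdist := (hdist x).
Local Notation L := (pair_lik x m).
Local Notation S := (pair_liks x e m).
Local Notation P := (post_path x e m).
Local Notation N := (nedges e : R).

Definition nbrs c : {set T} := [set c' | e c c']%SET.
Definition degree c : R := #|nbrs c|%:R.

Lemma sum_nbrs c (F : T -> R) : \sum_(c' in nbrs c) F c' = \sum_(c' | e c c') F c'.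
Proof. by apply: eq_bigl => c'; rewrite inE. Qed.

Lemma degreeE c : \sum_(c' | e c c') 1 = degree c.
Proof. by rewrite -sum_nbrs sumr_const. Qed.

Lemma degree_gt0 c c' : e c c' -> 0 < degree c.
Proof. by move=> cc'; apply: (@cardD_gt0 _ _ _ c'); rewrite inE. Qed.

(* Seen from m x c, the midpoints m (x c + x c') become the signals m x c'. *)
Definition recenter c w := expR (dot (m *: x c) w + m ^+ 2 / 2).

Lemma gexpect_recenter c (f : 'rV[R]_n -> R) : expgrowth f ->
  gexpect f = gexpect (fun w => f (w + m *: x c) / recenter c w).
Proof.
move=> gf; rewrite (gexpect_shift_inv (m *: x c) gf); apply: eq_gexpect => w.
by rewrite /recenter -expRN norm2Z x_unit mulr1 opprD.
Qed.

Lemma pair_lik_recenter c c' w : L c c' (w + m *: x c) = lik x (m ^+ 2) c' w * recenter c w.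
Proof.
rewrite /pair_lik /lik sqrtr_sqr (ger0_norm (ltW m_gt0)) -expRD; congr expR.
rewrite (norm2_sum x_unit) /hdist !dotZl !(dotDl, dotDr, dotZr) -!norm2E !x_unit.
by rewrite (dotC (x c') (x c)); field.
Qed.

Lemma pair_liks_recenter c w : S c (w + m *: x c) = liks (nbrs c) x (m ^+ 2) w * recenter c w.
Proof.
by rewrite /liks sum_nbrs mulr_suml; apply: eq_bigr => c' _; exact: pair_lik_recenter.
Qed.

Lemma gexpect_post_path c c' c'' : e c c' ->
  gexpect (P c c' c'') = gexpect (lik2 (nbrs c) x (m ^+ 2) c' c'').
Proof.
move=> cc'; have c'N : c' \in nbrs c by rewrite inE.
rewrite (gexpect_recenter c (expgrowth_post_path x m c'' cc')); apply: eq_gexpect => w.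
rewrite /post_path /edge_post -/(pair_liks x e m c _) !pair_lik_recenter pair_liks_recenter.
have := expR_gt0 (dot (m *: x c) w + m ^+ 2 / 2); rewrite -/(recenter c w) => r0.
by rewrite /lik2; field; rewrite !gt_eqF// (liks_gt0 _ c'N).
Qed.

Lemma mmse_nbrs c c0 : e c c0 ->
  degree c * mmse (nbrs c) x (m ^+ 2) =
  \sum_(c' | e c c') \sum_(c'' | e c c'') gexpect (P c c' c'') * hdist c' c''.
Proof.
move=> cc0; have c0N : c0 \in nbrs c by rewrite inE.
have gl c' c'' : expgrowth (fun w => lik2 (nbrs c) x (m ^+ 2) c' c'' w * hdist c' c'').
  by apply: expgrowthM; [exact: expgrowth_lik2 c0N _ _ _|exact: expgrowth_cst].
rewrite -(gexpect_post_var _ c0N) gexpect_sum => [|c' _]; last exact: expgrowth_sum.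
rewrite sum_nbrs; apply: eq_bigr => c' cc'; rewrite gexpect_sum => [|c'' _]; last exact: gl.
rewrite sum_nbrs; apply: eq_bigr => c'' _; rewrite (gexpect_post_path _ cc') mulrC.
rewrite -(gexpectZ _ (expgrowth_lik2 _ c0N _ _ _)).
by apply: eq_gexpect => w; rewrite mulrC.
Qed.

Definition ln_post c c' z := L c c' z * ln (L c c' z / S c z).

Lemma expgrowth_ln_post c c' : e c c' -> expgrowth (ln_post c c').
Proof.
move=> cc'; apply: expgrowthM; first exact: expgrowth_pair_lik.
by apply/expgrowth_ln/biexpgrowth_div; [exact: biexpgrowth_pair_lik|exact: biexpgrowth_pair_liks cc'].
Qed.

Lemma ln_post_le0 c c' z : e c c' -> ln_post c c' z <= 0.
Proof.
move=> cc'; rewrite /ln_post pmulr_rle0 ?pair_lik_gt0// ln_le0//.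
by rewrite ler_pdivrMr ?(pair_liks_gt0 x m z cc')// mul1r pair_lik_le_liks.
Qed.

Lemma sum_gexpect_ln_post_nbrs c c0 : e c c0 ->
  \sum_(c' | e c c') gexpect (ln_post c c') = - (degree c * cond_ent (nbrs c) x (m ^+ 2)).
Proof.
move=> cc0; have c0N : c0 \in nbrs c by rewrite inE.
have xN i : i \in nbrs c -> norm2 (x i) = 1 by [].
apply: etrans (sum_gexpect_ln_post xN c0N (sqr_ge0 m)).
apply: eq_big => [c'|c' cc']; first by rewrite inE.
rewrite (gexpect_recenter c (expgrowth_ln_post cc')); apply: eq_gexpect => w.
rewrite /ln_post pair_lik_recenter pair_liks_recenter.
have := expR_gt0 (dot (m *: x c) w + m ^+ 2 / 2); rewrite -/(recenter c w) => r0.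
have l0 := liks_gt0 x c0N (m ^+ 2) w.
have -> : lik x (m ^+ 2) c' w * recenter c w / (liks (nbrs c) x (m ^+ 2) w * recenter c w) =
  lik x (m ^+ 2) c' w / liks (nbrs c) x (m ^+ 2) w by field; rewrite !gt_eqF.
by field; rewrite gt_eqF.
Qed.

Definition post_entropy := edge_sum e (fun c c' => - gexpect (ln_post c c')).
Definition post_dist := path_sum e (fun c c' c'' => gexpect (P c c' c'') * hdist c' c'').

Lemma post_entropy_ge0 : 0 <= post_entropy.
Proof.
apply: edge_sum_ge0 => c c' cc'; rewrite -(gexpectN (expgrowth_ln_post cc')).
by apply: gexpect_ge0 => z; rewrite oppr_ge0 ln_post_le0.
Qed.

Lemma gexpect_post_path_ge0 c c' c'' : e c c' -> 0 <= gexpect (P c c' c'').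
Proof. by move=> cc'; apply: gexpect_ge0 => z; exact/ltW/post_path_gt0. Qed.

Lemma post_dist_ge0 : 0 <= post_dist.
Proof.
apply: path_sum_ge0 => c c' c'' cc' _; rewrite mulr_ge0 ?gexpect_post_path_ge0//.
by have /andP[] := hdist_bounds x_unit c' c''.
Qed.

Lemma post_dist_ge p0 delta : 0 <= p0 - delta ->
  (p0 - delta) * (N - match_mass x e m - close_mass x e m p0 delta) <= post_dist.
Proof.
move=> pdelta0; rewrite -(path_sum_gexpect_post_path x e m) /match_mass /close_mass.
rewrite -(path_sum_diag e (fun c c' c'' => gexpect (P c c' c''))) -!path_sumB -path_sumZ.
apply: le_path_sum => c c' c'' cc' _.
have P0 := gexpect_post_path_ge0 c'' cc'; have /andP[dist_ge0 _] := hdist_bounds x_unit c' c''.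
rewrite /close_pair; case: (c'' == c') => /=; first by rewrite mul1r mul0r subrr subr0 mulr0 mulr_ge0.
rewrite mul0r subr0; case: ltP => h /=; first by rewrite mul1r subrr mulr0 mulr_ge0.
by rewrite mul0r subr0 mulrC ler_wpM2l.
Qed.

Variable b : R.
Hypothesis n_gt0 : (0 < n)%N.
Hypothesis b_gt0 : 0 < b.
Hypothesis m_sqr : m ^+ 2 = n%:R * b.

Let n_pos : 0 < n%:R :> R. Proof. by rewrite ltr0n. Qed.

(* The logarithm in [cond_ent_le] is replaced by its tangent at b q, which can be summed over c. *)
Lemma post_entropy_le q D : 0 < D -> (forall c, degree c <= D) -> 0 < 1 - b * q ->
  post_entropy <= N * (ln D + n%:R / 2 * (ln (1 - b * q) + b * q / (1 - b * q)))
    - n%:R / 2 * (b / (1 - b * q)) * post_dist.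
Proof.
move=> D0 degD bq; rewrite /post_dist /post_entropy /nedges /path_sum /edge_sum.
rewrite mulr_suml mulr_sumr -sumrB; apply: ler_sum => c _.
have [c0 cc0|no_edge] := pickP (e c); last by rewrite !big_pred0// mul0r mulr0 subrr.
have c0N : c0 \in nbrs c by rewrite inE.
have xN i : i \in nbrs c -> norm2 (x i) = 1 by [].
rewrite sumrN (sum_gexpect_ln_post_nbrs cc0) opprK -(mmse_nbrs cc0) degreeE.
have m2_gt0 : 0 < m ^+ 2 by rewrite exprn_gt0.
have := cond_ent_le n_gt0 xN c0N m2_gt0; have := mmse_lt n_gt0 xN c0N m2_gt0.
move: (mmse _ _ _) (cond_ent _ _ _) => V K; rewrite m_sqr -/(degree c).
have -> : n%:R * b * V / n%:R = b * V by field; rewrite gt_eqF.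
have N0 := degree_gt0 cc0; set d := degree c in N0 * => bV K_le.
have lnd : ln d <= ln D by rewrite ler_ln ?posrE ?degD.
have tangent : ln (1 - b * V) <= ln (1 - b * q) + b * q / (1 - b * q) - b / (1 - b * q) * V.
  have r1 : -1 < (1 - b * V) / (1 - b * q) - 1 by rewrite ltrBrDl subrr divr_gt0.
  have := le_ln1Dx r1; rewrite addrC subrK ln_div ?posrE//.
  have -> : (1 - b * V) / (1 - b * q) - 1 = b * q / (1 - b * q) - b / (1 - b * q) * V.
    by field; rewrite gt_eqF.
  by lra.
have n2 : 0 <= n%:R / 2 :> R by rewrite divr_ge0.
have := ler_wpM2l n2 tangent => tangent_n.
have K_le' : K <= ln D + n%:R / 2 * (ln (1 - b * q) + b * q / (1 - b * q) - b / (1 - b * q) * V) by lra.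
by have := ler_wpM2l (ltW N0) K_le'; congr (_ <= _); ring.
Qed.

Lemma post_dist_le p0 d (B := p0 * (2 - p0) + 2 * d) : 0 <= p0 <= 2 -> 0 <= d ->
  (forall c c', e c c' -> `|hdist c c' - p0| <= d) ->
  post_dist <= N * (B / (1 + b * B)).
Proof.
move=> /andP[p0_ge0 p0_le2] d0 edge_dist.
have B0 : 0 <= B by rewrite addr_ge0 ?mulr_ge0//; lra.
rewrite /post_dist /nedges /path_sum /edge_sum mulr_suml; apply: ler_sum => c _.
have [c0 cc0|no_edge] := pickP (e c); last by rewrite !big_pred0// mul0r.
have c0N : c0 \in nbrs c by rewrite inE.
have xN i : i \in nbrs c -> norm2 (x i) = 1 by [].
rewrite -(mmse_nbrs cc0) degreeE ler_pM2l ?(degree_gt0 cc0)//.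
have -> : B / (1 + b * B) = n%:R * B / (n%:R + m ^+ 2 * B).
  have bB : 0 <= b * B by rewrite mulr_ge0// ltW.
  rewrite m_sqr; field; have -> : n%:R + n%:R * b * B = n%:R * (1 + b * B) by ring.
  by rewrite !gt_eqF// ?mulr_gt0//; lra.
apply: (mmse_center (y := (1 - p0) *: x c) n_gt0 xN c0N (sqr_ge0 m) B0) => c'; rewrite inE => cc'.
have := edge_dist _ _ cc'; rewrite ler_norml /hdist => /andP[h_ge h_le].
rewrite norm2B norm2Z !x_unit dotZr (dotC (x c')) /B; set t := dot (x c) (x c') in h_ge h_le *.
have : (1 - p0) * (1 - p0 - t) <= d.
  have [p0_le|p0_le] := leP 0 (1 - p0).
    by apply: (@le_trans _ _ ((1 - p0) * d)); [apply: ler_wpM2l; lra|rewrite ler_piMl//; lra].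
  by apply: (@le_trans _ _ ((1 - p0) * (- d))); [apply: ler_wnM2l; lra|nra].
by lra.
Qed.

End edge_channel.

(** * Error probability seen from the midpoint of an edge *)

Lemma measurable_has d (X : measurableType d) (I : Type) (f : I -> X -> bool) (r : seq I) :
  (forall i, measurable_fun setT (f i)) -> measurable_fun setT (fun t => has (f^~ t) r).
Proof.
move=> mf; elim: r => [|i r ih] /=; first exact: measurable_cst.
exact: measurable_or.
Qed.

Section edge_error.
Context {R : realType} {n : nat} {T : finType}.
Variables (x : T -> 'rV[R]_n) (e : rel T) (m : R).
Implicit Types (c : T) (z w : 'rV[R]_n) (t : R).
Hypothesis m_gt0 : 0 < m.
Hypothesis x_unit : forall c, norm2 (x c) = 1.
Local Notation hdist := (hdist x).
Local Notation L := (pair_lik x m).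
Local Notation S := (pair_liks x e m).
Local Notation P := (post_path x e m).
Local Notation N := (nedges e : R).

Definition err_event c z := [exists c', e c c' && (0 <= dot (x c' - x c) z)].
Definition err_prob c := gexpect (fun z => (err_event c z)%:R * L c c z).

Lemma measurable_dot_ge0 (a : 'rV[R]_n) :
  measurable_fun setT (fun t : n.-tuple R => 0 <= dot a (tuple_row t)).
Proof. by apply: measurable_fun_ler => //; exact: measurable_row_dot. Qed.

Lemma expgrowth_err_event c : expgrowth (fun z => (err_event c z)%:R).
Proof.
apply: expgrowth_ind; rewrite (_ : (fun _ => _) = fun t : n.-tuple R =>
  has (fun c' => e c c' && (0 <= dot (x c' - x c) (tuple_row t))) (enum T)); last first.
  apply/funext => t; apply/existsP/hasP => [[c' cc']|[c' _ cc']]; exists c' => //.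
  by rewrite mem_enum.
apply: measurable_has => c'; apply: measurable_and; first exact: measurable_cst.
exact: measurable_dot_ge0.
Qed.

Lemma err_prob_ge0 c : 0 <= err_prob c.
Proof. by apply: gexpect_ge0 => z; rewrite mulr_ge0// ltW// pair_lik_gt0. Qed.

Lemma err_probE c : err_prob c = gexpect (fun w => (err_event c (w + (2 * m) *: x c))%:R).
Proof.
rewrite /err_prob (gexpect_pair_lik_shift x m c c (expgrowth_err_event c)).
by apply: eq_gexpect => w; rewrite -mulr2n -[x c *+ 2]scaler_nat scalerA mulrC.
Qed.

Lemma expgrowth_post_err c c' : e c c' ->
  expgrowth (fun z => L c c' z / S c z * (0 <= dot (x c' - x c) z)%R%:R * L c c z).
Proof.
move=> cc'; apply: expgrowthM; last exact: expgrowth_pair_lik.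
apply: expgrowthM; last by apply: expgrowth_ind; exact: measurable_dot_ge0.
apply/biexpgrowth_expgrowth/biexpgrowth_div; first exact: biexpgrowth_pair_lik.
exact: biexpgrowth_pair_liks cc'.
Qed.

Lemma sum_post_err_le c :
  \sum_(c' | e c c') gexpect (fun z => L c c' z / S c z * (0 <= dot (x c' - x c) z)%R%:R * L c c z) <=
  err_prob c.
Proof.
rewrite -gexpect_sum => [|c' cc']; last exact: expgrowth_post_err.
apply: le_gexpect => [||z]; first by apply: expgrowth_sum => c'; exact: expgrowth_post_err.
  by apply: expgrowthM; [exact: expgrowth_err_event|exact: expgrowth_pair_lik].
rewrite -mulr_suml ler_wpM2r ?(ltW (pair_lik_gt0 _ _ _ _ _))//.
have [/existsP[c1 /andP[cc1 _]]|/existsPn no_err] := boolP (err_event c z); last first.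
  rewrite big1// => c' cc'; have := no_err c'; rewrite cc' /= => /negbTE->.
  by rewrite mulr0.
have S0 := pair_liks_gt0 x m z cc1.
apply: (@le_trans _ _ (\sum_(c' | e c c') L c c' z / S c z)); last by rewrite -mulr_suml divff// gt_eqF.
apply: ler_sum => c' _; rewrite ler_piMr ?lern1 ?leq_b1//.
by rewrite divr_ge0 ?ltW// pair_lik_gt0.
Qed.

Definition inside t c c' z : R := (`|dot (x c' - x c) z| <= 2 * t * Num.sqrt (hdist c c'))%R%:R.

Lemma expgrowth_inside t c c' : expgrowth (inside t c c').
Proof.
apply: expgrowth_ind; apply: measurable_fun_ler => //; apply: measurableT_comp => //.
exact: measurable_row_dot.
Qed.

Lemma expgrowth_match_inside t c c' : e c c' -> expgrowth (fun z => P c c' c' z * inside t c c' z).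
Proof. by move=> cc'; apply: expgrowthM; [exact: expgrowth_post_path|exact: expgrowth_inside]. Qed.

Lemma expgrowth_outside t c c' : expgrowth (fun z => L c c' z * (1 - inside t c c' z)).
Proof.
apply: expgrowthM; first exact: expgrowth_pair_lik.
by apply: expgrowthB; [exact: expgrowth_cst|exact: expgrowth_inside].
Qed.

Lemma hdist_diff_dot c c' z tau : dot (x c' - x c) (z + tau *: (x c' - x c)) =
  dot (x c' - x c) z + 2 * tau * hdist c c'.
Proof. by rewrite dotDr dotZr -norm2E (norm2_diff x_unit); ring. Qed.

Lemma pair_lik_shift_diff c c' z tau : L c c' (z + tau *: (x c' - x c)) = L c c' z.
Proof.
by rewrite /pair_lik dotZl dotDr dotZr (dotC (x c +
  x c') (x c' - x c)) (dot_diff_sum x_unit) mulr0 addr0 dotZl.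
Qed.

Lemma pair_lik_diag c c' z :
  L c c z = L c c' z * expR (- (m * dot (x c' - x c) z) - m ^+ 2 * hdist c c').
Proof.
rewrite /pair_lik -expRD; congr expR; rewrite !(norm2_sum x_unit) (hdistxx x_unit).
by rewrite !dotZl !dotDl dotNl; field.
Qed.

Lemma pair_liks_shift_le c c' z tau : 0 <= tau ->
  S c (z + tau *: (x c' - x c)) <= expR (3 * m * tau * Num.sqrt (hdist c c')) * S c z.
Proof.
move=> tau0; rewrite /pair_liks mulr_sumr; apply: ler_sum => c'' _.
rewrite /pair_lik -expRD ler_expR dotZl dotDr dotZr !dotZl.
have /andP[p0 _] := hdist_bounds x_unit c c'.
suff dot_le : dot (x c + x c'') (x c' - x c) <= 3 * Num.sqrt (hdist c c').
  have := ler_wpM2l (mulr_ge0 (ltW m_gt0) tau0) dot_le; lra.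
apply: le_trans (ler_norm _) _; rewrite -ler_sqr ?nnegrE ?mulr_ge0 ?sqrtr_ge0//.
rewrite real_normK ?num_real// exprMn sqr_sqrtr//; apply: le_trans (dot_sqr_le _ _) _.
rewrite (norm2_diff x_unit) (norm2_sum x_unit).
by have /andP[? _] := hdist_bounds x_unit c c''; nra.
Qed.

(* The shift by t / sqrt (hdist c c') times x c' - x c moves the window into the error event. *)
Lemma post_err_ge t c c' : 0 < t -> e c c' -> 0 < hdist c c' ->
  expR (- (m ^+ 2 * hdist c c') - 9 * m * t - 3 * t ^+ 2) *
    gexpect (fun z => P c c' c' z * inside t c c' z) <=
  gexpect (fun z => L c c' z / S c z * (0 <= dot (x c' - x c) z)%R%:R * L c c z).
Proof.
move=> t0 cc' p0; have gerr := expgrowth_post_err cc'.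
have [/andP[_ p2] gins] := (hdist_bounds x_unit c c', expgrowth_match_inside t cc').
have p0' := p0; set p := hdist c c' in p0' p2; pose r := Num.sqrt p; pose D := x c' - x c.
have r0 : 0 < r by rewrite sqrtr_gt0.
have r2 : r ^+ 2 = p by rewrite sqr_sqrtr// ltW.
have tau0 : 0 < t / r by rewrite divr_gt0.
rewrite (gexpect_shift_inv ((t / r) *: D) gerr) -(gexpectZ _ gins).
have gexp : expgrowth (fun w => expR (- dot ((t / r) *: D) w - norm2 ((t / r) *: D) / 2)).
  by apply: biexpgrowth_expgrowth; under eq_fun do rewrite -dotNl; exact: biexpgrowth_expR_affine.
apply: le_gexpect => [||z]; first exact: expgrowthZ.
  by apply: expgrowthM gexp; exact: expgrowth_shift gerr.
have S0 v := pair_liks_gt0 x m v cc'; have L0 v := pair_lik_gt0 x m c c' v.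
rewrite /inside -/D -/p -/r; case: (boolP (`|dot D z| <= _)%R) => [|_]; last first.
  rewrite !mulr0; apply: mulr_ge0 (expR_ge0 _); apply: mulr_ge0 (ltW (pair_lik_gt0 _ _ _ _ _)).
  by apply: mulr_ge0 => //; rewrite divr_ge0// ltW.
set u := dot D z; rewrite ler_norml => /andP[u_ge u_le].
rewrite hdist_diff_dot (pair_lik_diag c c') hdist_diff_dot pair_lik_shift_diff -/D -/p -/u.
have -> : 2 * (t / r) * p = 2 * t * r by rewrite -r2; field; rewrite gt_eqF.
have -> : (0 <= u + 2 * t * r) = true by lra.
have S_le := pair_liks_shift_le c c' z (ltW tau0); rewrite -/p -/r -/D in S_le.
have tauE : 3 * m * (t / r) * r = 3 * m * t by field; rewrite gt_eqF.
rewrite tauE in S_le; rewrite dotZl norm2Z /D (norm2_diff x_unit) -/D -/u -/p !mulr1.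
have P_shift (a b : R) : L c c' z / (expR (3 * m * t) * S c z) * (L c c' z * expR a) * expR b =
    expR (- (3 * m * t) + a + b) * P c c' c' z.
  rewrite 2!expRD expRN /post_path /edge_post -/(pair_liks x e m c z).
  by field; rewrite !gt_eqF ?expR_gt0.
set a := - (m * _) - _; set b := - (t / r * u) - _.
apply: (@le_trans _ _ (L c c' z / (expR (3 * m * t) * S c z) * (L c c' z * expR a) * expR b)); last first.
  do 2 (apply: ler_wpM2r; first by rewrite ?mulr_ge0 ?expR_ge0// ltW).
  by rewrite ler_wpM2l ?(ltW (L0 z))// lef_pV2 ?posrE ?mulr_gt0 ?expR_gt0.
rewrite P_shift ler_wpM2r ?(ltW (post_path_gt0 _ _ _ _ cc'))// ler_expR /a /b -/p.
have r_le : r <= 3 / 2 by rewrite -ler_sqr ?nnegrE ?(ltW r0) ?divr_ge0// r2; lra.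
have m_shift : m * (u + 2 * t * r) <= m * (6 * t) by rewrite ler_pM2l//; nra.
have t_shift : t / r * u <= 2 * t ^+ 2.
  have -> : 2 * t ^+ 2 = t / r * (2 * t * r) by field; rewrite gt_eqF.
  by rewrite ler_pM2l.
have -> : (t / r) ^+ 2 * (2 * p) / 2 = t ^+ 2 by rewrite -r2; field; rewrite gt_eqF.
by lra.
Qed.

Lemma gexpect_outside_le t c c' : 0 < t -> 0 < hdist c c' ->
  gexpect (fun z => L c c' z * (1 - inside t c c' z)) <= (2 * t ^+ 2)^-1.
Proof.
move=> t0; set p := hdist c c' => p0; pose D := x c' - x c.
have gL := expgrowth_pair_lik x m c c'.
have gD2 : expgrowth (fun z => dot D z ^+ 2) by apply: expgrowthX; exact: expgrowth_dot.
have r2 : Num.sqrt p ^+ 2 = p by rewrite sqr_sqrtr// ltW.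
have w0 : 0 < 2 * t * Num.sqrt p by rewrite !mulr_gt0 ?sqrtr_gt0.
apply: (@le_trans _ _ (gexpect (fun z => (2 * t * Num.sqrt p) ^- 2 * (dot D z ^+ 2 * L c c' z)))).
  apply: le_gexpect => [||z]; first exact: expgrowth_outside.
    by apply: expgrowthZ; exact: expgrowthM.
  rewrite mulrA [leRHS]mulrC ler_pM2l ?pair_lik_gt0// /inside -/D -/p.
  have [_|D_gt] := leP `|dot D z| (2 * t * Num.sqrt p).
    by rewrite subrr mulr_ge0 ?sqr_ge0// invr_ge0 exprn_ge0// ltW.
  rewrite subr0 ler_pdivlMl ?exprn_gt0// mulr1 -[leRHS]real_normK ?num_real//.
  by rewrite ler_sqr ?nnegrE ?ltW// (lt_trans w0).
rewrite (gexpectZ _ (expgrowthM gD2 gL)) (gexpect_pair_lik_shift x m c c' gD2).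
under eq_gexpect do rewrite dotDr dotZr (dot_diff_sum x_unit) mulr0 addr0.
have := gexpect_dot_sqr_le D; rewrite (norm2_diff x_unit) -/p => D2_le.
apply: le_trans (ler_wpM2l _ D2_le) _; first by rewrite invr_ge0 exprn_ge0// ltW.
by rewrite !exprMn r2 le_eqVlt; apply/orP; left; apply/eqP; field; rewrite !gt_eqF.
Qed.

Hypothesis edge_pos : forall c c', e c c' -> 0 < hdist c c'.

Definition inside_mass t := edge_sum e (fun c c' => gexpect (fun z => P c c' c' z * inside t c c' z)).

Lemma sum_err_prob_ge (A : {set T}) t q : 0 < t -> (forall c c', e c c' -> c \in A) ->
  (forall c c', e c c' -> hdist c c' <= q) ->
  expR (- (m ^+ 2 * q) - 9 * m * t - 3 * t ^+ 2) * inside_mass t <= \sum_(c in A) err_prob c.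
Proof.
move=> t0 edge_in edge_le; rewrite -edge_sumZ /edge_sum [leRHS]big_mkcond.
apply: ler_sum => c _; case: ifPn => [_|cA]; last first.
  by rewrite big_pred0// => c'; apply: contraNF cA; exact: edge_in.
apply: le_trans (sum_post_err_le c); apply: ler_sum => c' cc'.
apply: le_trans (post_err_ge t0 cc' (edge_pos cc')); apply: ler_wpM2r.
  by apply: gexpect_ge0 => z; rewrite mulr_ge0// ltW// post_path_gt0.
by rewrite ler_expR !lerD2r lerN2 ler_wpM2l ?sqr_ge0// edge_le.
Qed.

Lemma inside_mass_ge_match t : 0 < t ->
  match_mass x e m - (2 * t ^+ 2)^-1 * N <= inside_mass t.
Proof.
move=> t0; rewrite -edge_sum_cst -edge_sumB; apply: le_edge_sum => c c' cc'.
have gP := expgrowth_post_path x m c' cc'; have gO := expgrowth_outside t c c'.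
apply: (@le_trans _ _ (gexpect (P c c' c') - gexpect (fun z => L c c' z * (1 - inside t c c' z)))).
  by rewrite lerD2l lerN2 gexpect_outside_le// edge_pos.
rewrite -(gexpectB gP gO).
apply: le_gexpect => [||z]; [exact: expgrowthB|exact: expgrowth_match_inside|].
have P_le : P c c' c' z <= L c c' z.
  rewrite -(sum_post_path x m z cc') (bigD1 c')//= lerDl; apply: sumr_ge0 => c'' _.
  exact/ltW/post_path_gt0.
rewrite /inside; case: (`|_| <= _) => /=; first by rewrite subrr mulr0 subr0 mulr1.
by rewrite subr0 !mulr1 mulr0 subr_le0.
Qed.

Lemma inside_mass_ge_entropy t lam : 0 < t -> 0 <= lam ->
  expR (- lam) * ((1 + lam) * ((1 - (2 * t ^+ 2)^-1) * N) - post_entropy x e m) <= inside_mass t.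
Proof.
move=> t0 lam0; have lam1 : 0 <= 1 + lam by lra.
rewrite -edge_sum_cst -!edge_sumZ -edge_sumB -edge_sumZ; apply: le_edge_sum => c c' cc'.
have gL := expgrowth_pair_lik x m c c'; have gO := expgrowth_outside t c c'.
have gln := expgrowth_ln_post x m cc'; have gLO := expgrowthZ (1 + lam) (expgrowthB gL gO).
apply: (@le_trans _ _ (gexpect (fun z => expR (- lam) *
    ((1 + lam) * (L c c' z - L c c' z * (1 - inside t c c' z)) + ln_post x e m c c' z)))).
  rewrite (gexpectZ _ (expgrowthD gLO gln)) (gexpectD gLO gln) (gexpectZ _ (expgrowthB gL gO)).
  rewrite (gexpectB gL gO) gexpect_pair_lik opprK ler_wpM2l ?expR_ge0// lerD2r ler_wpM2l//.
  by rewrite lerD2l lerN2 gexpect_outside_le// edge_pos.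
apply: le_gexpect => [||z]; first exact: expgrowthZ (expgrowthD gLO gln).
  exact: expgrowth_match_inside.
have L0 := pair_lik_gt0 x m c c' z; have ln0 := ln_post_le0 x m z cc'.
have r0 : 0 < L c c' z / S c z by rewrite divr_gt0// (pair_liks_gt0 _ _ _ cc').
have PE : P c c' c' z = L c c' z * (L c c' z / S c z) by rewrite /post_path /edge_post mulrA.
rewrite /inside; case: (`|_| <= _) => /=; last first.
  by rewrite subr0 mulr1 subrr !mulr0 add0r pmulr_rle0 ?expR_gt0.
rewrite subrr mulr0 subr0 mulr1 PE /ln_post; set r := L c c' z / _ in r0 *.
rewrite [leLHS](_ : _ = L c c' z * (expR (- lam) * (1 + lam + ln r))); last by ring.
rewrite ler_pM2l//; have := expR_ge1Dx (ln r + lam); rewrite expRD lnK ?posrE// => lin_le.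
have := ler_wpM2l (expR_ge0 (- lam)) lin_le.
by rewrite mulrCA -expRD addNr expR0 mulr1; congr (_ * _ <= _); ring.
Qed.

End edge_error.

Section err_prob.
Context {R : realType} {n : nat} {T : finType}.
Variables (x : T -> 'rV[R]_n) (m : R).
Hypothesis m_gt0 : 0 < m.
Hypothesis x_unit : forall c, norm2 (x c) = 1.

Lemma le_err_prob (e e' : rel T) c : subrel e e' -> err_prob x e m c <= err_prob x e' m c.
Proof.
move=> ee'; apply: le_gexpect => [||z].
- by apply: expgrowthM; [exact: expgrowth_err_event|exact: expgrowth_pair_lik].
- by apply: expgrowthM; [exact: expgrowth_err_event|exact: expgrowth_pair_lik].
rewrite ler_wpM2r ?(ltW (pair_lik_gt0 _ _ _ _ _))// ler_nat.
have [/existsP[c' /andP[cc' dot_ge0]]|//] := boolP (err_event x e c z).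
by rewrite lt0b; apply/existsP; exists c'; rewrite ee'.
Qed.

Lemma err_prob_ge_edge (e : rel T) c c' : e c c' -> 0 < hdist x c c' ->
  2^-1 * expR (- (m ^+ 2 * hdist x c c') - 9 * m - 3) <= err_prob x e m c.
Proof.
move=> cc' p0; pose e1 : rel T := [rel a b | (a == c) && (b == c')].
have e1cc' : e1 c c' by rewrite /e1 /= !eqxx.
have e1e : subrel e1 e by move=> a b /andP[/eqP-> /eqP->].
apply: le_trans (le_err_prob c e1e); apply: le_trans (sum_post_err_le x e1 m c).
rewrite (big_pred1 c'); last by move=> b; rewrite /e1 /= eqxx.
have := post_err_ge m_gt0 x_unit ltr01 e1cc' p0; rewrite !mulr1 expr1n mulr1.
apply: le_trans; rewrite mulrC ler_wpM2l ?expR_ge0//.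
have PE z : post_path x e1 m c c' c' z = pair_lik x m c c' z.
  by rewrite -(sum_post_path x m z e1cc') (big_pred1 c')// => b; rewrite /e1 /= eqxx.
have gL := expgrowth_pair_lik x m c c'; have gO := expgrowth_outside x m 1 c c'.
have -> : gexpect (fun z => post_path x e1 m c c' c' z * inside x 1 c c' z) =
    gexpect (pair_lik x m c c') - gexpect (fun z => pair_lik x m c c' z * (1 - inside x 1 c c' z)).
  by rewrite -(gexpectB gL gO); apply: eq_gexpect => z; rewrite PE; ring.
by have := gexpect_outside_le m x_unit ltr01 p0; rewrite gexpect_pair_lik expr1n mulr1; lra.
Qed.

End err_prob.

(** * Lower bound on the error probability of a concentrated graph *)

Definition saddle {R : realType} (b s : R) := [/\ 0 < b, 0 < s, s < 1 & s = b * (1 - s ^+ 2)].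

Lemma div1Dlin_add_le {R : realType} (b u v : R) : 0 < b -> 0 <= u -> 0 <= v ->
  (u + v) / (1 + b * (u + v)) <= u / (1 + b * u) + v.
Proof.
move=> b0 u0 v0; have bu0 : 0 <= b * u by rewrite mulr_ge0// ltW.
have buv0 : 0 <= b * (u + v) by rewrite mulr_ge0 ?addr_ge0// ltW.
have D0 : 0 < 1 + b * u by lra.
have D1 : 0 < 1 + b * (u + v) by lra.
rewrite -subr_ge0.
have -> : u / (1 + b * u) + v - (u + v) / (1 + b * (u + v)) =
   v * ((1 + b * u) * (1 + b * (u + v)) - 1) / ((1 + b * u) * (1 + b * (u + v))).
  by field; rewrite !gt_eqF.
apply: divr_ge0; last by rewrite mulr_ge0// ltW.
by apply: mulr_ge0 => //; have := mulr_ge0 bu0 buv0; lra.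
Qed.

(* At p = 1 - s the estimation error p (2 - p) / (1 + b p (2 - p)) equals p. *)
Lemma estimation_gap {R : realType} (b s p d : R) : saddle b s -> 1 - s <= p <= 2 -> 0 <= d ->
  (p * (2 - p) + 2 * d) / (1 + b * (p * (2 - p) + 2 * d)) <=
  p - p * (p - (1 - s)) / (2 * (1 + b)) + 2 * d.
Proof.
move=> [b0 s0 s1 sE] /andP[p_ge p2] d0; have p0 : 0 <= p by lra.
set B := p * (2 - p); have B0 : 0 <= B by rewrite mulr_ge0//; lra.
have B1 : B <= 1 by rewrite /B; have := sqr_ge0 (p - 1); nra.
have D0 : 0 < 1 + b * B by rewrite ltr_pwDl// mulr_ge0// ltW.
apply: le_trans (div1Dlin_add_le b0 B0 (mulr_ge0 (ler0n _ 2) d0)) _; rewrite lerD2r.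
have s2 : 1 - s ^+ 2 != 0 by rewrite gt_eqF//; nra.
have bE : b = s / (1 - s ^+ 2) by rewrite {1}sE mulfK.
set g := p - (1 - s); have g0 : 0 <= g by rewrite /g; lra.
have -> : B / (1 + b * B) = p - p * (g / (1 + s) + b * (2 - p) * g) / (1 + b * B).
  have pE : B = p * (1 + b * B) - p * (g / (1 + s) + b * (2 - p) * g).
    by rewrite /B /g bE; field; rewrite s2 gt_eqF//; lra.
  by rewrite {1}pE mulrBl mulfK// gt_eqF.
rewrite lerD2l lerN2 ler_pdivrMr ?mulr_gt0//; last lra.
rewrite mulrAC ler_pdivlMr// -!mulrA ler_wpM2l//.
have g_half : g / 2 <= g / (1 + s) by rewrite ler_wpM2l// lef_pV2 ?posrE; lra.
have g_le : g * (1 + b * B) <= g * (1 + b) by rewrite ler_wpM2l// lerD2l ler_piMr// ltW.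
have w0 : 0 <= b * ((2 - p) * g) by rewrite !mulr_ge0//; lra.
apply: le_trans g_le _.
have : g * (1 + b) <= 2 * (g / (1 + s) + b * ((2 - p) * g)) * (1 + b) by rewrite ler_wpM2r; lra.
by lra.
Qed.

Lemma saddle_half {R : realType} (b s : R) : saddle b s ->
  b * (1 - s) = s / (1 + s) /\ 0 < b * (1 - s) <= 2^-1.
Proof.
move=> [b0 s0 s1 sE]; have bE : b * (1 - s) = s / (1 + s).
  by rewrite {2}sE; field; rewrite gt_eqF//; lra.
by split=> //; rewrite bE divr_gt0 ?ler_pdivrMr//; lra.
Qed.

Record tolerances {R : realType} (b Eb pm ep delta rho d : R) : Prop := Tolerances {
  tol_d_gt0 : 0 < d;
  tol_d_delta : d <= delta / 16;
  tol_delta1 : delta <= 1;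
  tol_delta_pm : delta <= pm / 4;
  tol_rho_gt0 : 0 < rho;
  tol_gap : 3 * delta < pm * rho / (4 * (1 + b));
  tol_close : 32 * (d * (b + 2 + 2 * Eb)) <= b * delta ^+ 3;
  tol_total : d * (8 * b + 3 + 2 * Eb) + b * rho + 2 * b * delta <= ep }.

(* The half-width t of the window is chosen so that Chebyshev's bound (2 t^2)^-1 is d. *)
Definition window_width {R : realType} (d : R) := Num.sqrt (2 * d)^-1.

Record long_block {R : realType} (n : nat) (b d : R) (m := Num.sqrt (n%:R * b)) : Prop := LongBlock {
  block_gt0 : (0 < n)%N;
  block_kl : ln 2 + 5 * m <= n%:R * d;
  block_window : 9 * m * window_width d + 3 * window_width d ^+ 2 - ln d <= n%:R * d }.

Record concentrated_graph {R : realType} (n : nat) (T : finType) (x : T -> 'rV[R]_n) (e : rel T)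
    (A : {set T}) (b pm d E p0 : R) : Prop := ConcentratedGraph {
  graph_unit : forall c, norm2 (x c) = 1;
  graph_sym : symmetric e;
  graph_in : forall c c', e c c' -> c \in A;
  graph_dist : forall c c', e c c' -> `|hdist x c c' - p0| <= d;
  graph_far : forall c c', e c c' -> pm <= hdist x c c';
  graph_center : 0 <= p0 <= 2;
  graph_card : (0 < #|A|)%N;
  graph_weight : forall c, c \in A ->
    \sum_(c' in A | c' != c) expR (- (n%:R * b * hdist x c c')) <= expR (- (n%:R * E));
  graph_nedges : #|A|%:R * expR (n%:R * (b * p0 - E - d)) <= nedges e }.

Section graph_bound.
Context {R : realType} {n : nat} {T : finType}.
Variables (x : T -> 'rV[R]_n) (e : rel T) (A : {set T}) (b s Eb pm ep delta rho d E p0 : R).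
Hypothesis bs : saddle b s.
Hypothesis pm_gt0 : 0 < pm.
Hypothesis tol : tolerances b Eb pm ep delta rho d.
Hypothesis block : long_block n b d.
Hypothesis graph : concentrated_graph x e A b pm d E p0.
Hypothesis E_le : `|E| <= Eb.

Local Notation m := (Num.sqrt (n%:R * b)).
Local Notation t := (window_width d).
Local Notation N := (nedges e : R).
Local Notation match_mass := (match_mass x e m).
Local Notation close_mass := (close_mass x e m p0 delta).
Local Notation post_dist := (post_dist x e m).
Local Notation post_entropy := (post_entropy x e m).
Local Notation hdist := (hdist x).

Let n_gt0 := block_gt0 block.
Let n_pos : 0 < n%:R :> R. Proof. by rewrite ltr0n. Qed.
Let b_gt0 : 0 < b. Proof. by case: bs. Qed.
Let d_gt0 := tol_d_gt0 tol.
Let delta_gt0 : 0 < delta. Proof. by have := tol_d_delta tol; have := d_gt0; lra. Qed.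
Let Eb_ge0 : 0 <= Eb. Proof. exact: le_trans (normr_ge0 _) E_le. Qed.
Let m_gt0 : 0 < m. Proof. by rewrite sqrtr_gt0 mulr_gt0. Qed.
Let m_sqr : m ^+ 2 = n%:R * b. Proof. by rewrite sqr_sqrtr// mulr_ge0// ltW. Qed.
Let x_unit := graph_unit graph.
Let cardA_gt0 : 0 < #|A|%:R :> R. Proof. by rewrite ltr0n (graph_card graph). Qed.

Let window_gt0 : 0 < t. Proof. by rewrite sqrtr_gt0 invr_gt0 mulr_gt0. Qed.

Let windowE : (2 * t ^+ 2)^-1 = d.
Proof. by rewrite sqr_sqrtr ?invr_ge0 ?mulr_ge0 ?ltW//; field; rewrite gt_eqF. Qed.

Let edge_pos c c' : e c c' -> 0 < hdist c c'.
Proof. by move=> /(graph_far graph); exact: lt_le_trans. Qed.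

Lemma graph_nedges_gt0 : 0 < N.
Proof. by apply: lt_le_trans (graph_nedges graph); rewrite mulr_gt0 ?expR_gt0. Qed.

Lemma ln_graph_nedges : ln #|A|%:R + n%:R * (b * p0 - E - d) <= ln N.
Proof.
rewrite -[X in _ + X]expRK -lnM ?posrE ?expR_gt0// ler_ln ?posrE ?graph_nedges_gt0//.
  exact: graph_nedges graph.
by rewrite mulr_gt0 ?expR_gt0.
Qed.

Lemma graph_center_ge : pm / 2 <= p0.
Proof.
have [[c c'] /= cc'|no_edge] := pickP (fun cc : T * T => e cc.1 cc.2).
  have := graph_dist graph cc'; have := graph_far graph cc'; rewrite ler_norml.
  by have := tol_d_delta tol; have := tol_delta_pm tol; have := delta_gt0; have := pm_gt0; lra.
have := graph_nedges_gt0; rewrite /nedges /edge_sum big1 ?ltxx// => c _.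
by rewrite big_pred0// => c'; exact: (no_edge (c, c')).
Qed.

Lemma degree_le c : degree e c <= expR (n%:R * (b * (p0 + d) - E)).
Proof.
have [c0 cc0|no_edge] := pickP (e c); last by rewrite -degreeE big_pred0// expR_ge0.
have cA := graph_in graph cc0.
apply: (@le_trans _ _ (\sum_(c' in A | c' != c)
    expR (- (n%:R * b * hdist c c')) * expR (n%:R * b * (p0 + d)))).
  rewrite -degreeE [leLHS]big_mkcond [leRHS]big_mkcond; apply: ler_sum => c' _.
  case: ifPn => cc'; last by case: ifP => // _; rewrite mulr_ge0 ?expR_ge0.
  have -> : c' \in A by apply: (graph_in graph (c' := c)); rewrite (graph_sym graph).
  have -> : c' != c by apply: contraTneq (edge_pos cc') => ->; rewrite (hdistxx x_unit) ltxx.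
  rewrite /= -expRD -[leLHS]expR0 ler_expR addrC -mulrBr mulr_ge0 ?mulr_ge0 ?(ltW b_gt0)//.
  by have := graph_dist graph cc'; rewrite ler_norml; lra.
rewrite -mulr_suml; apply: le_trans (ler_wpM2r (expR_ge0 _) (graph_weight graph cA)) _.
by rewrite -expRD ler_expR le_eqVlt; apply/orP; left; apply/eqP; ring.
Qed.

Lemma few_close_paths : match_mass <= 2 * d * N -> close_mass <= delta / 8 * N.
Proof.
move=> few_match; have N0 := graph_nedges_gt0; have lnN := ln_graph_nedges.
have delta_bounds : 0 < delta <= 1 by rewrite delta_gt0 (tol_delta1 tol).
have d_le : d <= delta / 4 by have := tol_d_delta tol; have := delta_gt0; lra.
have weight_le c : c \in A ->
    \sum_(c' in A | c' != c) expR (- (m ^+ 2 * hdist c c')) <= expR (- (n%:R * E)).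
  by move=> cA; have := graph_weight graph cA; rewrite m_sqr.
have := close_mass_le m_gt0 x_unit (graph_sym graph) (graph_in graph) (graph_dist graph)
  weight_le N0 delta_bounds d_le.
rewrite lnM ?posrE// m_sqr => SC_le.
have E_match : n%:R * E * match_mass <= n%:R * (2 * Eb * d) * N.
  rewrite -!(mulrA n%:R) ler_pM2l//; apply: (@le_trans _ _ (Eb * match_mass)).
    by rewrite ler_wpM2r ?match_mass_ge0// (le_trans (ler_norm _)).
  by have := ler_wpM2l Eb_ge0 few_match; congr (_ <= _); ring.
have ln_le : ln 2 + ln #|A|%:R - n%:R * E + n%:R * b * (p0 + d) - ln N + 5 * m <=
    n%:R * (d * (b + 2)) by have := block_kl block; lra.
have := ler_wpM2l (ltW N0) ln_le => N_ln_le.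
have k0 : 0 < n%:R * b * (delta ^+ 2 / 4) by rewrite !mulr_gt0// exprn_gt0.
rewrite -(ler_pM2l k0).
have := ler_wpM2l (ltW (mulr_gt0 n_pos N0)) (tol_close tol).
move: SC_le E_match N_ln_le; move: close_mass match_mass (ln _) (ln _) (ln _) => *.
by lra.
Qed.

Lemma graph_post_dist_ge : match_mass <= 2 * d * N -> (p0 - 2 * delta) * N <= post_dist.
Proof.
move=> few_match; have few_close := few_close_paths few_match; have N0 := graph_nedges_gt0.
have [d_le dpm p_ge] := And3 (tol_d_delta tol) (tol_delta_pm tol) graph_center_ge.
have /andP[_ p0_le2] := graph_center graph.
have p_delta : 0 <= p0 - delta by have := pm_gt0; lra.
apply: le_trans (post_dist_ge e m x_unit p_delta).
have lost_le : match_mass + close_mass <= delta / 4 * N.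
  have : 2 * d * N <= delta / 8 * N by rewrite ler_pM2r//; lra.
  by lra.
have := ler_wpM2l p_delta lost_le.
have : (p0 - delta) * (delta / 4 * N) <= 2 * (delta / 4 * N).
  by rewrite ler_wpM2r ?mulr_ge0 ?divr_ge0 ?ltW//; have := delta_gt0; lra.
by have := mulr_gt0 delta_gt0 N0; lra.
Qed.

Lemma graph_center_le : match_mass <= 2 * d * N -> p0 <= 1 - s + rho.
Proof.
move=> /graph_post_dist_ge U_ge; have N0 := graph_nedges_gt0; rewrite leNgt; apply/negP => p_gt.
have [rho0 pm0 p_ge] := And3 (tol_rho_gt0 tol) pm_gt0 graph_center_ge.
have /andP[p0_ge0 p0_le2] := graph_center graph.
have ps : 1 - s <= p0 <= 2 by apply/andP; split; lra.
have U_le := post_dist_le m_gt0 x_unit n_gt0 b_gt0 m_sqr (graph_center graph) (ltW d_gt0) (graph_dist graph).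
have := le_trans U_ge U_le; rewrite mulrC ler_pM2l// => gap.
have := le_trans gap (estimation_gap bs ps (ltW d_gt0)).
have : pm * rho / (4 * (1 + b)) <= p0 * (p0 - (1 - s)) / (2 * (1 + b)).
  have b1 : 0 < 1 + b by have := b_gt0; lra.
  have -> : pm * rho / (4 * (1 + b)) = pm / 2 * rho / (2 * (1 + b)) by field; rewrite gt_eqF.
  rewrite ler_pM2r ?invr_gt0 ?mulr_gt0//.
  by apply: ler_pM; lra.
by have := tol_gap tol; have := tol_d_delta tol; have := delta_gt0; lra.
Qed.

Let M := Num.max E (b * (1 - s) + ln (1 - b * (1 - s)) / 2).

Let K_le r := post_entropy_le (q := r) m_gt0 x_unit n_gt0 m_sqr (expR_gt0 _) degree_le.

Lemma graph_entropy_crude : post_entropy <= N * (n%:R * (3 * b + Eb)).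
Proof.
have N0 := graph_nedges_gt0; have b00 : 0 < 1 - b * 0 by rewrite mulr0 subr0.
have := K_le b00; rewrite expRK mulr0 subr0 ln1 mul0r addr0 mulr0 addr0 divr1 => K_le0.
have U0 := post_dist_ge0 e m x_unit.
have nbU : 0 <= n%:R / 2 * b * post_dist.
  by apply: mulr_ge0 U0; apply: mulr_ge0 (ltW b_gt0); rewrite divr_ge0.
apply: (@le_trans _ _ (N * (n%:R * (b * (p0 + d) - E)))); first by lra.
rewrite ler_pM2l// ler_pM2l//; have : b * (p0 + d) <= b * 3.
  have /andP[_ ?] := graph_center graph; rewrite ler_pM2l//.
  by have := tol_d_delta tol; have := tol_delta1 tol; lra.
by have := ler_norm (- E); rewrite normrN; have := E_le; lra.
Qed.

Lemma graph_entropy_fine : match_mass <= 2 * d * N ->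
  post_entropy <= N * (n%:R * (M - E + b * d + b * rho + 2 * b * delta)).
Proof.
move=> few_match; have N0 := graph_nedges_gt0.
have U_ge := graph_post_dist_ge few_match; have p_le := graph_center_le few_match.
have [_ /andP[q0 q_half]] := saddle_half bs; set q := 1 - s in q0 q_half p_le.
have bq : 0 < 1 - b * q by lra.
have := K_le bq; rewrite expRK; pose v := post_dist / N.
have -> : post_dist = N * v by rewrite /v [RHS]mulrC divfK// gt_eqF.
have v_ge : p0 - 2 * delta <= v by rewrite ler_pdivlMr.
pose be := b / (2 * (1 - b * q)).
have be0 : 0 <= be by rewrite divr_ge0 ?mulr_ge0 ?ltW.
have be_le : be <= b by rewrite ler_pdivrMr ?mulr_gt0// ler_peMr ?(ltW b_gt0)//; lra.
have -> : N * (n%:R * (b * (p0 + d) - E) + n%:R / 2 * (ln (1 - b * q) + b * q / (1 - b * q)))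
    - n%:R / 2 * (b / (1 - b * q)) * (N * v) =
    N * (n%:R * (b * (p0 + d) - E + ln (1 - b * q) / 2 - be * (v - q))).
  by rewrite /be; field; rewrite gt_eqF.
move=> /le_trans; apply; rewrite ler_pM2l// ler_pM2l//.
have : b * q + ln (1 - b * q) / 2 <= M by rewrite /M le_max lexx orbT.
have : be * (p0 - 2 * delta - q) <= be * (v - q) by rewrite ler_wpM2l//; lra.
have : (b - be) * (p0 - q) <= b * rho.
  apply: (@le_trans _ _ ((b - be) * rho)); first by rewrite ler_wpM2l//; lra.
  by rewrite ler_pM2r ?(tol_rho_gt0 tol)//; lra.
have : be * delta <= b * delta by rewrite ler_pM2r.
by lra.
Qed.

Lemma graph_entropy_le : match_mass <= 2 * d * N ->
  n%:R * E + post_entropy / N / (1 - d) <= n%:R * (M + ep - d * (b + 2)).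
Proof.
move=> few_match; have N0 := graph_nedges_gt0.
have := graph_entropy_fine few_match; have := graph_entropy_crude; pose k := post_entropy / N.
have -> : post_entropy = N * k by rewrite /k [RHS]mulrC divfK// gt_eqF.
have k0 : 0 <= k by rewrite divr_ge0 ?post_entropy_ge0// ltW.
rewrite [N * k / N]mulrAC mulfV ?gt_eqF// mul1r !ler_pM2l// => k_crude k_fine.
have d_small : d <= 4^-1 by have := tol_d_delta tol; have := tol_delta1 tol; lra.
have k_div : k / (1 - d) <= k + 2 * d * k.
  rewrite ler_pdivrMr; last by lra.
  have : 0 <= k * d * (1 - 2 * d) by apply: mulr_ge0; [exact: mulr_ge0 k0 (ltW d_gt0)|lra].
  by lra.
have := ler_wpM2l (ltW n_pos) (tol_total tol).
have := ler_wpM2l (ltW d_gt0) k_crude; have := mulr_gt0 n_pos d_gt0.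
by lra.
Qed.

Lemma sum_err_prob_ge_inside lam : 0 <= lam ->
  d * N * expR (- lam) <= inside_mass x e m t ->
  n%:R * E + lam <= n%:R * (M + ep - d * (b + 2)) ->
  #|A|%:R * expR (- (n%:R * (M + ep))) <= \sum_(c in A) err_prob x e m c.
Proof.
move=> lam0 inside_ge lam_le.
have edge_le c c' : e c c' -> hdist c c' <= p0 + d.
  by move=> /(graph_dist graph); rewrite ler_norml; lra.
apply: le_trans (sum_err_prob_ge m_gt0 x_unit edge_pos window_gt0 (graph_in graph) edge_le).
apply: le_trans (ler_wpM2l (expR_ge0 _) inside_ge).
apply: (@le_trans _ _ (expR (- (m ^+ 2 * (p0 + d)) - 9 * m * t - 3 * t ^+ 2) *
    (d * (#|A|%:R * expR (n%:R * (b * p0 - E - d))) * expR (- lam)))); last first.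
  rewrite ler_wpM2l ?expR_ge0// ler_wpM2r ?expR_ge0// ler_wpM2l ?(ltW d_gt0)//.
  exact: graph_nedges graph.
have -> : expR (- (m ^+ 2 * (p0 + d)) - 9 * m * t - 3 * t ^+ 2) *
    (d * (#|A|%:R * expR (n%:R * (b * p0 - E - d))) * expR (- lam)) =
    #|A|%:R * expR (- (m ^+ 2 * (p0 + d)) - 9 * m * t - 3 * t ^+ 2 + n%:R * (b * p0 - E - d)
      + ln d - lam).
  by rewrite [in RHS]expRD [expR (_ + ln d)]expRD [expR (_ + n%:R * _)]expRD lnK ?posrE//; ring.
rewrite ler_pM2l// ler_expR m_sqr; have := block_window block.
by lra.
Qed.

Lemma graph_bound : #|A|%:R * expR (- (n%:R * (M + ep))) <= \sum_(c in A) err_prob x e m c.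
Proof.
have N0 := graph_nedges_gt0.
have [few_match|many_match] := leP match_mass (2 * d * N); last first.
  apply: (@sum_err_prob_ge_inside 0) => //.
    by have := inside_mass_ge_match m x_unit edge_pos window_gt0; rewrite windowE oppr0 expR0; lra.
  rewrite addr0 ler_pM2l//; have : E <= M by rewrite le_max lexx.
  have := mulr_gt0 b_gt0 d_gt0; have := mulr_gt0 b_gt0 (tol_rho_gt0 tol).
  have := mulr_gt0 b_gt0 delta_gt0; have := mulr_ge0 Eb_ge0 (ltW d_gt0).
  by have := tol_total tol; have := d_gt0; lra.
have d1 : 0 < 1 - d by have := tol_d_delta tol; have := tol_delta1 tol; lra.
set K := post_entropy; pose lam := K / N / (1 - d).
have lam0 : 0 <= lam by rewrite !divr_ge0 ?post_entropy_ge0// ltW.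
apply: (sum_err_prob_ge_inside lam0 _ (graph_entropy_le few_match)).
apply: le_trans (inside_mass_ge_entropy m x_unit edge_pos window_gt0 lam0); rewrite windowE.
have -> : (1 + lam) * ((1 - d) * N) - K = (1 - d) * N by rewrite /lam; field; rewrite !gt_eqF.
rewrite mulrC ler_wpM2l ?expR_ge0// ler_pM2r//.
by have := tol_d_delta tol; have := tol_delta1 tol; lra.
Qed.

End graph_bound.

Section asymptotics.
Context {R : realType}.

Lemma near_le_linear (K d : R) : 0 < d -> \forall n \near \oo, K <= n%:R * d.
Proof.
move=> d0; near=> n; rewrite -ler_pdivrMr//; near: n; exact: nbhs_infty_ger.
Unshelve. all: end_near. Qed.

Lemma near_sqrt_le_linear (b C K d : R) : 0 <= b -> 0 <= C -> 0 < d ->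
  \forall n \near \oo, K + C * Num.sqrt (n%:R * b) <= n%:R * d.
Proof.
move=> b0 C0 d0; have d2 : 0 < d / 2 by rewrite divr_gt0.
near=> n; have K_le : K <= n%:R * (d / 2) by near: n; exact: near_le_linear.
have C_le : 4 * C ^+ 2 * b <= n%:R * d ^+ 2 by near: n; apply: near_le_linear; rewrite exprn_gt0.
suff : C * Num.sqrt (n%:R * b) <= n%:R * (d / 2) by lra.
rewrite -ler_sqr ?nnegrE; last 2 first.
- by rewrite mulr_ge0 ?sqrtr_ge0.
- by rewrite mulr_ge0// ltW.
rewrite exprMn sqr_sqrtr ?mulr_ge0//.
by have := ler_wpM2l (ler0n R n) C_le; lra.
Unshelve. all: end_near. Qed.

Lemma exists_tolerances (b Eb pm ep : R) : 0 < b -> 0 <= Eb -> 0 < pm -> 0 < ep ->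
  exists delta rho d, tolerances b Eb pm ep delta rho d.
Proof.
move=> b0 Eb0 pm0 ep0; pose rho := ep / (4 * b); have rho0 : 0 < rho by rewrite divr_gt0// mulr_gt0.
have b1 : 0 < 1 + b by lra.
have gap0 : 0 < pm * rho / (16 * (1 + b)) by rewrite divr_gt0// mulr_gt0.
pose delta := Num.min (Num.min 1 (pm / 4)) (Num.min (pm * rho / (16 * (1 + b))) (ep / (8 * b))).
have delta0 : 0 < delta by rewrite !lt_min ltr01 gap0 !divr_gt0// mulr_gt0.
have delta1 : delta <= 1 by rewrite !ge_min lexx.
have delta_pm : delta <= pm / 4 by rewrite !ge_min lexx orbT.
have delta_gap : delta <= pm * rho / (16 * (1 + b)) by rewrite !ge_min lexx !orbT.
have delta_ep : delta <= ep / (8 * b) by rewrite !ge_min lexx !orbT.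
clearbody delta.
have C0 : 0 < 32 * (b + 2 + 2 * Eb) by lra.
have D0 : 0 < 2 * (8 * b + 3 + 2 * Eb) by lra.
pose d := Num.min (delta / 16) (Num.min (b * delta ^+ 3 / (32 * (b + 2 + 2 * Eb)))
  (ep / (2 * (8 * b + 3 + 2 * Eb)))).
have d0 : 0 < d by rewrite !lt_min !divr_gt0// mulr_gt0 ?exprn_gt0.
have d_delta : d <= delta / 16 by rewrite !ge_min lexx.
have d_close : d <= b * delta ^+ 3 / (32 * (b + 2 + 2 * Eb)) by rewrite !ge_min lexx !orbT.
have d_ep : d <= ep / (2 * (8 * b + 3 + 2 * Eb)) by rewrite !ge_min lexx !orbT.
exists delta, rho, d; split=> //.
- have -> : pm * rho / (4 * (1 + b)) = 4 * (pm * rho / (16 * (1 + b))) by field; rewrite gt_eqF.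
  by lra.
- by move: d_close; rewrite ler_pdivlMr//; lra.
move: d_ep delta_ep; rewrite (ler_pdivlMr _ _ D0) ler_pdivlMr ?mulr_gt0// => d_ep delta_ep.
have -> : b * rho = ep / 4 by rewrite /rho; field; rewrite gt_eqF.
by lra.
Qed.

Lemma near_long_block (b d : R) : 0 < b -> 0 < d -> \forall n \near \oo, long_block n b d.
Proof.
move=> b0 d0; have w0 : 0 <= 9 * window_width d by rewrite mulr_ge0// sqrtr_ge0.
near=> n; split.
- by near: n; exact: nbhs_infty_gt.
- by near: n; exact: near_sqrt_le_linear (ltW b0) (ler0n _ 5) d0.
have -> : 9 * Num.sqrt (n%:R * b) * window_width d + 3 * window_width d ^+ 2 - ln d =
    3 * window_width d ^+ 2 - ln d + 9 * window_width d * Num.sqrt (n%:R * b) by ring.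
by near: n; exact: near_sqrt_le_linear (ltW b0) w0 d0.
Unshelve. all: end_near. Qed.

Lemma near_graph_bound (b s Eb pm ep : R) : saddle b s -> 0 <= Eb -> 0 < pm -> 0 < ep ->
  exists2 d, 0 < d <= 1 & \forall n \near \oo,
  forall (T : finType) (x : T -> 'rV[R]_n) (e : rel T) (A : {set T}) (E p0 : R),
  concentrated_graph x e A b pm d E p0 -> `|E| <= Eb ->
  #|A|%:R * expR (- (n%:R * (Num.max E (b * (1 - s) + ln (1 - b * (1 - s)) / 2) + ep))) <=
  \sum_(c in A) err_prob x e (Num.sqrt (n%:R * b)) c.
Proof.
move=> bs Eb0 pm0 ep0; have [b0 _ _ _] := bs.
have [delta [rho [d tol]]] := exists_tolerances b0 Eb0 pm0 ep0.
have d0 := tol_d_gt0 tol; exists d.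
  by rewrite d0; have := tol_d_delta tol; have := tol_delta1 tol; lra.
near=> n => T x e A E p0 graph E_le; apply: (graph_bound bs pm0 tol _ graph E_le).
by near: n; exact: near_long_block.
Unshelve. all: end_near. Qed.

End asymptotics.

(** * Regular subsets of a code *)

Section regular_subset.
Context {R : realType} {T : finType}.
Implicit Types (A B : {set T}).

Lemma half_card_le_double_mean A (F : T -> R) w : (forall c, 0 <= F c) -> 0 < w ->
  \sum_(c in A) F c <= #|A|%:R * w ->
  #|A|%:R / 2 <= #|[set c in A | F c <= 2 * w]%SET|%:R :> R.
Proof.
move=> F0 w0 sum_le; set A1 := [set c in A | _]%SET.
have A1A : A1 \subset A by apply/fintype.subsetP => c; rewrite inE => /andP[].
have : #|A :\: A1|%:R * (2 * w) <= #|A|%:R * w.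
  apply: le_trans sum_le; rewrite -sum1_card natr_sum mulr_suml.
  apply: (@le_trans _ _ (\sum_(c in A :\: A1) F c)); last first.
    by rewrite [leRHS](big_setID A1)/= lerDr; apply: sumr_ge0.
  by apply: ler_sum => c; rewrite !inE mul1r => /andP[+ cA]; rewrite cA/= -ltNge => /ltW.
rewrite mulrA ler_pM2r// => few_heavy; have := cardsID A1 A.
by rewrite (finset.setIidPr A1A) => /(congr1 (fun k => k%:R : R)); rewrite natrD; lra.
Qed.

Lemma exists_subset_card B k : (k <= #|B|)%N -> exists2 A : {set T}, A \subset B & #|A| = k.
Proof.
move=> kB; exists [set c in take k (enum B)]%SET.
  by apply/fintype.subsetP => c; rewrite inE => /mem_take; rewrite mem_enum.
rewrite cardsE (card_uniqP _) ?take_uniq ?enum_uniq// size_take -cardE.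
by case: ltnP => // Bk; apply/eqP; rewrite eqn_leq Bk kB.
Qed.

Lemma exists_subset_card_near B (y : R) : 0 <= y -> y / 2 <= #|B|%:R ->
  exists2 A : {set T}, A \subset B & y / 2 <= #|A|%:R <= y + 1.
Proof.
move=> y0 yB; pose k := minn #|B| (Num.truncn y).+1.
have [A AB cardA] := exists_subset_card (geq_minl #|B| (Num.truncn y).+1).
exists A => //; rewrite cardA; apply/andP; split.
  by rewrite /minn; case: ltnP => // _; have := truncnS_gt y; lra.
apply: (@le_trans _ _ (Num.truncn y).+1%:R); first by rewrite ler_nat geq_minr.
by rewrite -natr1 lerD2r; have := truncn_le y; rewrite y0.
Qed.

Variable f : T -> T -> R.
Hypothesis f_ge0 : forall c c', 0 <= f c c'.

Definition weight A c := \sum_(c' in A | c' != c) f c c'.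
Definition total_weight A := \sum_(c in A) weight A c.

Lemma weight_ge0 A c : 0 <= weight A c. Proof. exact: sumr_ge0. Qed.

Lemma le_weight A B c : A \subset B -> weight A c <= weight B c.
Proof.
move=> /fintype.subsetP AB; rewrite /weight [leLHS]big_mkcond [leRHS]big_mkcond.
apply: ler_sum => c' _; case: (boolP (c' \in A)) => [/AB->//|_] /=; by case: ifP.
Qed.

Lemma total_weight_le_sqr A : (forall c c', f c c' <= 1) -> total_weight A <= #|A|%:R * #|A|%:R.
Proof.
move=> f_le1; rewrite -{1}sum1_card natr_sum mulr_suml; apply: ler_sum => c _; rewrite mul1r.
rewrite -sum1_card natr_sum /weight big_mkcondr; apply: ler_sum => c' _.
by case: ifP.
Qed.

Definition regular_set (W g : R) A :=
  (forall c, c \in A -> weight A c <= 2 * W) /\ #|A|%:R * W / g <= total_weight A.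

Lemma exists_light_half A (W := total_weight A / #|A|%:R) : 0 < #|A|%:R :> R -> 0 < W ->
  exists A1 : {set T}, [/\ A1 \subset A, #|A|%:R / 2 <= #|A1|%:R :> R &
    forall c, c \in A1 -> weight A1 c <= 2 * W].
Proof.
move=> A0 W0; exists [set c in A | weight A c <= 2 * W]%SET.
have A1A : [set c in A | weight A c <= 2 * W]%SET \subset A.
  by apply/fintype.subsetP => c; rewrite inE => /andP[].
split=> // [|c cA1]; last by apply: le_trans (le_weight c A1A) _; move: cA1; rewrite inE => /andP[].
apply: half_card_le_double_mean => // [c|]; first exact: weight_ge0.
by rewrite /W mulrC divfK// gt_eqF.
Qed.

(* The light half of A is regular unless its mean weight is smaller than that of A by a factor g,
   which cannot happen j times. *)
Lemma exists_regular_subset (X w0 g : R) : 0 < X -> 0 < w0 -> 1 <= g ->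
  (forall A, X <= #|A|%:R -> #|A|%:R * w0 <= total_weight A) ->
  forall j A, 2 ^+ j * X <= #|A|%:R -> total_weight A < #|A|%:R * w0 * g ^+ j ->
  exists A' W, [/\ A' \subset A, X <= #|A'|%:R, w0 <= W <= w0 * g ^+ j & regular_set W g A'].
Proof.
move=> X0 w0_gt0 g1 total_ge; have g0 : 0 < g by lra.
elim=> [|j ih] A cardA total_lt.
  rewrite expr0 mul1r in cardA; move: total_lt; rewrite expr0 mulr1.
  by move=> /(le_lt_trans (total_ge _ cardA)); rewrite ltxx.
have XA : X <= #|A|%:R.
  by apply: le_trans cardA; rewrite ler_peMl ?(ltW X0)// exprn_ege1// ler1n.
have A0 : 0 < #|A|%:R :> R by exact: lt_le_trans XA.
pose W := total_weight A / #|A|%:R.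
have totalE : total_weight A = #|A|%:R * W by rewrite /W mulrC divfK// gt_eqF.
have w0W : w0 <= W by rewrite -(ler_pM2l A0) -totalE total_ge.
have W0 : 0 < W by exact: lt_le_trans w0W.
have Wg : W < w0 * g ^+ j.+1 by rewrite -(ltr_pM2l A0) -totalE mulrA.
have [A1 [A1A cardA1 light]] := exists_light_half A0 W0.
have card_A1 : 2 ^+ j * X <= #|A1|%:R.
  by apply: le_trans cardA1; rewrite ler_pdivlMr// mulrAC -exprSr.
have XA1 : X <= #|A1|%:R.
  by apply: le_trans card_A1; rewrite ler_peMl ?(ltW X0)// exprn_ege1// ler1n.
have [reg|irreg] := leP (#|A1|%:R * W / g) (total_weight A1).
  by exists A1, W; rewrite w0W (ltW Wg).
have [|A' [W' [A'A1 XA' /andP[w0W' W'g] reg]]] := ih A1 card_A1.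
  apply: (lt_le_trans irreg); have A1_gt0 := lt_le_trans X0 XA1.
  by rewrite -(mulrA _ W) -(mulrA _ w0) (ler_pM2l A1_gt0) (ler_pdivrMr _ _ g0) -mulrA -exprSr ltW.
exists A', W'; split=> //; first exact: fintype.subset_trans A'A1 A1A.
by rewrite w0W'/= (le_trans W'g)// ler_pM2l// ler_weXn2l// leqnSn.
Qed.

End regular_subset.

(** * The converse bound *)

Section converse.
Context {R : realType}.

Definition many_close_pairs (b s R1 Rx : R) : Prop :=
  forall ep, 0 < ep -> exists2 eta, 0 < eta & \forall n \near \oo,
  forall (T : finType) (x : T -> 'rV[R]_n) (A : {set T}),
  (forall c, norm2 (x c) = 1) -> expR (n%:R * (R1 - eta)) <= #|A|%:R ->
  #|A|%:R ^+ 2 * expR (- (n%:R * (b * (1 - s) + Rx + ep))) <=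
  total_weight (fun c c' => expR (- (n%:R * b * hdist x c c'))) A.

Lemma exists_ge_mean (I : finType) (f : I -> R) (t : R) : (0 < #|I|)%N -> t <= \sum_i f i ->
  exists i, t / #|I|%:R <= f i.
Proof.
move=> I0 t_le; have [i _] : exists i : I, i \in I by apply/card_gt0P.
apply: contrapT => /forallNP f_lt; move: t_le; apply/negP; rewrite -ltNge.
have -> : t = \sum_(i : I) t / #|I|%:R.
  by rewrite sumr_const -[_ *+ _]mulr_natr divfK// pnatr_eq0 -lt0n.
by apply: ltr_sum => // [|k _]; [apply/hasP; exists i; rewrite ?mem_index_enum|rewrite ltNge; apply/negP].
Qed.

(* The pairs are sorted by distance into windows of width d. *)
Lemma exists_distance_window (n : nat) (T : finType) (x : T -> 'rV[R]_n) (b d tot : R) (A : {set T}) :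
  0 < b -> 0 < d -> (forall c, norm2 (x c) = 1) -> 0 < tot ->
  tot <= total_weight (fun c c' => expR (- (n%:R * b * hdist x c c'))) A ->
  exists (e : rel T) (p0 : R), [/\ symmetric e,
    (forall c c', e c c' -> [/\ c \in A, c' \in A & c' != c]),
    (forall c c', e c c' -> `|hdist x c c' - p0| <= d), 0 <= p0 <= 2 &
    tot / (Num.truncn (2 / d)).+1%:R <= nedges e * expR (- (n%:R * b * p0))].
Proof.
move=> b0 d0 x1 tot0 tot_le; pose K := (Num.truncn (2 / d)).+1.
pose ix c c' := Num.truncn (hdist x c c' / d).
pose e (k : 'I_K) c c' := [&& c \in A, c' \in A, c' != c & ix c c' == k].
have hb c c' := hdist_bounds x1 c c'.
have ixK c c' : (ix c c' < K)%N.
  by rewrite ltnS /ix; apply: le_truncn; rewrite ler_pM2r ?invr_gt0//; have /andP[] := hb c c'.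
have ixb c c' : (ix c c')%:R * d <= hdist x c c' < (ix c c').+1%:R * d.
  rewrite -ler_pdivlMr// -ltr_pdivrMr//; apply: truncn_itv.
  by apply: divr_ge0; [have /andP[] := hb c c'|exact: ltW].
pose w c c' := expR (- (n%:R * b * hdist x c c')).
have totalE : total_weight w A = \sum_(k < K) edge_sum (e k) w.
  rewrite /total_weight [LHS]big_mkcond exchange_big; apply: eq_bigr => c _ /=.
  case: ifPn => cA; last first.
    by rewrite big1// => k _; rewrite big_pred0// => c'; rewrite /e (negbTE cA).
  rewrite [LHS](partition_big (fun c' => Ordinal (ixK c c')) xpredT)//=.
  by apply: eq_bigr => k _; apply: eq_bigl => c'; rewrite /e cA/= -andbA.
have K0 : (0 < #|'I_K|)%N by rewrite card_ord.
rewrite -/w totalE in tot_le; have [k] := exists_ge_mean K0 tot_le; rewrite card_ord => k_ge.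
have [c [c' /and4P[_ _ _ /eqP ixk]]] : exists c c', e k c c'.
  apply: contrapT => /forallNP no_edge; move: k_ge; apply/negP; rewrite -ltNge.
  rewrite /edge_sum big1 ?divr_gt0 ?ltr0n// => c _; rewrite big_pred0// => c'.
  by apply/negP => cc'; apply: (no_edge c); exists c'.
exists (e k), (k%:R * d); split.
- by move=> a a'; rewrite /e /ix hdistC eq_sym; case: (a \in A); case: (a' \in A).
- by move=> a a' /and4P[].
- move=> a a' /and4P[_ _ _ /eqP ak]; have := ixb a a'; rewrite ak -natr1 mulrDl mul1r ler_norml.
  by move=> /andP[lo hi]; lra.
- have := ixb c c'; rewrite ixk => /andP[lo _]; rewrite mulr_ge0 ?(ltW d0)//=.
  by have /andP[_] := hb c c'; lra.
apply: le_trans k_ge _; rewrite mulrC -edge_sum_cst; apply: le_edge_sum => a a' /and4P[_ _ _ /eqP ak].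
rewrite ler_expR lerN2; have := ixb a a'; rewrite ak => /andP[lo _].
by rewrite ler_wpM2l// mulr_ge0// ltW.
Qed.

Lemma pow2E k : 2 ^+ k = expR (k%:R * ln 2) :> R.
Proof. by rewrite expRM_natl lnK ?posrE. Qed.

Lemma regular_exponent_bounds (n J : nat) (Q Rt ep ep' a W : R) (w0 := a / 2 ^+
  J * expR (- (n%:R * (Q + ep)))) :
  (0 < n)%N -> 0 < ep <= 1 -> 0 < ep' <= 1 -> J%:R * ep' <= `|Q| + ep + 1 + ep' ->
  J.+1%:R * ln 2 <= n%:R * ep ->
  expR (n%:R * Rt) / 2 <= a <= expR (n%:R * (`|Rt| + 1)) ->
  w0 <= W <= w0 * expR (n%:R * ep') ^+ J ->
  - ln (2 * W) / n%:R <= Q - Rt + 2 * ep /\ `|- ln (2 * W) / n%:R| <= `|Rt| + 2 * `|Q| + 4.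
Proof.
move=> n0 /andP[ep0 ep1] /andP[ep'0 ep'1] J_le J_ln /andP[a_ge a_le] /andP[W_ge W_le].
have n_gt0 : 0 < n%:R :> R by rewrite ltr0n.
have a0 : 0 < a by apply: lt_le_trans a_ge; rewrite divr_gt0 ?expR_gt0.
have w0_gt0 : 0 < w0 by rewrite !mulr_gt0 ?invr_gt0 ?exprn_gt0 ?expR_gt0.
have W0 : 0 < W by exact: lt_le_trans W_ge.
have lnw0 : ln w0 = ln a - J%:R * ln 2 - n%:R * (Q + ep).
  rewrite /w0 [LHS]lnM ?posrE ?divr_gt0 ?exprn_gt0 ?expR_gt0// expRK ln_div ?posrE ?exprn_gt0//.
  by rewrite pow2E expRK.
have lna_ge : n%:R * Rt - ln 2 <= ln a.
  rewrite -[X in X - _](expRK (n%:R * Rt)) -ln_div ?posrE ?expR_gt0//.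
  by rewrite ler_ln ?posrE ?divr_gt0 ?expR_gt0.
have lna_le : ln a <= n%:R * (`|Rt| + 1) by rewrite -ler_expR lnK ?posrE.
have lnW_ge : ln w0 <= ln W by rewrite ler_ln.
have lnW_le : ln W <= ln w0 + J%:R * (n%:R * ep').
  by rewrite -[X in _ + X]expRK expRM_natl -lnM ?posrE ?exprn_gt0 ?expR_gt0// ler_ln ?posrE ?(lt_le_trans W0).
rewrite lnw0 in lnW_ge lnW_le; have ln2_ge0 : 0 <= ln 2 :> R by rewrite ln_ge0// ler1n.
rewrite -natr1 mulrDl mul1r in J_ln.
have upper : - ln (2 * W) / n%:R <= Q - Rt + 2 * ep.
  by rewrite (ler_pdivrMr _ _ n_gt0) lnM ?posrE//; lra.
have ln2_le1 : ln 2 <= n%:R :> R.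
  have : 1 <= n%:R :> R by rewrite ler1n.
  by have := @le_ln1Dx R 1; have -> : 1 + 1 = 2 :> R by []; lra.
split=> //; rewrite ler_norml; apply/andP; split; last first.
  by apply: le_trans upper _; have := ler_norm Q; have := ler_norm (- Rt); rewrite normrN; have :=
    normr_ge0 Q; lra.
rewrite ler_pdivlMr// lnM ?posrE//.
have := ler_wpM2l (ltW n_gt0) J_le; have := ler_wpM2l (ltW n_gt0) (ler_norm (- Q)).
have := mulr_ge0 (ler0n R J) ln2_ge0; rewrite normrN => Jln2 Q_ge J_le'.
have : n%:R * ep' <= n%:R * 1 by rewrite ler_wpM2l.
by have : n%:R * ep <= n%:R * 1 by [rewrite ler_wpM2l]; lra.
Qed.

Lemma expRD1_le (n : nat) (r : R) : (0 < n)%N -> expR (n%:R * r) + 1 <= expR (n%:R * (`|r| + 1)).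
Proof.
move=> n0; have er_le : expR (n%:R * r) <= expR (n%:R * `|r|) by rewrite ler_expR ler_wpM2l// ler_norm.
have er1 : 1 <= expR (n%:R * `|r|) by rewrite -[leLHS]expR0 ler_expR mulr_ge0.
have en2 : 2 <= expR (n%:R : R).
  by have := expR_ge1Dx (n%:R : R); have : 1 <= n%:R :> R by [rewrite ler1n]; lra.
by rewrite mulrDr mulr1 expRD; nra.
Qed.

Lemma exists_halving_depth (K d : R) : 0 <= K -> 0 < d -> exists J : nat, K <= J%:R * d <= K + d.
Proof.
move=> K0 d0; exists (Num.truncn (K / d)).+1; rewrite -ler_pdivrMr// ltW ?truncnS_gt//=.
by have := truncn_le (K / d); rewrite divr_ge0 ?(ltW d0)// ler_pdivlMr// -natr1; lra.
Qed.

Lemma total_weight_lt_halvings (n J : nat) (b Q ep ep' : R) (T : finType) (x : T -> 'rV[R]_n)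
    (A : {set T}) : 0 <= b -> (0 < n)%N -> (0 < #|A|)%N -> (forall c, norm2 (x c) = 1) ->
  `|Q| + ep + 1 <= J%:R * ep' -> J.+1%:R * ln 2 <= n%:R :> R ->
  total_weight (fun c c' => expR (- (n%:R * b * hdist x c c'))) A <
  #|A|%:R * (#|A|%:R / 2 ^+ J * expR (- (n%:R * (Q + ep)))) * expR (n%:R * ep') ^+ J.
Proof.
move=> b0 n0 A0 x1 J_ge J_n; have n_gt0 : 0 < n%:R :> R by rewrite ltr0n.
apply: le_lt_trans (total_weight_le_sqr _ _) _ => [c c'|].
  rewrite -[leRHS]expR0 ler_expR oppr_le0 mulr_ge0 ?mulr_ge0//.
  by have /andP[] := hdist_bounds x1 c c'.
have a0 : 0 < #|A|%:R :> R by rewrite ltr0n.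
rewrite -mulrA ltr_pM2l// -mulrA mulrAC ltr_pdivlMr ?exprn_gt0// ltr_pM2l//.
rewrite pow2E -expRM_natl -expRD ltr_expR.
have ln2_gt0 : 0 < ln 2 :> R by rewrite ln_gt0// ltr1n.
have := ler_wpM2l (ltW n_gt0) J_ge; have := ler_wpM2l (ltW n_gt0) (ler_norm Q).
by move: J_n; rewrite -natr1; lra.
Qed.

Lemma exists_regular_of_total_weight (n J : nat) (b Q R1 Rt ep ep' eta : R) (T : finType)
    (x : T -> 'rV[R]_n) (f := fun c c' => expR (- (n%:R * b * hdist x c c'))) (B : {set T}) :
  0 <= b -> (0 < n)%N -> 0 < ep <= 1 -> 0 < ep' <= 1 -> R1 <= Rt -> (forall c, norm2 (x c) = 1) ->
  `|Q| + ep + 1 <= J%:R * ep' <= `|Q| + ep + 1 + ep' -> J.+1%:R * ln 2 <= n%:R * eta ->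
  J.+1%:R * ln 2 <= n%:R * ep -> expR (n%:R * Rt) / 2 <= #|B|%:R ->
  (forall A : {set T}, expR (n%:R * (R1 - eta)) <= #|A|%:R ->
    #|A|%:R ^+ 2 * expR (- (n%:R * (Q + ep))) <= total_weight f A) ->
  exists (A : {set T}) (E : R), [/\ A \subset B, (0 < #|A|)%N, E <= Q - Rt + 2 * ep,
    `|E| <= `|Rt| + 2 * `|Q| + 4 & regular_set f (expR (- (n%:R * E)) / 2) (expR (n%:R * ep')) A].
Proof.
move=> b0 n0 ep_bounds ep'_bounds R1Rt x1 /andP[J_ge J_le] J_eta J_ep B_ge total_ge.
have n_gt0 : 0 < n%:R :> R by rewrite ltr0n.
have f0 c c' : 0 <= f c c' by exact: expR_ge0.
set ee := expR (n%:R * Rt) in B_ge; have ee0 : 0 < ee by exact: expR_gt0.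
have [A0 A0B] := exists_subset_card_near (ltW ee0) B_ge; set a : R := #|A0|%:R => /andP[a_ge a_le].
have {}a_le := le_trans a_le (expRD1_le Rt n0).
have a0 : 0 < a by lra.
pose X := a / 2 ^+ J; have X0 : 0 < X by rewrite divr_gt0 ?exprn_gt0.
pose w0 := X * expR (- (n%:R * (Q + ep))); have w0_gt0 : 0 < w0 by rewrite mulr_gt0 ?expR_gt0.
have g1 : 1 <= expR (n%:R * ep').
  by rewrite -[leLHS]expR0 ler_expR mulr_ge0 ?ltW//; case/andP: ep'_bounds.
have X_ge : expR (n%:R * (R1 - eta)) <= X.
  apply: (@le_trans _ _ (ee / 2 / 2 ^+ J)); last by rewrite ler_pM2r ?invr_gt0 ?exprn_gt0.
  have -> : ee / 2 / 2 ^+ J = ee / 2 ^+ J.+1 by rewrite exprS invfM mulrA.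
  rewrite pow2E -expRN -expRD ler_expR mulrBr.
  by have := ler_wpM2l (ltW n_gt0) R1Rt; lra.
have J_n : J.+1%:R * ln 2 <= n%:R :> R.
  by apply: le_trans J_ep _; rewrite ler_piMr//; case/andP: ep_bounds.
have total_lt : total_weight f A0 < a * w0 * expR (n%:R * ep') ^+ J.
  by apply: total_weight_lt_halvings; rewrite // -(ltr0n R).
have total_regular (A : {set T}) : X <= #|A|%:R -> #|A|%:R * w0 <= total_weight f A.
  move=> XA; apply: le_trans (total_ge A (le_trans X_ge XA)).
  by rewrite /w0 mulrA expr2 ler_wpM2r ?expR_ge0// ler_wpM2l.
have cardA0 : 2 ^+ J * X <= #|A0|%:R by rewrite -/a /X mulrC divfK// gt_eqF ?exprn_gt0.
have [A [W [AA0 XA W_bounds reg]]] := exists_regular_subset f0 X0 w0_gt0 g1 total_regular cardA0 total_lt.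
have [E_le E_norm] := regular_exponent_bounds n0 ep_bounds ep'_bounds J_le J_ep
  (introT andP (conj a_ge a_le)) W_bounds.
have W0 : 0 < W by case/andP: W_bounds => W_ge _; exact: lt_le_trans W_ge.
exists A, (- ln (2 * W) / n%:R); split=> //.
- exact: fintype.subset_trans AA0 A0B.
- by rewrite -(ltr0n R); exact: lt_le_trans XA.
have -> : n%:R * (- ln (2 * W) / n%:R) = - ln (2 * W) by rewrite mulrC divfK// gt_eqF.
by rewrite opprK lnK ?posrE ?mulr_gt0// mulrC mulKf.
Qed.

Lemma near_exists_regular (b s R1 Rx Rt ep ep' : R) (Q := b * (1 - s) + Rx) :
  0 < b -> many_close_pairs b s R1 Rx -> R1 <= Rt -> 0 < ep <= 1 -> 0 < ep' <= 1 ->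
  \forall n \near \oo, forall (T : finType) (x : T -> 'rV[R]_n) (B : {set T}),
  (forall c, norm2 (x c) = 1) -> expR (n%:R * Rt) / 2 <= #|B|%:R ->
  exists (A : {set T}) (E : R), [/\ A \subset B, (0 < #|A|)%N, E <= Q - Rt + 2 * ep, `|E| <=
    `|Rt| + 2 * `|Q| + 4 &
    regular_set (fun c c' => expR (- (n%:R * b * hdist x c c'))) (expR (- (n%:R * E)) / 2)
      (expR (n%:R * ep')) A].
Proof.
move=> b0 close_pairs R1Rt ep_bounds ep'_bounds.
have [/andP[ep0 _] /andP[ep'0 _]] := (ep_bounds, ep'_bounds).
have [eta eta0 near_total_ge] := close_pairs ep ep0.
have Q0 : 0 <= `|Q| + ep + 1 by rewrite !addr_ge0// ltW.
have [J J_bounds] := exists_halving_depth Q0 ep'0.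
near=> n => T x B x1 B_ge.
apply: (exists_regular_of_total_weight (eta :=
  eta) (ltW b0) _ ep_bounds ep'_bounds R1Rt x1 J_bounds _ _ B_ge).
- by near: n; exact: nbhs_infty_gt.
- by near: n; exact: near_le_linear.
- by near: n; exact: near_le_linear.
move=> A; move: T x x1 A {B B_ge}; near: n; apply: filterS near_total_ge => n total_ge T x x1 A.
exact: total_ge.
Unshelve. all: end_near. Qed.

(* Windows of width d cost a factor K = O(1 / d), a regular set a factor e^{n d / 2}. *)
Lemma near_exists_concentrated (b pm d : R) : 0 < b -> 0 < d ->
  \forall n \near \oo, forall (T : finType) (x : T -> 'rV[R]_n) (A : {set T}) (E : R),
  (forall c, norm2 (x c) = 1) -> (0 < #|A|)%N ->
  regular_set (fun c c' => expR (- (n%:R * b * hdist x c c'))) (expR (- (n%:R * E)) / 2)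
    (expR (n%:R * (d / 2))) A ->
  {in A, forall c c', c' != c -> pm <= hdist x c c'} ->
  exists (e : rel T) (p0 : R), (forall c c', e c c' -> c' != c) /\ concentrated_graph x e A b pm d E p0.
Proof.
move=> b0 d0; have d2 : 0 < d / 2 by rewrite divr_gt0.
pose K : R := (Num.truncn (2 / d)).+1%:R; have K0 : 0 < K by rewrite ltr0n.
near=> n => T x A E x1 A0 [weight_le total_ge] far.
have ln2K_le : ln (2 * K) <= n%:R * (d / 2) by near: n; exact: near_le_linear.
set g := expR (n%:R * (d / 2)) in total_ge; have g0 : 0 < g by exact: expR_gt0.
set W := expR (- (n%:R * E)) in weight_le total_ge; have W0 : 0 < W by exact: expR_gt0.
have tot0 : 0 < #|A|%:R * (W / 2) / g by rewrite !mulr_gt0 ?ltr0n ?invr_gt0.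
have [e [p0 [esym e_in e_dist p0_bounds nedges_ge]]] := exists_distance_window b0 d0 x1 tot0 total_ge.
exists e, p0; split=> [c c' /e_in[]//|]; split=> //.
- by move=> c c' /e_in[].
- by move=> c c' /e_in[cA _ cc']; exact: far.
- by move=> c cA; apply: le_trans (weight_le c cA) _; rewrite mulrC divfK.
have -> : n%:R * (b * p0 - E - d) = n%:R * b * p0 + - (n%:R * E) + - (n%:R * d) by ring.
rewrite 2!expRD -/W; have expd_le : expR (- (n%:R * d)) <= (2 * K * g)^-1.
  rewrite expRN lef_pV2 ?posrE ?mulr_gt0 ?expR_gt0//.
  have -> : 2 * K = expR (ln (2 * K)) by rewrite lnK// posrE mulr_gt0.
  rewrite /g -expRD ler_expR.
  by rewrite (_ : n%:R * d = n%:R * (d / 2) + n%:R * (d / 2)); [rewrite lerD2r|field].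
have := ler_wpM2r (expR_ge0 (n%:R * b * p0)) nedges_ge.
rewrite -[nedges e * _ * _]mulrA -expRD addNr expR0 mulr1; apply: le_trans.
apply: (@le_trans _ _ (#|A|%:R * (expR (n%:R * b * p0) * W * (2 * K * g)^-1))).
  by rewrite !ler_wpM2l ?mulr_ge0 ?expR_ge0// ltW.
rewrite -/K le_eqVlt; apply/orP; left; apply/eqP; field.
by rewrite !gt_eqF.
Unshelve. all: end_near. Qed.

(* A code with error probabilities at most 2 e^{-n (E0 + nu)} has no pair at distance less than
   E0 / b. *)
Lemma near_hdist_ge_of_err_prob (b E0 nu : R) : 0 < b -> 0 < nu ->
  \forall n \near \oo, forall (T : finType) (x : T -> 'rV[R]_n) (e : rel T) c c',
  (forall c, norm2 (x c) = 1) -> e c c' -> 0 < hdist x c c' ->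
  err_prob x e (Num.sqrt (n%:R * b)) c <= 2 * expR (- (n%:R * (E0 + nu))) -> E0 / b <= hdist x c c'.
Proof.
move=> b0 nu0; near=> n => T x e c c' x1 cc' p0 err_le.
have n0 : 0 < n%:R :> R by near: n; exact: nbhs_infty_gtr.
have m_le : 3 + ln 4 + 9 * Num.sqrt (n%:R * b) <= n%:R * nu.
  by near: n; exact: near_sqrt_le_linear (ltW b0) (ler0n _ 9) nu0.
set m := Num.sqrt (n%:R * b) in err_le m_le.
have m0 : 0 < m by rewrite sqrtr_gt0 mulr_gt0.
have m2 : m ^+ 2 = n%:R * b by rewrite sqr_sqrtr// mulr_ge0// ltW.
have := le_trans (err_prob_ge_edge m0 x1 cc' p0) err_le.
have -> : 2^-1 * expR (- (m ^+ 2 * hdist x c c') - 9 * m - 3) =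
    2 * expR (- (m ^+ 2 * hdist x c c') - 9 * m - 3 - ln 4).
  by rewrite [in RHS]expRD [expR (- ln 4)]expRN lnK ?posrE//; field.
rewrite ler_pM2l// ler_expR m2 => exp_le.
rewrite ler_pdivrMr// -(ler_pM2l n0); have -> : n%:R * (hdist x c c' * b) = n%:R * b * hdist x c c' by ring.
by lra.
Unshelve. all: end_near. Qed.

Lemma half_card_le_of_mean_lt (T : finType) (F : T -> R) (w : R) : (0 < #|T|)%N ->
  (forall c, 0 <= F c) -> #|T|%:R^-1 * \sum_c F c < w -> #|T|%:R / 2 <= #|[set c | F c <= 2 * w]%SET|%:R :> R.
Proof.
move=> T0 F0 mean_lt; have T_gt0 : 0 < #|T|%:R :> R by rewrite ltr0n.
have w0 : 0 < w by apply: le_lt_trans mean_lt; rewrite mulr_ge0 ?invr_ge0 ?sumr_ge0.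
rewrite (_ : [set _ | _]%SET = [set c in [set: T]%SET | F c <= 2 * w]%SET); last first.
  by apply/setP => c; rewrite !inE.
rewrite -cardsT; apply: half_card_le_double_mean => //.
rewrite (eq_bigl xpredT); last by move=> c; rewrite finset.in_setT.
by rewrite cardsT ltW// -ltr_pdivrMl.
Qed.

Lemma converse (b s R1 Rx Rt nu : R) (E0 := b * (1 - s) + Rx - Rt) : saddle b s ->
  many_close_pairs b s R1 Rx -> R1 <= Rt -> 0 < nu <= 1 ->
  b * (1 - s) + ln (1 - b * (1 - s)) / 2 <= E0 -> 0 < E0 ->
  \forall n \near \oo, forall (T : finType) (x : T -> 'rV[R]_n),
  (forall c, norm2 (x c) = 1) -> (forall c c', c' != c -> 0 < hdist x c c') ->
  expR (n%:R * Rt) <= #|T|%:R ->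
  expR (- (n%:R * (E0 + nu))) <=
  #|T|%:R^-1 * \sum_c err_prob x (fun c c' => c' != c) (Num.sqrt (n%:R * b)) c.
Proof.
move=> bs close_pairs R1Rt /andP[nu0 nu1] F_le E00; have [b0 _ _ _] := bs.
pose ep := nu / 8; have ep0 : 0 < ep by rewrite divr_gt0.
have ep_bounds : 0 < ep <= 1 by rewrite ep0 /ep; lra.
pose Q := b * (1 - s) + Rx; pose Eb := `|Rt| + 2 * `|Q| + 4.
have Eb0 : 0 <= Eb by rewrite !addr_ge0// mulr_ge0.
have pm0 : 0 < E0 / b by rewrite divr_gt0.
have [d d_bounds near_bound] := near_graph_bound bs Eb0 pm0 ep0; have /andP[d0 d1] := d_bounds.
have d2_bounds : 0 < d / 2 <= 1 by apply/andP; split; lra.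
have near_regular := near_exists_regular b0 close_pairs R1Rt ep_bounds d2_bounds.
have near_graph := near_exists_concentrated (E0 / b) b0 d0.
have near_far := near_hdist_ge_of_err_prob E0 b0 nu0.
have near_ln2 := near_le_linear (ln 2) ep0.
apply: filterS (filterI near_bound (filterI near_regular (filterI near_graph (filterI near_far near_ln2)))).
move=> n [graph_err_ge [exists_regular [exists_graph [hdist_ge ln2_le]]]] T x x1 x_neq T_ge.
rewrite leNgt; apply/negP => err_lt; set m := Num.sqrt (n%:R * b) in err_lt.
set w := expR (- _) in err_lt; have w0 : 0 < w by exact: expR_gt0.
pose F c := err_prob x (fun c c' => c' != c) m c.
have T0 : (0 < #|T|)%N by rewrite -(ltr0n R); apply: lt_le_trans T_ge; exact: expR_gt0.
pose B := [set c | F c <= 2 * w]%SET.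
have B_ge : expR (n%:R * Rt) / 2 <= #|B|%:R.
  apply: (@le_trans _ _ (#|T|%:R / 2)); first by rewrite ler_pM2r ?invr_gt0.
  by apply: half_card_le_of_mean_lt => // c; exact: err_prob_ge0.
have [A [E [AB A0 E_le E_norm reg]]] := exists_regular T x B x1 B_ge.
have err_le c : c \in A -> F c <= 2 * w.
  by move=> /(fintype.subsetP AB); rewrite !inE.
have far : {in A, forall c c', c' != c -> E0 / b <= hdist x c c'}.
  move=> c cA c' cc'.
  by apply: (hdist_ge T x (fun c c' => c' != c)); rewrite ?x_neq ?err_le.
have [e [p0 [e_neq graph]]] := exists_graph T x A E x1 A0 reg far.
have := graph_err_ge T x e A E p0 graph E_norm; apply/negP; rewrite -ltNge.
apply: (@le_lt_trans _ _ (\sum_(c in A) 2 * w)).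
  apply: ler_sum => c cA; apply: le_trans (err_le c cA).
  by apply: le_err_prob => a a' /e_neq.
rewrite sumr_const -[_ *+ _]mulr_natl ltr_pM2l ?ltr0n//.
set M := Num.max _ _; have M_le : M <= E0 + 2 * ep.
  by rewrite ge_max E_le/= (le_trans F_le)// lerDl mulr_ge0// ltW.
have -> : 2 * w = expR (ln 2 - n%:R * (E0 + nu)) by rewrite expRD lnK ?posrE.
rewrite ltr_expR; have := ler_wpM2l (ler0n R n) M_le; have ln2_gt0 : 0 < ln 2 :> R by rewrite ln_gt0// ltr1n.
have -> : nu = 8 * ep by rewrite /ep; field.
by lra.
Qed.

End converse.

Import Zonal.

(** * Differential equation and growth of Gegenbauer polynomials *)

Section gegenbauer.
Context {R : realType}.
Variable N : nat.
Hypothesis N5 : (4 < N)%N.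
Implicit Types (x y s t k d : R) (i j : nat).
Local Notation c := (geg_coef R N).
Local Notation P := (geg R N).
Local Notation lam := (N%:R / 2 - 1 : R).
Local Notation M i := (i%:R + lam).

(* The squared norm of the i-th polynomial for the weight (1 - x^2)^(lam - 1/2), normalised to give
   1 the norm 1. *)
Fixpoint geg_sqnorm i : R := if i is i'.+1 then c i * geg_sqnorm i' else 1.

Lemma lambda_gt1 : 1 < lam.
Proof.
have : (5 : R) <= N%:R by rewrite (ler_nat R 5).
by lra.
Qed.

Lemma lambda_le_shift i : lam <= M i.
Proof. by have : (0 : R) <= i%:R; [rewrite ler0n|lra]. Qed.

Lemma geg_coefE i : c i = (1 - lam * (lam - 1) / (M i * (M i - 1))) / 4.
Proof.
have := lambda_gt1; have := lambda_le_shift i; rewrite /geg_coef => shift_ge lam_gt1.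
by field; lra.
Qed.

Lemma pronic_ratio_antitone (l m m' : R) : 1 < l -> l <= m -> m <= m' ->
  l * (l - 1) / (m' * (m' - 1)) <= l * (l - 1) / (m * (m - 1)).
Proof.
move=> l1 lm mm; apply: ler_wpM2l; first by apply: mulr_ge0; lra.
have pronic_gt0 : 0 < m * (m - 1) by apply: mulr_gt0; lra.
have pronic_le : m * (m - 1) <= m' * (m' - 1) by apply: ler_pM; lra.
by rewrite lef_pV2 ?posrE//; lra.
Qed.

Lemma geg_coef_le i j : (i <= j)%N -> c i <= c j.
Proof.
move=> ij; have mm : M i <= M j by rewrite lerD2r ler_nat.
have := pronic_ratio_antitone lambda_gt1 (lambda_le_shift i) mm; rewrite !geg_coefE; lra.
Qed.

Lemma geg_coef0 : c 0 = 0.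
Proof. by rewrite /geg_coef !mul0r. Qed.

Lemma geg_coefS_gt0 i : 0 < c i.+1.
Proof.
have := lambda_gt1; have := lambda_le_shift i => shift_ge lam_gt1.
have i0 : (0 : R) <= i%:R by rewrite ler0n.
rewrite /geg_coef -natr1; apply: divr_gt0; apply: mulr_gt0; lra.
Qed.

Lemma geg_coef_ge0 i : 0 <= c i.
Proof. by case: i => [|i]; [rewrite geg_coef0|exact: ltW (geg_coefS_gt0 i)]. Qed.

Lemma geg_coef_le_quarter i : 4 * c i <= 1.
Proof.
have l1 := lambda_gt1; have m1 := lambda_le_shift i; rewrite geg_coefE.
have : 0 <= lam * (lam - 1) / (M i * (M i - 1)).
  by apply: divr_ge0; apply: mulr_ge0; lra.
lra.
Qed.

Lemma pronic_ratio_le_sqr (l m t : R) : 1 < l -> l <= m -> 0 <= t -> l <= t * m ->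
  l * (l - 1) / (m * (m - 1)) <= t ^+ 2.
Proof.
move=> l1 lm t0 lt; rewrite ler_pdivrMr; last by apply: mulr_gt0; lra.
case: (lerP 1 t) => t1.
  have sqr_ge1 : 1 <= t ^+ 2 by rewrite expr2; nra.
  have pronic_le : l * (l - 1) <= m * (m - 1) by nra.
  have pronic_ge0 : 0 <= l * (l - 1) by nra.
  by apply: le_trans pronic_le _; rewrite ler_peMl//; nra.
have pred_le : l - 1 <= t * (m - 1) by lra.
have -> : t ^+ 2 * (m * (m - 1)) = (t * m) * (t * (m - 1)) by ring.
by apply: ler_pM => //; lra.
Qed.

Lemma sqr_le_pronic_ratio (l m t : R) : 1 < l -> l <= m -> 0 <= t -> t * (m - 1) <= l - 1 ->
  t ^+ 2 <= l * (l - 1) / (m * (m - 1)).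
Proof.
move=> l1 lm t0 lt; rewrite ler_pdivlMr; last by apply: mulr_gt0; lra.
have t1 : t <= 1 by rewrite leNgt; apply/negP => t1; nra.
have scaled_le : t * m <= l by lra.
have -> : t ^+ 2 * (m * (m - 1)) = (t * m) * (t * (m - 1)) by ring.
by apply: ler_pM => //; apply: mulr_ge0; lra.
Qed.

Lemma geg_sqnorm_gt0 i : 0 < geg_sqnorm i.
Proof. by elim: i => [|i ih] //=; apply: mulr_gt0 => //; exact: geg_coefS_gt0. Qed.

Lemma horner_gegS i x : (P i.+2).[x] = x * (P i.+1).[x] - c i.+1 * (P i).[x].
Proof. by rewrite gegS !hornerE. Qed.

Lemma horner_deriv_gegS i x : (P i.+2)^`().[x] = (P i.+1).[x] + x * (P i.+1)^`().[x] - c i.+1 * (P i)^`().[x].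
Proof. by rewrite gegS derivB derivM derivX derivZ mul1r !hornerE. Qed.

Lemma deriv_geg0 : (P 0)^`() = 0.
Proof. by rewrite geg0 -polyC1 derivC. Qed.

Lemma sqr_geg_at0_le i : (P i).[0] ^+ 2 <= geg_sqnorm i.
Proof.
elim/two_step_ind: i => [||i ih _].
- by rewrite geg0 hornerE expr1n.
- by rewrite geg1 hornerE expr0n /= mulr1 geg_coef_ge0.
rewrite horner_gegS mul0r sub0r sqrrN exprMn /=.
have coef_le := geg_coef_le (leqnSn i.+1); have coef_gt0 := geg_coefS_gt0 i; have nrm_gt0 := geg_sqnorm_gt0 i.
rewrite mulrA; apply: ler_pM => //; rewrite ?sqr_ge0// expr2; apply: ler_wpM2r => //; exact: ltW.
Qed.

Lemma geg_dcoefE i : geg_dcoef R N i = 2 * M i * c i.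
Proof. by rewrite /geg_dcoef; field. Qed.

Lemma geg_deriv_step (x k p1 p2 p3 c2 c1 g3 g2 g1 q2 q1 : R) :
  g3 = 1 + g2 - 2 * c2 -> (g2 - 2 * c2) * c1 = c2 * g1 ->
  p3 = x * p2 - c1 * p1 ->
  (1 - x ^+ 2) * q2 = - (k + 1) * x * p3 + g2 * p2 ->
  (1 - x ^+ 2) * q1 = - k * x * p2 + g1 * p1 ->
  (1 - x ^+ 2) * (p3 + x * q2 - c2 * q1) = - (k + 2) * x * (x * p3 - c2 * p2) + g3 * p3.
Proof.
move=> -> coef_eq rec_eq deriv_eq deriv_prev_eq.
rewrite [LHS](_ : _ = (1 - x ^+ 2) * p3 + x * ((1 - x ^+ 2) * q2) - c2 * ((1 - x ^+ 2) * q1)); last by ring.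
rewrite deriv_eq deriv_prev_eq.
apply: subr0_eq; rewrite [LHS](_ : _ = (g2 - 2 * c2) * (x * p2 - p3) - c2 * g1 * p1); last by ring.
by rewrite rec_eq -coef_eq; ring.
Qed.

Lemma geg_deriv i x : (1 - x ^+ 2) * (P i.+1)^`().[x] =
  - i.+1%:R * x * (P i.+1).[x] + geg_dcoef R N i.+1 * (P i).[x].
Proof.
have N3 : (2 < N)%N by apply: leq_trans N5.
elim/two_step_ind: i => [||i ih1 ih2].
- by rewrite geg1 geg0 (geg_dcoef1 R N3) derivX !hornerE; ring.
- rewrite horner_deriv_gegS horner_gegS deriv_geg0 geg1 geg0 derivX (geg_dcoefS R N3) (geg_dcoef1 R
  N3) -polyC1 !hornerC hornerX.
  by ring.
- rewrite (horner_deriv_gegS i.+1) (horner_gegS i.+1).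
  have := geg_deriv_step (geg_dcoefS R N3 i.+1) (geg_dcoef_coef R N3 i) (horner_gegS i x) _ ih1.
  have e2 : i.+1%:R + 1 = i.+2%:R :> R by rewrite natr1.
  have e3 : i.+1%:R + 2 = i.+3%:R :> R by rewrite -!natr1; ring.
  by rewrite e3 e2 => /(_ _ ih2).
Qed.

Lemma geg_deriv_up i x : (1 - x ^+ 2) * (P i)^`().[x] =
  (i%:R + 2 * lam) * x * (P i).[x] - 2 * M i * (P i.+1).[x].
Proof.
case: i => [|i].
  by rewrite deriv_geg0 geg0 geg1 !hornerE; ring.
rewrite geg_deriv horner_gegS geg_dcoefE; ring.
Qed.

Lemma der_uniq (f : R -> R) x a b : der f x a -> der f x b -> a = b.
Proof. by move=> ha hb; rewrite -(@derive_val _ _ _ _ _ _ _ ha) (@derive_val _ _ _ _ _ _ _ hb). Qed.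

Lemma geg_ode i x : x ^+ 2 < 1 ->
  (1 - x ^+ 2) * (P i)^`()^`().[x] =
  (2 * lam + 1) * x * (P i)^`().[x] - i%:R * (i%:R + 2 * lam) * (P i).[x].
Proof.
move=> x1; case: i => [|i].
  by rewrite deriv_geg0 linear0 !hornerE; ring.
have der_product : der (fun x => (1 - x ^+ 2) * (P i.+1)^`().[x]) x
   (- (2 * x) * (P i.+1)^`().[x] + (1 - x ^+ 2) * (P i.+1)^`()^`().[x]).
  apply: der_eq.
    by apply: derM; [apply: derB; [exact: der_cst|apply: derX; exact: der_id]|exact: der_horner].
  by rewrite /=; ring.
have der_recurrence : der (fun x => (1 - x ^+ 2) * (P i.+1)^`().[x]) x
   (- i.+1%:R * ((P i.+1).[x] + x * (P i.+1)^`().[x]) + geg_dcoef R N i.+1 * (P i)^`().[x]).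
  rewrite (funext (geg_deriv i)).
  apply: der_eq.
    apply: derD; last by apply: derM; [exact: der_cst|exact: der_horner].
    by apply: derM; [apply: derM; [exact: der_cst|exact: der_id]|exact: der_horner].
  by rewrite /=; ring.
have derivativesE := der_uniq der_product der_recurrence.
have deriv_up := geg_deriv_up i x.
have deriv_down := geg_deriv i x.
have dcoef_degreeE : 2 * M i * geg_dcoef R N i.+1 = i.+1%:R * (i.+1%:R + 2 * lam - 1).
  rewrite geg_dcoefE geg_coefE -natr1; have := lambda_gt1; have :=
    lambda_le_shift i => shift_ge lam_gt1; by field; lra.
have x0 : 1 - x ^+ 2 != 0 by lra.
have e1 : i.+1%:R = i%:R + 1 :> R by rewrite natr1.
apply: (mulfI x0); move: derivativesE deriv_up deriv_down dcoef_degreeE.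
move: ((P i.+1)^`()^`().[x]) ((P i.+1)^`().[x]) ((P i.+1).[x]) ((P i)^`().[x]) ((P i).[x])
  (geg_dcoef R N i.+1).
rewrite e1; move: (i%:R : R) (lam) => k l p2 p1 p q1 q g derivativesE deriv_up deriv_down dcoef_degreeE.
have ode_up : (1 - x ^+ 2) * p2 = 2 * x * p1 - (k + 1) * (p + x * p1) + g * q1 by lra.
rewrite [X in _ * X]ode_up.
rewrite [LHS](_ : _ = (1 - x ^+ 2) * (2 * x * p1 - (k + 1) * (p + x * p1)) + g * ((1 - x ^+
  2) * q1)); last by ring.
rewrite deriv_up.
rewrite [LHS](_ : _ = (1 - x ^+ 2) * (2 * x * p1 - (k + 1) * (p + x * p1)) + (k +
  2 * l) * x * (g * q) - 2 * (k + l) * g * p); last by ring.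
have -> : g * q = (1 - x ^+ 2) * p1 + (k + 1) * x * p by lra.
by rewrite dcoef_degreeE; ring.
Qed.

Definition geg_weight x : R := expR (lam * ln (1 - x ^+ 2)).
Definition sonin_coef i x : R := M i ^+ 2 - lam * (lam - 1) / (1 - x ^+ 2).
Definition sonin_slope i x : R := (1 - x ^+ 2) * (P i)^`().[x] - lam * x * (P i).[x].
(* With v = (1 - x^2)^(lam / 2) P this is sonin_coef v^2 + (1 - x^2) v'^2. *)
Definition sonin i x : R := geg_weight x * (sonin_coef i x * (P i).[x] ^+ 2 + sonin_slope i x ^+
  2 / (1 - x ^+ 2)).

Lemma der_1Bsqr x : der (fun y => 1 - y ^+ 2) x (- (2 * x)).
Proof.
apply: der_eq; first by apply: derB; [exact: der_cst|apply: derX; exact: der_id].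
by rewrite /=; ring.
Qed.

Lemma der_one_sub_sqr_powR (l x : R) : x ^+ 2 < 1 ->
  der (fun y => expR (l * ln (1 - y ^+ 2))) x (expR (l * ln (1 - x ^+ 2)) * (l * (- (2 * x) / (1 - x ^+ 2)))).
Proof.
move=> x1; apply: der_expR; apply: derZ; apply: der_ln; first by lra.
exact: der_1Bsqr.
Qed.

Lemma sonin_deriv_eq (W x p p1 p2 l k : R) : x ^+ 2 < 1 ->
  (1 - x ^+ 2) * p2 = (2 * l + 1) * x * p1 - k * (k + 2 * l) * p ->
  let f := (k + l) ^+ 2 - l * (l - 1) / (1 - x ^+ 2) in
  let f' := - (l * (l - 1) * (- - (2 * x) / (1 - x ^+ 2) ^+ 2)) in
  let q := (1 - x ^+ 2) * p1 - l * x * p in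
  let q' := - (2 * x) * p1 + (1 - x ^+ 2) * p2 - (l * p + l * x * p1) in
  W * (l * (- (2 * x) / (1 - x ^+ 2))) * (f * p ^+ 2 + q ^+ 2 / (1 - x ^+ 2)) +
  W * ((f' * p ^+ 2 + f * (2 * p * p1)) + ((2 * q * q') / (1 - x ^+ 2) + q ^+
    2 * (- - (2 * x) / (1 - x ^+ 2) ^+ 2)))
  = W * p ^+ 2 * f'.
Proof.
move=> x1 ode /=; rewrite ode.
have x0 : 1 - x ^+ 2 != 0 by lra.
by field.
Qed.

Lemma der_sonin i x : x ^+ 2 < 1 ->
  der (sonin i) x (geg_weight x * (P i).[x] ^+ 2 * - (lam * (lam - 1) * (- - (2 * x) / (1 - x ^+ 2) ^+ 2))).
Proof.
move=> x1; have x0 : 1 - x ^+ 2 != 0 by lra.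
apply: der_eq; last exact: (sonin_deriv_eq (geg_weight x) x1 (geg_ode i x1)).
have der_inv : der (fun y => (1 - y ^+ 2)^-1) x (- - (2 * x) / (1 - x ^+ 2) ^+ 2).
  by apply: derV => //; exact: der_1Bsqr.
have der_coef : der (sonin_coef i) x (- (lam * (lam - 1) * (- - (2 * x) / (1 - x ^+ 2) ^+ 2))).
  apply: der_eq; first by apply: derB; [exact: der_cst|apply: derZ; exact: der_inv].
  by rewrite sub0r.
have der_slope : der (sonin_slope i) x (- (2 * x) * (P i)^`().[x] + (1 - x ^+
  2) * (P i)^`()^`().[x] - (lam * (P i).[x] + lam * x * (P i)^`().[x])).
  apply: derB; first by apply: derM; [exact: der_1Bsqr|exact: der_horner].
  apply: derM; last exact: der_horner.
  by apply: der_eq; [apply: derZ; exact: der_id|rewrite mulr1].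
apply: derM; first exact: der_one_sub_sqr_powR.
apply: derD.
  apply: derM => //; apply: der_eq; first by apply: derX; exact: der_horner.
  by rewrite expr1.
apply: derM => //; apply: der_eq; first by apply: derX; exact: der_slope.
by rewrite expr1.
Qed.

Lemma sqr_lt1 x : 0 <= x -> x < 1 -> x ^+ 2 < 1.
Proof. by move=> x0 x1; rewrite expr_lt1. Qed.

Lemma sonin_le_sonin0 i x : 0 <= x -> x < 1 -> sonin i x <= sonin i 0.
Proof.
move=> x0 x1; apply: der_le0_ge x0 _ _ => t /andP[t0 tx].
  by apply: der_sonin; apply: sqr_lt1 => //; lra.
have l1 := lambda_gt1; have t1 : t ^+ 2 < 1 by apply: sqr_lt1 => //; lra.
rewrite mulrN oppr_le0; apply: mulr_ge0; first by apply: mulr_ge0; [exact: expR_ge0|exact: sqr_ge0].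
apply: mulr_ge0; first by apply: mulr_ge0; lra.
by apply: divr_ge0; [lra|exact: sqr_ge0].
Qed.

Lemma sonin_at0_bound (k l p q nrm nrm0 c' : R) : 1 < l -> 1 <= k -> 0 <= nrm -> 0 <= c' -> 4 * c' <= 1 ->
  p ^+ 2 <= nrm -> nrm = c' * nrm0 -> q ^+ 2 <= nrm0 ->
  ((k + l) ^+ 2 - l * (l - 1)) * p ^+ 2 + (2 * (k + l) * c' * q) ^+ 2 <= 3 * (k + l) ^+ 2 * nrm.
Proof.
move=> l1 k1 n0 c0 c1 p_le nrmE q_le.
have value_le : ((k + l) ^+ 2 - l * (l - 1)) * p ^+ 2 <= (k + l) ^+ 2 * nrm.
  apply: ler_pM => //; rewrite ?sqr_ge0//; first by nra.
  by have : 0 <= l * (l - 1); [nra|lra].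
have slope_le : (2 * (k + l) * c' * q) ^+ 2 <= (k + l) ^+ 2 * nrm.
  rewrite [leLHS](_ : _ = (k + l) ^+ 2 * ((4 * c') * (c' * q ^+ 2))); last by ring.
  apply: ler_wpM2l; first exact: sqr_ge0.
  have cq : 0 <= c' * q ^+ 2 by apply: mulr_ge0 => //; exact: sqr_ge0.
  apply: le_trans (_ : c' * q ^+ 2 <= _); first by apply: ler_piMl.
  by rewrite nrmE; apply: ler_wpM2l.
have : 0 <= (k + l) ^+ 2 * nrm by apply: mulr_ge0 => //; exact: sqr_ge0.
lra.
Qed.

Lemma sonin_le i x : 0 <= x -> x < 1 -> sonin i.+1 x <= 3 * M i.+1 ^+ 2 * geg_sqnorm i.+1.
Proof.
move=> x0 x1; apply: le_trans (sonin_le_sonin0 i.+1 x0 x1) _.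
have e : (P i.+1)^`().[0] = 2 * M i.+1 * c i.+1 * (P i).[0].
  by have := geg_deriv i 0; rewrite geg_dcoefE expr0n /= subr0 mul1r mulr0 mul0r add0r.
have z : (0 : R) ^+ 2 = 0 by rewrite expr2 mulr0.
rewrite /sonin /geg_weight /sonin_coef /sonin_slope z subr0 ln1 !mulr0 expR0 !mul1r mul0r subr0 !divr1 e.
apply: (@sonin_at0_bound _ _ _ _ (geg_sqnorm i.+1) (geg_sqnorm i) (c i.+1));
  rewrite ?geg_coef_le_quarter ?geg_coef_ge0 ?sqr_geg_at0_le ?lambda_gt1//.
- by rewrite -natr1; have : (0 : R) <= i%:R; [rewrite ler0n|lra].
- exact: ltW (geg_sqnorm_gt0 _).
Qed.

Definition weighted_sqr i x : R := geg_weight x * (P i).[x] ^+ 2.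

Lemma weighted_sqr_ge0 i x : 0 <= weighted_sqr i x.
Proof. by apply: mulr_ge0; [exact: expR_ge0|exact: sqr_ge0]. Qed.

Lemma der_weighted_sqr i x : x ^+ 2 < 1 ->
  der (weighted_sqr i) x (2 * (geg_weight x * (P i).[x] * sonin_slope i x / (1 - x ^+ 2))).
Proof.
move=> x1; have x0 : 1 - x ^+ 2 != 0 by lra.
apply: der_eq; first by apply: derM; [exact: der_one_sub_sqr_powR|apply: derX; exact: der_horner].
rewrite -/(geg_weight x) /sonin_slope /=; move: (geg_weight x) ((P i).[x]) ((P i)^`().[x]) => W p p1.
by move: lam => l; field.
Qed.

Lemma sqr_le_of_sonin_bound (m l d y2 v nrm t : R) : 1 < l -> 0 < m -> 0 < d -> 0 <= y2 -> 0 <=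
  t -> l <= t * m ->
  y2 < 1 -> t ^+ 2 + d <= 1 - y2 -> 0 <= v -> v * (m ^+ 2 - l * (l - 1) / (1 - y2)) <= 3 * m ^+ 2 * nrm ->
  v <= 3 / d * nrm.
Proof.
move=> l1 m0 d0 y0 t0 lt y1 td v0 sonin_bound.
have m2 : 0 < m ^+ 2 by apply: exprn_gt0.
have coef_ge : m ^+ 2 * d <= m ^+ 2 - l * (l - 1) / (1 - y2).
  rewrite lerBrDr -lerBrDl ler_pdivrMr; last by lra.
  have lam_sqr_le : l * (l - 1) <= t ^+ 2 * m ^+ 2.
    by rewrite -exprMn; apply: le_trans (_ : l ^+ 2 <= _); [nra|rewrite lerXn2r ?nnegrE//; lra].
  apply: le_trans lam_sqr_le _.
  have -> : (m ^+ 2 - m ^+ 2 * d) * (1 - y2) = m ^+ 2 * ((1 - y2) - d * (1 - y2)) by ring.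
  rewrite mulrC; apply: ler_wpM2l; first exact: ltW.
  have : d * (1 - y2) <= d by rewrite ler_piMr//; lra.
  lra.
have scaled_le : v * (m ^+ 2 * d) <= 3 * m ^+ 2 * nrm by apply: le_trans (ler_wpM2l v0 coef_ge) sonin_bound.
rewrite -(ler_pM2r m2) -(ler_pM2r d0); apply: le_trans (_ : v * (m ^+ 2 * d) <= _); first by lra.
apply: le_trans scaled_le _; rewrite [leRHS](_ : _ = 3 * m ^+ 2 * nrm)//; field; lra.
Qed.

Lemma weighted_sqr_le i y t d : 0 <= y -> y < 1 -> 0 < d -> 0 <= t -> lam <= t * M i.+1 ->
  t ^+ 2 + d <= 1 - y ^+ 2 -> weighted_sqr i.+1 y <= 3 / d * geg_sqnorm i.+1.
Proof.
move=> y0 y1 d0 t0 lt td; have l1 := lambda_gt1; have ml := lambda_le_shift i.+1.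
have yy := sqr_lt1 y0 y1.
have m0 : 0 < M i.+1 by lra.
apply: (sqr_le_of_sonin_bound l1 m0 d0 (sqr_ge0 y) t0 lt yy td (weighted_sqr_ge0 i.+1 y)).
have hs := sonin_le i y0 y1.
apply: le_trans hs; rewrite -/(sonin_coef i.+1 y) /weighted_sqr /sonin [leRHS]mulrDr.
have : 0 <= geg_weight y * (sonin_slope i.+1 y ^+ 2 / (1 - y ^+ 2)).
  by apply: mulr_ge0; [exact: expR_ge0|apply: divr_ge0; [exact: sqr_ge0|lra]].
have -> : geg_weight y * (P i.+1).[y] ^+ 2 * sonin_coef i.+1 y =
  geg_weight y * (sonin_coef i.+1 y * (P i.+1).[y] ^+ 2) by ring.
lra.
Qed.

Lemma slope_le_of_sonin_bound (m l s2 x2 W p q nrm : R) : 1 < l -> l <= m -> 0 <= x2 -> x2 <= s2 ->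
  s2 < 1 -> 0 <= W -> 0 <= nrm ->
  W * ((m ^+ 2 - l * (l - 1) / (1 - x2)) * p ^+ 2 + q ^+ 2 / (1 - x2)) <= 3 * m ^+ 2 * nrm ->
  2 * (W * p * q / (1 - x2)) <= 2 / (1 - s2) * m * (W * p ^+ 2 + 3 * nrm).
Proof.
move=> l1 lm x0 xs s1 W0 n0 sonin_bound.
have m0 : 0 < m by lra.
set k := (1 - x2)^-1; set ks := (1 - s2)^-1.
have k1 : 1 <= ks by rewrite /ks invf_ge1 ?lerBlDr ?lerDl; lra.
have k0 : 0 <= k by rewrite /k invr_ge0; lra.
have kk : k <= ks by rewrite /k /ks lef_pV2 ?posrE; lra.
move: sonin_bound; rewrite -/k -/ks => sonin_bound.
have v0 : 0 <= W * p ^+ 2 by apply: mulr_ge0 => //; exact: sqr_ge0.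
(* AM-GM: 2 p q <= m p^2 + q^2 / m *)
have am_gm : 2 * (p * q) <= m * p ^+ 2 + q ^+ 2 / m.
  rewrite -subr_ge0 [leRHS](_ : _ = (m * p - q) ^+ 2 / m); last by field; lra.
  by apply: divr_ge0; [exact: sqr_ge0|lra].
have q_sqr_le : W * (q ^+ 2 * k) <= 3 * m ^+ 2 * nrm + m ^+ 2 * ks * (W * p ^+ 2).
  have q_sqrE : W * (q ^+ 2 * k) = W * ((m ^+ 2 - l * (l - 1) * k) * p ^+ 2 + q ^+ 2 * k) - m ^+
    2 * (W * p ^+ 2) + l * (l - 1) * k * (W * p ^+ 2) by ring.
  have singular_le : l * (l - 1) * k * (W * p ^+ 2) <= m ^+ 2 * ks * (W * p ^+ 2).
    apply: ler_wpM2r => //; apply: ler_pM => //; first by apply: mulr_ge0; lra.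
    by rewrite expr2; apply: ler_pM; lra.
  have mass_ge0 : 0 <= m ^+ 2 * (W * p ^+ 2) by apply: mulr_ge0 => //; exact: sqr_ge0.
  by rewrite q_sqrE; lra.
have slope_le : 2 * (W * p * q * k) <= m * (k * (W * p ^+ 2)) + (W * (q ^+ 2 * k)) / m.
  have -> : 2 * (W * p * q * k) = (W * k) * (2 * (p * q)) by ring.
  have -> : m * (k * (W * p ^+ 2)) + (W * (q ^+ 2 * k)) / m = (W * k) * (m * p ^+ 2 + q ^+
    2 / m) by field; lra.
  by apply: ler_wpM2l => //; apply: mulr_ge0.
apply: le_trans slope_le _.
have q_term_le : (W * (q ^+ 2 * k)) / m <= 3 * m * nrm + m * ks * (W * p ^+ 2).
  rewrite ler_pdivrMr//; apply: le_trans q_sqr_le _; rewrite le_eqVlt; apply/orP; left; apply/eqP; ring.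
have p_term_le : m * (k * (W * p ^+ 2)) <= m * (ks * (W * p ^+ 2)).
  by apply: ler_wpM2l; [lra|apply: ler_wpM2r].
have nrm_term_le : 3 * m * nrm <= 2 * ks * m * (3 * nrm).
  have : 0 <= m * nrm by apply: mulr_ge0 => //; lra.
  have : m * nrm <= ks * (m * nrm) by apply: ler_peMl => //; apply: mulr_ge0 => //; lra.
  have -> : 2 * ks * m * (3 * nrm) = 6 * (ks * (m * nrm)) by ring.
  have -> : 3 * m * nrm = 3 * (m * nrm) by ring.
  lra.
have -> : 2 * ks * m * (W * p ^+ 2 + 3 * nrm) = 2 * (m * (ks * (W * p ^+ 2))) +
  2 * ks * m * (3 * nrm) by ring.
have p_termE : m * ks * (W * p ^+ 2) = m * (ks * (W * p ^+ 2)) by ring.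
lra.
Qed.

Lemma weighted_sqr_growth i y x s : 0 <= y -> y <= x -> x <= s -> s < 1 ->
  weighted_sqr i.+1 x <= (weighted_sqr i.+1 y + 3 * geg_sqnorm i.+1) * expR (2 / (1 - s ^+
    2) * M i.+1 * (x - y)).
Proof.
move=> y0 yx xs s1.
set k := 2 / (1 - s ^+ 2) * M i.+1.
have n0 := ltW (geg_sqnorm_gt0 i.+1).
pose G t := (weighted_sqr i.+1 t + 3 * geg_sqnorm i.+1) * expR (- (k * t)).
have damped_le : G x <= G y.
  apply: (@der_le0_ge _ G (fun t => 2 * (geg_weight t * (P i.+1).[t] * sonin_slope i.+1 t / (1 - t
    ^+ 2)) * expR (- (k * t)) + (weighted_sqr i.+1 t +
    3 * geg_sqnorm i.+1) * (expR (- (k * t)) * - k)) _ _ yx _ _) => t /andP[ty tx].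
    apply: derM.
      apply: der_eq; first by apply: derD; [apply: der_weighted_sqr; apply: sqr_lt1; lra|exact: der_cst].
      by rewrite addr0.
    apply: der_expR; apply: derN; apply: der_eq; first by apply: derZ; exact: der_id.
    by rewrite mulr1.
  have -> (a b e : R) : a * e + b * (e * - k) = (a - k * b) * e by ring.
  rewrite pmulr_lle0 ?expR_gt0// subr_le0.
  have t0 : 0 <= t by lra.
  have t1 : t < 1 by lra.
  apply: (slope_le_of_sonin_bound lambda_gt1 (lambda_le_shift i.+1) (sqr_ge0 t) _ _ (expR_ge0 _) n0
    (sonin_le i t0 t1)).
    by rewrite lerXn2r ?nnegrE//; lra.
  by apply: sqr_lt1; lra.
move: damped_le; rewrite /G !expRN ler_pdivrMr ?expR_gt0// => damped_le.
apply: le_trans (_ : weighted_sqr i.+1 x + 3 * geg_sqnorm i.+1 <= _); first by lra.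
apply: le_trans damped_le _; rewrite -mulrA mulrBr expRB mulrC [X in _ <= _ * X]mulrC.
by rewrite mulrC.
Qed.

Lemma geg_ratio_ge i x : 0 < x -> 4 * c i <= x ^+ 2 -> forall j, (j <= i)%N ->
  0 < (P j).[x] /\ x / 2 * (P j).[x] <= (P j.+1).[x].
Proof.
move=> x0 ci; elim=> [|j ih] ji.
  by rewrite geg0 geg1 !hornerE; split=> //; lra.
have [p0 pj] := ih (ltnW ji); have p1 : 0 < (P j.+1).[x].
  by apply: lt_le_trans pj; apply: mulr_gt0 => //; lra.
split=> //; rewrite horner_gegS.
have coef_le : 4 * c j.+1 <= x ^+ 2 by apply: le_trans ci; rewrite ler_pM2l//; exact: geg_coef_le.
have coef_term_le : c j.+1 * (P j).[x] <= x ^+ 2 / 4 * (P j).[x] by apply: ler_wpM2r; lra.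
have quarter_le : x ^+ 2 / 4 * (P j).[x] <= x / 2 * (P j.+1).[x].
  have -> : x ^+ 2 / 4 * (P j).[x] = x / 2 * (x / 2 * (P j).[x]) by field.
  by apply: ler_wpM2l => //; lra.
lra.
Qed.

Lemma geg_at1S i : (P i.+1).[1] = (i%:R + 2 * lam) / (2 * M i) * (P i).[1].
Proof.
have := geg_deriv_up i 1; have := lambda_gt1; have := lambda_le_shift i => shift_ge lam_gt1.
rewrite expr1n subrr mul0r mulr1 => /esym/eqP; rewrite subr_eq0 => /eqP recE.
by rewrite mulrAC recE; field; lra.
Qed.

Lemma geg_at1_gt0 i : 0 < (P i).[1].
Proof.
elim: i => [|i ih]; first by rewrite geg0 hornerE.
have := lambda_gt1; have := lambda_le_shift i => shift_ge lam_gt1; have i0 : (0 : R) <= i%:R by rewrite ler0n.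
by rewrite geg_at1S; apply: mulr_gt0 => //; apply: divr_gt0; lra.
Qed.

Lemma deriv_geg_at1 i : (2 * lam + 1) * (P i)^`().[1] = i%:R * (i%:R + 2 * lam) * (P i).[1].
Proof.
elim/two_step_ind: i => [||i ih1 ih2].
- by rewrite deriv_geg0 !hornerE; ring.
- by rewrite geg1 derivX !hornerE; ring.
have l1 := lambda_gt1.
have l2 : 2 * lam + 1 != 0 by lra.
have solve (a b : R) : (2 * lam + 1) * a = b -> a = b / (2 * lam + 1) by move=> <-;
  rewrite mulrAC mulfV// mul1r.
rewrite horner_deriv_gegS (solve _ _ ih1) (solve _ _ ih2) !geg_at1S geg_coefE.
move: l1; have := lambda_le_shift i; have i0 : (0 : R) <= i%:R by rewrite ler0n.
have e1 : i.+1%:R = i%:R + 1 :> R by rewrite natr1.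
have e2 : i.+2%:R = i%:R + 1 + 1 :> R by rewrite !natr1.
rewrite e2 e1; move: (P i).[1] i0 => p; move: (i%:R : R) (lam) => k l k_ge0 shift_ge lam_gt1.
by field; lra.
Qed.

Section decay.
Variables (i : nat) (s k : R).
Hypotheses (s_gt0 : 0 < s) (s_lt1 : s < 1) (k_gt0 : 0 < k).
Hypothesis coef_le : 4 * c i <= s ^+ 2.
Hypothesis rate_ge : i%:R * (i%:R + 2 * lam) + k ^+ 2 * (1 - s ^+ 2) <= (2 * lam + 1) * s * k.
Local Notation degree_form := (i%:R * (i%:R + 2 * lam)).

Lemma geg_gt0 t : s <= t -> 0 < (P i).[t].
Proof.
have s0 := s_gt0; move=> st; have [] := @geg_ratio_ge i t _ _ i (leqnn i) => //; first by lra.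
by apply: le_trans coef_le _; rewrite lerXn2r ?nnegrE//; lra.
Qed.

Definition decay_defect : {poly R} := (P i)^`() - k *: P i.

Lemma horner_decay_defect t : decay_defect.[t] = (P i)^`().[t] - k * (P i).[t].
Proof. by rewrite !hornerE. Qed.

Lemma decay_defect_at1_lt0 : decay_defect.[1] < 0.
Proof.
have l1 := lambda_gt1; have l2 : 0 < 2 * lam + 1 by lra.
have s1 := s_lt1; have k0 := k_gt0; have rate := rate_ge.
rewrite horner_decay_defect -(pmulr_rlt0 _ l2) mulrBr deriv_geg_at1 mulrA -mulrBl.
rewrite pmulr_llt0 ?geg_at1_gt0// subr_lt0.
have rate1 : (2 * lam + 1) * s * k <= (2 * lam + 1) * k.
  by rewrite -mulrA; apply: ler_wpM2l; [lra|rewrite ler_piMl//; lra].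
have : 0 < k ^+ 2 * (1 - s ^+ 2).
  by apply: mulr_gt0; [exact: exprn_gt0|have := sqr_lt1 (ltW s_gt0) s1; lra].
lra.
Qed.

Definition scaled_defect t : R :=
  expR ((lam + 2^-1) * ln (1 - t ^+ 2)) * (expR (k * t) * decay_defect.[t]).

Lemma der_scaled_defect t : t ^+ 2 < 1 -> der scaled_defect t
  (expR ((lam + 2^-1) * ln (1 - t ^+ 2)) * expR (k * t) * (P i).[t] *
    (((2 * lam + 1) * t * k - k ^+ 2 * (1 - t ^+ 2) - degree_form) / (1 - t ^+ 2))).
Proof.
move=> t1; have t0 : 1 - t ^+ 2 != 0 by lra.
apply: der_eq.
  apply: derM; first exact: der_one_sub_sqr_powR.
  apply: derM; last exact: der_horner.
  by apply: der_expR; apply: derZ; exact: der_id.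
have -> : decay_defect^`().[t] = (P i)^`()^`().[t] - k * (P i)^`().[t].
  by rewrite derivB derivZ !hornerE.
rewrite horner_decay_defect; have := geg_ode i t1.
move: (expR _) (expR _) (P i)^`()^`().[t] (P i)^`().[t] (P i).[t] => W E p2 p1 p ode.
have -> : p2 = ((2 * lam + 1) * t * p1 - degree_form * p) / (1 - t ^+ 2).
  by rewrite -ode mulrAC mulfV// mul1r.
by move: lam degree_form k => l L K; field.
Qed.

Lemma scaled_defect_le t r : s <= t -> t <= r -> r < 1 -> scaled_defect t <= scaled_defect r.
Proof.
have s0 := s_gt0; move=> st tr r1.
apply: der_ge0_le tr (fun z hz => der_scaled_defect _) _ => z /andP[tz zr].
  by apply: sqr_lt1; lra.
have z1 : z ^+ 2 < 1 by apply: sqr_lt1; lra.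
have sz : s <= z by exact: le_trans tz.
apply: mulr_ge0.
  by apply: mulr_ge0; [apply: mulr_ge0; exact: expR_ge0|apply: ltW; exact: geg_gt0].
apply: divr_ge0; last by lra.
have sqr_sz : s ^+ 2 <= z ^+ 2 by apply: lerXn2r => //; rewrite nnegrE; lra.
have quad_le : k ^+ 2 * (1 - z ^+ 2) <= k ^+ 2 * (1 - s ^+ 2).
  by apply: ler_wpM2l; [exact: sqr_ge0|lra].
have linear_le : (2 * lam + 1) * s * k <= (2 * lam + 1) * z * k.
  apply: ler_wpM2r; first exact: ltW k_gt0.
  by apply: ler_wpM2l => //; have := lambda_gt1; lra.
have := rate_ge; lra.
Qed.

(* A positive value at t would, [scaled_defect] being nondecreasing, exclude a zero in [t, 1),
   although the defect is negative at 1. *)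
Lemma decay_defect_le0 t : s <= t -> t <= 1 -> decay_defect.[t] <= 0.
Proof.
move=> st t1; have defect1 := decay_defect_at1_lt0.
rewrite leNgt; apply/negP => defect_gt0.
have [r /andP[tr r1] root_r] : exists2 r, t <= r <= 1 & root decay_defect r.
  have [|r r1 root_r] := @poly_ivt _ (- decay_defect) t 1 t1; last by exists r => //; rewrite rootN in root_r.
  by rewrite !hornerN; apply/andP; split; lra.
have r_lt1 : r < 1.
  rewrite lt_neqAle r1 andbT; apply/eqP => re; move: root_r; rewrite re => /rootP defect0.
  by rewrite defect0 ltxx in defect1.
have := scaled_defect_le st tr r_lt1.
rewrite /scaled_defect (rootP root_r) !mulr0 leNgt => /negP; apply.
by apply: mulr_gt0; [exact: expR_gt0|apply: mulr_gt0 => //; exact: expR_gt0].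
Qed.

Lemma geg_decay x : s <= x -> x <= 1 -> (P i).[x] <= (P i).[s] * expR (k * (x - s)).
Proof.
move=> sx x1.
have : (P i).[x] * expR (- (k * x)) <= (P i).[s] * expR (- (k * s)).
  apply: (@der_le0_ge _ (fun t => (P i).[t] * expR (- (k * t))) (fun t => (P i)^`().[t] * expR (-
    (k * t)) + (P i).[t] * (expR (- (k * t)) * - k)) _ _ sx _ _) => t /andP[st tx].
    apply: derM; first exact: der_horner.
    apply: der_expR; apply: derN; apply: der_eq; first by apply: derZ; exact: der_id.
    by rewrite mulr1.
  have -> (a b e : R) : a * e + b * (e * - k) = (a - k * b) * e by ring.
  by rewrite pmulr_lle0 ?expR_gt0// -horner_decay_defect; apply: decay_defect_le0 => //; lra.
rewrite !expRN ler_pdivrMr ?expR_gt0// => /le_trans; apply.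
by rewrite mulrBr expRB mulrA mulrAC.
Qed.

End decay.

End gegenbauer.

(** * The linear programming bound *)

Section lp.
Context {R : realType}.
Variable N : nat.
Hypothesis N5 : (4 < N)%N.
Implicit Types (i j m k : nat) (p q : {poly R}).
Local Notation c := (geg_coef R N).
Local Notation P := (geg R N).
Local Notation geg_sqnorm := (@geg_sqnorm R N).

Variable L : {poly R} -> R.
Hypothesis functionalD : forall p q, L (p + q) = L p + L q.
Hypothesis functionalZ : forall (a : R) p, L (a *: p) = a * L p.
Hypothesis functional_geg_ge0 : forall i, 0 <= L (P i).

Definition turan m n : {poly R} :=
  if m is m'.+1 then P m * P n - P m' * P n.+1 else P n.

Lemma turanS_ring (A : comNzRingType) (X p0 p1 q0 q1 a b : A) :
  (X * p1 - a * p0) * q1 - p1 * (X * q1 - b * q0) = (b - a) * (p1 * q0) + a * (p1 * q0 - p0 * q1).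
Proof. by ring. Qed.

Lemma turanS0_ring (A : comNzRingType) (X q0 q1 b : A) :
  X * q1 - 1 * (X * q1 - b * q0) = b * (1 * q0).
Proof. by ring. Qed.

Lemma turanS m n : turan m.+1 n.+1 = (c n.+1 - c m) *: (P m * P n) + c m *: turan m n.
Proof.
rewrite /turan gegS; case: m => [|m].
  rewrite geg0 geg1 geg_coef0 subr0 scale0r addr0 -!mul_polyC.
  exact: turanS0_ring.
rewrite [in LHS]gegS -!mul_polyC polyCB; exact: turanS_ring.
Qed.

(* Askey's induction for the nonnegativity of the linearization coefficients of P_m P_n, carried
   out under a functional that is nonnegative on the basis. *)
Lemma functional_gegM_ge m n : (m <= n)%N ->
  (m == n)%:R * geg_sqnorm m * L 1 <= L (P m * P n) /\ (m == n)%:R * geg_sqnorm m * L 1 <= L (turan m n).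
Proof.
elim: m n => [|m ih] n mn.
  rewrite /turan geg0 mul1r /= mulr1; case: n mn => [|n] _.
    by rewrite geg0 eqxx mul1r.
  by rewrite /= !mul0r.
case: n mn => [//|n]; rewrite ltnS => mn; have [prod_ge turan_ge] := ih n mn.
have turanS_ge : (m.+1 == n.+1)%:R * geg_sqnorm m.+1 * L 1 <= L (turan m.+1 n.+1).
  rewrite turanS functionalD !functionalZ eqSS.
  have c1 : 0 <= c n.+1 - c m by rewrite subr_ge0; apply: geg_coef_le => //; exact: leqW.
  have := ler_wpM2l c1 prod_ge; have := ler_wpM2l (geg_coef_ge0 N5 m) turan_ge.
  case: eqP => [->|_]; rewrite ?mul1r ?mul0r ?mulr0 /=; last by lra.
  have -> : c n.+1 * geg_sqnorm n * L 1 = (c n.+1 - c n) * (geg_sqnorm n * L 1) +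
    c n * (geg_sqnorm n * L 1) by ring.
  lra.
split=> //; have [next_ge _] := ih n.+2 (leqW (leqW mn)).
have -> : P m.+1 * P n.+1 = turan m.+1 n.+1 + P m * P n.+2 by rewrite /turan subrK.
rewrite functionalD; move: next_ge; rewrite (_ : (m == n.+2) = false) ?mul0r; first by lra.
by apply/negbTE; rewrite neq_ltn ltnS (leqW mn).
Qed.

Definition ngeg i : {poly R} := (Num.sqrt (geg_sqnorm i))^-1 *: P i.
Local Notation Q := ngeg.

Lemma sqrt_geg_sqnorm_gt0 i : 0 < Num.sqrt (geg_sqnorm i).
Proof. by rewrite sqrtr_gt0 geg_sqnorm_gt0. Qed.

Lemma functional_ngegM_ge i j : (i == j)%:R * L 1 <= L (Q i * Q j).
Proof.
wlog ij : i j / (i <= j)%N.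
  by move=> prod_ge; case: (leqP i j) => [|/ltnW] /prod_ge//; rewrite eq_sym [Q j * _]mulrC.
have [prod_ge _] := functional_gegM_ge ij; have n0 := sqrt_geg_sqnorm_gt0 i; have n0' :=
  sqrt_geg_sqnorm_gt0 j.
rewrite /ngeg -scalerAl -scalerAr scalerA functionalZ.
have r0 : 0 <= (Num.sqrt (geg_sqnorm i))^-1 / Num.sqrt (geg_sqnorm j) by apply: divr_ge0;
  rewrite ?invr_ge0; exact: ltW.
apply: le_trans (ler_wpM2l r0 prod_ge); case: eqP => [e|_]; rewrite ?mul0r ?mulr0// !mul1r.
rewrite -e -invfM -expr2 sqr_sqrtr; last exact: ltW (geg_sqnorm_gt0 N5 i).
by rewrite mulKf// gt_eqF// geg_sqnorm_gt0.
Qed.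

Lemma functional1_ge0 : 0 <= L 1.
Proof. by have := functional_geg_ge0 0; rewrite geg0. Qed.

Lemma functional_ngegM_ge0 i j : 0 <= L (Q i * Q j).
Proof. by apply: le_trans (functional_ngegM_ge i j); apply: mulr_ge0;
  [exact: ler0n|exact: functional1_ge0]. Qed.

Lemma mulX_ngeg i : 'X * Q i.+1 = Num.sqrt (c i.+2) *: Q i.+2 + Num.sqrt (c i.+1) *: Q i.
Proof.
have s0 := sqrt_geg_sqnorm_gt0 i; have s1 := sqrt_geg_sqnorm_gt0 i.+1.
have c1 : 0 < Num.sqrt (c i.+1) by rewrite sqrtr_gt0 geg_coefS_gt0.
have c2 : 0 < Num.sqrt (c i.+2) by rewrite sqrtr_gt0 geg_coefS_gt0.
have sqrt_nrmS : Num.sqrt (geg_sqnorm i.+1) =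
  Num.sqrt (c i.+1) * Num.sqrt (geg_sqnorm i) by rewrite /= sqrtrM// geg_coef_ge0.
have sqrt_nrmSS : Num.sqrt (geg_sqnorm i.+2) =
  Num.sqrt (c i.+2) * Num.sqrt (geg_sqnorm i.+1) by rewrite /= [in LHS]sqrtrM// geg_coef_ge0.
rewrite /ngeg (gegS R N i) !scalerA sqrt_nrmSS invfM mulVKf ?gt_eqF// -scalerAr scalerBr scalerA.
suff -> : (Num.sqrt (geg_sqnorm i.+1))^-1 * c i.+1 =
  Num.sqrt (c i.+1) / Num.sqrt (geg_sqnorm i) by rewrite subrK.
rewrite sqrt_nrmS -{2}[c i.+1]sqr_sqrtr ?geg_coef_ge0//; field.
by rewrite !gt_eqF.
Qed.

Lemma functionalB p q : L (p - q) = L p - L q.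
Proof. by rewrite functionalD -scaleN1r functionalZ mulN1r. Qed.
Lemma functionalZl (a : R) p q : L ((a *: p) * q) = a * L (p * q).
Proof. by rewrite -scalerAl functionalZ. Qed.
Lemma functionalZr (a : R) p q : L (p * (a *: q)) = a * L (p * q).
Proof. by rewrite -scalerAr functionalZ. Qed.
Lemma functional0 : L 0 = 0.
Proof. by rewrite -(scale0r 0) functionalZ mul0r. Qed.
Lemma functional_sum n (F : 'I_n -> {poly R}) : L (\sum_(i < n) F i) = \sum_(i < n) L (F i).
Proof. by apply: (big_morph L) => [p q|]; [exact: functionalD|exact: functional0]. Qed.

Variables (i0 K : nat).
Hypothesis K0 : (0 < K)%N.
(* The second differences of [lp_weight] are -2 and [lp_weight] >= K on 1..K,
   so that ('X - lp_shift) lp_poly has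
   nonnegative coefficients. *)
Definition lp_weight j : R := j%:R * (K%:R + 1 - j%:R).

Lemma lp_weight_sum_by_parts (G : nat -> R) n :
  \sum_(j < n) lp_weight j.+1 * (G j.+2 + G j - 2 * G j.+1) =
  lp_weight 1 * G 0 + lp_weight n * G n.+1 - lp_weight n.+1 * G n - 2 * \sum_(j < n) G j.+1.
Proof.
elim: n => [|n ih]; first by rewrite !big_ord0 /lp_weight; ring.
rewrite !big_ord_recr /= ih /lp_weight -!natr1; ring.
Qed.

Lemma lp_weight_ge j : (j < K)%N -> K%:R <= lp_weight j.+1.
Proof.
move=> jK; rewrite /lp_weight -natr1 -subr_ge0.
have -> : (j%:R + 1) * (K%:R + 1 - (j%:R + 1)) - K%:R = j%:R * (K%:R - (j%:R + 1)) :> R by ring.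
by apply: mulr_ge0; rewrite ?ler0n// subr_ge0 natr1 ler_nat.
Qed.

Lemma lp_weight_ge0 j : (j < K)%N -> 0 <= lp_weight j.+1.
Proof. by move=> /lp_weight_ge; apply: le_trans; rewrite ler0n. Qed.

Lemma lp_weight_second_diff_ge0 (G : nat -> R) : (forall j, 0 <= G j) ->
  0 <= \sum_(j < K) lp_weight j.+1 * (G j.+2 + G j - 2 * (1 - K%:R^-1) * G j.+1).
Proof.
move=> G0; have k0 : (0 : R) < K%:R by rewrite ltr0n.
have -> : \sum_(j < K) lp_weight j.+1 * (G j.+2 + G j - 2 * (1 - K%:R^-1) * G j.+1) =
   \sum_(j < K) lp_weight j.+1 * (G j.+2 + G j - 2 * G j.+1) +
     2 * \sum_(j < K) (lp_weight j.+1 / K%:R * G j.+1).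
  by rewrite mulr_sumr -big_split; apply: eq_bigr => j _ /=; ring.
rewrite lp_weight_sum_by_parts.
have w1 : 0 <= lp_weight 1 * G 0 by apply: mulr_ge0 => //; exact: lp_weight_ge0.
have w2 : 0 <= lp_weight K * G K.+1.
  by apply: mulr_ge0 => //; have := @lp_weight_ge0 K.-1; rewrite prednK//; apply.
have w3 : lp_weight K.+1 = 0 by rewrite /lp_weight -natr1 subrr mulr0.
have : \sum_(j < K) G j.+1 <= \sum_(j < K) (lp_weight j.+1 / K%:R * G j.+1).
  apply: ler_sum => j _; rewrite ler_peMl// ler_pdivlMr// mul1r; exact: lp_weight_ge.
rewrite w3 mul0r; lra.
Qed.

Lemma scalerD_mull (a b l : R) (u v w z : {poly R}) :
  (a *: u + b *: v - l *: w) * z = a *: (u * z) + b *: (v * z) - l *: (w * z).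
Proof. by rewrite mulrBl mulrDl -!scalerAl. Qed.

Definition lp_poly : {poly R} := \sum_(j < K) lp_weight j.+1 *: Q (i0 + j.+1).
Definition lp_shift : R := 2 * Num.sqrt (c i0.+1) * (1 - K%:R^-1).

Lemma functional_shift_ngeg_ge0 k : 0 <= L (('X - lp_shift%:P) * lp_poly * Q k).
Proof.
pose G j := L (Q (i0 + j) * Q k).
have G0 j : 0 <= G j by exact: functional_ngegM_ge0.
set be := Num.sqrt (c i0.+1).
have b0 : 0 <= be by exact: sqrtr_ge0.
have bj j : be <= Num.sqrt (c (i0 + j.+1)).
  by apply: ler_wsqrtr; apply: geg_coef_le => //; rewrite addnS ltnS leq_addr.
have -> : ('X - lp_shift%:P) * lp_poly * Q k = \sum_(j < K) lp_weight j.+1 *: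
   (Num.sqrt (c (i0 + j.+2)) *: (Q (i0 + j.+2) * Q k) + Num.sqrt (c (i0 + j.+1)) *: (Q (i0 +
     j) * Q k) - lp_shift *: (Q (i0 + j.+1) * Q k)).
  rewrite /lp_poly mulr_sumr mulr_suml; apply: eq_bigr => j _.
  rewrite -[_ * (lp_weight _ *: _)]scalerAr -[(lp_weight _ *: _) * _]scalerAl; congr (_ *: _).
  by rewrite mulrBl addnS mulX_ngeg mul_polyC !addnS; exact: scalerD_mull.
rewrite functional_sum.
apply: le_trans (_ : be * \sum_(j < K) lp_weight j.+1 * (G j.+2 + G j - 2 * (1 - K%:R^-1) * G j.+1) <= _).
  by apply: mulr_ge0 => //; exact: lp_weight_second_diff_ge0.
rewrite mulr_sumr; apply: ler_sum => j _;
  rewrite functionalZ functionalB functionalD !functionalZ mulrCA; apply: ler_wpM2l;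
  first exact: lp_weight_ge0.
have up_le := ler_wpM2r (G0 j.+2) (bj j.+1); have down_le := ler_wpM2r (G0 j) (bj j).
rewrite /lp_shift -/be -!/(G _).
have -> : be * (G j.+2 + G j - 2 * (1 - K%:R^-1) * G j.+1) = be * G j.+2 +
  be * G j - 2 * be * (1 - K%:R^-1) * G j.+1 by ring.
by apply: lerB => //; apply: lerD.
Qed.

Lemma functional_shift_sqr_ge0 : 0 <= L (('X - lp_shift%:P) * lp_poly * lp_poly).
Proof.
rewrite {2}/lp_poly mulr_sumr functional_sum; apply: sumr_ge0 => j _.
by rewrite functionalZr; apply: mulr_ge0; [exact: lp_weight_ge0|exact: functional_shift_ngeg_ge0].
Qed.

Lemma functional_sqr_ge : (\sum_(j < K) lp_weight j.+1 ^+ 2) * L 1 <= L (lp_poly * lp_poly).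
Proof.
rewrite {1}/lp_poly [X in _ <= L X]mulr_suml functional_sum mulr_suml; apply: ler_sum => j _.
rewrite functionalZl /lp_poly mulr_sumr functional_sum expr2 -mulrA; apply: ler_wpM2l;
  first exact: lp_weight_ge0.
rewrite (bigD1 j)//= functionalZr.
have diag_ge : lp_weight j.+1 * L 1 <= lp_weight j.+1 * L (Q (i0 + j.+1) * Q (i0 + j.+1)).
  by apply: ler_wpM2l; [exact: lp_weight_ge0|have := functional_ngegM_ge (i0 + j.+1) (i0 + j.+1);
    rewrite eqxx mul1r].
apply: le_trans diag_ge _; rewrite lerDl; apply: sumr_ge0 => k _.
by rewrite functionalZr; apply: mulr_ge0; [exact: lp_weight_ge0|exact: functional_ngegM_ge0].
Qed.

Lemma functional_test_ge (s' : R) : s' <= lp_shift ->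
  (lp_shift - s') * (\sum_(j < K) lp_weight j.+1 ^+ 2) * L 1 <= L (('X - s'%:P) * (lp_poly * lp_poly)).
Proof.
move=> ss.
have -> : ('X - s'%:P) * (lp_poly * lp_poly) = ('X - lp_shift%:P) * lp_poly * lp_poly +
  (lp_shift - s') *: (lp_poly * lp_poly).
  by rewrite -mul_polyC polyCB -mulrA -mulrDl addrA subrK.
rewrite functionalD functionalZ -mulrA; have gap_ge0 : 0 <= lp_shift - s' by lra.
have := ler_wpM2l gap_ge0 functional_sqr_ge; have := functional_shift_sqr_ge0; lra.
Qed.

Lemma sqr_lp_poly_le (t : R) : lp_poly.[t] ^+ 2 <=
  (\sum_(j < K) lp_weight j.+1 ^+ 2) * \sum_(j < K) (P (i0 + j.+1)).[t] ^+ 2 / geg_sqnorm (i0 + j.+1).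
Proof.
have := dot_sqr_le (\row_(j < K) lp_weight j.+1) (\row_(j < K) (Q (i0 + j.+1)).[t]).
rewrite !norm2E /dot /lp_poly horner_sum.
under eq_bigr do rewrite !mxE.
under [X in _ <= X * _ -> _]eq_bigr do rewrite mxE -expr2.
under [X in _ <= _ * X -> _]eq_bigr => j _.
  rewrite mxE -expr2 /ngeg hornerZ exprMn exprVn sqr_sqrtr ?[_^-1 * _]mulrC;
    last exact: ltW (geg_sqnorm_gt0 N5 _).
  over.
by under [X in _ -> X ^+ 2 <= _]eq_bigr do rewrite hornerZ.
Qed.

End lp.

Section lp_code.
Context {R : realType}.
Variable N : nat.
Hypothesis N5 : (4 < N)%N.
Variables (T : finType) (x : T -> 'rV[R]_N) (A : {set T}).
Hypothesis x_unit : forall c, norm2 (x c) = 1.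

Definition dot_functional (p : {poly R}) := \sum_(c in A) \sum_(c' in A) p.[dot (x c) (x c')].
Local Notation L := dot_functional.

Lemma dot_functionalD p q : L (p + q) = L p + L q.
Proof.
rewrite /L -big_split; apply: eq_bigr => c _; rewrite -big_split; apply: eq_bigr => c' _.
by rewrite hornerD.
Qed.

Lemma dot_functionalZ (a : R) p : L (a *: p) = a * L p.
Proof.
rewrite /L mulr_sumr; apply: eq_bigr => c _; rewrite mulr_sumr; apply: eq_bigr => c' _.
by rewrite hornerZ.
Qed.

Lemma dot_functional_geg_ge0 i : 0 <= L (geg R N i).
Proof. by apply: geg_posdef => [|c]; [exact: ltnW (ltnW N5)|rewrite -norm2E]. Qed.

Lemma dot_functional1 : L 1 = #|A|%:R ^+ 2.
Proof.
rewrite /L -polyC1; under eq_bigr do under eq_bigr do rewrite hornerC.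
by rewrite !sumr_const expr2 mulr_natr.
Qed.

Variables (i0 K : nat) (y D B k : R).
Hypothesis K_gt0 : (0 < K)%N.
Hypothesis y_bounds : 0 <= y < 1.
Hypothesis y_lt_shift : y < lp_shift N i0 K.
Hypothesis B_ge0 : 0 <= B.
Hypothesis geg_at1_le_D : forall j, (i0 < j <= i0 + K)%N -> (geg R N j).[1] ^+ 2 <= D * geg_sqnorm N j.
Hypothesis geg_le_B : forall j t, (i0 < j <= i0 + K)%N -> y <= t -> t <= 1 ->
  (geg R N j).[t] ^+ 2 <= B * expR (k * (t - 1)) * geg_sqnorm N j.
Local Notation h := (lp_poly N i0 K : {poly R}).
Local Notation W := (\sum_(j < K) lp_weight K j.+1 ^+ 2 : R).

Lemma lp_weight_sqr_sum_gt0 : 0 < W.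
Proof.
rewrite (bigD1 (Ordinal K_gt0))//=; apply: ltr_pwDl; last by apply: sumr_ge0 => j _; exact: sqr_ge0.
apply: exprn_gt0; apply: (@lt_le_trans _ _ K%:R); first by rewrite ltr0n.
exact: lp_weight_ge.
Qed.

Lemma test_poly_le (t e : R) : t <= 1 -> 0 <= e ->
  (y <= t -> forall j, (i0 < j <= i0 + K)%N -> (geg R N j).[t] ^+ 2 <= e * geg_sqnorm N j) ->
  (('X - y%:P) * (h * h)).[t] <= W * (K%:R * e).
Proof.
have W0 := lp_weight_sqr_sum_gt0.
move=> t1 e0 geg_le; rewrite !hornerM hornerXsubC -expr2.
have [yt|ty] := lerP y t; last first.
  apply: (@le_trans _ _ 0); last by rewrite !mulr_ge0 ?ler0n// ltW.
  by apply: mulr_le0_ge0; [lra|exact: sqr_ge0].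
apply: le_trans (_ : h.[t] ^+ 2 <= _).
  by rewrite ler_piMl ?sqr_ge0//; have /andP[? ?] := y_bounds; lra.
apply: le_trans (sqr_lp_poly_le N5 _ _ _) _; apply: ler_wpM2l; first exact: ltW.
rewrite mulr_natl -[X in _ *+ X](card_ord K) -sumr_const; apply: ler_sum => j _.
rewrite ler_pdivrMr ?geg_sqnorm_gt0//; apply: geg_le => //.
by rewrite addnS ltnS leq_addr /= -addnS leq_add2l.
Qed.

Lemma dot_functional_test_le : L (('X - y%:P) * (h * h)) <= W * (K%:R *
  (#|A|%:R * D + B * total_weight (fun c c' => expR (- (k * hdist x c c'))) A)).
Proof.
have D0 : 0 <= D.
  have i0S : (i0 < i0.+1 <= i0 + K)%N by rewrite leqnn /= -addn1 leq_add2l.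
  rewrite -(pmulr_lge0 _ (geg_sqnorm_gt0 N5 i0.+1)); apply: le_trans (geg_at1_le_D i0S).
  exact: sqr_ge0.
rewrite (_ : #|A|%:R * D = \sum_(c in A) D); last by rewrite sumr_const mulr_natl.
rewrite [B * _]mulr_sumr -big_split /= [K%:R * _]mulr_sumr [W * _]mulr_sumr; apply: ler_sum => c cA.
rewrite (bigD1 c)//= -norm2E x_unit !mulrDr; apply: lerD.
  by apply: test_poly_le => // _ j; exact: geg_at1_le_D.
rewrite [B * _]mulr_sumr [K%:R * _]mulr_sumr [W * _]mulr_sumr; apply: ler_sum => c' _.
have t1 : dot (x c) (x c') <= 1.
  by have := dot_unit (x_unit c) (x_unit c'); rewrite ler_norml => /andP[].
apply: test_poly_le => //; first by apply: mulr_ge0 => //; exact: expR_ge0.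
by move=> yt j jK; rewrite -mulrN /hdist opprB; exact: geg_le_B.
Qed.

Lemma lp_code_bound : (lp_shift N i0 K - y) * #|A|%:R ^+ 2 <= K%:R *
  (#|A|%:R * D + B * total_weight (fun c c' => expR (- (k * hdist x c c'))) A).
Proof.
rewrite -(ler_pM2l lp_weight_sqr_sum_gt0); apply: le_trans dot_functional_test_le;
  rewrite -dot_functional1 mulrA [W * _]mulrC.
refine (functional_test_ge N5 dot_functionalD dot_functionalZ dot_functional_geg_ge0 K_gt0 (ltW y_lt_shift)).
Qed.

End lp_code.

Section lp_exponent.
Context {R : realType}.

Lemma bin_prob_le1 (p : R) m i : 0 <= p <= 1 -> (i <= m)%N ->
  'C(m, i)%:R * (1 - p) ^+ (m - i) * p ^+ i <= 1.
Proof.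
move=> /andP[p0 p1] im; have := exprDn (1 - p) p m; rewrite subrK expr1n => e; rewrite [leRHS]e.
have im' : (i < m.+1)%N by rewrite ltnS.
rewrite (bigD1 (Ordinal im'))//= -mulrA mulr_natl lerDl; apply: sumr_ge0 => j _.
by apply: mulrn_wge0; apply: mulr_ge0; apply: exprn_ge0; lra.
Qed.

Lemma bin_expR_le (p : R) m i : 0 < p < 1 ->
  'C(m + i, i)%:R <= expR (- (i%:R * ln p) - m%:R * ln (1 - p)).
Proof.
move=> /andP[p0 p1]; have prob_le1 := @bin_prob_le1 p (m + i) i; rewrite addnK in prob_le1.
have q0 : 0 < 1 - p by lra.
rewrite -opprD expRN -div1r ler_pdivlMr ?expR_gt0// expRD !expRM_natl !lnK ?posrE//.
rewrite [p ^+ i * _]mulrC mulrA; apply: prob_le1; last exact: leq_addl.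
by apply/andP; split; lra.
Qed.

Lemma sqr_geg_at1 n i : (4 < n)%N ->
  (geg R n i).[1] ^+ 2 * (n%:R / 2 - 1) = (i%:R + (n%:R / 2 - 1)) * 'C(n - 3 + i, i)%:R * geg_sqnorm n i.
Proof.
move=> n5; have l1 := @lambda_gt1 R n n5.
elim: i => [|i ih]; first by rewrite geg0 addn0 bin0 hornerE expr1n /=; ring.
have i0 : (0 : R) <= i%:R by rewrite ler0n.
have succE : (n - 3 + i).+1%:R = i%:R + n%:R - 2 :> R.
  by rewrite -natr1 natrD natrB ?(ltnW (ltnW n5))//; ring.
have binE : 'C(n - 3 + i.+1, i.+1)%:R = (i%:R + n%:R - 2) * 'C(n - 3 + i, i)%:R / (i%:R + 1) :> R.
  have := mul_bin_diag (n - 3 + i).+1 i; rewrite /= -addnS => bin_diag.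
  have := congr1 (fun k => k%:R : R) bin_diag; rewrite /= !natrM addnS succE => ->.
  by rewrite -natr1 mulrAC mulfV ?mul1r//; lra.
rewrite geg_at1S// exprMn -[_ * _ * (n%:R / 2 - 1)]mulrA ih binE /= geg_coefE// -(natr1 i).
move: l1 ('C(_, _)%:R) (geg_sqnorm n i) i0 => l1 C v i0.
move: (i%:R) (n%:R) l1 i0 => k N l1 i0.
by field; lra.
Qed.

Lemma sqr_geg_at1_le n i (p : R) : (4 < n)%N -> 0 < p < 1 ->
  (geg R n i).[1] ^+ 2 <= (1 + 4 * (i%:R / n%:R)) * expR (- (i%:R * ln p) - n%:R * ln (1 - p)) *
    geg_sqnorm n i.
Proof.
move=> n5 p01; have l1 := @lambda_gt1 R n n5; have l0 : 0 < n%:R / 2 - 1 :> R by lra.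
have n5' : (5 : R) <= n%:R by rewrite (ler_nat R 5).
rewrite -(ler_pM2r l0) sqr_geg_at1// [leRHS]mulrAC; apply: ler_wpM2r; first exact: ltW (geg_sqnorm_gt0 _ _).
rewrite mulrAC; apply: ler_pM; rewrite ?ler0n//.
- by have : (0 : R) <= i%:R; [rewrite ler0n|lra].
- rewrite mulrDl mul1r addrC lerD2l.
  have -> : 4 * (i%:R / n%:R) * (n%:R / 2 - 1) = i%:R * (2 - 4 / n%:R) :> R by field; lra.
  have i0 : (0 : R) <= i%:R by rewrite ler0n.
  rewrite ler_peMr// lerBrDr -lerBrDl ler_pdivrMr; lra.
apply: le_trans (bin_expR_le _ _ p01) _; rewrite ler_expR lerD2l lerN2.
move: p01 => /andP[p0 p1]; apply: ler_wnM2r; first by rewrite ln_le0//; lra.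
by rewrite ler_nat leq_subr.
Qed.

Lemma geg_coef_le_sqr n i (r s : R) : (4 < n)%N -> 0 < r -> s ^+ 2 = 1 - (2 * r + 1)^-1 ^+ 2 ->
  i%:R <= r * (n%:R - 4) -> 4 * geg_coef R n i <= s ^+ 2.
Proof.
move=> n5 r0 -> ir; rewrite geg_coefE//; have l1 := @lambda_gt1 R n n5; have ml := @lambda_le_shift R n i.
have : (2 * r + 1)^-1 ^+ 2 <= (n%:R / 2 - 1) * (n%:R / 2 - 1 - 1) / ((i%:R +
  (n%:R / 2 - 1)) * (i%:R + (n%:R / 2 - 1) - 1)).
  apply: sqr_le_pronic_ratio => //; first by rewrite invr_ge0; lra.
  rewrite mulrC ler_pdivrMr; lra.
lra.
Qed.

Lemma sqr_le_geg_coef n i (r s : R) : (4 < n)%N -> 0 < r -> s ^+ 2 = 1 - (2 * r + 1)^-1 ^+ 2 ->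
  r * n%:R <= i%:R -> s ^+ 2 <= 4 * geg_coef R n i.
Proof.
move=> n5 r0 -> ir; rewrite geg_coefE//; have l1 := @lambda_gt1 R n n5; have ml := @lambda_le_shift R n i.
have : (n%:R / 2 - 1) * (n%:R / 2 - 1 - 1) / ((i%:R + (n%:R / 2 - 1)) * (i%:R +
  (n%:R / 2 - 1) - 1)) <= (2 * r + 1)^-1 ^+ 2.
  apply: pronic_ratio_le_sqr => //; first by rewrite invr_ge0; lra.
  rewrite ler_pdivlMl; lra.
lra.
Qed.

Lemma decay_rate_ge (r s b i n : R) : 0 < r -> 0 <= i -> 4 < n -> b * s = 4 * (r ^+ 2 + r) -> s =
  b * (1 - s ^+ 2) ->
  i <= r * (n - 4) ->
  i * (i + 2 * (n / 2 - 1)) + (n * b / 2) ^+ 2 * (1 - s ^+ 2) <= (2 * (n / 2 - 1) + 1) * s * (n * b / 2).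
Proof.
move=> r0 i0 n4 bs sb ir.
have -> : (n * b / 2) ^+ 2 * (1 - s ^+ 2) = n ^+ 2 / 4 * (b * (b * (1 - s ^+ 2))) by field.
rewrite -sb bs.
have -> : (2 * (n / 2 - 1) + 1) * s * (n * b / 2) = (n - 1) * n / 2 * (b * s) by field.
rewrite bs.
have degree_form_le : i * (i + 2 * (n / 2 - 1)) <= (r * (n - 2)) * (r * n + n).
  by apply: ler_pM => //; nra.
nra.
Qed.

Record lp_params (s r r' y d st : R) : Prop := LpParams {
  lp_r'_gt0 : 0 < r';
  lp_r'_lt_r : r' < r;
  lp_s_sqr : 1 - s ^+ 2 = (2 * r + 1)^-1 ^+ 2;
  lp_st_sqr : st ^+ 2 = 1 - (2 * r' + 1)^-1 ^+ 2;
  lp_st_ge0 : 0 <= st;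
  lp_y_gt0 : 0 < y;
  lp_y_lt_s : y < s;
  lp_d_gt0 : 0 < d;
  lp_y_sqr : (2 * r' + 1)^-1 ^+ 2 + d <= 1 - y ^+ 2 }.

Section geg_growth.
Variables (n i : nat) (b s r r' y d st : R).
Hypothesis n5 : (4 < n)%N.
Hypothesis bs_saddle : saddle b s.
Hypothesis params : lp_params s r r' y d st.
Hypothesis degree_lo : r' * n%:R <= i.+1%:R.
Hypothesis degree_hi : i.+1%:R <= r * (n%:R - 4).
Local Notation Q := (geg R n i.+1).
Local Notation nrm := (geg_sqnorm n i.+1).

Lemma lp_r_gt0 : 0 < r. Proof. exact: lt_trans (lp_r'_gt0 params) (lp_r'_lt_r params). Qed.

Lemma lp_s_sqr_lt1 : s ^+ 2 < 1.
Proof. by case: bs_saddle => _ s0 s1 _; rewrite expr_lt1//; lra. Qed.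

Lemma weighted_sqr_le_below z : y <= z -> z <= s ->
  weighted_sqr n i.+1 z <= (3 / d + 3) * nrm * expR (n%:R * ((s - y) * ((2 * r + 1) / (1 - s ^+ 2)))).
Proof.
case: bs_saddle => _ s0 s1 _ yz zs.
have [[r0 s21] r'0] := (lp_r_gt0, lp_s_sqr_lt1, lp_r'_gt0 params).
have [[y0 ys] d0] := (lp_y_gt0 params, lp_y_lt_s params, lp_d_gt0 params).
have l1 := @lambda_gt1 R n n5; have nrm0 := ltW (@geg_sqnorm_gt0 R n n5 i.+1).
have at_y : weighted_sqr n i.+1 y <= 3 / d * nrm.
  apply: (weighted_sqr_le n5 (ltW y0) _ d0 _ _ (lp_y_sqr params)); first exact: lt_trans s1.
    by rewrite invr_ge0; lra.
  by rewrite ler_pdivlMl; [have := degree_lo; lra|lra].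
apply: le_trans (weighted_sqr_growth n5 i (ltW y0) yz zs s1) _; apply: ler_pM; rewrite ?expR_ge0//.
- by apply: addr_ge0; [exact: weighted_sqr_ge0|exact: mulr_ge0].
- by rewrite [leRHS]mulrDl lerD2r.
have shift_le : i.+1%:R + (n%:R / 2 - 1) <= n%:R * (2 * r + 1) / 2 :> R.
  by have := degree_hi; lra.
rewrite ler_expR.
have -> : n%:R * ((s - y) * ((2 * r + 1) / (1 - s ^+ 2))) = 2 / (1 - s ^+ 2) * (n%:R * (2 * r +
  1) / 2) * (s - y).
  by field; lra.
have q0 : 0 <= 2 / (1 - s ^+ 2) by apply: divr_ge0 => //; rewrite subr_ge0 ltW.
apply: ler_pM; [|by rewrite subr_ge0| |by rewrite lerD2r]; last exact: ler_wpM2l.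
by apply: mulr_ge0 => //; have := @lambda_le_shift R n i.+1; lra.
Qed.

Lemma geg_weight_ge z : 0 <= z -> z <= s -> expR (n%:R * (ln (1 - s ^+ 2) / 2)) <= geg_weight n z.
Proof.
case: bs_saddle => _ s0 _ _ z0 zs; have s21 := lp_s_sqr_lt1.
rewrite /geg_weight ler_expR.
have zz : z ^+ 2 <= s ^+ 2 by apply: lerXn2r => //; rewrite nnegrE ltW.
have ln_le : ln (1 - s ^+ 2) <= ln (1 - z ^+ 2) by rewrite ler_ln ?posrE; lra.
have ln_s_le0 : ln (1 - s ^+ 2) <= 0 by apply: ln_le0; have := sqr_ge0 s; lra.
by have := @lambda_gt1 R n n5; nra.
Qed.

Lemma geg_sqr_le_below z : y <= z -> z <= s -> Q.[z] ^+ 2 <=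
  (3 / d + 3) * expR (n%:R * ((s - y) * ((2 * r + 1) / (1 - s ^+ 2)) - ln (1 - s ^+ 2) / 2)) * nrm.
Proof.
move=> yz zs; have z0 : 0 <= z by apply: le_trans yz; exact: ltW (lp_y_gt0 params).
rewrite mulrBr expRB -(ler_pM2l (expR_gt0 (n%:R * (ln (1 - s ^+ 2) / 2)))).
apply: le_trans (le_trans (ler_wpM2r (sqr_ge0 _) (geg_weight_ge z0 zs)) (weighted_sqr_le_below yz zs)) _.
rewrite le_eqVlt; apply/orP; left; apply/eqP.
have := expR_gt0 (n%:R * (ln (1 - s ^+ 2) / 2)); have := lp_d_gt0 params.
move: (expR _) (expR _) nrm => u v w d0 v0.
by field; lra.
Qed.

Lemma saddle_rateE : b * s = 4 * (r ^+ 2 + r).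
Proof.
case: bs_saddle => _ _ _ sb; have r0 := lp_r_gt0.
have sqr1 : (2 * r + 1) ^+ 2 * (1 - s ^+ 2) = 1.
  by rewrite (lp_s_sqr params) exprVn mulfV// expf_neq0//; lra.
have bE : b = (2 * r + 1) ^+ 2 * s by rewrite sb mulrCA sqr1 mulr1.
have -> : b * s = (2 * r + 1) ^+ 2 - (2 * r + 1) ^+ 2 * (1 - s ^+ 2) by rewrite bE; ring.
by rewrite sqr1; ring.
Qed.

Lemma geg_sqr_le_above x : s <= x -> x <= 1 -> Q.[x] ^+ 2 <= Q.[s] ^+ 2 * expR (n%:R * b * (x - s)).
Proof.
case: bs_saddle => b0 s0 s1 sb sx x1; have r0 := lp_r_gt0.
have n4 : (4 : R) < n%:R by rewrite (ltr_nat R 4).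
have coef_le : 4 * geg_coef R n i.+1 <= s ^+ 2.
  by apply: geg_coef_le_sqr degree_hi => //; rewrite -(lp_s_sqr params) opprB addrC subrK.
have k0 : 0 < n%:R * b / 2 by apply: divr_gt0 => //; apply: mulr_gt0 => //; exact: lt_trans n4.
have rate := decay_rate_ge r0 (ler0n R i.+1) n4 saddle_rateE sb degree_hi.
have Qx0 := geg_gt0 n5 s0 coef_le sx.
have decay := geg_decay n5 s0 s1 k0 coef_le rate sx x1.
have -> : n%:R * b * (x - s) = 2 * (n%:R * b / 2 * (x - s)) by field.
rewrite expRM_natl -exprMn lerXn2r ?nnegrE//; first exact: ltW.
exact: le_trans (ltW Qx0) decay.
Qed.

Lemma geg_sqr_le x : y <= x -> x <= 1 -> Q.[x] ^+ 2 <= (3 / d + 3) *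
   expR (n%:R * ((s - y) * (b + (2 * r + 1) / (1 - s ^+ 2)) - ln (1 - s ^+ 2) / 2 + b * (1 - s))) *
   expR (n%:R * b * (x - 1)) * nrm.
Proof.
move=> yx x1; case: bs_saddle => b0 _ _ _; have ys := lp_y_lt_s params.
have nb0 : 0 <= n%:R * b by apply: mulr_ge0; [exact: ler0n|exact: ltW].
set E := expR (n%:R * ((s - y) * ((2 * r + 1) / (1 - s ^+ 2)) - ln (1 - s ^+ 2) / 2)).
have bound_ge0 : 0 <= (3 / d + 3) * E * nrm.
  apply: mulr_ge0; last exact: ltW (geg_sqnorm_gt0 n5 _).
  by apply: mulr_ge0; [rewrite addr_ge0 ?divr_ge0// ltW// (lp_d_gt0 params)|exact: expR_ge0].
rewrite [leRHS](_ : _ = (3 / d + 3) * E * nrm * expR (n%:R * b * (x - y))); last first.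
  have -> : n%:R * b * (x - y) = n%:R * ((s - y) * b + b * (1 - s)) + n%:R * b * (x - 1) by ring.
  have -> : (s - y) * (b + (2 * r + 1) / (1 - s ^+ 2)) - ln (1 - s ^+ 2) / 2 + b * (1 - s) =
    ((s - y) * ((2 * r + 1) / (1 - s ^+ 2)) - ln (1 - s ^+ 2) / 2) + ((s - y) * b + b * (1 - s)) by ring.
  rewrite /E mulrDr !expRD; move: (expR _) (expR _) (expR _) => u v w; ring.
have [xs|sx] := lerP x s.
  apply: le_trans (geg_sqr_le_below yx xs) _; rewrite ler_peMr//.
  by rewrite -[leLHS]expR0 ler_expR mulr_ge0// subr_ge0.
apply: le_trans (geg_sqr_le_above (ltW sx) x1) _; apply: ler_pM; rewrite ?sqr_ge0 ?expR_ge0//.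
  by apply: geg_sqr_le_below; rewrite ?lexx ?ltW.
by rewrite ler_expR ler_wpM2l// lerD2l lerN2 ltW.
Qed.

End geg_growth.

Lemma lp_final_arith (a D B S g K E : R) : 0 <= a -> 0 < K -> 0 < B -> 0 <= E ->
  g * a ^+ 2 <= K * (a * D + B * S) -> K * D <= g / 2 * a -> E * (K * B) <= g / 2 -> a ^+ 2 * E <= S.
Proof.
move=> a0 K0 B0 E0 card_le diag_le decay_le.
have KB : 0 < K * B by apply: mulr_gt0.
have half_le : g / 2 * a ^+ 2 <= K * B * S.
  have : a * (K * D) <= a * (g / 2 * a) by apply: ler_wpM2l.
  have -> : a * (g / 2 * a) = g / 2 * a ^+ 2 by ring.
  have -> : a * (K * D) = K * (a * D) by ring.
  have e : g * a ^+ 2 = g / 2 * a ^+ 2 + g / 2 * a ^+ 2 by field.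
  move: card_le; rewrite e mulrDr mulrA; lra.
rewrite -(ler_pM2l KB); apply: le_trans half_le.
have -> : K * B * (a ^+ 2 * E) = a ^+ 2 * (E * (K * B)) by ring.
by rewrite [leRHS]mulrC; apply: ler_wpM2l => //; exact: sqr_ge0.
Qed.

Lemma le_2sqrt (u v : R) : 0 <= u -> 0 <= v -> u ^+ 2 <= 4 * v -> u <= 2 * Num.sqrt v.
Proof.
move=> u0 v0 sqr_le; have := sqr_sqrtr v0; have := sqrtr_ge0 v; move: (Num.sqrt v) => w w0 e.
by rewrite leNgt; apply/negP => ww; nra.
Qed.

Definition degree_ratio (t : R) : R := (1 - t) / (2 * t).

Lemma degree_ratioK (t : R) : 0 < t -> (2 * degree_ratio t + 1)^-1 = t.
Proof. by move=> t0; rewrite /degree_ratio; field; lra. Qed.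

Lemma degree_ratio_gt0 (t : R) : 0 < t -> t < 1 -> 0 < degree_ratio t.
Proof. by move=> t0 t1; apply: divr_gt0; lra. Qed.

Lemma degree_ratio_anti (t u : R) : 0 < t -> t < u -> degree_ratio u < degree_ratio t.
Proof.
move=> t0 tu.
have e (v : R) : 0 < v -> degree_ratio v = (v^-1 - 1) / 2 by move=> v0; rewrite /degree_ratio; field; lra.
rewrite !e//; last by lra.
have : u^-1 < t^-1 by rewrite ltf_pV2 ?posrE//; lra.
lra.
Qed.

Lemma lp_shift_ge (st y g k c : R) : 0 <= st -> 0 <= c -> st ^+ 2 <= 4 * c -> 0 < k -> 1 <= k ->
  y + g <= st * (1 - k^-1) ->
  y + g <= 2 * Num.sqrt c * (1 - k^-1).
Proof.
move=> st0 c0 sqr_le k0 k1 gap; apply: le_trans gap _; apply: ler_wpM2r; last exact: le_2sqrt.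
by rewrite subr_ge0 invf_le1.
Qed.

Lemma lp_degree_le (r r' i K n : R) : i <= r' * n + K -> K + 4 * r <= n * (r - r') -> i <= r * (n - 4).
Proof. by lra. Qed.

Lemma degree_div_le (r i n : R) : 4 < n -> 0 < r -> i <= r * (n - 4) -> i / n <= r.
Proof. by move=> n4 r0 degree_hi; rewrite ler_pdivrMr; lra. Qed.

Definition lp_diag_bound (n p r r' K : R) := (1 + 4 * r) * expR (- ((r' * n + K) * ln p) - n * ln (1 - p)).
Definition lp_decay_bound (n b s r y d : R) := (3 / d + 3) *
  expR (n * ((s - y) * (b + (2 * r + 1) / (1 - s ^+ 2)) - ln (1 - s ^+ 2) / 2 + b * (1 - s))).

Lemma sqr_geg_at1_le_diag n j (p r r' K : R) : (4 < n)%N -> 0 < p < 1 -> 0 < r ->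
  j%:R <= r' * n%:R + K -> j%:R <= r * (n%:R - 4) ->
  (geg R n j).[1] ^+ 2 <= lp_diag_bound n%:R p r r' K * geg_sqnorm n j.
Proof.
move=> n5 p01 r0 j_le j_le4; apply: le_trans (sqr_geg_at1_le j n5 p01) _.
have n4 : (4 : R) < n%:R by rewrite (ltr_nat R 4).
apply: ler_wpM2r; first exact: ltW (geg_sqnorm_gt0 n5 j).
apply: ler_pM; [|exact: expR_ge0| |].
- by apply: addr_ge0 => //; apply: mulr_ge0 => //; apply: divr_ge0; rewrite ler0n.
- by rewrite lerD2l; apply: ler_wpM2l => //; exact: degree_div_le.
rewrite ler_expR lerD2r lerN2; apply: ler_wnM2r => //.
by apply: ln_le0; case/andP: p01 => _ /ltW.
Qed.

Lemma lp_card_bound n (T : finType) (x : T -> 'rV[R]_n) (A : {set T}) (b s r r' p y d st g : R) K :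
  (4 < n)%N -> (0 < K)%N -> (forall c, norm2 (x c) = 1) ->
  saddle b s -> lp_params s r r' y d st -> 0 < p < 1 ->
  0 < g -> y + g <= st * (1 - K%:R^-1) -> K%:R + 4 * r <= n%:R * (r - r') ->
  g * #|A|%:R ^+ 2 <= K%:R * (#|A|%:R * lp_diag_bound n%:R p r r' K%:R + lp_decay_bound n%:R b s r y d *
     total_weight (fun c c' => expR (- (n%:R * b * hdist x c c'))) A).
Proof.
move=> n5 K0 x1 bs params p01 g0 gap K_le; have [_ s0 s1 _] := bs.
have [[r'0 r'r] st2] := (lp_r'_gt0 params, lp_r'_lt_r params, lp_st_sqr params).
have [[y0 ys] d0] := (lp_y_gt0 params, lp_y_lt_s params, lp_d_gt0 params).
have r0 := lp_r_gt0 params.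
have n4 : (4 : R) < n%:R by rewrite (ltr_nat R 4).
pose i0 := Num.truncn (r' * n%:R).
have rn0 : 0 <= r' * n%:R by apply: mulr_ge0; [exact: ltW|exact: ler0n].
have /andP[i0le i0gt] : i0%:R <= r' * n%:R < i0.+1%:R by exact: truncn_itv.
have degree_lo j : (i0 < j)%N -> r' * n%:R <= j%:R.
  by move=> ij; apply: le_trans (ltW i0gt) _; rewrite ler_nat.
have degree_hi j : (j <= i0 + K)%N -> j%:R <= r' * n%:R + K%:R.
  by move=> ij; apply: le_trans (_ : (i0 + K)%:R <= _); [rewrite ler_nat|rewrite natrD lerD2r].
have degree_hi4 j : (j <= i0 + K)%N -> j%:R <= r * (n%:R - 4).
  by move=> /degree_hi jK; exact: lp_degree_le jK K_le.
have shift_ge : g <= lp_shift n i0 K - y.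
  rewrite lerBrDl; apply: (lp_shift_ge (lp_st_ge0 params) (geg_coef_ge0 n5 _) _ _ _ gap).
  - exact: (sqr_le_geg_coef n5 r'0 st2 (degree_lo _ (leqnn _))).
  - by rewrite ltr0n.
  - by rewrite ler1n.
apply: le_trans (ler_wpM2r (sqr_ge0 _) shift_ge) _.
apply: (lp_code_bound n5) => //.
- by rewrite (ltW y0) (lt_trans ys s1).
- by rewrite -subr_gt0; exact: lt_le_trans shift_ge.
- by apply: mulr_ge0; [rewrite addr_ge0 ?divr_ge0// ltW|exact: expR_ge0].
- by move=> j /andP[j0 jK]; apply: sqr_geg_at1_le_diag => //; [exact: degree_hi|exact: degree_hi4].
- move=> [//|j] t /andP[j0 jK] yt t1.
  exact: (geg_sqr_le n5 bs params (degree_lo _ j0) (degree_hi4 _ jK) yt t1).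
Qed.

Lemma lp_diag_bound_le (n p r r' K g a u v w : R) : 0 < K -> 0 < r -> 0 < g -> u = ln p -> v = ln (1 - p) ->
  w = ln (2 * K * (1 + 4 * r) / g) -> w + K * - u <= n * ((r - r') * - u / 2) ->
  expR (n * (- r * u - v - (r - r') * - u / 2)) <= a -> K * lp_diag_bound n p r r' K <= g / 2 * a.
Proof.
move=> K0 r0 g0 -> -> wE n_large card_ge; have g2 : 0 < 2 / g by apply: divr_gt0.
rewrite -(ler_pM2l g2).
have -> : 2 / g * (g / 2 * a) = a by field; lra.
apply: le_trans card_ge.
have -> : 2 / g * (K * lp_diag_bound n p r r' K) = (2 * K * (1 + 4 * r) / g) * expR (- ((r' * n +
  K) * ln p) - n * ln (1 - p)).
  by rewrite /lp_diag_bound; ring.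
have c0 : 0 < 2 * K * (1 + 4 * r) / g by apply: divr_gt0 => //; apply: mulr_gt0; [apply: mulr_gt0|lra].
rewrite -[X in X * _]lnK ?posrE// -wE -expRD ler_expR.
move: (ln (1 - p)) (ln p) n_large => v' u' n_large; nra.
Qed.

Lemma lp_decay_bound_le (n b s r y d K g ep : R) : 0 < n -> 0 < K -> 0 < g -> 0 < d ->
  (s - y) * (b + (2 * r + 1) / (1 - s ^+ 2)) <= ep / 2 ->
  ln (2 * K * (3 / d + 3) / g) <= n * (ep / 2) ->
  expR (- (n * (b * (1 - s) + - (ln (1 - s ^+ 2) / 2) + ep))) * (K * lp_decay_bound n b s r y d) <= g / 2.
Proof.
move=> n0 K0 g0 d0 slack_le n_large.
have dd : 0 < 3 / d + 3 by apply: addr_gt0 => //; apply: divr_gt0.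
have c0 : 0 < 2 * K * (3 / d + 3) / g by apply: divr_gt0 => //; apply: mulr_gt0 => //; apply: mulr_gt0.
have g2 : 0 < 2 / g by apply: divr_gt0.
rewrite -(ler_pM2l g2).
have -> : 2 / g * (g / 2) = 1 by field; lra.
rewrite /lp_decay_bound; move: slack_le n_large; set C := (s - y) * _; set v := ln (1 - s ^+
  2) => slack_le n_large.
rewrite [leLHS](_ : _ = (2 * K * (3 / d + 3) / g) * (expR (- (n * (b * (1 - s) + - (v / 2) +
  ep))) * expR (n * (C - v / 2 + b * (1 - s))))); last by ring.
rewrite -[X in X * _]lnK ?posrE// -!expRD -[leRHS]expR0 ler_expR.
have scaled_le : n * C <= n * (ep / 2) by apply: ler_wpM2l => //; exact: ltW.
move: n_large; move: (ln (_ / g)) => u n_large.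
have -> : u + (- (n * (b * (1 - s) + - (v / 2) + ep)) + n * (C - v / 2 + b * (1 - s))) = u +
  n * C - n * (ep / 2) - n * (ep / 2) by field.
lra.
Qed.

Lemma exists_lp_gap (s C ep : R) : 0 < s -> s < 1 -> 0 < C -> 0 < ep ->
  exists y st ta d : R, [/\ 0 < y, y < s, (s - y) * C <= ep / 2, 0 <= st & [/\ st ^+ 2 = 1 - ta ^+
    2, 0 < ta, ta < 1, 0 < d &
    [/\ 1 - s ^+ 2 < ta ^+ 2, ta ^+ 2 + d <= 1 - y ^+ 2 & y + (s - y) / 4 <= st * (1 - (s - y) / 4)]]].
Proof.
move=> s0 s1 C0 ep0.
pose e := Num.min (ep / (2 * C)) (s / 2).
have e0 : 0 < e by rewrite /e lt_min; apply/andP; split; apply: divr_gt0 => //; lra.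
have e1 : e * C <= ep / 2.
  apply: le_trans (_ : ep / (2 * C) * C <= _); last by rewrite le_eqVlt; apply/orP; left;
    apply/eqP; field; lra.
  by apply: ler_wpM2r; [lra|rewrite /e ge_min lexx].
have e2 : e <= s / 2 by rewrite /e ge_min lexx orbT.
clearbody e.
have st0 : 0 < s - e / 2 by lra.
have st1 : s - e / 2 < 1 by lra.
exists (s - e), (s - e / 2), (Num.sqrt (1 - (s - e / 2) ^+ 2)), ((s - e / 2) ^+ 2 - (s - e) ^+ 2).
have sq : 0 < 1 - (s - e / 2) ^+ 2 by rewrite subr_gt0 expr_lt1//; lra.
have sqs : (s - e / 2) ^+ 2 < s ^+ 2 by rewrite ltrXn2r// ?nnegrE; lra.
have sqy : (s - e) ^+ 2 < (s - e / 2) ^+ 2 by rewrite ltrXn2r// ?nnegrE; lra.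
have st2 : 0 < (s - e / 2) ^+ 2 by exact: exprn_gt0.
rewrite sqr_sqrtr; last exact: ltW.
have -> : s - (s - e) = e by ring.
split; [lra|lra|lra|lra|split; [by ring| by rewrite sqrtr_gt0| |lra|split; [lra|lra|]]].
  by rewrite -[ltRHS]sqrtr1 ltr_sqrt; lra.
have : (s - e / 2) * (e / 4) <= e / 4 by rewrite ler_piMl//; lra.
lra.
Qed.

Lemma near_lp_total_weight (b s r r' p y d st g ep : R) :
  saddle b s -> lp_params s r r' y d st -> 0 < p < 1 -> 0 < g -> y + g <= st * (1 - g) ->
  0 < ep -> (s - y) * (b + (2 * r + 1) / (1 - s ^+ 2)) <= ep / 2 ->
  \forall n \near \oo, forall (T : finType) (x : T -> 'rV[R]_n) (A : {set T}),
  (forall c, norm2 (x c) = 1) ->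
  expR (n%:R * (- r * ln p - ln (1 - p) - (r - r') * - ln p / 2)) <= #|A|%:R ->
  #|A|%:R ^+ 2 * expR (- (n%:R * (b * (1 - s) + - (ln (1 - s ^+ 2) / 2) + ep))) <=
  total_weight (fun c c' => expR (- (n%:R * b * hdist x c c'))) A.
Proof.
move=> bs params p01 g0 gap ep0 ep_ge; have [p0 p1] := andP p01.
have [[r0 rr] d0] := (lp_r_gt0 params, lp_r'_lt_r params, lp_d_gt0 params).
pose K := (Num.truncn g^-1).+1.
have K_gt0 : (0 : R) < K%:R by rewrite ltr0n.
have gapK : y + g <= st * (1 - K%:R^-1).
  apply: le_trans gap _; apply: ler_wpM2l; first exact: lp_st_ge0 params.
  by rewrite lerD2l lerN2 -[g]invrK lef_pV2 ?posrE ?invr_gt0// ltW// truncnS_gt.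
have rr0 : 0 < r - r' by rewrite subr_gt0.
have eta0 : 0 < (r - r') * - ln p / 2.
  by rewrite divr_gt0// mulr_gt0// oppr_gt0 ln_lt0// p01.
have ep2 : 0 < ep / 2 by exact: divr_gt0.
near=> n; move=> T x A x1 cardA.
have n5 : (4 < n)%N by near: n; exact: nbhs_infty_gt.
have n0 : (0 : R) < n%:R by rewrite ltr0n; apply: leq_trans n5.
have K_le : K%:R + 4 * r <= n%:R * (r - r') by near: n; exact: near_le_linear.
have := lp_card_bound A n5 (ltn0Sn _) x1 bs params p01 g0 gapK K_le.
move=> /(lp_final_arith (ler0n _ _) K_gt0 _ (expR_ge0 _)); apply.
- by apply: mulr_gt0; [rewrite addr_gt0 ?divr_gt0|exact: expR_gt0].
- apply: (lp_diag_bound_le K_gt0 r0 g0 erefl erefl erefl _ cardA).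
  by near: n; exact: near_le_linear.
- apply: lp_decay_bound_le => //; near: n; exact: near_le_linear.
Unshelve. all: end_near. Qed.

Lemma lp_many_close_pairs (b s sg : R) : saddle b s -> 0 < sg -> sg ^+ 2 = 1 - s ^+ 2 ->
  many_close_pairs b s (- degree_ratio sg * ln ((1 - sg) / (1 + sg)) - ln (2 * sg / (1 + sg)))
    (- (ln (1 - s ^+ 2) / 2)).
Proof.
move=> bs sg0 sg2 ep ep0; have [b0 s0 s1 _] := bs.
have s20 : 0 < s ^+ 2 by apply: exprn_gt0.
have sg1 : sg < 1 by rewrite -(ltr_pXn2r (n := 2))// ?nnegrE ?expr1n; lra.
have qE : 2 * sg / (1 + sg) = 1 - (1 - sg) / (1 + sg) by field; lra.
have p01 : 0 < (1 - sg) / (1 + sg) < 1.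
  by rewrite -[X in _ && X]subr_gt0 -qE; apply/andP; split; apply: divr_gt0; lra.
have r0 := degree_ratio_gt0 sg0 sg1.
have C0 : 0 < b + (2 * degree_ratio sg + 1) / (1 - s ^+ 2).
  by rewrite -sg2 addr_gt0// divr_gt0 ?exprn_gt0//; lra.
have [y [st [ta [d [y0 ys ep_ge st0 [st2 ta0 ta1 d0 [sta dy gap]]]]]]] := exists_lp_gap s0 s1 C0 ep0.
have sgta : sg < ta by rewrite -(ltr_pXn2r (n := 2))// ?nnegrE; [rewrite sg2|exact: ltW|exact: ltW].
have r'r := degree_ratio_anti sg0 sgta.
have params : lp_params s (degree_ratio sg) (degree_ratio ta) y d st.
  by split; rewrite ?degree_ratioK//; exact: degree_ratio_gt0.
exists ((degree_ratio sg - degree_ratio ta) * - ln ((1 - sg) / (1 + sg)) / 2).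
  by rewrite divr_gt0// mulr_gt0 ?subr_gt0// oppr_gt0 ln_lt0.
rewrite qE; apply: (near_lp_total_weight bs params p01 _ gap ep0 ep_ge).
by rewrite divr_gt0// subr_gt0.
Qed.

End lp_exponent.

(** * Achievability *)

Section shell.
Context {R : realType}.

(* The left-hand side is, up to the term in ln, the exponent of e^{l n} E e^{b sqrt n <c, W> - l |W|^2};
   1 + 2 l = 1 / (1 - s^2) is its minimizer in l. *)
Lemma saddle_exponent (b s l n : R) : saddle b s -> 1 + 2 * l = (1 - s ^+ 2)^-1 ->
  l * n + n * b ^+ 2 / (2 * (1 + 2 * l)) = n * (b * s).
Proof.
move=> [b0 s0 s1 sb] lE; have s2 : s ^+ 2 < 1 by rewrite expr_lt1//; lra.
have -> : l = ((1 - s ^+ 2)^-1 - 1) / 2 by rewrite -lE; field.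
have -> : b = s / (1 - s ^+ 2) by rewrite [X in _ = X / _]sb mulfK//; lra.
by field; lra.
Qed.

Lemma direction_exponent_le (n b d r t : R) : 0 < n -> 0 < b -> 0 < r ->
  n * (1 - d) <= r ^+ 2 -> r ^+ 2 <= n * (1 + d) -> `|t| <= r ->
  n * b * (t / r) <= b * Num.sqrt n * t + n * b * d.
Proof.
move=> n0 b0 r0 lo hi tr.
have [q0 qE] : 0 < Num.sqrt n /\ Num.sqrt n ^+ 2 = n by split; [rewrite sqrtr_gt0|rewrite sqr_sqrtr// ltW].
move: (Num.sqrt n) q0 qE => q q0 qE.
rewrite -lerBlDl -[X in X * b * _]qE.
have -> : q ^+ 2 * b * (t / r) - b * q * t = b * q * (q - r) * (t / r) by field; lra.
have t1 : `|t / r| <= 1 by rewrite normrM normfV (gtr0_norm r0) ler_pdivrMr// mul1r.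
have norm_le : b * q * (q - r) * (t / r) <= b * q * `|q - r|.
  apply: le_trans (ler_norm _) _; rewrite !normrM (gtr0_norm b0) (gtr0_norm q0) -normrM.
  by rewrite ler_piMr//; apply: mulr_ge0; [apply: mulr_ge0; exact: ltW|exact: normr_ge0].
apply: le_trans norm_le _; rewrite mulrAC -!mulrA [n * _]mulrC -mulrA.
apply: ler_wpM2l; first exact: ltW.
have diff_le : `|q - r| * (q + r) <= d * n.
  rewrite -[X in _ * X]gtr0_norm; last by lra.
  rewrite -normrM (_ : (q - r) * (q + r) = q ^+ 2 - r ^+ 2); last by ring.
  by rewrite qE ler_norml; apply/andP; split; lra.
by apply: le_trans diff_le; apply: ler_wpM2l; [exact: normr_ge0|lra].
Qed.

Section shell_average.
Variables (n : nat) (b l d u K : R) (cs : seq 'rV[R]_n).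
Hypotheses (n_gt0 : (0 < n)%N) (b_gt0 : 0 < b) (l_ge0 : 0 <= l) (d_gt0 : 0 < d) (d_lt1 : d < 1).
Hypotheses (u_ge0 : 0 <= u) (K_ge0 : 0 <= K).
Hypothesis cs_unit : all (fun c => norm2 c == 1) cs.
Hypothesis sum_ge : forall x : 'rV[R]_n, norm2 x = 1 ->
  (size cs)%:R * K <= \sum_(c <- cs) expR (n%:R * b * dot c x).
Implicit Types w c : 'rV[R]_n.

(* 1 - shell_excess - shell_deficit is a lower bound of the indicator of the shell. *)
Definition in_shell w := n%:R * (1 - d) <= norm2 w <= n%:R * (1 + d).
Definition shell_excess w := (n%:R * (1 + d))^-1 * norm2 w.
Definition shell_deficit w := expR (u * (n%:R * (1 - d)) / 2) * expR (dot 0 w - u / 2 * norm2 w).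
Definition shell_tilt c w :=
  expR (n%:R * b * d + l * (n%:R * (1 + d))) * expR (dot ((b * Num.sqrt n%:R) *: c) w - l * norm2 w).

Lemma n_pos : (0 : R) < n%:R. Proof. by rewrite ltr0n. Qed.

Lemma shell_radius_gt0 : 0 < n%:R * (1 + d).
Proof. by have d0 := d_gt0; apply: mulr_gt0; [exact: n_pos|lra]. Qed.

Lemma expgrowth_shell_excess : expgrowth shell_excess.
Proof. by apply: expgrowthZ; exact: expgrowth_norm2. Qed.

Lemma expgrowth_shell_deficit : expgrowth shell_deficit.
Proof. by apply: expgrowthZ; apply: expgrowth_expR_quad; exact: divr_ge0. Qed.

Lemma expgrowth_shell_tilt c : expgrowth (shell_tilt c).
Proof. by apply: expgrowthZ; exact: expgrowth_expR_quad. Qed.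

Lemma gexpect_shell_excess_le : gexpect shell_excess <= (1 + d)^-1.
Proof.
rewrite gexpectZ; last exact: expgrowth_norm2.
apply: le_trans (_ : (n%:R * (1 + d))^-1 * n%:R <= _).
  by apply: ler_wpM2l; [rewrite invr_ge0 ltW// shell_radius_gt0|exact: gexpect_norm2_le].
by rewrite invfM mulrAC mulVf ?mul1r// gt_eqF// n_pos.
Qed.

Lemma gexpect_shell_deficit : gexpect shell_deficit = expR (n%:R * (u * (1 - d) - ln (1 + u)) / 2).
Proof.
have u2 : 0 <= u / 2 by exact: divr_ge0.
rewrite gexpectZ; last exact: expgrowth_expR_quad.
rewrite gexpect_expR_quad// -expRD norm2E dot0l mul0r (_ : 1 + 2 * (u / 2) = 1 + u); last by field.
by congr expR; field.
Qed.

Lemma gexpect_shell_tilt c : c \in cs -> gexpect (shell_tilt c) =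
  expR (n%:R * b * d + l * (n%:R * (1 + d)) +
    (n%:R * b ^+ 2 / (2 * (1 + 2 * l)) - n%:R * (ln (1 + 2 * l) / 2))).
Proof.
move=> /(allP cs_unit) /eqP c1; rewrite gexpectZ; last exact: expgrowth_expR_quad.
rewrite gexpect_expR_quad// -expRD; congr expR; congr (_ + (_ / _ - _)).
by rewrite norm2E dotZl dotZr -norm2E c1 mulr1 -expr2 exprMn sqr_sqrtr ?ler0n// mulrC.
Qed.

Lemma shell_weight_le0 w : ~~ in_shell w -> 1 - shell_excess w - shell_deficit w <= 0.
Proof.
have excess_ge0 : 0 <= shell_excess w.
  by apply: mulr_ge0; [rewrite invr_ge0 ltW// shell_radius_gt0|exact: norm2_ge0].
have deficit_ge0 : 0 <= shell_deficit w by apply: mulr_ge0; exact: expR_ge0.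
rewrite negb_and -!ltNge => /orP[low|high]; last first.
  have : 1 <= shell_excess w.
    by rewrite /shell_excess mulrC ler_pdivlMr ?shell_radius_gt0// mul1r ltW.
  lra.
have : 1 <= shell_deficit w.
  rewrite /shell_deficit -expRD -[leLHS]expR0 ler_expR dot0l.
  have : u * norm2 w <= u * (n%:R * (1 - d)) by apply: ler_wpM2l => //; exact: ltW.
  lra.
lra.
Qed.

Lemma sum_shell_tilt_ge w : in_shell w -> (size cs)%:R * K <= \sum_(c <- cs) shell_tilt c w.
Proof.
move=> /andP[low high]; have d1 := d_lt1.
have w0 : 0 < norm2 w by apply: lt_le_trans low; apply: mulr_gt0; [exact: n_pos|lra].
set r := Num.sqrt (norm2 w).
have r0 : 0 < r by rewrite sqrtr_gt0.
have r2 : r ^+ 2 = norm2 w by rewrite sqr_sqrtr// ltW.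
have w_unit : norm2 (r^-1 *: w) = 1.
  by rewrite norm2E dotZl dotZr -norm2E -r2; field; rewrite gt_eqF.
apply: le_trans (sum_ge w_unit) _; rewrite big_seq [leRHS]big_seq.
apply: ler_sum => c /(allP cs_unit) /eqP c1.
rewrite /shell_tilt -expRD ler_expR dotZr dotZl [r^-1 * _]mulrC.
have dot_le : `|dot c w| <= r.
  by have := dot_unit c1 w_unit; rewrite dotZr normrM gtr0_norm ?invr_gt0// mulrC ler_pdivrMr// mul1r.
have quad_le : l * norm2 w <= l * (n%:R * (1 + d)) by exact: ler_wpM2l.
rewrite -r2 in low high.
have := direction_exponent_le n_pos b_gt0 r0 low high dot_le.
move: quad_le; move: (l * norm2 w) (l * _) (_ * dot c w) (n%:R * b * (_ / r)) => p q t v; lra.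
Qed.

Lemma shell_bound :
  (size cs)%:R * K * (1 - (1 + d)^-1 - expR (n%:R * (u * (1 - d) - ln (1 + u)) / 2)) <=
  (size cs)%:R * expR (n%:R * b * d + l * (n%:R * (1 + d)) +
    (n%:R * b ^+ 2 / (2 * (1 + 2 * l)) - n%:R * (ln (1 + 2 * l) / 2))).
Proof.
have [gA gB] := (expgrowth_shell_excess, expgrowth_shell_deficit).
have sK : 0 <= (size cs)%:R * K by apply: mulr_ge0 => //; exact: ler0n.
have weight_le w : (size cs)%:R * K * (1 - shell_excess w - shell_deficit w) <= \sum_(c <- cs) shell_tilt c w.
  have [in_w|out_w] := boolP (in_shell w).
    apply: le_trans (sum_shell_tilt_ge in_w); rewrite ler_piMr// -addrA gerDl -opprD oppr_le0.
    apply: addr_ge0; apply: mulr_ge0; rewrite ?expR_ge0 ?norm2_ge0// invr_ge0 ltW//.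
    exact: shell_radius_gt0.
  apply: (@le_trans _ _ 0); first exact: mulr_ge0_le0 (shell_weight_le0 out_w).
  by apply: sumr_ge0 => c _; apply: mulr_ge0; exact: expR_ge0.
have g1A : expgrowth (fun w => 1 - shell_excess w) by apply: expgrowthB => //; exact: expgrowth_cst.
have := le_gexpect (expgrowthZ _ (expgrowthB g1A gB)) (expgrowth_sum _ (fun c _ =>
  expgrowth_shell_tilt c)) weight_le.
rewrite gexpectZ; last exact: expgrowthB.
rewrite gexpectB// gexpectB//; last exact: expgrowth_cst.
rewrite gexpect_cst gexpect_sum; last by move=> c _; exact: expgrowth_shell_tilt.
rewrite gexpect_shell_deficit (eq_big_seq _ gexpect_shell_tilt).
rewrite big_const_seq iter_addr_0 count_predT -[X in _ <= X -> _]mulr_natl.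
apply: le_trans; apply: ler_wpM2l => //; rewrite lerD2r lerD2l lerN2.
exact: gexpect_shell_excess_le.
Qed.

End shell_average.

Lemma shell_rate_le (d : R) : 0 < d -> d < 1 -> d * (1 - d) - ln (1 + d) <= - (d ^+ 2 / 4).
Proof.
move=> d0 d1; pose f (y : R) : R := ln (1 + y) - y + (3 / 4) * y ^+ 2.
have : f 0 <= f d.
  apply: (@der_ge0_le _ f (fun y => (1 + y)^-1 - 1 + 3 / 4 * (2 * y)) 0 d (ltW d0)) => y /andP[y0 yd].
    apply: derD; last by apply: derZ; apply: der_eq; [apply: derX; exact: der_id|rewrite /=; ring].
    apply: derB; last exact: der_id.
    apply: der_eq; first by apply: der_ln; [lra|apply: derD; [exact: der_cst|exact: der_id]].
    by rewrite add0r div1r.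
  rewrite [leRHS](_ : _ = y * (2^-1 + 3 / 2 * y) / (1 + y)); last by field; lra.
  by apply: divr_ge0; [apply: mulr_ge0; lra|lra].
rewrite /f addr0 ln1 expr0n /=; lra.
Qed.

Lemma exists_shell_width (k ep : R) : 0 < k -> 0 < ep -> exists d, [/\ 0 < d, d < 1 & k * d <= ep].
Proof.
move=> k0 ep0; exists (Num.min 2^-1 (ep / k)); split.
- by rewrite lt_min invr_gt0 ltr0n divr_gt0.
- by rewrite gt_min invf_lt1// ltr1n.
by rewrite mulrC -ler_pdivlMr// ge_min lexx orbT.
Qed.

Lemma shell_exponent_lt (b s l d ep n q : R) : saddle b s -> 1 + 2 * l = (1 - s ^+ 2)^-1 ->
  (b + l) * d <= ep / 2 -> 0 < n -> 0 < q -> 1 - ln q <= n * (ep / 2) ->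
  expR (n * b * d + l * (n * (1 + d)) + (n * b ^+ 2 / (2 * (1 + 2 * l)) - n * (ln (1 + 2 * l) / 2))) <
  expR (n * (b * s + ln (1 - s ^+ 2) / 2 + ep)) * q.
Proof.
move=> bs lE width_le n0 q0 n_large; rewrite -[X in _ < _ * X]lnK ?posrE// -expRD ltr_expR.
have exponentE := saddle_exponent n bs lE; have [_ s0 s1 _] := bs.
have lnE : ln (1 + 2 * l) = - ln (1 - s ^+ 2) by rewrite lE lnV// posrE subr_gt0 expr_lt1//; lra.
rewrite lnE.
have dn : n * ((b + l) * d) <= n * (ep / 2) by apply: ler_wpM2l => //; exact: ltW.
move: (ln q) (ln (1 - s ^+ 2)) (n * b ^+ 2 / (2 * (1 +
  2 * l))) n_large exponentE dn => Q L Z n_large exponentE dn.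
have -> : n * b * d + l * (n * (1 + d)) + (Z - n * (- L / 2)) = n * ((b + l) * d) + (l * n + Z) +
  n * (L / 2) by field.
rewrite exponentE.
have -> : n * (b * s + L / 2 + ep) + Q = n * (b * s) + n * (L / 2) + n * (ep / 2) + n * (ep / 2) + Q by field.
lra.
Qed.

Lemma exists_unit_row n : (0 < n)%N -> exists x : 'rV[R]_n, norm2 x = 1.
Proof.
case: n => [//|n] _; exists (delta_mx 0 ord0).
rewrite /norm2 (bigD1 ord0)//= mxE !eqxx expr1n big1 ?addr0// => i /negbTE i0.
by rewrite mxE i0 expr0n.
Qed.

(* The sphere average of e^{n b <c, x>} has exponent b s + ln(1 - s^2) / 2, hence some direction does
   not exceed it. *)
Lemma near_exists_low_direction (b s ep : R) : saddle b s -> 0 < ep ->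
  \forall n \near \oo, forall cs : seq 'rV[R]_n, all (fun c => norm2 c == 1) cs ->
  exists2 x : 'rV[R]_n, norm2 x = 1 &
    \sum_(c <- cs) expR (n%:R * b * dot c x) <= (size cs)%:R * expR (n%:R * (b * s + ln (1 - s ^+
      2) / 2 + ep)).
Proof.
move=> bs ep0; have [b0 s0 s1 _] := bs.
have s21 : 0 < 1 - s ^+ 2 by rewrite subr_gt0 expr_lt1//; exact: ltW.
pose l := ((1 - s ^+ 2)^-1 - 1) / 2.
have lE : 1 + 2 * l = (1 - s ^+ 2)^-1 by rewrite /l; field; lra.
have l0 : 0 <= l by apply: divr_ge0 => //; rewrite subr_ge0 invf_ge1// gerBl sqr_ge0.
clearbody l.
have ep2 : 0 < ep / 2 by exact: divr_gt0.
have [d [d0 d1 width_le]] := exists_shell_width (ltr_wpDr l0 b0) ep2.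
pose q := d / (4 * (1 + d)); have q0 : 0 < q by apply: divr_gt0 => //; lra.
have qE : 1 - (1 + d)^-1 = 4 * q by rewrite /q; field; lra.
have d8 : 0 < d ^+ 2 / 8 by apply: divr_gt0 => //; exact: exprn_gt0.
near=> n; move=> cs cs1.
have n0 : (0 < n)%N by near: n; exact: nbhs_infty_gt.
have n_pos : (0 : R) < n%:R by rewrite ltr0n.
have [->|cs_neq0] := eqVneq cs [::].
  by have [x x1] := exists_unit_row n0; exists x => //; rewrite big_nil mul0r.
set K := expR (n%:R * (b * s + ln (1 - s ^+ 2) / 2 + ep)).
apply: contrapT => no_direction.
have sum_ge (x : 'rV[R]_n) : norm2 x = 1 -> (size cs)%:R * K <= \sum_(c <- cs) expR (n%:R * b * dot c x).
  by move=> x1; rewrite leNgt; apply/negP => /ltW low; apply: no_direction; exists x.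
have := shell_bound n0 b0 l0 d0 d1 (ltW d0) (expR_ge0 _) cs1 sum_ge.
have size_gt0 : (0 : R) < (size cs)%:R by rewrite ltr0n lt0n size_eq0.
rewrite -mulrA ler_pM2l// leNgt => /negP; apply.
have deficit_le : expR (n%:R * (d * (1 - d) - ln (1 + d)) / 2) <= q.
  rewrite -[q]lnK ?posrE// ler_expR.
  have n_large : - ln q <= n%:R * (d ^+ 2 / 8) by near: n; exact: near_le_linear.
  have := ler_wpM2l (ltW n_pos) (shell_rate_le d0 d1); lra.
apply: (@lt_le_trans _ _ (K * q)).
  have n_large : 1 - ln q <= n%:R * (ep / 2) by near: n; exact: near_le_linear.
  exact: shell_exponent_lt.
by apply: ler_wpM2l; [exact: expR_ge0|rewrite qE; lra].
Unshelve. all: end_near. Qed.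

End shell.

Section codebook.
Context {R : realType}.

Lemma greedy_code n (b K : R) M : 0 <= b -> 0 <= K -> M%:R * K < expR (n%:R * b) ->
  (forall cs : seq 'rV[R]_n, all (fun c => norm2 c == 1) cs ->
    exists2 x : 'rV[R]_n, norm2 x = 1 & \sum_(c <- cs) expR (n%:R * b * dot c x) <= (size cs)%:R * K) ->
  exists cs : seq 'rV[R]_n, [/\ is_code cs, size cs = M &
    \sum_(c <- cs) \sum_(c' <- cs | c' != c) expR (n%:R * b * dot c c') <= M%:R ^+ 2 * K].
Proof.
move=> b0 K0 + exists_direction; elim: M => [|M ih] M_lt.
  by exists [::]; split=> //; rewrite big_nil expr0n /= mul0r.
have MK_le : M%:R * K <= M.+1%:R * K by apply: ler_wpM2r => //; rewrite ler_nat.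
have [cs [/andP[cs_uniq cs_unit] size_cs cs_le]] := ih (le_lt_trans MK_le M_lt).
have [x x1 x_le] := exists_direction cs cs_unit; rewrite size_cs in x_le.
have x_new : x \notin cs.
  apply/negP => x_cs; move: x_le; rewrite leNgt => /negP; apply.
  apply: le_lt_trans MK_le _; apply: lt_le_trans M_lt _.
  rewrite (big_rem x)//= -norm2E x1 mulr1 lerDl; apply: sumr_ge0 => c _; exact: expR_ge0.
exists (x :: cs); split; rewrite /= ?size_cs//.
  by rewrite /is_code /= x_new cs_uniq x1 eqxx cs_unit.
rewrite big_cons big_mkcond big_cons eqxx /= add0r -big_mkcond /=.
have row_le : \sum_(c' <- cs | c' != x) expR (n%:R * b * dot x c') <=
  \sum_(c <- cs) expR (n%:R * b * dot c x).
  rewrite big_mkcond; apply: ler_sum => c _; case: ifP => _; last exact: expR_ge0.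
  by rewrite dotC.
have col_le : \sum_(c <- cs) \sum_(c' <- x :: cs | c' != c) expR (n%:R * b * dot c c') <=
   \sum_(c <- cs) expR (n%:R * b * dot c x) + \sum_(c <- cs) \sum_(c' <- cs | c' !=
     c) expR (n%:R * b * dot c c').
  rewrite -big_split /=; apply: ler_sum => c _; rewrite big_cons; case: ifP => _ //.
  by rewrite lerDr expR_ge0.
have -> : M.+1%:R ^+ 2 * K = M%:R * K + (M%:R * K + M%:R ^+ 2 * K) + K by rewrite -natr1; ring.
lra.
Qed.

Lemma err_prob_le (n : nat) (T : finType) (x : T -> 'rV[R]_n) (e : rel T) (m : R) c : 0 < m ->
  (forall c, norm2 (x c) = 1) ->
  err_prob x e m c <= \sum_(c' | e c c') expR (- (m ^+ 2 * hdist x c c')).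
Proof.
move=> m0 x_unit; rewrite err_probE.
pose G c' (w : 'rV[R]_n) := expR (- (2 * m ^+ 2 * hdist x c c')) * expR (dot (m *: (x c' - x c)) w).
have gG c' : expgrowth (G c') by apply: expgrowthZ; exact: expgrowth_expR_dot.
have G_ge0 c' w : 0 <= G c' w by apply: mulr_ge0; exact: expR_ge0.
apply: (@le_trans _ _ (gexpect (fun w => \sum_(c' | e c c') G c' w))).
  apply: le_gexpect => [||w]; first exact: (expgrowth_shift _ (expgrowth_err_event x e c)).
    by apply: expgrowth_sum => c' _; exact: gG.
  have [/existsP[c' /andP[cc' dot_ge0]]|_] := boolP (err_event _ _ _ _); last by apply: sumr_ge0.
  rewrite (bigD1 c')//= ler_wpDr//; first by apply: sumr_ge0.
  rewrite /G /hdist -expRD -[leLHS]expR0 ler_expR dotZl.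
  have := mulr_ge0 (ltW m0) dot_ge0.
  rewrite dotDr dotZr [dot (x c' - x c) (x c)]dotBl -[dot (x c) (x c)]norm2E x_unit [dot (x c) (x c')]dotC.
  by move: (dot (x c' - x c) w) (dot (x c') (x c)) => u p; lra.
rewrite gexpect_sum; last by move=> c' _; exact: gG.
apply: ler_sum => c' _; rewrite gexpectZ; last exact: expgrowth_expR_dot.
rewrite gexpect_expR_dot -expRD ler_expR norm2E dotZl dotZr -norm2E norm2B !x_unit [dot (x c') _]dotC.
by rewrite /hdist; lra.
Qed.

Section code.
Variables (n : nat) (C : seq 'rV[R]_n).
Hypothesis codeC : is_code C.

Definition codeword (i : 'I_(size C)) := nth 0 C i.
Local Notation x := codeword.

Lemma codeword_in i : x i \in C. Proof. exact: mem_nth. Qed.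

Lemma codeword_unit i : norm2 (x i) = 1.
Proof. by have /andP[_ /allP C1] := codeC; exact/eqP/C1/codeword_in. Qed.

Lemma eq_codeword i j : (x i == x j) = (i == j).
Proof. by have /andP[uC _] := codeC; rewrite nth_uniq. Qed.

Lemma codeword_of c : c \in C -> exists i, c = x i.
Proof.
move=> cC; have i_lt : (index c C < size C)%N by rewrite index_mem.
by exists (Ordinal i_lt); rewrite /x /= nth_index.
Qed.

Lemma hdist_codeword_gt0 i j : j != i -> 0 < hdist x i j.
Proof.
rewrite -eq_codeword => ji; have : norm2 (x j - x i) != 0.
  by apply: contraNneq ji => /norm2_eq0/eqP; rewrite subr_eq0.
have := norm2_ge0 (x j - x i); rewrite norm2B !codeword_unit /hdist dotC; lra.
Qed.

Lemma sum_code (f : 'rV[R]_n -> R) : \sum_(c <- C) f c = \sum_i f (x i).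
Proof. by rewrite (big_nth 0) big_mkord. Qed.

Lemma sum_code_neq (f : 'rV[R]_n -> R) i :
  \sum_(c <- C | c != x i) f c = \sum_(j | j != i) f (x j).
Proof. by rewrite (big_nth 0) big_mkord; apply: eq_bigl => j; rewrite eq_codeword. Qed.

Lemma ml_errorE (t : R) i j (z : 'rV[R]_n) : 0 < t ->
  (norm2 (t *: x i + z - t *: x j) <= norm2 z) = (0 <= dot (x j - x i) (z + t *: x i)).
Proof.
move=> t0; have -> : t *: x i + z - t *: x j = z - t *: (x j - x i).
  by rewrite scalerBr opprB addrCA addrA.
rewrite norm2B [norm2 (t *: _)]norm2E dotZl !dotZr [dot (x j - x i) (z + _)]dotDr dotZr.
rewrite -[dot (x j - x i) (x j - x i)]norm2E norm2B !codeword_unit.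
rewrite [dot (x j - x i) (x i)]dotBl -[dot (x i) (x i)]norm2E codeword_unit [dot z _]dotC.
move: (norm2 z) (dot (x j) (x i)) (dot (x j - x i) z) => Z p w.
have -> : Z + t * (t * (1 + 1 - 2 * p)) - 2 * (t * w) = Z - (2 * t) * (w + t * (p - 1)) by ring.
by rewrite lerBlDr lerDl pmulr_rge0//; lra.
Qed.

Lemma err_prob_cwE (b : R) i : 0 < n%:R * b ->
  err_prob_cw (4 * b) C (x i) = err_prob x (fun i j => j != i) (Num.sqrt (n%:R * b)) i.
Proof.
move=> nb0; have sqrtE : 2 * Num.sqrt (n%:R * b) = Num.sqrt (n%:R * (4 * b)).
  rewrite [n%:R * (4 * b)]mulrCA [RHS]sqrtrM//; congr (_ * _).
  by rewrite (_ : 4 = 2 ^+ 2) ?sqrtr_sqr ?ger0_norm//; ring.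
have t0 : 0 < Num.sqrt (n%:R * (4 * b)) by rewrite sqrtr_gt0 mulrCA mulr_gt0.
rewrite err_probE sqrtE /err_prob_cw /gexpect; set t := Num.sqrt _ in t0 *.
have errE z : has (fun c' => (c' != x i) && (norm2 (t *: x i + z - t *: c') <= norm2 z)) C =
    err_event x (fun i j => j != i) i (z + t *: x i).
  apply/hasP/existsP => [[c' /codeword_of[j ->]]|[j ij]].
    by rewrite eq_codeword ml_errorE// => ij; exists j.
  by exists (x j); [exact: codeword_in|rewrite eq_codeword ml_errorE].
under [X in gauss_expect X]funext do rewrite errE.
rewrite gauss_expectE => [//||v]; last by rewrite lee_fin ler0n.
exact: (expgrowth_rowfun (expgrowth_shift _ (expgrowth_err_event _ _ _))).
Qed.

Lemma PeE (b : R) : 0 < n%:R * b ->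
  Pe (4 * b) C = (size C)%:R^-1 * \sum_i err_prob x (fun i j => j != i) (Num.sqrt (n%:R * b)) i.
Proof. by move=> nb0; rewrite /Pe sum_code; congr (_ * _); apply: eq_bigr => i _; exact: err_prob_cwE. Qed.

Lemma Pe_ge0 (b : R) : 0 < n%:R * b -> 0 <= Pe (4 * b) C.
Proof.
move=> nb0; rewrite PeE// mulr_ge0 ?invr_ge0 ?ler0n//; apply: sumr_ge0 => i _; exact: err_prob_ge0.
Qed.

Lemma Pe_le (b : R) : 0 < n%:R * b -> Pe (4 * b) C <= (size C)%:R^-1 *
  (expR (- (n%:R * b)) * \sum_(c <- C) \sum_(c' <- C | c' != c) expR (n%:R * b * dot c c')).
Proof.
move=> nb0; rewrite PeE// ler_wpM2l ?invr_ge0 ?ler0n// sum_code mulr_sumr; apply: ler_sum => i _.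
rewrite sum_code_neq mulr_sumr.
apply: le_trans (err_prob_le _ _ _ codeword_unit) _; first by rewrite sqrtr_gt0.
apply: ler_sum => j _; rewrite sqr_sqrtr; last exact: ltW.
by rewrite -expRD ler_expR /hdist; lra.
Qed.

End code.

Lemma near_achievable (b s Rt ep : R) (E := b * (1 - s) + - (ln (1 - s ^+ 2) / 2) - Rt) :
  saddle b s -> 0 < ep -> 0 <= Rt -> 0 < E ->
  \forall n \near \oo, exists C : seq 'rV[R]_n,
  [/\ is_code C, expR (n%:R * Rt) <= (size C)%:R & Pe (4 * b) C <= expR (- (n%:R * (E - ep)))].
Proof.
move=> bs ep0 Rt0 E0; have [b0 _ _ _] := bs.
pose e := Num.min ep E / 2.
have e0 : 0 < e by apply: divr_gt0 => //; rewrite lt_min ep0.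
have e_le_ep : 2 * e <= ep by rewrite /e mulrC divfK// ge_min lexx.
have e_le_E : 2 * e <= E by rewrite /e mulrC divfK// ge_min lexx orbT.
clearbody e.
near=> n.
have n_pos : (0 : R) < n%:R by rewrite ltr0n; near: n; exact: nbhs_infty_gt.
have n_large : ln 2 + 1 <= n%:R * e by near: n; exact: near_le_linear.
set K := expR (n%:R * (b * s + ln (1 - s ^+ 2) / 2 + e)).
pose M := (Num.truncn (expR (n%:R * Rt))).+1.
have M_le : M%:R <= 2 * expR (n%:R * Rt).
  have trunc_le : (Num.truncn (expR (n%:R * Rt)))%:R <= expR (n%:R * Rt) by rewrite truncn_le// expR_ge0.
  have exp_ge1 : 1 <= expR (n%:R * Rt) by rewrite -[leLHS]expR0 ler_expR; apply: mulr_ge0 => //; exact: ltW.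
  by rewrite /M -[leLHS]natr1; lra.
have KE : expR (- (n%:R * b)) * K = expR (- (n%:R * (E + Rt - e))).
  by rewrite /K -expRD; congr expR; rewrite /E; field.
have MK_le : M%:R * (expR (- (n%:R * b)) * K) <= expR (- (n%:R * (E - 2 * e) + 1)).
  apply: le_trans (ler_wpM2r (_ : 0 <= _) M_le) _; first by rewrite KE expR_ge0.
  rewrite KE -[X in X * _ * _]lnK ?posrE// -!expRD ler_expR; lra.
have MK_lt : M%:R * K < expR (n%:R * b).
  rewrite -(ltr_pM2l (expR_gt0 (- (n%:R * b)))) -expRD addNr expR0 mulrCA.
  apply: le_lt_trans MK_le _; rewrite -[ltRHS]expR0 ltr_expR oppr_lt0.
  by apply: ltr_wpDl => //; apply: mulr_ge0; [exact: ltW|lra].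
have [|C [codeC size_C sum_le]] := greedy_code (ltW b0) (expR_ge0 _) MK_lt _.
  by near: n; exact: near_exists_low_direction.
exists C; split=> //; first by rewrite size_C ltW// truncnS_gt.
apply: le_trans (Pe_le codeC (mulr_gt0 n_pos b0)) _; rewrite size_C mulrC ler_pdivrMr ?ltr0n//.
apply: le_trans (ler_wpM2l (expR_ge0 _) sum_le) _.
have -> : expR (- (n%:R * b)) * (M%:R ^+ 2 * K) = M%:R * (expR (- (n%:R * b)) * K) * M%:R by ring.
apply: ler_wpM2r; first exact: ler0n.
apply: le_trans MK_le _; rewrite ler_expR.
have : n%:R * (2 * e) <= n%:R * ep by apply: ler_wpM2l => //; exact: ltW.
lra.
Unshelve. all: end_near. Qed.

End codebook.

(** * The reliability function *)

Section reliability.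
Context {R : realType}.
Implicit Types (a b s Rt E nu : R).

Lemma exponent_of_ge n b E (C : seq 'rV[R]_n) : (0 < n)%N -> 0 < b -> is_code C ->
  Pe (4 * b) C <= expR (- (n%:R * E)) -> (E%:E <= exponent_of (4 * b) C)%E.
Proof.
move=> n0 b0 codeC Pe_le; have n_pos : (0 : R) < n%:R by rewrite ltr0n.
rewrite /exponent_of; case: ifPn => [_|Pe_neq0]; first by rewrite leey.
have Pe_gt0 : 0 < Pe (4 * b) C by rewrite lt0r Pe_neq0 Pe_ge0// mulr_gt0.
by rewrite lee_fin ler_pdivlMr// lerNr [E * _]mulrC -ler_expR lnK.
Qed.

Lemma exponent_of_le n a E (C : seq 'rV[R]_n) : (0 < n)%N ->
  expR (- (n%:R * E)) <= Pe a C -> (exponent_of a C <= E%:E)%E.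
Proof.
move=> n0 Pe_ge; have n_pos : (0 : R) < n%:R by rewrite ltr0n.
have Pe_gt0 : 0 < Pe a C by exact: lt_le_trans (expR_gt0 _) Pe_ge.
by rewrite /exponent_of gt_eqF// lee_fin ler_pdivrMr// lerNl [E * _]mulrC -ler_expR lnK.
Qed.

Lemma degree_ratio_rate_ge0 (sg : R) : 0 < sg -> sg < 1 ->
  0 <= - degree_ratio sg * ln ((1 - sg) / (1 + sg)) - ln (2 * sg / (1 + sg)).
Proof.
move=> sg0 sg1.
have ln1_le0 : ln ((1 - sg) / (1 + sg)) <= 0 by apply: ln_le0; rewrite ler_pdivrMr; lra.
have ln2_le0 : ln (2 * sg / (1 + sg)) <= 0 by apply: ln_le0; rewrite ler_pdivrMr; lra.
rewrite addr_ge0 ?oppr_ge0// mulr_le0// oppr_le0 ltW//; exact: degree_ratio_gt0.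
Qed.

(* The two hypotheses of the converse amount to R <= R_crit. *)
Lemma saddle_exponent_ge b s Rt (E := b * (1 - s) + - (ln (1 - s ^+ 2) / 2) - Rt) : saddle b s ->
  Rt <= - (ln (1 - s ^+ 2) / 2) + ln (1 + s) / 2 ->
  b * (1 - s) + ln (1 - b * (1 - s)) / 2 <= E /\ 0 < E.
Proof.
move=> bs Rt_le; have [_ s0 s1 _] := bs; have [halfE _] := saddle_half bs.
have lnE : ln (1 - b * (1 - s)) = - ln (1 + s).
  by rewrite halfE (_ : 1 - s / (1 + s) = (1 + s)^-1) ?lnV ?posrE//; [lra|field; lra].
have ln_le : ln (1 + s) <= s by apply: le_trans (le_ln1Dx _) _ => //; lra.
have half_lt : s / 2 < b * (1 - s) by rewrite halfE ltr_pM2l// ltf_pV2 ?posrE; lra.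
by rewrite lnE /E; split; lra.
Qed.

Lemma near_best_exponent b s (sg : R) Rt nu (E := b * (1 - s) + - (ln (1 - s ^+ 2) / 2) - Rt) :
  saddle b s -> 0 < sg -> sg ^+ 2 = 1 - s ^+ 2 ->
  - degree_ratio sg * ln ((1 - sg) / (1 + sg)) - ln (2 * sg / (1 + sg)) <= Rt ->
  Rt <= - (ln (1 - s ^+ 2) / 2) + ln (1 + s) / 2 -> 0 < nu <= 1 ->
  \forall n \near \oo, ((E - nu)%:E <= best_exponent Rt (4 * b) n <= (E + nu)%:E)%E.
Proof.
move=> bs sg0 sg2 R1_le Rt_le nu01; have [b0 s0 s1 _] := bs; have [nu0 _] := andP nu01.
have sg1 : sg < 1.
  by rewrite -(ltr_pXn2r (n := 2))// ?nnegrE ?ltW// expr1n sg2 gtrBl exprn_gt0.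
have Rt0 : 0 <= Rt by apply: le_trans R1_le; exact: degree_ratio_rate_ge0.
have [F_le E0] := saddle_exponent_ge bs Rt_le.
have close_pairs := lp_many_close_pairs bs sg0 sg2.
near=> n.
have n0 : (0 < n)%N by near: n; exact: nbhs_infty_gt.
apply/andP; split.
  have [C [codeC size_C Pe_le]] : exists C : seq 'rV[R]_n,
      [/\ is_code C, expR (n%:R * Rt) <= (size C)%:R & Pe (4 * b) C <= expR (- (n%:R * (E - nu)))].
    by near: n; exact: near_achievable.
  by apply: le_ereal_sup_tmp; exists (exponent_of (4 * b) C); [exists C|exact: exponent_of_ge].
apply: ge_ereal_sup => _ [C [codeC size_C] <-]; apply: exponent_of_le => //.
rewrite PeE//; last by rewrite mulr_gt0// ltr0n.
rewrite -[X in X%:R^-1]card_ord.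
have converse_n : forall (T : finType) (x : T -> 'rV[R]_n),
    (forall c, norm2 (x c) = 1) -> (forall c c', c' != c -> 0 < hdist x c c') ->
    expR (n%:R * Rt) <= #|T|%:R -> expR (- (n%:R * (E + nu))) <=
    #|T|%:R^-1 * \sum_c err_prob x (fun c c' => c' != c) (Num.sqrt (n%:R * b)) c.
  by near: n; exact: (converse bs close_pairs).
apply: converse_n; [exact: codeword_unit|exact: hdist_codeword_gt0|by rewrite card_ord].
Unshelve. all: end_near. Qed.

Lemma limn_esup_near (u : (\bar R)^nat) E :
  (forall nu, 0 < nu <= 1 -> \forall n \near \oo, ((E - nu)%:E <= u n <= (E + nu)%:E)%E) ->
  limn_esup u = E%:E.
Proof.
move=> near_u; suff cu : u @ \oo --> E%:E.
  by rewrite is_cvg_limn_esupE ?(cvg_lim _ cu)//; apply/cvg_ex; exists E%:E.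
apply/fine_cvgP; split.
  have : 0 < (1 : R) <= 1 by rewrite ltr01 lexx.
  move=> /near_u; apply: filterS => n /andP[lo hi].
  by rewrite fin_numElt (lt_le_trans _ lo) ?ltNyr// (le_lt_trans hi) ?ltry.
apply/cvgrPdist_le => e e0.
have nu01 : 0 < Num.min e 1 <= 1 by rewrite lt_min e0 ltr01 ge_min lexx orbT.
have nue : Num.min e 1 <= e by rewrite ge_min lexx.
apply: filterS (near_u _ nu01) => n /andP[lo hi] /=.
case: (u n) lo hi => [r| |] //=; rewrite !lee_fin => lo hi.
by rewrite ler_norml; apply/andP; split; lra.
Qed.

Section snr.
Variable a : R.
Hypothesis a_gt0 : 0 < a.

Definition snr_root : R := 2^-1 + 2^-1 * Num.sqrt (1 + a ^+ 2 / 4).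

Lemma snr_root_gt1 : 1 < snr_root.
Proof.
have a2 : 0 < a ^+ 2 by exact: exprn_gt0.
rewrite /snr_root; suff : 1 < Num.sqrt (1 + a ^+ 2 / 4) by lra.
by rewrite -[ltLHS]sqrtr1 ltr_sqrt; lra.
Qed.

Lemma snr_rootE : snr_root ^+ 2 - snr_root = (a / 4) ^+ 2.
Proof.
have := sqr_sqrtr (_ : 0 <= 1 + a ^+ 2 / 4); rewrite /snr_root => /(_ _) sqrE.
have a2 := sqr_ge0 a; move: (Num.sqrt _) sqrE => w sqrE.
by have := sqrE ltac:(lra); nra.
Qed.

Lemma invr_snr_root_bounds : 0 < snr_root^-1 < 1.
Proof. by have D1 := snr_root_gt1; rewrite invr_gt0 invf_lt1 ?D1 ?andbT; lra. Qed.

Lemma expR_R_x : expR (- (2 * R_x a)) = snr_root^-1.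
Proof.
by rewrite expRN /R_x mulrA mulfV// mul1r lnK// posrE; have := snr_root_gt1; rewrite /snr_root; lra.
Qed.

Lemma cos_theta_xE : cos (theta_x a) = Num.sqrt (1 - snr_root^-1).
Proof.
have := invr_snr_root_bounds; rewrite /theta_x expR_R_x => /andP[D0 D1].
rewrite acosK// in_itv /= (@le_trans _ _ 0) ?sqrtr_ge0//= -[leRHS]sqrtr1 ler_wsqrtr//; lra.
Qed.

Lemma sqr_cos_theta_x : 1 - cos (theta_x a) ^+ 2 = snr_root^-1.
Proof. by have /andP[D0 D1] := invr_snr_root_bounds; rewrite cos_theta_xE sqr_sqrtr; [ring|lra]. Qed.

Lemma sqr_sin_theta_x : sin (theta_x a) ^+ 2 = 1 - cos (theta_x a) ^+ 2.
Proof. exact: sin2cos2. Qed.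

Lemma sin_theta_x_gt0 : 0 < sin (theta_x a).
Proof.
have /andP[D0 D1] := invr_snr_root_bounds.
rewrite /theta_x sin_acos expR_R_x; last first.
  by rewrite (@le_trans _ _ 0) ?sqrtr_ge0//= -[leRHS]sqrtr1 ler_wsqrtr//; lra.
by rewrite sqrtr_gt0 sqr_sqrtr; lra.
Qed.

Lemma cos_theta_xM : cos (theta_x a) * snr_root = a / 4.
Proof.
have D1 := snr_root_gt1; apply/eqP; rewrite -(eqrXn2 (n := 2))//; last by have := a_gt0; lra.
  rewrite exprMn -snr_rootE; have -> : cos (theta_x a) ^+ 2 =
    1 - snr_root^-1 by rewrite -sqr_cos_theta_x; ring.
  by apply/eqP; field; lra.
by rewrite cos_theta_xE mulr_ge0 ?sqrtr_ge0//; lra.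
Qed.

Lemma saddle_theta_x : saddle (a / 4) (cos (theta_x a)).
Proof.
have /andP[D0 D1] := invr_snr_root_bounds; have root_gt1 := snr_root_gt1.
split; [by rewrite divr_gt0| | |].
- by rewrite cos_theta_xE sqrtr_gt0; lra.
- by rewrite cos_theta_xE -[ltRHS]sqrtr1 ltr_sqrt; lra.
by rewrite sqr_cos_theta_x -cos_theta_xM mulfK//; lra.
Qed.

Lemma R_xE : R_x a = - (ln (1 - cos (theta_x a) ^+ 2) / 2).
Proof.
have D1 := snr_root_gt1; rewrite sqr_cos_theta_x lnV ?posrE; last by lra.
by rewrite /R_x -/snr_root; field.
Qed.

Lemma R_critE : R_crit a = - (ln (1 - cos (theta_x a) ^+ 2) / 2) + ln (1 + cos (theta_x a)) / 2.
Proof.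
have D1 := snr_root_gt1; have [_ s0 _ _] := saddle_theta_x.
rewrite -R_xE /R_crit /R_x -/snr_root.
have -> : 2^-1 + a / 4 + 2^-1 * Num.sqrt (1 + a ^+ 2 / 4) = snr_root * (1 + cos (theta_x a)).
  by rewrite mulrDr mulr1 [snr_root * _]mulrC cos_theta_xM /snr_root; ring.
by rewrite lnM ?posrE; [field| |]; lra.
Qed.

End snr.

End reliability.

Theorem theorem19 (R : realType) (a Rt : R) :
  0 < a -> a <= 57 / 10 ->
  R_1 a <= Rt -> Rt <= R_crit a ->
  reliability Rt a = (E0 Rt a)%:E.
Proof.
move=> a_gt0 _; rewrite R_critE// => R1_le Rt_le.
apply: limn_esup_near => nu nu01.
rewrite /E0 R_xE//; have aE : 4 * (a / 4) = a by field.
have := near_best_exponent (saddle_theta_x a_gt0) (sin_theta_x_gt0 a_gt0) (sqr_sin_theta_x a)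
  R1_le Rt_le nu01.
by rewrite aE.
Qed.
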